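(* Let $\Sigma$ be a smooth complex surface and $(C,z)\subset(\Sigma,z)$ a reduced plane curve singularity (with $z$ a singular point of $C$) defined by $f\in\mathcal O_{\Sigma,z}$. Let $j(f)$ be the Jacobian ideal of $f$, $\mathfrak m_z\subset\mathcal O_{\Sigma,z}$ the maximal ideal, and $I^s(C,z)$ the topological singularity ideal. (1) There exist $g_1,\dots,g_{\tau'}\in I^s(C,z)$ inducing a basis of $I^s(C,z)/\langle f,\mathfrak m_z j(f)\rangle$ such that $$\varphi^s: V\Bigl(f+\sum_i t_ig_i\Bigr)\subset(\Sigma\times\mathbb C^{\tau'},(z,\mathbf 0))\xrightarrow{\ \mathrm{pr}\ }(\mathbb C^{\tau'},\mathbf 0)$$ is a semiuniversal straight equisingular deformation of $(C,z)$. (2) There exist $g_1,\dots,g_{\tau''}\in\langle j(f),I^s(C,z)\rangle$ inducing a basis of the quotient $\langle j(f),I^s(C,z)\rangle/\langle f,j(f)\rangle$ such that $$\varphi^s: V\Bigl(f+\sum_i t_ig_i\Bigr)\subset(\Sigma\times\mathbb C^{\tau''},(z,\mathbf 0))\xrightarrow{\ \mathrm{pr}\ }(\mathbb C^{\tau''},\mathbf 0)$$ is a semiuniversal straight equisingular deformation of $(C,z)$ without section.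
   Context: **Essential tree, transforms.** The minimal good embedded resolution of $(C,z)$ is the sequence of point blow-ups with centres infinitely near to $z$, in which (after $z$) exactly the non-nodal singular points of the reduced total transform of $C$ are blown up, until the reduced total transform is a normal crossing divisor. The essential tree $\mathscr T^*=\mathscr T^*(C,z)$ is the set of blown-up points, including $z$. For $q\in\mathscr T^*$, $\widehat C_{(q)},\widetilde C_{(q)}$ denote the germs at $q$ of the total and reduced total transform of $C$ (for $q=z$ both are $(C,z)$). For $g\in\mathcal O_{\Sigma,z}$, $\widehat g_{(q)}$ is the total transform (pull-back) of $g$ at $q$; $\mathrm{mt}$ denotes multiplicity. The topological singularity ideal is $$I^s(C,z)=\{g\in\mathcal O_{\Sigma,z}\mid \mathrm{mt}\,\widehat g_{(q)}\ge\mathrm{mt}\,\widehat C_{(q)}\text{ for each }q\in\mathscr T^*(C,z)\}.$$ **Deformations.** An embedded deformation of $(C,z)$ over a complex germ $(T,0)$ (possibly non-reduced) is a flat $\Phi:(\mathcal C,z)\to(T,0)$ with special fibre $(C,z)$, where $(\mathcal C,z)\subset(\mathcal M,z)$ is a hypersurface germ and $(\mathcal M,z)\to(T,0)$ is flat with special fibre $(\Sigma,z)$ (so $\mathcal M\cong\Sigma\times T$ over $T$); with section if a section $\sigma$ of $\Phi$ is given. It is equimultiple along $\sigma$ if a defining equation of $\mathcal C$ lies in $I_\sigma^m$, where $I_\sigma$ is the ideal of $\sigma(T,0)$ in $\mathcal M$ and $m$ is the multiplicity of the special fibre. The deformation is equisingular (an es-deformation) if: (1) there is a section $\sigma$ along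 which it is equimultiple; (2) for each $q\in\mathscr T^*$, $q\neq z$, there are morphisms $\widetilde{\mathcal C}_{(q)}\hookrightarrow\mathcal M_{(q)}\to\mathcal M\to T$ such that $\widetilde{\mathcal C}_{(q)}\to T$ is an embedded deformation of $\widetilde C_{(q)}$, equimultiple along a section $\sigma_{(q)}$; (3) each $\mathcal M_{(q)}$ is obtained by blowing up some $\mathcal M_{(p)}$, $p$ of smaller level (an earlier infinitely near point), along $\sigma_{(p)}$, with $\widetilde{\mathcal C}_{(q)}$ the reduced total transform of $\widetilde{\mathcal C}_{(p)}$ (for $p=z$: $\mathcal M,\sigma,\mathcal C$). The sections are unique. A straight es-deformation is a deformation with section that is an es-deformation along the trivial section $\sigma(t)=(z,t)$ ($\mathcal M=\Sigma\times T$) such that all $\sigma_{(q)}$, $q\in\mathscr T^*$, are trivial ($\mathcal M_{(q)}=\Sigma_{(q)}\times T$, $\sigma_{(q)}(t)=(q,t)$). Straight es-deformations form a full subcategory $\mathcal Def^s_{(C,z)}$ of the category of deformations with section. The image of $\mathcal Def^s_{(C,z)}$ in the category of es-deformations (without section) under forgetting the section is the category of straight es-deformations without section. Semiuniversal refers to these categories. The numbers $\tau'$, $\tau''$ are the $\mathbb C$-dimensions of the respective quotients. *)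

(* Defs.v *)
From HB Require Import structures.
From mathcomp Require Import all_boot all_order all_algebra.
From mathcomp Require Import boolp reals complex.
From mathcomp Require Import mpoly.

Set Implicit Arguments.
Unset Strict Implicit.
Unset Printing Implicit Defensive.

Import Order.TTheory GRing.Theory Num.Theory.
Local Open Scope ring_scope.

Section Truncations.
Context {C : numClosedFieldType} {N : nat}.
Implicit Types (a b : 'X_{1..N} -> C) (p q : {mpoly C[N]}) (m : 'X_{1..N}).

Definition trunc n a : {mpoly C[N]} :=
  \sum_(m : 'X_{1..N < n}) a m *: 'X_[m].

Lemma truncE n a m : (trunc n a)@_m = if (mdeg m < n)%N then a m else 0.
Proof.
case: ifP => h; first by rewrite mcoeff_mpoly.
rewrite /trunc raddf_sum big1 //= => i _.
rewrite mcoeffZ mcoeffX; case: eqP => [e|]; last by rewrite mulr0.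
by move: h; rewrite -e bmdeg.
Qed.

Definition pnorm n (r : C) a : C :=
  \sum_(m : 'X_{1..N < n}) `|a m| * r ^+ mdeg m.

(* [C] is to be R[i] for R : realType.
   The power series with coefficients [a] converges absolutely on the closed
   polydisc of some radius r > 0, i.e. on a neighbourhood of the origin. *)
Definition convergent a : Prop :=
  exists r M : C, 0 < r /\ forall n, pnorm n r a <= M.

Lemma eq_pnorm n r a b : (forall m, (mdeg m < n)%N -> a m = b m) ->
  pnorm n r a = pnorm n r b.
Proof. by move=> e; apply: eq_bigr => m _; rewrite e // bmdeg. Qed.

Lemma pnorm_ge0 n r a : 0 <= r -> 0 <= pnorm n r a.
Proof.
by move=> r0; apply: sumr_ge0 => m _; rewrite mulr_ge0 // exprn_ge0.
Qed.

Lemma pnorm_le n r s a : 0 <= r -> r <= s -> pnorm n r a <= pnorm n s a.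
Proof.
move=> r0 rs; apply: ler_sum => m _; apply: ler_wpM2l => //.
by apply: lerXn2r => //; rewrite nnegrE // (le_trans r0).
Qed.

Lemma pnormD n r a b : 0 <= r ->
  pnorm n r (fun m => a m + b m) <= pnorm n r a + pnorm n r b.
Proof.
move=> r0; rewrite /pnorm -big_split; apply: ler_sum => m _ /=.
by rewrite -mulrDl ler_wpM2r ?exprn_ge0 // ler_normD.
Qed.

Lemma pnormZ n r c a : pnorm n r (fun m => c * a m) = `|c| * pnorm n r a.
Proof. by rewrite /pnorm mulr_sumr; apply: eq_bigr => m _; rewrite normrM mulrA. Qed.

Definition mulc a b m : C :=
  \sum_(k : 'X_{1..N < (mdeg m).+1, (mdeg m).+1} | m == (k.1 + k.2)%MM)
    a k.1 * b k.2.

Lemma mulc_trunc n a b m : (mdeg m < n)%N ->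
  mulc a b m = (trunc n a * trunc n b)@_m.
Proof.
move=> mn; rewrite mcoeffM /mulc; apply: eq_bigr => -[k l] /= _.
rewrite !truncE !(leq_trans (bmdeg _)) //.
Qed.

Lemma mcoeff_mul_trunc n p q m : (mdeg m < n)%N ->
  (p * q)@_m = (trunc n (fun k => p@_k) * trunc n (fun k => q@_k))@_m.
Proof.
by move=> mn; rewrite -mulc_trunc // mcoeffM.
Qed.

Lemma pnormM n r a b : 0 <= r ->
  pnorm n r (mulc a b) <= pnorm n r a * pnorm n r b.
Proof.
move=> r0.
have -> : pnorm n r (mulc a b) = pnorm n r (fun k => (trunc n a * trunc n b)@_k).
  by apply: eq_pnorm => m mn; apply: mulc_trunc.
pose F (k : 'X_{1..N < n, n}) := `|a k.1| * r ^+ mdeg k.1 * (`|b k.2| * r ^+ mdeg k.2).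
have -> : pnorm n r a * pnorm n r b = \sum_k F k.
  rewrite /pnorm mulr_suml (eq_bigr (fun i => \sum_j F (i, j))).
    by rewrite pair_bigA; apply: eq_bigr => -[].
  by move=> i _; rewrite mulr_sumr.
apply: (@le_trans _ _ (\sum_(m : 'X_{1..N < n})
   \sum_(k : 'X_{1..N < n, n} | (m : 'X_{1..N}) == (k.1 + k.2)%MM) F k)).
  apply: ler_sum => m _.
  rewrite (@mcoeff_poly_mul _ _ _ _ _ n) ?bmdeg //.
  apply: (@le_trans _ _ ((\sum_(k : 'X_{1..N < n, n} | (m : 'X_{1..N}) == (k.1 + k.2)%MM)
     `|a k.1| * `|b k.2|) * r ^+ mdeg m)).
    apply: ler_wpM2r; first exact: exprn_ge0.
    apply: le_trans (ler_norm_sum _ _ _) _; apply: ler_sum => k _.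
    by rewrite !truncE !bmdeg normrM.
  rewrite mulr_suml; apply: ler_sum => k /eqP ->.
  by rewrite /F mdegD exprD mulrACA.
rewrite (exchange_big_dep xpredT) //=; apply: ler_sum => k _.
have F0 : 0 <= F k by rewrite /F !mulr_ge0 ?exprn_ge0.
rewrite sumr_const -[leRHS]mulr1n.
apply: ler_wpMn2l => //.
apply/card_le1_eqP => i j ki kj; apply: val_inj.
have ei : bmnm i = (k.1 + k.2)%MM by apply/eqP.
have ej : bmnm j = (k.1 + k.2)%MM by apply/eqP.
by rewrite /= ei ej.
Qed.

Lemma convergent2 a b : convergent a -> convergent b ->
  exists r M1 M2 : C, [/\ 0 < r, forall n, pnorm n r a <= M1
                        & forall n, pnorm n r b <= M2].
Proof.
move=> [r [M [r0 hM]]] [s [L [s0 hL]]].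
have t0 : 0 < (r^-1 + s^-1)^-1 by rewrite invr_gt0 addr_gt0 // invr_gt0.
exists (r^-1 + s^-1)^-1, M, L; split => // n.
- apply: le_trans (hM n); apply: pnorm_le; first exact: ltW.
  rewrite -[leRHS]invrK lef_pV2 ?posrE ?addr_gt0 ?invr_gt0 //.
  by rewrite lerDl invr_ge0 ltW.
- apply: le_trans (hL n); apply: pnorm_le; first exact: ltW.
  rewrite -[leRHS]invrK lef_pV2 ?posrE ?addr_gt0 ?invr_gt0 //.
  by rewrite lerDr invr_ge0 ltW.
Qed.

Lemma convergentD a b : convergent a -> convergent b ->
  convergent (fun m => a m + b m).
Proof.
move=> ca cb; have [r [M1 [M2 [r0 h1 h2]]]] := convergent2 ca cb.
exists r, (M1 + M2); split => // n.
by apply: le_trans (pnormD _ _ _ (ltW r0)) _; apply: lerD.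
Qed.

Lemma convergentZ c a : convergent a -> convergent (fun m => c * a m).
Proof.
move=> [r [M [r0 h]]]; exists r, (`|c| * M); split => // n.
by rewrite pnormZ ler_wpM2l.
Qed.

Lemma convergentM a b : convergent a -> convergent b -> convergent (mulc a b).
Proof.
move=> ca cb; have [r [M1 [M2 [r0 h1 h2]]]] := convergent2 ca cb.
exists r, (M1 * M2); split => // n.
apply: le_trans (pnormM _ _ _ (ltW r0)) _.
by apply: ler_pM => //; apply: pnorm_ge0; apply: ltW.
Qed.

Definition monc (m0 : 'X_{1..N}) m : C := (m == m0)%:R.

Lemma pnorm_monc n r m0 : 0 <= r -> pnorm n r (monc m0) <= r ^+ mdeg m0.
Proof.
move=> r0; rewrite /pnorm.
have E m : `|monc m0 m| * r ^+ mdeg m = if m == m0 then r ^+ mdeg m0 else 0.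
  rewrite /monc; case: eqP => [->|_]; first by rewrite normr1 mul1r.
  by rewrite normr0 mul0r.
under eq_bigr => m _ do rewrite E.
rewrite -big_mkcond /=.
rewrite sumr_const -[leRHS]mulr1n; apply: ler_wpMn2l; first exact: exprn_ge0.
apply/card_le1_eqP => i j ki kj; apply: val_inj.
have ei : bmnm i = m0 by apply/eqP.
have ej : bmnm j = m0 by apply/eqP.
by rewrite /= ei ej.
Qed.

Lemma convergent_mon m0 : convergent (monc m0).
Proof.
exists 1, 1; split => // n.
by apply: le_trans (pnorm_monc n m0 ler01) _; rewrite expr1n.
Qed.

End Truncations.

(* Convergent power series in N variables: coefficients are indexed by the
   multi-indices of [mpoly], which carry the degree [mdeg]. *)
Record cps (C : numClosedFieldType) (N : nat) :=
  Cps { coef :> 'X_{1..N} -> C; coef_convergent : convergent coef }.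

HB.instance Definition _ C N := gen_eqMixin (cps C N).
HB.instance Definition _ C N := gen_choiceMixin (cps C N).

Section RingStructure.
Context {C : numClosedFieldType} {N : nat}.
Implicit Types (f g h : cps C N).

Lemma cpsP f g : (forall m, f m = g m) -> f = g.
Proof.
case: f g => [a ca] [b cb] /= /funext e; subst b.
by congr Cps; apply: Prop_irrelevance.
Qed.

Lemma convergent0 : convergent (fun _ : 'X_{1..N} => 0 : C).
Proof.
by exists 1, 0; split => // n; rewrite /pnorm big1 // => m _; rewrite normr0 mul0r.
Qed.

Lemma convergentN f : convergent (fun m => - f m).
Proof.
have -> : (fun m => - f m) = (fun m => -1 * f m).
  by apply/funext => m; rewrite mulN1r.
exact: convergentZ (coef_convergent f).
Qed.

Definition cps_zero : cps C N := Cps convergent0.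
Definition cps_opp f : cps C N := Cps (convergentN f).
Definition cps_add f g : cps C N :=
  Cps (convergentD (coef_convergent f) (coef_convergent g)).
Definition cps_one : cps C N := Cps (convergent_mon 0%MM).
Definition cps_mul f g : cps C N :=
  Cps (convergentM (coef_convergent f) (coef_convergent g)).
Definition cps_scale (c : C) f : cps C N :=
  Cps (convergentZ c (coef_convergent f)).

Fact cps_addA : associative cps_add.
Proof. by move=> f g h; apply: cpsP => m /=; rewrite addrA. Qed.
Fact cps_addC : commutative cps_add.
Proof. by move=> f g; apply: cpsP => m /=; rewrite addrC. Qed.
Fact cps_add0 : left_id cps_zero cps_add.
Proof. by move=> f; apply: cpsP => m /=; rewrite add0r. Qed.
Fact cps_addN : left_inverse cps_zero cps_opp cps_add.
Proof. by move=> f; apply: cpsP => m /=; rewrite addNr. Qed.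

HB.instance Definition _ := GRing.isZmodule.Build (cps C N)
  cps_addA cps_addC cps_add0 cps_addN.

Lemma truncM n a b :
  trunc n (mulc a b) = trunc n (fun k => (trunc n a * trunc n b)@_k) :> {mpoly C[N]}.
Proof.
by apply/mpolyP => m; rewrite !truncE; case: ifP => // mn; apply: mulc_trunc.
Qed.

Lemma trunc_trunc n a :
  trunc n (fun k => (trunc n a)@_k) = trunc n a :> {mpoly C[N]}.
Proof. by apply/mpolyP => m; rewrite !truncE; case: ifP => // mn; rewrite ?truncE ?mn. Qed.

Fact cps_mulC : commutative cps_mul.
Proof.
move=> f g; apply: cpsP => m /=.
by rewrite !(mulc_trunc _ _ (ltnSn _)) mulrC.
Qed.

Fact cps_mulA : associative cps_mul.
Proof.
move=> f g h; apply: cpsP => m /=.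
rewrite !(mulc_trunc _ _ (ltnSn _)) !truncM.
set n := (mdeg m).+1.
have E (p q : {mpoly C[N]}) : (p * q)@_m =
    (trunc n (fun k => p@_k) * trunc n (fun k => q@_k))@_m.
  exact: mcoeff_mul_trunc.
rewrite -[in LHS](trunc_trunc n f) -E -[in RHS](trunc_trunc n h) -E.
by rewrite mulrA.
Qed.

Fact cps_mul1 : left_id cps_one cps_mul.
Proof.
move=> f; apply: cpsP => m /=; rewrite (mulc_trunc _ _ (ltnSn _)).
have -> : trunc (mdeg m).+1 (monc 0%MM) = 1 :> {mpoly C[N]}.
  apply/mpolyP => k; rewrite truncE mcoeff1 /monc.
  by case: eqP => [->|_]; rewrite ?mdeg0 // if_same.
by rewrite mul1r truncE ltnSn.
Qed.

Fact cps_mulD : left_distributive cps_mul cps_add.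
Proof.
move=> f g h; apply: cpsP => m /=.
by rewrite /mulc -big_split; apply: eq_bigr => k _; rewrite mulrDl.
Qed.

Fact cps_one_neq0 : cps_one != 0 :> cps C N.
Proof.
apply/eqP => /(congr1 (fun f : cps C N => f 0%MM)) /eqP.
by rewrite /= /monc eqxx oner_eq0.
Qed.

HB.instance Definition _ := GRing.Zmodule_isComNzRing.Build (cps C N)
  cps_mulA cps_mulC cps_mul1 cps_mulD cps_one_neq0.

Fact cps_scaleA c d f : cps_scale c (cps_scale d f) = cps_scale (c * d) f.
Proof. by apply: cpsP => m /=; rewrite mulrA. Qed.
Fact cps_scale1 : left_id 1 cps_scale.
Proof. by move=> f; apply: cpsP => m /=; rewrite mul1r. Qed.
Fact cps_scaleDr : right_distributive cps_scale +%R.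
Proof. by move=> c f g; apply: cpsP => m /=; rewrite mulrDr. Qed.
Fact cps_scaleDl f : {morph cps_scale^~ f : c d / c + d}.
Proof. by move=> c d; apply: cpsP => m /=; rewrite mulrDl. Qed.

HB.instance Definition _ := GRing.Zmodule_isLmodule.Build C (cps C N)
  cps_scaleA cps_scale1 cps_scaleDr cps_scaleDl.

Fact cps_scaleAl (c : C) f g : c *: (f * g) = (c *: f) * g.
Proof.
apply: cpsP => m /=; rewrite /mulc mulr_sumr.
by apply: eq_bigr => k _; rewrite /= mulrA.
Qed.

HB.instance Definition _ := GRing.Lmodule_isLalgebra.Build C (cps C N) cps_scaleAl.
HB.instance Definition _ := GRing.Lalgebra_isComAlgebra.Build C (cps C N).

End RingStructure.

Section Substitution.
Context {C : numClosedFieldType} {N K : nat}.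
Implicit Types (f : cps C N) (phi : 'I_N -> cps C K) (p q : {mpoly C[K]}).

Definition drop_const (a : 'X_{1..K} -> C) (m : 'X_{1..K}) : C :=
  if m == 0%MM then 0 else a m.

Definition subst_trunc n f phi : {mpoly C[K]} :=
  trunc n f \mPo [tuple trunc n (drop_const (phi i)) | i < N].

(* The coefficient at m of f(phi_0, ..., phi_(N-1)) only involves the terms of
   degree <= mdeg m, the phi_i having no constant term.  Pitfall: constant
   terms of the phi_i are dropped, so this is f(phi - phi(0)) in general. *)
Definition substc f phi (m : 'X_{1..K}) : C :=
  (subst_trunc (mdeg m).+1 f phi)@_m.

Definition ord_ge d p := forall m, (mdeg m < d)%N -> p@_m = 0.

Lemma ord_geM d e p q : ord_ge d p -> ord_ge e q -> ord_ge (d + e) (p * q).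
Proof.
move=> hp hq m hm; rewrite mcoeffM big1 // => -[k l] /= /eqP em.
have [hk|hk] := ltnP (mdeg k) d; first by rewrite hp // mul0r.
rewrite [X in _ * X]hq ?mulr0 //; rewrite ltnNge; apply/negP => hl.
by move: hm; rewrite em mdegD ltnNge leq_add.
Qed.

Lemma ord_ge1 : ord_ge 0 1. Proof. by []. Qed.

Lemma ord_geX d p : ord_ge 1 p -> ord_ge d (p ^+ d).
Proof.
move=> hp; elim: d => [|d ih]; first by [].
by rewrite exprS -add1n; apply: ord_geM.
Qed.

Lemma ord_ge_prod (lq : N.-tuple {mpoly C[K]}) (m : 'X_{1..N}) :
  (forall i, ord_ge 1 (tnth lq i)) ->
  ord_ge (mdeg m) (\prod_(i < N) tnth lq i ^+ m i).
Proof.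
move=> h; rewrite mdegE.
by apply: (big_ind2 (fun p d => ord_ge d p)) => // [? ? ? ?|i _];
  [apply: ord_geM | apply: ord_geX].
Qed.

Lemma ord_ge_trunc_drop_const n (a : 'X_{1..K} -> C) : ord_ge 1 (trunc n (drop_const a)).
Proof.
by move=> m; rewrite ltnS leqn0 mdeg_eq0 => hm; rewrite truncE /drop_const hm if_same.
Qed.

Definition cong d p q := forall m, (mdeg m < d)%N -> p@_m = q@_m.

Lemma congM d p p' q q' : cong d p p' -> cong d q q' -> cong d (p * q) (p' * q').
Proof.
move=> hp hq m hm; rewrite !mcoeffM; apply: eq_bigr => -[k l] /= _.
by rewrite hp ?hq // (leq_trans (bmdeg _)).
Qed.

Lemma cong_prod d (lq lq' : N.-tuple {mpoly C[K]}) (m : 'X_{1..N}) :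
  (forall i, cong d (tnth lq i) (tnth lq' i)) ->
  cong d (\prod_(i < N) tnth lq i ^+ m i) (\prod_(i < N) tnth lq' i ^+ m i).
Proof.
move=> h; apply: (big_ind2 (cong d)) => // [? ? ? ?|i _]; first exact: congM.
by elim: (m i) => [|e ih] //; rewrite !exprS; apply: congM.
Qed.

Lemma comp_truncE n (a : 'X_{1..N} -> C) (lq : N.-tuple {mpoly C[K]}) :
  trunc n a \mPo lq =
  \sum_(m : 'X_{1..N < n}) a m *: \prod_(i < N) tnth lq i ^+ m i.
Proof.
rewrite /trunc raddf_sum; apply: eq_bigr => m _ /=.
by rewrite comp_mpolyZ comp_mpolyX.
Qed.

Lemma substc_trunc n f phi m : (mdeg m < n)%N ->
  substc f phi m = (subst_trunc n f phi)@_m.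
Proof.
move=> mn; rewrite /substc /subst_trunc !comp_truncE.
set lq := [tuple _ | _ < _]; set lq' := [tuple _ | _ < _].
rewrite -(comp_truncE n f) -[trunc n f](subrK (trunc (mdeg m).+1 f)).
have : forall k, (mdeg k < (mdeg m).+1)%N ->
    (trunc n f - trunc (mdeg m).+1 f)@_k = 0.
  by move=> k kn; rewrite mcoeffB !truncE kn (leq_trans kn mn) subrr.
move: (trunc n f - _) => rest hrest.
rewrite comp_mpolyD mcoeffD [X in _ = X + _](_ : _ = 0) ?add0r; last first.
  rewrite comp_mpolyE raddf_sum big1 // => k _ /=; rewrite mcoeffZ.
  have [/hrest ->|kn] := ltnP (mdeg k) (mdeg m).+1; first by rewrite mul0r.
  rewrite ord_ge_prod ?mulr0 // => i.
  by rewrite tnth_mktuple; apply: ord_ge_trunc_drop_const.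
rewrite comp_truncE !raddf_sum /=.
apply: eq_bigr => i _; rewrite !mcoeffZ; congr (_ * _).
apply: (@cong_prod (mdeg m).+1) => // j k hk.
by rewrite !tnth_mktuple !truncE hk (leq_trans hk).
Qed.

Lemma pnorm_prod n r s (lq : N.-tuple {mpoly C[K]}) (m : 'X_{1..N}) :
  0 <= r -> 0 <= s ->
  (forall i, pnorm n r (fun k => (tnth lq i)@_k) <= s) ->
  pnorm n r (fun k => (\prod_(i < N) tnth lq i ^+ m i)@_k) <= s ^+ mdeg m.
Proof.
move=> r0 s0 h; rewrite mdegE.
have P1 : pnorm n r (fun k => (1 : {mpoly C[K]})@_k) <= s ^+ 0.
  rewrite expr0; apply: le_trans (_ : pnorm n r (monc 0%MM) <= _).
    by rewrite le_eqVlt; apply/orP; left; apply/eqP/eq_pnorm => k _; rewrite mcoeff1.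
  by apply: le_trans (pnorm_monc n _ r0) _; rewrite mdeg0 expr0.
have PM p q d e : pnorm n r (fun k => p@_k) <= s ^+ d ->
    pnorm n r (fun k => q@_k) <= s ^+ e ->
    pnorm n r (fun k => (p * q)@_k) <= s ^+ (d + e).
  move=> hp hq; rewrite exprD; apply: le_trans (_ : pnorm n r
      (mulc (fun k => p@_k) (fun k => q@_k)) <= _).
    by rewrite le_eqVlt; apply/orP; left; apply/eqP/eq_pnorm => k _; rewrite mcoeffM.
  by apply: le_trans (pnormM n _ _ r0) _; apply: ler_pM => //; apply: pnorm_ge0.
apply: (big_ind2 (fun p d => pnorm n r (fun k => p@_k) <= s ^+ d)) => // [|i _].
  by move=> p d q e; apply: PM.
elim: (m i) => [|e ih] //; rewrite exprS -add1n; exact: PM.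
Qed.

Lemma small_drop_const (a : 'X_{1..K} -> C) (s : C) : convergent a -> 0 < s ->
  exists2 r, 0 < r & forall n, pnorm n r (drop_const a) <= s.
Proof.
move=> [r [M [r0 hM]]] s0.
have M0 : 0 <= M by apply: le_trans (hM 0%N); apply: pnorm_ge0; apply: ltW.
have D0 : 0 < s + M by rewrite ltr_wpDr.
pose t := s / (s + M).
have t0 : 0 < t by rewrite divr_gt0.
have t1 : t <= 1 by rewrite ler_pdivrMr // mul1r lerDl.
exists (t * r) => [|n]; first by rewrite mulr_gt0.
apply: (@le_trans _ _ (t * M)); last first.
  by rewrite /t mulrAC ler_pdivrMr // ler_wpM2l ?(ltW s0) // lerDr ltW.
apply: le_trans (ler_wpM2l (ltW t0) (hM n)).
rewrite /pnorm mulr_sumr; apply: ler_sum => m _.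
rewrite /drop_const; case: eqP => [_|/eqP hm].
  rewrite normr0 mul0r; apply: mulr_ge0; first exact: ltW.
  by apply: mulr_ge0 => //; apply: exprn_ge0; apply: ltW.
rewrite exprMn mulrCA; apply: ler_wpM2r.
  by apply: mulr_ge0 => //; apply: exprn_ge0; apply: ltW.
by rewrite ler_iXnr ?(ltW t0) // lt0n mdeg_eq0.
Qed.

Lemma substc_convergent f phi : convergent (substc f phi).
Proof.
have [s [M [s0 hM]]] := coef_convergent f.
have /choice [r hr] : forall i, exists r, 0 < r /\
    forall n, pnorm n r (drop_const (phi i)) <= s.
  move=> i; have [r r0 h] := small_drop_const (coef_convergent (phi i)) s0.
  by exists r.
pose t := (1 + \sum_i (r i)^-1)^-1.
have S0 : 0 <= \sum_i (r i)^-1.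
  by apply: sumr_ge0 => i _; rewrite invr_ge0 ltW //; case: (hr i).
have t0 : 0 < t by rewrite invr_gt0 ltr_wpDr.
have tr i : t <= r i.
  have [ri0 _] := hr i.
  rewrite -[leRHS]invrK lef_pV2 ?posrE ?invr_gt0 // ?ltr_wpDr //.
  rewrite (bigD1 i) //= addrCA lerDl addr_ge0 //.
  by apply: sumr_ge0 => j _; rewrite invr_ge0 ltW //; case: (hr j).
exists t, M; split => // n.
have -> : pnorm n t (substc f phi) = pnorm n t (fun k => (subst_trunc n f phi)@_k).
  by apply: eq_pnorm => m mn; apply: substc_trunc.
rewrite /subst_trunc comp_truncE; apply: le_trans (hM n).
set lq := [tuple _ | _ < _].
have hlq i : pnorm n t (fun k => (tnth lq i)@_k) <= s.
  rewrite tnth_mktuple; apply: le_trans (_ : pnorm n t (drop_const (phi i)) <= _).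
    by rewrite le_eqVlt; apply/orP; left; apply/eqP/eq_pnorm => k kn; rewrite truncE kn.
  by have [_ h] := hr i; apply: le_trans (h n); apply: pnorm_le => //; apply: ltW.
rewrite {2}/pnorm.
elim/big_ind2: _ => [|p d q e hp hq|m _].
- by rewrite /pnorm big1 // => m _; rewrite mcoeff0 normr0 mul0r.
- apply: le_trans (lerD hp hq); apply: le_trans (pnormD _ _ _ (ltW t0)).
  by rewrite le_eqVlt; apply/orP; left; apply/eqP/eq_pnorm => k _; rewrite mcoeffD.
- apply: le_trans (_ : `|f m| * pnorm n t (fun k =>
      (\prod_(i < N) tnth lq i ^+ bmnm m i)@_k) <= _).
    rewrite -pnormZ le_eqVlt; apply/orP; left; apply/eqP/eq_pnorm => k _.
    by rewrite mcoeffZ.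
  by rewrite ler_wpM2l // pnorm_prod // ltW.
Qed.

Definition subst f phi : cps C K := Cps (substc_convergent f phi).

End Substitution.

Section Derivative.
Context {C : numClosedFieldType} {N : nat}.

Definition derivc (i : 'I_N) (f : cps C N) (m : 'X_{1..N}) : C :=
  (m i).+1%:R * f (m + U_(i))%MM.

Lemma derivc_convergent i f : convergent (derivc i f).
Proof.
have [r [M [r0 hM]]] := coef_convergent f.
exists (r / 2%:R), (r^-1 * M); split => [|n]; first by rewrite divr_gt0 // ltr0n.
have r20 : 0 <= r / 2%:R by rewrite ltW // divr_gt0 // ltr0n.
apply: le_trans (ler_wpM2l _ (hM n.+1)); last by rewrite invr_ge0 ltW.
have sh (m : 'X_{1..N < n}) : (mdeg (m + U_(i))%MM < n.+1)%N.
  by rewrite mdegD mdeg1 addn1 ltnS bmdeg.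
pose h (m : 'X_{1..N < n}) : 'X_{1..N < n.+1} := BMultinom (sh m).
have hinj : injective h.
  move=> m m' /(congr1 (@bmnm _ _)) /= /addIm e.
  exact: val_inj.
pose g (m : 'X_{1..N < n.+1}) := r^-1 * (`|f m| * r ^+ mdeg m).
rewrite {2}/pnorm mulr_sumr -/g.
apply: (@le_trans _ _ (\sum_(m in h @: setT) g m)); last first.
  rewrite [leRHS](bigID (mem (h @: setT))) /= lerDl.
  by apply: sumr_ge0 => m _; rewrite !mulr_ge0 ?invr_ge0 ?exprn_ge0 // ltW.
rewrite big_imset /=; last by move=> ? ? _ _; apply: hinj.
rewrite (eq_bigl xpredT) => [|m]; last by rewrite in_setT.
apply: ler_sum => m _.
rewrite /g /derivc /= mdegD mdeg1 addn1 normrM normr_nat exprS.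
have -> : r^-1 * (`|f (m + U_(i))%MM| * (r * r ^+ mdeg m)) =
    `|f (m + U_(i))%MM| * r ^+ mdeg m by rewrite mulrCA mulKf // gt_eqF.
rewrite [_%:R * _]mulrC -mulrA ler_wpM2l // expr_div_n mulrCA.
rewrite ler_piMr ?exprn_ge0 ?(ltW r0) // ler_pdivrMr ?exprn_gt0 ?ltr0n //.
rewrite mul1r -natrX ler_nat; apply: (@leq_trans (2 ^ m i)); first exact: ltn_expl.
by rewrite leq_exp2l // mdegE (bigD1 i) //= leq_addr.
Qed.

Definition pderiv i f : cps C N := Cps (derivc_convergent i f).

End Derivative.

Definition cvar {C : numClosedFieldType} {N : nat} (i : 'I_N) : cps C N :=
  Cps (convergent_mon U_(i)).

Section Ideals.
Context {A : comNzRingType}.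
Implicit Types (S I J : A -> Prop).

Definition ideal_gen S (h : A) : Prop :=
  exists n (a s : 'I_n -> A), (forall i, S (s i)) /\ h = \sum_i a i * s i.

Definition principal (f : A) : A -> Prop := ideal_gen (fun h => h = f).

Definition ideal_sum I J (h : A) : Prop :=
  exists a b, [/\ I a, J b & h = a + b].

Definition ideal_mul I J : A -> Prop :=
  ideal_gen (fun h => exists a b, [/\ I a, J b & h = a * b]).

Definition ideal_exp I (m : nat) : A -> Prop :=
  iter m (ideal_mul I) (fun=> True).

End Ideals.

Section Multiplicity.
Context {C : numClosedFieldType} {N : nat}.
Implicit Types (h : cps C N).

Definition max_ideal h : Prop := h 0%MM = 0.

Definition mt_ge (d : nat) h : Prop := forall m, (mdeg m < d)%N -> h m = 0.
Definition has_mt h (d : nat) : Prop := mt_ge d h /\ ~ mt_ge d.+1 h.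

(* [g] induces a C-basis of the image of [W] in the quotient by [J], that is
   of W / (W :&: J), which is W / J when [W] contains [J]. *)
Definition basis_mod (W J : cps C N -> Prop) n (g : 'I_n -> cps C N) : Prop :=
  [/\ forall i, W (g i),
      forall c : 'I_n -> C, J (\sum_i c i *: g i) -> forall i, c i = 0
    & forall h, W h -> exists c : 'I_n -> C, J (h - \sum_i c i *: g i)].

End Multiplicity.

(* Plane curve germs.  The smooth surface germ is identified with the germ of
   C^2 at 0, so that its local ring is [cps C 2]. *)
Section PlaneCurves.
Context {C : numClosedFieldType}.
Implicit Types (f g h u v : cps C 2).

Definition reduced_singularity f : Prop :=
  [/\ f <> 0, mt_ge 2 f &
      forall h n, principal f (h ^+ n) -> principal f h].

Definition jacobian_ideal f : cps C 2 -> Prop :=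
  ideal_gen (fun h => h = pderiv ord0 f \/ h = pderiv ord_max f).

(* h = u v for local coordinates u, v at the point *)
Definition node h : Prop :=
  exists u v, [/\ max_ideal u, max_ideal v,
    u U_(ord0)%MM * v U_(ord_max)%MM - u U_(ord_max)%MM * v U_(ord0)%MM != 0
    & h = u * v].

(* Points of the exceptional line of the blow-up of the origin: the tangent
   direction y = c x, or x = 0. *)
Inductive direction := Slope of C | Vertical.

(* The infinitely near points are the finite sequences of directions, the
   first one being a direction at z.  At each of them we use the coordinates
   (x, y) of the chart (x, x (c + y)), resp. (x y, y), of the last blow-up,
   which are centred at that point. *)
Definition infinitely_near := seq direction.
Implicit Types (p q : infinitely_near) (d : direction).

Definition pullback d g : cps C 2 :=
  let x := cvar ord0 in let y := cvar ord_max in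
  match d with
  | Slope c => subst g (fun i => if i == ord0 then x else x * (c%:A + y))
  | Vertical => subst g (fun i => if i == ord0 then x * y else y)
  end.

Definition exceptional d : cps C 2 :=
  if d is Slope _ then cvar ord0 else cvar ord_max.

Definition total_transform g q : cps C 2 :=
  foldl (fun h d => pullback d h) g q.

(* [reduced_transform f q h]: h is an equation of the germ at q of the reduced
   total transform; blowing up a point replaces a reduced equation h of
   multiplicity m by e * g, where e is the exceptional divisor and g the strict
   transform, e ^+ m * g being the pull-back of h. *)
Inductive reduced_transform f : infinitely_near -> cps C 2 -> Prop :=
| reduced_transform_root : reduced_transform f [::] f
| reduced_transform_blowup p d h m g :
    reduced_transform f p h -> has_mt h m ->
    exceptional d ^+ m * g = pullback d h ->
    reduced_transform f (rcons p d) (exceptional d * g).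

Inductive essential_tree f : infinitely_near -> Prop :=
| essential_tree_root : essential_tree f [::]
| essential_tree_blowup p d h :
    essential_tree f p -> reduced_transform f (rcons p d) h ->
    mt_ge 2 h -> ~ node h -> essential_tree f (rcons p d).

(* The topological singularity ideal I^s(C, z). *)
Definition singularity_ideal f g : Prop :=
  forall q m, essential_tree f q -> has_mt (total_transform f q) m ->
    mt_ge m (total_transform g q).

End PlaneCurves.

Arguments direction : clear implicits.
Arguments infinitely_near : clear implicits.

(* The complex germ in (C^k, 0) with local ring C{t_1, ..., t_k} / gideal; up
   to isomorphism every complex germ is of this form. *)
Record germ (C : numClosedFieldType) (k : nat) := Germ {
  gideal : cps C k -> Prop;
  gideal_ideal : forall h, ideal_gen gideal h -> gideal h;
  gideal_proper : forall h, gideal h -> max_ideal h }.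

Definition subgerm {C k} (T' T : germ C k) : Prop :=
  forall h, gideal T h -> gideal T' h.

Section AffineGerm.
Context {C : numClosedFieldType} (k : nat).

Lemma affine_ideal (h : cps C k) : ideal_gen (fun h => h = 0) h -> h = 0.
Proof.
by move=> [n [a [s [hs ->]]]]; rewrite big1 // => i _; rewrite hs mulr0.
Qed.

Lemma affine_proper (h : cps C k) : h = 0 -> max_ideal h.
Proof. by move=> ->. Qed.

(* (C^k, 0) *)
Definition affine_germ : germ C k := Germ affine_ideal affine_proper.

End AffineGerm.

(* Functions on Sigma x (C^k, 0): series in x, y, t_1, ..., t_k, in this
   order.  Functions on Sigma x T are such series modulo [idealM T]. *)
Section Families.
Context {C : numClosedFieldType}.

Definition xvar {k} : cps C (2 + k) := cvar (lshift k ord0).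
Definition yvar {k} : cps C (2 + k) := cvar (lshift k ord_max).
Definition tvar {k} (j : 'I_k) : cps C (2 + k) := cvar (rshift 2 j).

(* F(a, b, c_1, ..., c_k) *)
Definition eval {k n} (F : cps C (2 + k)) (a b : cps C n) (c : 'I_k -> cps C n)
    : cps C n :=
  subst F (fun i => match split i with
                    | inl j => if j == ord0 then a else b
                    | inr j => c j
                    end).

Definition liftT {k} (a : cps C k) : cps C (2 + k) := subst a tvar.
Definition liftS {k} (g : cps C 2) : cps C (2 + k) :=
  subst g (fun i => cvar (lshift k i)).
Definition special {k} (F : cps C (2 + k)) : cps C 2 :=
  eval F (cvar ord0) (cvar ord_max) (fun=> 0).
Definition on_trivial_section {k} (F : cps C (2 + k)) : cps C k :=
  eval F 0 0 cvar.

Definition idealM {k} (T : germ C k) : cps C (2 + k) -> Prop :=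
  ideal_gen (fun h => exists2 a, gideal T a & h = liftT a).

(* The ideal of the hypersurface germ F = 0 of Sigma x T. *)
Definition idealC {k} (T : germ C k) (F : cps C (2 + k)) : cps C (2 + k) -> Prop :=
  ideal_gen (fun h => h = F \/ exists2 a, gideal T a & h = liftT a).

(* Flatness of O_(Sigma x T) / J over O_T, by the equational criterion: every
   relation with coefficients in O_T is a consequence of relations in O_T. *)
Definition flat {k} (T : germ C k) (J : cps C (2 + k) -> Prop) : Prop :=
  forall n (a : 'I_n -> cps C k) (m : 'I_n -> cps C (2 + k)),
    J (\sum_i liftT (a i) * m i) ->
    exists l (b : 'I_n -> 'I_l -> cps C k) (w : 'I_l -> cps C (2 + k)),
      (forall i, J (m i - \sum_j liftT (b i j) * w j)) /\
      (forall j, gideal T (\sum_i a i * b i j)).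

Definition embedded_deformation (f : cps C 2) {k} (T : germ C k)
    (F : cps C (2 + k)) : Prop :=
  (forall h, principal (special F) h <-> principal f h) /\ flat T (idealC T F).

(* F lies in the m-th power of the ideal of the section (a, b) of Sigma x T. *)
Definition equimultiple {k} (T : germ C k) (F : cps C (2 + k))
    (s : cps C k * cps C k) (m : nat) : Prop :=
  ideal_sum
    (ideal_exp (ideal_gen (fun h => h = xvar - liftT s.1 \/ h = yvar - liftT s.2)) m)
    (idealM T) F.

(* Pull-back to the blow-up of Sigma x T along the section s, in the chart
   around the point d of the exceptional line of the special fibre. *)
Definition pullback_rel (d : direction C) {k} (s : cps C k * cps C k)
    (F : cps C (2 + k)) : cps C (2 + k) :=
  match d with
  | Slope c => eval F (liftT s.1 + xvar) (liftT s.2 + xvar * (c%:A + yvar)) tvar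
  | Vertical => eval F (liftT s.1 + xvar * yvar) (liftT s.2 + yvar) tvar
  end.

Definition exceptional_rel (d : direction C) {k} : cps C (2 + k) :=
  if d is Slope _ then xvar else yvar.

(* F = 0 is an equisingular deformation of f = 0 over T, with sections [s q]
   and reduced total transforms [Ft q] = 0 at the points q of the essential
   tree. *)
Record es_structure (f : cps C 2) {k} (T : germ C k) (F : cps C (2 + k))
    (s : infinitely_near C -> cps C k * cps C k)
    (Ft : infinitely_near C -> cps C (2 + k)) : Prop := EsStructure {
  es_root : Ft [::] = F;
  es_section : forall q, essential_tree f q ->
    max_ideal (s q).1 /\ max_ideal (s q).2;
  es_deformation : forall q h m, essential_tree f q ->
    reduced_transform f q h -> has_mt h m ->
    embedded_deformation h T (Ft q) /\ equimultiple T (Ft q) (s q) m;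
  es_blowup : forall p d h m, essential_tree f (rcons p d) ->
    reduced_transform f p h -> has_mt h m ->
    exists2 G, idealM T (exceptional_rel d ^+ m * G - pullback_rel d (s p) (Ft p))
             & idealM T (Ft (rcons p d) - exceptional_rel d * G) }.

(* Straight: all the sections, including the one through z, are trivial. *)
Definition straight_es (f : cps C 2) {k} (T : germ C k) (F : cps C (2 + k)) : Prop :=
  exists Ft, es_structure f T F (fun=> (0, 0)) Ft.

(* A morphism of deformations of f = 0, from F = 0 over T to G = 0 over S,
   given by (x, y, t) |-> (X, Y, phi).  It has to restrict to the identity of
   the special fibre.  By flatness the square over T -> S is cartesian, so that
   F = 0 is then isomorphic to the pull-back of G = 0 by phi. *)
Definition deformation_morphism (f : cps C 2) {k l} (T : germ C k) (S : germ C l)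
    (F : cps C (2 + k)) (G : cps C (2 + l)) (X Y : cps C (2 + k))
    (phi : 'I_l -> cps C k) : Prop :=
  [/\ forall j, max_ideal (phi j),
      forall a, gideal S a -> gideal T (subst a phi),
      idealC T F (eval G X Y (fun j => liftT (phi j))),
      principal f (special X - cvar ord0)
    & principal f (special Y - cvar ord_max)].

(* The same, compatible with the trivial sections. *)
Definition deformation_morphism_sec (f : cps C 2) {k l} (T : germ C k)
    (S : germ C l) (F : cps C (2 + k)) (G : cps C (2 + l)) (X Y : cps C (2 + k))
    (phi : 'I_l -> cps C k) : Prop :=
  [/\ deformation_morphism f T S F G X Y phi,
      gideal T (on_trivial_section X) & gideal T (on_trivial_section Y)].

(* Semiuniversality of G over S among the deformations satisfying [obj]:
   versality (a morphism to G defined on the restriction of F to a closed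
   subgerm T' of T extends to F) and uniqueness of the tangent map T -> S,
   i.e. of the induced map on cotangent spaces m / (m^2 + I). *)
Definition semiuniversal
    (obj : forall k, germ C k -> cps C (2 + k) -> Prop)
    (mor : forall k l, germ C k -> germ C l -> cps C (2 + k) -> cps C (2 + l) ->
       cps C (2 + k) -> cps C (2 + k) -> ('I_l -> cps C k) -> Prop)
    {l} (S : germ C l) (G : cps C (2 + l)) : Prop :=
  [/\ obj l S G,
      forall k (T T' : germ C k) F X' Y' phi', obj k T F -> subgerm T' T ->
        mor k l T' S F G X' Y' phi' ->
        exists X Y phi, [/\ mor k l T S F G X Y phi,
          forall j, gideal T' (phi j - phi' j),
          idealC T' F (X - X') & idealC T' F (Y - Y')]
    & forall k (T : germ C k) F X1 Y1 phi1 X2 Y2 phi2, obj k T F ->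
        mor k l T S F G X1 Y1 phi1 -> mor k l T S F G X2 Y2 phi2 ->
        forall j, ideal_sum (ideal_exp max_ideal 2) (gideal T) (phi1 j - phi2 j)].

Definition semiuniversal_straight_es (f : cps C 2) {l} (S : germ C l)
    (G : cps C (2 + l)) : Prop :=
  semiuniversal (@straight_es f) (@deformation_morphism_sec f) S G.

(* After forgetting the trivial section the objects are the same, but the
   morphisms no longer have to preserve it. *)
Definition semiuniversal_straight_es_nosec (f : cps C 2) {l} (S : germ C l)
    (G : cps C (2 + l)) : Prop :=
  semiuniversal (@straight_es f) (@deformation_morphism f) S G.

(* f + sum_i t_i g_i *)
Definition unfolding (f : cps C 2) n (g : 'I_n -> cps C 2) : cps C (2 + n) :=
  liftS f + \sum_i tvar i * liftS (g i).

End Families.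

(* Main.v *)
(* Write I for the topological singularity ideal and J for <f, m j(f)>, resp.
   <f, j(f)>.  The essential tree has bounded height, so I has finite
   codimension, and J has finite codimension since f is reduced.

   (a) If xi is a vector field with xi f in I, then xi vanishes at z and
   preserves I: otherwise the points infinitely near to z on an integral curve
   of xi would all belong to the tree.
   (b) Up to the ideal of the base, a straight family is given by an equation all
   of whose coefficients with respect to t are in I.
   (c) Complete a basis g of I modulo J by elements e to a basis modulo J of the
   local ring.  Flows of vector fields show that a family which agrees with
   f + sum v_i g_i + sum w_j e_j over a closed subgerm is induced from it, the
   induction morphism extending the given one.
   (d) Along a straight family, (a) applied to the homogeneous components of the
   vector field induced by the Euler field of the base shows that w = 0.

   This gives versality; the tangent map is unique because the g_i are
   independent modulo J. *)

Require Import Defs.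
From HB Require Import structures.
From mathcomp Require Import all_boot all_order all_algebra.
From mathcomp Require Import boolp reals complex.
From mathcomp Require Import mpoly.
From mathcomp Require Import separable mxpoly zify ring.

Set Implicit Arguments.
Unset Strict Implicit.
Unset Printing Implicit Defensive.

Import Order.TTheory GRing.Theory Num.Theory.
Local Open Scope ring_scope.

(** * Convergent power series *)

(** The base is an arbitrary convergent germ, so an argument by small extensions would leave
    convergence open. Instead the work is done on the smooth ambient germ [(C^k, 0)]: modulo the
    ideal of the base a straight family is replaced by one whose coefficients lie in I exactly, and
    this family over [(C^k, 0)] is compared with the unfolding. There an Euler field exists, which a
    general base does not have. Extending a morphism from a subgerm becomes the absorption of a
    perturbation [sum a_j w_j] with the [a_j] in its ideal: the flow for the time [a_j] changes all
    data by multiples of [a_j] only. Two analytic inputs carry the convergence: division with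
    parameters, which spreads a decomposition on the special fibre over the base, and the solution
    of [V u + al u = 0] by an exponential series. Flatness of the unfolding over a base of any
    dimension is a separate obstacle; it is reduced to relations between power series in fewer
    variables. Both parts of the theorem are instances of one argument: a flag [sec] tells whether
    the vector fields have to vanish along the section. *)

Section Coefficients.
Context {C : numClosedFieldType} {N : nat}.
Implicit Types (f g h : cps C N) (m k l : 'X_{1..N}) (c : C).

Lemma coefD f g m : (f + g) m = f m + g m. Proof. by []. Qed.
Lemma coefN f m : (- f) m = - f m. Proof. by []. Qed.
Lemma coefB f g m : (f - g) m = f m - g m. Proof. by []. Qed.
Lemma coef0 m : (0 : cps C N) m = 0. Proof. by []. Qed.
Lemma coef1 m : (1 : cps C N) m = (m == 0%MM)%:R. Proof. by []. Qed.
Lemma coefZ c f m : (c *: f) m = c * f m. Proof. by []. Qed.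

Lemma coef_sum I (r : seq I) P (F : I -> cps C N) m :
  (\sum_(i <- r | P i) F i) m = \sum_(i <- r | P i) F i m.
Proof. by apply: (big_ind2 (fun (f : cps C N) c => f m = c)) => // f c g d <- <-. Qed.

Lemma coefM n f g m : (mdeg m < n)%N -> (f * g) m =
  \sum_(k : 'X_{1..N < n, n} | m == (k.1 + k.2)%MM) f k.1 * g k.2.
Proof.
move=> mn; rewrite [LHS](mulc_trunc _ _ mn) (mcoeff_poly_mul _ _ mn).
by apply: eq_bigr => k _; rewrite !truncE !bmdeg.
Qed.

Lemma coefM_single f g (k0 l0 : 'X_{1..N}) :
  (forall k l, (k + l = k0 + l0)%MM -> k <> k0 -> f k * g l = 0) ->
  (f * g) (k0 + l0)%MM = f k0 * g l0.
Proof.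
move=> h; rewrite (coefM _ _ (ltnSn _)).
have h1 : (mdeg k0 < (mdeg (k0 + l0)).+1)%N by rewrite ltnS mdegD leq_addr.
have h2 : (mdeg l0 < (mdeg (k0 + l0)).+1)%N by rewrite ltnS mdegD leq_addl.
rewrite (bigD1 (BMultinom h1, BMultinom h2)) //= big1 ?addr0 // => -[k l] /= /andP[/eqP e].
move=> n; apply: h => // e1; case/eqP: n; move: e; rewrite e1 => /addmI e.
by congr pair; apply: val_inj.
Qed.

Lemma coefM_eq0 f g m :
  (forall k l, (k + l)%MM = m -> f k * g l = 0) -> (f * g) m = 0.
Proof.
by move=> h; rewrite (coefM _ _ (ltnSn _)) big1 // => -[k l] /= /eqP e; apply: h.
Qed.

Lemma coefM0 f g : (f * g) 0%MM = f 0%MM * g 0%MM.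
Proof.
rewrite -[in LHS](addm0 0%MM); apply: coefM_single => k l /eqP.
by rewrite addm0 mnmD_eq0 => /andP[/eqP -> _].
Qed.

Lemma coefX0 f n : (f ^+ n) 0%MM = f 0%MM ^+ n.
Proof. by elim: n => [|n ih]; rewrite ?expr0 ?coef1 ?eqxx // !exprS coefM0 ih. Qed.

Definition zm m : cps C N := Cps (convergent_mon m).

Lemma coef_zm m k : zm m k = (k == m)%:R. Proof. by []. Qed.
Lemma cvarE (i : 'I_N) : cvar i = zm U_(i). Proof. by []. Qed.
Lemma zm0 : zm 0%MM = 1. Proof. exact: cpsP. Qed.

Lemma coef_zmM k f m : (zm k * f) m = if (k <= m)%MM then f (m - k)%MM else 0.
Proof.
case: ifP => hk.
  rewrite -[in LHS](submK hk) addmC coefM_single ?coef_zm ?eqxx ?mul1r // => a b _.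
  by move=> /eqP/negPf n; rewrite coef_zm n mul0r.
apply: coefM_eq0 => a b e; rewrite coef_zm; case: eqP => [ea|_]; last by rewrite mul0r.
by move: hk; rewrite -e ea lem_addr.
Qed.

Lemma coef_zmMD k f m : (zm k * f) (k + m)%MM = f m.
Proof. by rewrite coef_zmM lem_addr addmC addmK. Qed.

Lemma zmD m k : zm (m + k)%MM = zm m * zm k.
Proof.
apply: cpsP => a; rewrite coef_zmM !coef_zm; case: ifP => h.
  by congr (nat_of_bool _)%:R; rewrite -{1}(submK h) [RHS]eq_sym addmC eqm_add2l eq_sym.
by case: eqP => // e; move: h; rewrite e lem_addr.
Qed.

Lemma zm_ind (P : cps C N -> Prop) :
  P 1 -> (forall i f, P f -> P (cvar i * f)) -> forall m, P (zm m).
Proof.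
move=> P1 PS m; have [n] := ubnP (mdeg m); elim: n m => // n ih m.
have [->|mn0] := eqVneq m 0%MM; first by rewrite zm0.
have [i im] : exists i, m i != 0%N.
  apply/existsP; rewrite -[X in is_true X]negbK negb_exists; apply/negP => /forallP h.
  by case/eqP: mn0; apply/mnmP => i; rewrite mnm0E; move: (h i); rewrite negbK => /eqP.
have -> : m = (U_(i) + (m - U_(i)))%MM by rewrite addmC submK // lep1mP.
by rewrite mdegD mdeg1 ltnS => h; rewrite zmD; apply: PS; apply: ih.
Qed.

Lemma coef_cvarM (i : 'I_N) f m :
  (cvar i * f) m = if m i == 0%N then 0 else f (m - U_(i))%MM.
Proof. by rewrite cvarE coef_zmM lep1mP; case: eqP. Qed.

Lemma coef_cvarMU (i : 'I_N) f m : (cvar i * f) (U_(i) + m)%MM = f m.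
Proof. by rewrite cvarE coef_zmMD. Qed.

Lemma max_cvar (i : 'I_N) : max_ideal (cvar i : cps C N).
Proof. by rewrite /max_ideal cvarE coef_zm eq_sym mnm1_eq0. Qed.

Lemma coefA c m : (c%:A : cps C N) m = if m == 0%MM then c else 0.
Proof. by rewrite coefZ coef1; case: eqP; rewrite ?mulr1 ?mulr0. Qed.

Lemma mt_ge1P f : mt_ge 1 f <-> max_ideal f.
Proof.
split=> [h|h m]; first by apply: h; rewrite mdeg0.
by rewrite ltnS leqn0 mdeg_eq0 => /eqP ->.
Qed.
Lemma mt_ge_le d e f : (d <= e)%N -> mt_ge e f -> mt_ge d f.
Proof. by move=> de h m md; apply: h; apply: leq_trans de. Qed.
Lemma mt_ge_zero d : mt_ge d (0 : cps C N). Proof. by []. Qed.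
Lemma mt_geD d f g : mt_ge d f -> mt_ge d g -> mt_ge d (f + g).
Proof. by move=> hf hg m md; rewrite coefD hf ?hg ?addr0. Qed.
Lemma mt_geN d f : mt_ge d f -> mt_ge d (- f).
Proof. by move=> hf m md; rewrite coefN hf ?oppr0. Qed.
Lemma mt_geB d f g : mt_ge d f -> mt_ge d g -> mt_ge d (f - g).
Proof. by move=> hf hg; apply: mt_geD => //; apply: mt_geN. Qed.
Lemma mt_geZ d c f : mt_ge d f -> mt_ge d (c *: f).
Proof. by move=> hf m md; rewrite coefZ hf ?mulr0. Qed.
Lemma mt_ge_sum d I (r : seq I) (P : pred I) (F : I -> cps C N) :
  (forall i, P i -> mt_ge d (F i)) -> mt_ge d (\sum_(i <- r | P i) F i).
Proof. by move=> h; apply: big_ind => // f g; apply: mt_geD. Qed.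
Lemma mt_geM d e f g : mt_ge d f -> mt_ge e g -> mt_ge (d + e) (f * g).
Proof.
move=> hf hg m hm; apply: coefM_eq0 => k l em.
have [hk|hk] := ltnP (mdeg k) d; first by rewrite hf // mul0r.
rewrite hg ?mulr0 // ltnNge; apply/negP => hl.
by move: hm; rewrite -em mdegD ltnNge leq_add.
Qed.
Lemma mt_geMl d f g : mt_ge d g -> mt_ge d (f * g).
Proof. by move=> h; rewrite -[d]add0n; apply: mt_geM. Qed.
Lemma mt_geMr d f g : mt_ge d f -> mt_ge d (f * g).
Proof. by rewrite mulrC; apply: mt_geMl. Qed.
Lemma mt_geX d f n : mt_ge d f -> mt_ge (d * n) (f ^+ n).
Proof.
by move=> h; elim: n => [|n ih]; rewrite ?muln0 // exprS mulnS; apply: mt_geM.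
Qed.
Lemma mt_ge_zm m : mt_ge (mdeg m) (zm m).
Proof. by move=> k; rewrite coef_zm; case: eqP => // ->; rewrite ltnn. Qed.
Lemma mt_ge_eq0 f : (forall d, mt_ge d f) -> f = 0.
Proof. by move=> h; apply: cpsP => m; apply: (h (mdeg m).+1). Qed.

Lemma max_idealD f g : max_ideal f -> max_ideal g -> max_ideal (f + g).
Proof. by rewrite -!mt_ge1P; apply: mt_geD. Qed.
Lemma max_idealMl f g : max_ideal g -> max_ideal (f * g).
Proof. by rewrite -!mt_ge1P; apply: mt_geMl. Qed.
Lemma max_idealMr f g : max_ideal f -> max_ideal (f * g).
Proof. by rewrite -!mt_ge1P; apply: mt_geMr. Qed.

Definition jet n f : cps C N := \sum_(m : 'X_{1..N < n}) f m *: zm m.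

Lemma coef_jet n f m : jet n f m = if (mdeg m < n)%N then f m else 0.
Proof.
rewrite coef_sum; case: ifP => h.
  rewrite (bigD1 (BMultinom h)) // coefZ coef_zm eqxx mulr1 big1 => [|k hk]; first exact: addr0.
  rewrite coefZ coef_zm; case: (m =P k) => [e|_]; last by rewrite mulr0.
  by move/eqP: hk => []; apply: val_inj.
rewrite big1 // => k _; rewrite coefZ coef_zm; case: (m =P k) => [e|_]; last by rewrite mulr0.
by move: h; rewrite e bmdeg.
Qed.

Lemma jet_rest n f : mt_ge n (f - jet n f).
Proof. by move=> m h; rewrite coefB coef_jet h subrr. Qed.

Lemma lead_exists f : f <> 0 ->
  exists m, f m != 0 /\ forall k, (k < m)%O -> f k = 0.
Proof.
move=> f0; suff: exists m, f m != 0.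
  case=> m; elim/(@ltmwf N): m => m ih fm.
  have [[k [km fk]]|h] := pselect (exists k, (k < m)%O /\ f k != 0); first exact: ih fk.
  exists m; split=> // k km; apply/eqP; apply: contraPT isT => fk _.
  by apply: h; exists k.
apply: contra_notP f0 => h; apply: cpsP => m; apply/eqP; apply: contraPT isT => fm _.
by apply: h; exists m.
Qed.

(** The order on exponents is compatible with addition and refines the degree, so leading terms
    multiply. This gives both the absence of zero divisors and the additivity of multiplicities. *)
Lemma leadM f g (m k : 'X_{1..N}) : (forall l, (l < m)%O -> f l = 0) ->
  (forall l, (l < k)%O -> g l = 0) -> (f * g) (m + k)%MM = f m * g k.
Proof.
move=> hf hg; apply: coefM_single => a b e am.
have [lt|ge] := boolP (a < m)%O; first by rewrite hf ?mul0r.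
rewrite hg ?mulr0 //; rewrite ltNge; apply/negP => kb.
have ma : (m < a)%O by rewrite lt_neqAle eq_sym leNgt ge andbT; apply/eqP.
by have := ltmc_le_add ma kb; rewrite e ltxx.
Qed.

Lemma cps_mulf_eq0 f g : f * g = 0 -> (f == 0) || (g == 0).
Proof.
move=> fg; apply/orP; have [_|f0] := (f =P 0); [by left|right].
apply/negPn/negP => /eqP g0.
have [m [fm hm]] := lead_exists f0.
have [k [gk hk]] := lead_exists g0.
by have := leadM hm hk; rewrite fg coef0 => /esym/eqP; rewrite mulf_eq0 (negPf fm) (negPf gk).
Qed.

Lemma has_mt_lead f m : f m != 0 -> (forall k, (k < m)%O -> f k = 0) -> has_mt f (mdeg m).
Proof.
move=> fm h; split=> [k km|/(_ m (ltnSn _))/eqP]; last by rewrite (negPf fm).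
by apply: h; apply: lt_mdeg_ltmc.
Qed.

Lemma has_mt_exists f : f <> 0 -> exists d, has_mt f d.
Proof. by case/lead_exists=> m [fm h]; exists (mdeg m); apply: has_mt_lead. Qed.

Lemma has_mt_neq0 f d : has_mt f d -> f <> 0.
Proof. by case=> _ h e; apply: h; rewrite e. Qed.

Lemma has_mt_le f d e : has_mt f d -> mt_ge e f -> (e <= d)%N.
Proof.
by case=> _ hd he; rewrite leqNgt; apply/negP => de; apply: hd; apply: mt_ge_le he.
Qed.

Lemma has_mt_uniq f d e : has_mt f d -> has_mt f e -> d = e.
Proof.
by move=> hd he; apply/eqP; rewrite eqn_leq (has_mt_le hd (proj1 he)) (has_mt_le he (proj1 hd)).
Qed.

Lemma has_mtP f d : has_mt f d <->
  mt_ge d f /\ exists2 m, mdeg m = d & f m != 0.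
Proof.
split=> -[h1 h2]; split=> //.
  apply: contra_notP h2 => h m; rewrite ltnS leq_eqVlt => /predU1P[e|]; last exact: h1.
  by apply/eqP; apply: contraPT isT => fm _; apply: h; exists m.
by case: h2 => m md fm /(_ m); rewrite md ltnSn => /(_ isT)/eqP; rewrite (negPf fm).
Qed.

Lemma has_mtM f g d e : has_mt f d -> has_mt g e -> has_mt (f * g) (d + e).
Proof.
move=> hf hg.
have [m [fm hm]] := lead_exists (has_mt_neq0 hf).
have [k [gk hk]] := lead_exists (has_mt_neq0 hg).
rewrite (has_mt_uniq hf (has_mt_lead fm hm)) (has_mt_uniq hg (has_mt_lead gk hk)).
apply/has_mtP; split; first by apply: mt_geM; [exact: (has_mt_lead fm hm).1|exact: (has_mt_lead gk hk).1].
by exists (m + k)%MM; rewrite ?mdegD // leadM // mulf_neq0.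
Qed.

End Coefficients.

(** * Linear maps of series determined by their values on monomials *)

Section LinearExtension.
Context {C : numClosedFieldType} {N K : nat}.
Implicit Types (L : cps C N -> cps C K).

Definition lin L := forall c f g, L (c *: f + g) = c *: L f + L g.
(** Continuity for the filtration by order with a fixed loss [d]: 0 for substitutions, 1 for
    derivations. *)
Definition order_lowering d L := forall e f, mt_ge (e + d) f -> mt_ge e (L f).

Lemma lin0 L : lin L -> L 0 = 0.
Proof.
move=> h; have := h 1 0 0; rewrite !scale1r addr0 => /eqP.
by rewrite -{1}[L 0]addr0 (inj_eq (addrI _)) => /eqP.
Qed.
Lemma linD L f g : lin L -> L (f + g) = L f + L g.
Proof. by move=> h; have := h 1 f g; rewrite !scale1r. Qed.
Lemma linZ L c f : lin L -> L (c *: f) = c *: L f.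
Proof. by move=> h; have := h c f 0; rewrite (lin0 h) !addr0. Qed.
Lemma linN L f : lin L -> L (- f) = - L f.
Proof. by move=> h; rewrite -scaleN1r linZ // scaleN1r. Qed.
Lemma linB L f g : lin L -> L (f - g) = L f - L g.
Proof. by move=> h; rewrite linD // linN. Qed.
Lemma lin_sum L I (r : seq I) P F : lin L ->
  L (\sum_(i <- r | P i) F i) = \sum_(i <- r | P i) L (F i).
Proof. by move=> h; apply: (big_morph L (fun f g => linD f g h) (lin0 h)). Qed.

(** Modulo any order a series is a finite combination of monomials, which are built from [1] by
    multiplication with variables; the bounded loss of order controls the rest. *)
Lemma lin_ext d L1 L2 : lin L1 -> lin L2 -> order_lowering d L1 -> order_lowering d L2 ->
  L1 1 = L2 1 -> (forall i f, L1 f = L2 f -> L1 (cvar i * f) = L2 (cvar i * f)) ->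
  forall f, L1 f = L2 f.
Proof.
move=> l1 l2 o1 o2 h1 hS f; apply/eqP; rewrite -subr_eq0; apply/eqP/mt_ge_eq0 => e.
have E : L1 (jet (e + d) f) = L2 (jet (e + d) f).
  rewrite !lin_sum //; apply: eq_bigr => m _; rewrite !linZ //; congr (_ *: _).
  exact: (zm_ind (P := fun f => L1 f = L2 f)).
set j := jet (e + d) f in E.
have -> : L1 f = L1 (f - j) + L1 j by rewrite -linD // subrK.
have -> : L2 f = L2 (f - j) + L2 j by rewrite -linD // subrK.
rewrite E opprD addrACA subrr addr0.
by apply: mt_geB; [apply: o1|apply: o2]; apply: jet_rest.
Qed.

End LinearExtension.

(** * Substitution as a morphism of algebras *)

Section SubstitutionTheory.
Context {C : numClosedFieldType} {N K : nat}.
Implicit Types (f g h : cps C N) (phi psi : 'I_N -> cps C K).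

Lemma comp_ord n (p : {mpoly C[N]}) (lq : N.-tuple {mpoly C[K]}) :
  (forall i, ord_ge 1 (tnth lq i)) -> ord_ge n p -> ord_ge n (p \mPo lq).
Proof.
move=> hq hp m mn; rewrite comp_mpolyE raddf_sum big1 // => k _ /=; rewrite mcoeffZ.
have [/hp ->|kn] := ltnP (mdeg k) n; first by rewrite mul0r.
by rewrite (@ord_ge_prod _ _ _ lq k hq m) ?mulr0 // (leq_trans mn).
Qed.

Definition sarg n phi : N.-tuple {mpoly C[K]} :=
  [tuple trunc n (drop_const (phi i)) | i < N].

Lemma sarg_ord n phi i : ord_ge 1 (tnth (sarg n phi) i).
Proof. by rewrite tnth_mktuple; apply: ord_ge_trunc_drop_const. Qed.

Lemma coef_subst n f phi m : (mdeg m < n)%N ->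
  subst f phi m = (trunc n f \mPo sarg n phi)@_m.
Proof. exact: substc_trunc. Qed.

Lemma comp_cong n (p p' : {mpoly C[N]}) (lq : N.-tuple {mpoly C[K]}) :
  (forall i, ord_ge 1 (tnth lq i)) -> cong n p p' -> cong n (p \mPo lq) (p' \mPo lq).
Proof.
move=> hq hp m mn; apply/eqP; rewrite -subr_eq0 -mcoeffB -comp_mpolyB.
by apply/eqP; apply: (comp_ord hq _ mn) => k kn; rewrite mcoeffB hp ?subrr.
Qed.

Lemma substL c f g phi : subst (c *: f + g) phi = c *: subst f phi + subst g phi.
Proof.
apply: cpsP => m; rewrite coefD coefZ !(coef_subst _ _ (ltnSn _)).
rewrite -mcoeffZ -mcoeffD -comp_mpolyZ -comp_mpolyD.
apply: comp_cong (ltnSn _) => [i|k kn]; first exact: sarg_ord.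
by rewrite mcoeffD mcoeffZ !truncE kn.
Qed.

Lemma subst_lin phi : lin (fun f => subst f phi).
Proof. by move=> c f g; apply: substL. Qed.

Lemma mt_ge_subst d f phi : mt_ge d f -> mt_ge d (subst f phi).
Proof.
move=> h m md; rewrite (coef_subst _ _ md).
apply: comp_ord md => [i|k kd]; first exact: sarg_ord.
by rewrite truncE kd h.
Qed.

Lemma substM f g phi : subst (f * g) phi = subst f phi * subst g phi.
Proof.
apply: cpsP => m; pose n := (mdeg m).+1.
rewrite (coef_subst _ _ (ltnSn _)) -/n.
rewrite [RHS](mulc_trunc _ _ (ltnSn _)) -/n.
transitivity (((trunc n f * trunc n g) \mPo sarg n phi)@_m).
  apply: comp_cong (ltnSn _) => [i|k kn]; first exact: sarg_ord.
  by rewrite truncE kn; apply: mulc_trunc.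
rewrite rmorphM; apply: (congM _ _ (ltnSn _)) => k kn; rewrite truncE kn.
  by rewrite -coef_subst.
by rewrite -coef_subst.
Qed.

Lemma subst1 phi : subst 1 phi = 1 :> cps C K.
Proof.
apply: cpsP => m; rewrite (coef_subst _ _ (ltnSn _)).
have -> : trunc (mdeg m).+1 (1 : cps C N) = 1 :> {mpoly C[N]}.
  apply/mpolyP => k; rewrite truncE mcoeff1 coef1.
  by case: eqP => [->|_]; rewrite ?mdeg0 // if_same.
by rewrite rmorph1 mcoeff1 coef1.
Qed.

Lemma subst_cvar_drop i phi : subst (cvar i) phi = phi i - (phi i 0%MM)%:A.
Proof.
apply: cpsP => m; rewrite coefB coefA (coef_subst _ _ (ltnSn _)).
have [->|m0] := eqVneq m 0%MM.
  rewrite subrr mdeg0.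
  have -> : trunc 1 (cvar i : cps C N) = 0 :> {mpoly C[N]}.
    apply/mpolyP => k; rewrite truncE mcoeff0 ltnS leqn0 mdeg_eq0 cvarE coef_zm.
    by case: eqP => // ->; rewrite eq_sym mnm1_eq0.
  by rewrite comp_mpoly0 mcoeff0.
have -> : trunc (mdeg m).+1 (cvar i : cps C N) = 'X_i :> {mpoly C[N]}.
  apply/mpolyP => k; rewrite truncE cvarE coef_zm mcoeffX eq_sym.
  by case: eqP => [<-|_]; rewrite ?if_same // mdeg1 ltnS lt0n mdeg_eq0 m0.
by rewrite comp_mpolyXU -tnth_nth tnth_mktuple truncE ltnSn /drop_const (negPf m0) subr0.
Qed.

Lemma subst_cvar i phi : max_ideal (phi i) -> subst (cvar i) phi = phi i.
Proof. by move=> h; rewrite subst_cvar_drop h scale0r subr0. Qed.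

Lemma substD f g phi : subst (f + g) phi = subst f phi + subst g phi.
Proof. exact: linD (subst_lin phi). Qed.
Lemma substB f g phi : subst (f - g) phi = subst f phi - subst g phi.
Proof. exact: linB (subst_lin phi). Qed.
Lemma substZ c f phi : subst (c *: f) phi = c *: subst f phi.
Proof. exact: linZ (subst_lin phi). Qed.
Lemma subst0 phi : subst 0 phi = 0.
Proof. exact: lin0 (subst_lin phi). Qed.
Lemma subst_sum I (r : seq I) P (F : I -> cps C N) phi :
  subst (\sum_(i <- r | P i) F i) phi = \sum_(i <- r | P i) subst (F i) phi.
Proof. exact: lin_sum (subst_lin phi). Qed.
Lemma substX f n phi : subst (f ^+ n) phi = subst f phi ^+ n.
Proof. by elim: n => [|n ih]; rewrite ?expr0 ?subst1 // !exprS substM ih. Qed.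
Lemma substA c phi : subst c%:A phi = c%:A.
Proof. by rewrite substZ subst1. Qed.
Lemma subst_lowering phi : order_lowering 0 (fun f => subst f phi).
Proof. by move=> e f; rewrite addn0; apply: mt_ge_subst. Qed.

Lemma coef_subst0 f phi : subst f phi 0%MM = f 0%MM.
Proof.
have : mt_ge 1 (subst (f - (f 0%MM)%:A) phi).
  by apply: mt_ge_subst; apply/mt_ge1P; rewrite /max_ideal coefB coefA eqxx subrr.
move/mt_ge1P; rewrite /max_ideal substB substA coefB coefA eqxx => /eqP.
by rewrite subr_eq0 => /eqP.
Qed.

Lemma max_ideal_subst f phi : max_ideal f -> max_ideal (subst f phi).
Proof. by rewrite /max_ideal coef_subst0. Qed.

Lemma eq_subst phi psi f : phi =1 psi -> subst f phi = subst f psi.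
Proof. by move=> /funext ->. Qed.

Lemma subst_linear (L : cps C N -> cps C K) phi : lin L -> order_lowering 0 L ->
  (forall i, max_ideal (phi i)) -> L 1 = 1 ->
  (forall i f, L (cvar i * f) = phi i * L f) -> forall f, L f = subst f phi.
Proof.
move=> l o h h1 hM; apply: (lin_ext l (subst_lin phi) o (subst_lowering phi)).
  by rewrite h1 subst1.
by move=> i f e; rewrite hM substM subst_cvar // e.
Qed.

End SubstitutionTheory.

Section Composition.
Context {C : numClosedFieldType} {N K L : nat}.

(** [subst] drops the constant terms of its arguments and preserves that of the series, so both
    sides drop the same constants. *)
Lemma subst_subst (f : cps C N) (phi : 'I_N -> cps C K) (psi : 'I_K -> cps C L) :
  subst (subst f phi) psi = subst f (fun i => subst (phi i) psi).
Proof.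
move: f; apply: (@lin_ext _ _ _ 0) => [c f g|c f g|e f|e f||i f e].
- by rewrite !substL.
- by rewrite !substL.
- by rewrite addn0 => h; do 2!apply: mt_ge_subst.
- by rewrite addn0; apply: mt_ge_subst.
- by rewrite !subst1.
- by rewrite !substM e !subst_cvar_drop substB substA coef_subst0.
Qed.

Lemma subst_id (f : cps C N) : subst f cvar = f.
Proof.
apply/esym; move: f; apply: subst_linear => // [e f|i]; first by rewrite addn0.
exact: max_cvar.
Qed.

End Composition.

(** * Partial derivatives and the chain rule *)

Section Derivations.
Context {C : numClosedFieldType} {N : nat}.
Implicit Types (f g h : cps C N).

Lemma coef_pderiv i f m : pderiv i f m = (m i).+1%:R * f (m + U_(i))%MM.
Proof. by []. Qed.

Lemma pderivL i c f g : pderiv i (c *: f + g) = c *: pderiv i f + pderiv i g.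
Proof.
apply: cpsP => m; rewrite coefD coefZ !coef_pderiv coefD coefZ mulrDr; congr (_ + _).
by rewrite mulrCA.
Qed.
Lemma pderiv_lin i : lin (pderiv i : cps C N -> cps C N).
Proof. by move=> c f g; apply: pderivL. Qed.
Lemma pderivD i f g : pderiv i (f + g) = pderiv i f + pderiv i g.
Proof. exact: linD (pderiv_lin i). Qed.
Lemma pderivB i f g : pderiv i (f - g) = pderiv i f - pderiv i g.
Proof. exact: linB (pderiv_lin i). Qed.
Lemma pderivZ i c f : pderiv i (c *: f) = c *: pderiv i f.
Proof. exact: linZ (pderiv_lin i). Qed.
Lemma pderiv0 i : pderiv i (0 : cps C N) = 0.
Proof. exact: lin0 (pderiv_lin i). Qed.
Lemma pderiv_sum i J (r : seq J) P (F : J -> cps C N) :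
  pderiv i (\sum_(j <- r | P j) F j) = \sum_(j <- r | P j) pderiv i (F j).
Proof. exact: lin_sum (pderiv_lin i). Qed.
Lemma pderiv1 i : pderiv i (1 : cps C N) = 0.
Proof.
apply: cpsP => m; rewrite coef_pderiv coef1 coef0 mnmD_eq0 mnm1_eq0 andbF.
exact: mulr0.
Qed.
Lemma pderivA i c : pderiv i (c%:A : cps C N) = 0.
Proof. by rewrite pderivZ pderiv1 scaler0. Qed.

Lemma pderiv_lowering i : order_lowering 1 (pderiv i : cps C N -> cps C N).
Proof.
by move=> e f h m me; rewrite coef_pderiv h ?mulr0 // mdegD mdeg1 ltn_add2r.
Qed.

Lemma mt_ge_pderiv d i f : mt_ge d.+1 f -> mt_ge d (pderiv i f).
Proof. by rewrite -addn1; apply: pderiv_lowering. Qed.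

Lemma pderiv_cvarM i j f :
  pderiv i (cvar j * f) = (i == j)%:R *: f + cvar j * pderiv i f.
Proof.
apply: cpsP => m; rewrite coefD coefZ coef_pderiv !coef_cvarM coef_pderiv mnmDE mnm1E.
have [<-|ij] := eqVneq i j; rewrite ?mul1r ?mul0r ?add0r.
  rewrite addn1 /= addmK; have [m0|m0] := eqVneq (m i) 0%N.
    by rewrite m0 mul1r addr0.
  rewrite mnmBE mnm1E eqxx subn1 prednK ?lt0n // submK ?lep1mP //.
  by rewrite -{2}[f m]mul1r -mulrDl -natr1 addrC.
rewrite addn0; have [m0|m0] := eqVneq (m j) 0%N; first by rewrite mulr0.
rewrite mnmBE mnm1E eq_sym (negPf ij) subn0; congr (_ * f _).
by rewrite [in RHS]addmC addmBA ?lep1mP // [in RHS]addmC.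
Qed.

Lemma pderivM i f g : pderiv i (f * g) = pderiv i f * g + f * pderiv i g.
Proof.
move: f; apply: (@lin_ext _ _ _ 1) => [c f h|c f h|e f|e f he||j f e].
- by rewrite mulrDl -scalerAl pderivL.
- by rewrite pderivL !mulrDl -!scalerAl scalerDr addrACA.
- by move=> he; apply: pderiv_lowering; apply: mt_geMr.
- apply: mt_geD; apply: mt_geMr; first exact: pderiv_lowering.
  by apply: mt_ge_le he; rewrite leq_addr.
- by rewrite pderiv1 mul0r add0r !mul1r.
- rewrite -mulrA !pderiv_cvarM e mulrDl mulrDr -scalerAl addrA; ring.
Qed.

Lemma pderiv_cvar i j : pderiv i (cvar j : cps C N) = (i == j)%:R.
Proof. by rewrite -[cvar j]mulr1 pderiv_cvarM pderiv1 mulr0 addr0 scaler_nat. Qed.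

Lemma pderivX i f n : pderiv i (f ^+ n) = n%:R * f ^+ n.-1 * pderiv i f.
Proof.
elim: n => [|n ih]; first by rewrite expr0 pderiv1 !mul0r.
rewrite exprS pderivM ih; case: n ih => [|n] _; first by rewrite expr0; ring.
rewrite exprS -[n.+2%:R]natr1; ring.
Qed.

Lemma coef_euler i f m : (cvar i * pderiv i f) m = (m i)%:R * f m.
Proof.
rewrite coef_cvarM coef_pderiv; case: eqP => [->|/eqP m0]; first by rewrite mul0r.
by rewrite mnmBE mnm1E eqxx subn1 prednK ?lt0n // submK // lep1mP.
Qed.

End Derivations.

Lemma chain_rule {C : numClosedFieldType} {N K : nat} (i : 'I_K) (f : cps C N)
    (phi : 'I_N -> cps C K) :
  pderiv i (subst f phi) = \sum_j subst (pderiv j f) phi * pderiv i (phi j).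
Proof.
move: f; apply: (@lin_ext _ _ _ 1) => [c f h|c f h|e f he|e f he||k f e].
- by rewrite substL pderivL.
- rewrite scaler_sumr -big_split; apply: eq_bigr => j _ /=.
  by rewrite pderivL substL mulrDl scalerAl.
- by apply: pderiv_lowering; apply: mt_ge_subst.
- by apply: mt_ge_sum => j _; apply: mt_geMr; apply: mt_ge_subst; apply: pderiv_lowering.
- by rewrite subst1 pderiv1 big1 // => j _; rewrite pderiv1 subst0 mul0r.
- rewrite substM subst_cvar_drop pderivM e pderivB pderivA subr0.
  transitivity (\sum_j ((j == k)%:R *: (subst f phi * pderiv i (phi j)) +
      (phi k - (phi k 0%MM)%:A) * (subst (pderiv j f) phi * pderiv i (phi j)))).
    rewrite big_split /= mulr_sumr; congr (_ + _).
    rewrite (bigD1 k) //= eqxx scale1r big1 ?addr0 1?mulrC // => j /negPf ->.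
    by rewrite scale0r.
  apply: eq_bigr => j _; rewrite pderiv_cvarM substD substZ substM subst_cvar_drop.
  by rewrite [RHS]mulrDl -scalerAl mulrA.
Qed.

(** * Norms and rearrangement *)

Section WeightedNorms.
Context {C : numClosedFieldType} {N : nat}.
Implicit Types (a b : 'X_{1..N} -> C) (rho : 'I_N -> C) (m : 'X_{1..N}) (f g : cps C N).

Definition wt rho m : C := \prod_i rho i ^+ m i.

(* [bdw rho M a]: the series with coefficients [a] has norm at most [M] on the
   closed polydisc of polyradius [rho]. *)
Definition bdw rho (M : C) a : Prop :=
  forall s, uniq s -> \sum_(m <- s) `|a m| * wt rho m <= M.

Lemma wtD rho m k : wt rho (m + k)%MM = wt rho m * wt rho k.
Proof. by rewrite -big_split; apply: eq_bigr => i _; rewrite mnmDE exprD. Qed.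

Lemma wt_ge0 rho m : (forall i, 0 <= rho i) -> 0 <= wt rho m.
Proof. by move=> h; apply: prodr_ge0 => i _; apply: exprn_ge0. Qed.

Lemma wt_gt0 rho m : (forall i, 0 < rho i) -> 0 < wt rho m.
Proof. by move=> h; apply: prodr_gt0 => i _; apply: exprn_gt0. Qed.

Lemma wt_const (r : C) m : wt (fun=> r) m = r ^+ mdeg m.
Proof. by rewrite mdegE /wt -prodrXr. Qed.

Lemma le_wt rho rho' m : (forall i, 0 <= rho i <= rho' i) -> wt rho m <= wt rho' m.
Proof.
move=> h; apply: ler_prod => i _; have /andP[h1 h2] := h i.
by rewrite exprn_ge0 // lerXn2r // nnegrE (le_trans h1).
Qed.

Lemma bdw_fin rho M a n : bdw rho M a ->
  \sum_(m : 'X_{1..N < n}) `|a m| * wt rho m <= M.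
Proof.
move=> h; have := h (map val (enum {: 'X_{1..N < n}})).
rewrite map_inj_uniq ?enum_uniq => [/(_ isT)|]; last exact: val_inj.
by rewrite big_map big_enum.
Qed.

Lemma fin_bdw rho M a : (forall i, 0 <= rho i) ->
  (forall n, \sum_(m : 'X_{1..N < n}) `|a m| * wt rho m <= M) -> bdw rho M a.
Proof.
move=> rho0 h s us.
have [n hn] : exists n, forall m, m \in s -> (mdeg m < n)%N.
  exists (\max_(m <- s) mdeg m).+1 => m ms; rewrite ltnS.
  by apply: (leq_bigmax_seq (F := @mdeg N)).
apply: le_trans (h n).
have -> : s = map val (pmap (insub : _ -> option 'X_{1..N < n}) s).
  elim: s hn {us} => //= m s ih hs; rewrite insubT ?hs ?mem_head //= => hm.
  by rewrite -ih // => k ks; apply: hs; rewrite inE ks orbT.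
rewrite big_map big_uniq; last by apply: pmap_sub_uniq.
rewrite [leRHS](bigID (mem (pmap (insub : _ -> option 'X_{1..N < n}) s))) /= lerDl.
by apply: sumr_ge0 => m _; rewrite mulr_ge0 // wt_ge0.
Qed.

Lemma bdw_ge0 rho M a : bdw rho M a -> 0 <= M.
Proof. by move=> /(_ [::] isT); rewrite big_nil. Qed.

Lemma bdw_leM rho M M' a : M <= M' -> bdw rho M a -> bdw rho M' a.
Proof. by move=> h ha s us; apply: le_trans h; apply: ha. Qed.

Lemma bdw_le rho rho' M a : (forall i, 0 <= rho i <= rho' i) -> bdw rho' M a -> bdw rho M a.
Proof.
move=> h ha s us; apply: le_trans (ha s us); apply: ler_sum => m _.
by rewrite ler_wpM2l // le_wt.
Qed.

Lemma bdw0 rho : bdw rho 0 (fun=> 0 : C).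
Proof. by move=> s _; rewrite big1 // => m _; rewrite normr0 mul0r. Qed.

Lemma bdwD rho M M' a b : (forall i, 0 <= rho i) -> bdw rho M a -> bdw rho M' b ->
  bdw rho (M + M') (fun m => a m + b m).
Proof.
move=> r0 ha hb s us; apply: le_trans (lerD (ha s us) (hb s us)).
rewrite -big_split; apply: ler_sum => m _ /=; rewrite -mulrDl.
by rewrite ler_wpM2r ?wt_ge0 // ler_normD.
Qed.

Lemma bdwZ rho M c a : bdw rho M a -> bdw rho (`|c| * M) (fun m => c * a m).
Proof.
move=> ha s us; apply: le_trans (ler_wpM2l (normr_ge0 c) (ha s us)).
by rewrite mulr_sumr; apply: ler_sum => m _; rewrite normrM mulrA.
Qed.

Lemma bdwN rho M a : bdw rho M a -> bdw rho M (fun m => - a m).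
Proof. by move=> ha s us; under eq_bigr do rewrite normrN; apply: ha. Qed.

Lemma bdw_scaled rho M a : (forall i, 0 <= rho i) ->
  bdw rho M a <-> forall n, pnorm n 1 (fun m => a m * wt rho m) <= M.
Proof.
move=> r0; have E n : pnorm n 1 (fun m => a m * wt rho m) =
    \sum_(m : 'X_{1..N < n}) `|a m| * wt rho m.
  by apply: eq_bigr => m _; rewrite expr1n mulr1 normrM [`|wt _ _|]ger0_norm // wt_ge0.
split=> h; first by move=> n; rewrite E; apply: bdw_fin.
by apply: fin_bdw => // n; rewrite -E.
Qed.

Lemma bdwM rho M M' f g : (forall i, 0 <= rho i) -> bdw rho M f -> bdw rho M' g ->
  bdw rho (M * M') (f * g).
Proof.
move=> r0 /(bdw_scaled _ _ r0) hf /(bdw_scaled _ _ r0) hg; apply/(bdw_scaled _ _ r0) => n.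
have -> : (fun m : 'X_{1..N} => (f * g) m * wt rho m) =
    Defs.mulc (fun m => f m * wt rho m) (fun m => g m * wt rho m).
  apply/funext => m; rewrite [LHS]mulr_suml; apply: eq_bigr => k /eqP e.
  by rewrite [in LHS](congr1 (wt rho) e) wtD mulrACA.
apply: le_trans (pnormM _ _ _ ler01) _.
by apply: ler_pM => //; apply: pnorm_ge0.
Qed.

Lemma bdw_sum rho I (r : seq I) (P : pred I) (M : I -> C) (F : I -> cps C N) :
  (forall i, 0 <= rho i) -> (forall i, P i -> bdw rho (M i) (F i)) ->
  bdw rho (\sum_(i <- r | P i) M i) (\sum_(i <- r | P i) F i : cps C N).
Proof.
move=> r0 h; apply: (big_ind2 (fun (f : cps C N) M => bdw rho M f)) => //.
  exact: bdw0.
by move=> f a g b; apply: bdwD.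
Qed.

Lemma convergent_bdw a : convergent a -> exists r M, 0 < r /\ bdw (fun=> r) M a.
Proof.
move=> [r [M [r0 h]]]; exists r, M; split=> //; apply: fin_bdw => [_|n]; first exact: ltW.
by apply: le_trans (h n); apply: ler_sum => m _; rewrite wt_const.
Qed.

Lemma bdw_convergent rho M a : (forall i, 0 < rho i) -> bdw rho M a -> convergent a.
Proof.
move=> r0 h; pose r := (1 + \sum_i (rho i)^-1)^-1.
have s0 : 0 <= \sum_i (rho i)^-1 by apply: sumr_ge0 => i _; rewrite invr_ge0 ltW.
have rp : 0 < r by rewrite invr_gt0 ltr_wpDr.
exists r, M; split=> // n; have {}h : bdw (fun=> r) M a.
  apply: bdw_le h => i; rewrite (ltW rp) -[leRHS]invrK lef_pV2 ?posrE ?invr_gt0 // ?ltr_wpDr //.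
  rewrite (bigD1 i) //= addrCA lerDl addr_ge0 //.
  by apply: sumr_ge0 => j _; rewrite invr_ge0 ltW.
by apply: le_trans (bdw_fin n h); apply: ler_sum => m _; rewrite wt_const.
Qed.

Lemma common_radius (I : finType) (F : I -> cps C N) :
  exists r M, [/\ 0 < r, 0 <= M & forall i, bdw (fun=> r) M (F i)].
Proof.
have /choice[rM hr] : forall i, exists rM : C * C, 0 < rM.1 /\ bdw (fun=> rM.1) rM.2 (F i).
  by move=> i; have [r [M h]] := convergent_bdw (coef_convergent (F i)); exists (r, M).
have s0 : 0 <= \sum_i (rM i).1^-1.
  by apply: sumr_ge0 => i _; rewrite invr_ge0 ltW //; case: (hr i).
have M0 i : 0 <= (rM i).2 by case: (hr i) => _ /bdw_ge0.
(* This radius is at most every [(rM i).1], and the summand 1 keeps it positive for an empty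
   family. *)
exists (1 + \sum_i (rM i).1^-1)^-1, (\sum_i (rM i).2); split=> [||i].
- by rewrite invr_gt0 ltr_wpDr.
- exact: sumr_ge0.
have [r0 h] := hr i; apply: bdw_leM (bdw_le _ h) => [|_].
  by rewrite (bigD1 i) //= lerDl sumr_ge0.
rewrite invr_ge0 addr_ge0 //=.
rewrite -[leRHS]invrK lef_pV2 ?posrE ?invr_gt0 // ?ltr_wpDr //.
rewrite (bigD1 i) //= addrCA lerDl addr_ge0 //.
by apply: sumr_ge0 => j _; rewrite invr_ge0 ltW //; case: (hr j).
Qed.

(** The orders make the sum finite in each coefficient; the norms, bounded independently of the
    number of terms, make it converge. *)
Lemma formal_sum rho (h : nat -> cps C N) (M : nat -> C) (B : C) :
  (forall i, 0 < rho i) -> (forall n, mt_ge n (h n)) -> (forall n, bdw rho (M n) (h n)) ->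
  (forall d, \sum_(n < d) M n <= B) ->
  exists u : cps C N, (forall d, mt_ge d (u - \sum_(n < d) h n)) /\ bdw rho B u.
Proof.
move=> r0 ho hb hM; pose u m : C := \sum_(n < (mdeg m).+1) h n m.
have uE d m : (mdeg m < d)%N -> u m = \sum_(n < d) h n m.
  move=> md; rewrite -(big_mkord xpredT (fun n => h n m)) (big_cat_nat (n := (mdeg m).+1)) //=.
  rewrite big_mkord [X in _ + X]big_nat_cond [X in _ + X]big1 ?addr0 // => n.
  by rewrite andbT => /andP[mn _]; rewrite ho.
have bu : bdw rho B u.
  apply: fin_bdw => [i|d]; first exact: ltW.
  apply: le_trans (hM d); apply: (@le_trans _ _ (\sum_(n < d) \sum_(m : 'X_{1..N < d})
    `|h n m| * wt rho m)); last by apply: ler_sum => n _; apply: bdw_fin.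
  rewrite exchange_big; apply: ler_sum => m _ /=; rewrite -mulr_suml ler_wpM2r //.
    by apply: wt_ge0 => i; apply: ltW.
  by rewrite (uE d) ?bmdeg // ler_norm_sum.
exists (Cps (bdw_convergent r0 bu)); split=> // d m md.
by rewrite coefB coef_sum /= (uE _ _ md) subrr.
Qed.

End WeightedNorms.

Section Rearrangement.
Context {C : numClosedFieldType} {N K : nat}.

(** The common source of convergence for all operations that move, drop or rescale coefficients:
    restrictions, parts, shifts, derivatives, masks. *)
Lemma bdw_inj (rho : 'I_N -> C) (rho' : 'I_K -> C) (P : pred 'X_{1..K})
    (h : 'X_{1..K} -> 'X_{1..N}) (k M : C) (a : 'X_{1..N} -> C) (b : 'X_{1..K} -> C) :
  0 <= k -> {in P &, injective h} -> (forall m, ~~ P m -> b m = 0) ->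
  (forall m, P m -> `|b m| * wt rho' m <= k * (`|a (h m)| * wt rho (h m))) ->
  bdw rho M a -> bdw rho' (k * M) b.
Proof.
move=> k0 hi b0 hb ha s us; rewrite (bigID P) /= addrC big1 ?add0r => [|m /b0 ->]; last first.
  by rewrite normr0 mul0r.
apply: (@le_trans _ _ (\sum_(m <- s | P m) k * (`|a (h m)| * wt rho (h m)))).
  exact: ler_sum.
rewrite -mulr_sumr ler_wpM2l // -big_filter -(big_map h xpredT (fun m => `|a m| * wt rho m)).
apply: ha; rewrite map_inj_in_uniq ?filter_uniq // => x y.
by rewrite !mem_filter => /andP[px _] /andP[py _]; apply: hi.
Qed.

End Rearrangement.

Lemma submonomial {N : nat} (m : 'X_{1..N}) d : (d <= mdeg m)%N ->
  exists k, (k <= m)%MM /\ mdeg k = d.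
Proof.
elim: d => [|d ih] h; first by exists 0%MM; rewrite mdeg0; split=> //; apply/mnm_lepP => i; rewrite mnm0E.
have [k [km kd]] := ih (ltnW h).
have [i ki] : exists i, (k i < m i)%N.
  apply/existsP; rewrite -[X in is_true X]negbK negb_exists; apply/negP => /forallP hi.
  move: h; rewrite -kd ltnNge => /negP[]; rewrite !mdegE; apply: leq_sum => i _.
  by rewrite leqNgt.
exists (k + U_(i))%MM; rewrite mdegD mdeg1 kd addn1; split=> //; apply/mnm_lepP => j.
rewrite mnmDE mnm1E; case: eqP => [<-|_]; first by rewrite addn1.
by rewrite addn0; apply: (mnm_lepP km).
Qed.

(** * Division with parameters *)

Section ParameterVariables.
Context {C : numClosedFieldType} {N : nat} (T : {set 'I_N}).
Implicit Types (f g : cps C N) (m k mu : 'X_{1..N}).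

Definition mx m : 'X_{1..N} := [multinom if i \in T then 0%N else m i | i < N].
Definition mp m : 'X_{1..N} := [multinom if i \in T then m i else 0%N | i < N].

Lemma mxp m : m = (mx m + mp m)%MM.
Proof. by apply/mnmP => i; rewrite mnmDE !mnmE; case: ifP; rewrite ?addn0. Qed.
Lemma mxD m k : mx (m + k)%MM = (mx m + mx k)%MM.
Proof. by apply/mnmP => i; rewrite !(mnmDE, mnmE); case: ifP. Qed.
Lemma mpD m k : mp (m + k)%MM = (mp m + mp k)%MM.
Proof. by apply/mnmP => i; rewrite !(mnmDE, mnmE); case: ifP. Qed.
Lemma mx_le m : (mx m <= m)%MM.
Proof. by rewrite [X in (_ <= X)%MM]mxp lem_addr. Qed.
Lemma mdeg_mp m : (mdeg (mp m) <= mdeg m)%N.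
Proof. by rewrite [X in (_ <= mdeg X)%N]mxp mdegD leq_addl. Qed.

(** With [T] as the set of parameters, [dep] is the subring of series in the parameters alone, and
    [pord] the filtration by the powers of the ideal generated by the parameters. *)
Definition dep f := forall m, mx m != 0%MM -> f m = 0.
Definition pord d f := forall m, (mdeg (mp m) < d)%N -> f m = 0.

Lemma pord_mt_ge d f : pord d f -> mt_ge d f.
Proof. by move=> h m md; apply: h; apply: leq_ltn_trans md; apply: mdeg_mp. Qed.
Lemma pordD d f g : pord d f -> pord d g -> pord d (f + g).
Proof. by move=> hf hg m md; rewrite coefD hf ?hg ?addr0. Qed.
Lemma pordN d f : pord d f -> pord d (- f).
Proof. by move=> hf m md; rewrite coefN hf ?oppr0. Qed.
Lemma pord_sum d I (r : seq I) (P : pred I) (F : I -> cps C N) :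
  (forall i, P i -> pord d (F i)) -> pord d (\sum_(i <- r | P i) F i).
Proof. by move=> h; apply: big_ind => // f g; apply: pordD. Qed.
Lemma pord_le d e f : (d <= e)%N -> pord e f -> pord d f.
Proof. by move=> de h m md; apply: h; apply: leq_trans de. Qed.
Lemma pordM d e f g : pord d f -> pord e g -> pord (d + e) (f * g).
Proof.
move=> hf hg m hm; apply: coefM_eq0 => k l em.
have [hk|hk] := ltnP (mdeg (mp k)) d; first by rewrite hf // mul0r.
rewrite hg ?mulr0 // ltnNge; apply/negP => hl.
by move: hm; rewrite -em mpD mdegD ltnNge leq_add.
Qed.

Lemma depD f g : dep f -> dep g -> dep (f + g).
Proof. by move=> hf hg m md; rewrite coefD hf ?hg ?addr0. Qed.
Lemma depN f : dep f -> dep (- f).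
Proof. by move=> hf m md; rewrite coefN hf ?oppr0. Qed.
Lemma depZ c f : dep f -> dep (c *: f).
Proof. by move=> hf m md; rewrite coefZ hf ?mulr0. Qed.
Lemma dep0 : dep 0. Proof. by []. Qed.
Lemma dep1 : dep 1.
Proof.
move=> m hm; rewrite coef1; case: eqP => // m0; case/eqP: hm.
by rewrite m0; apply/mnmP => i; rewrite mnmE mnm0E if_same.
Qed.
Lemma dep_sum I (r : seq I) (P : pred I) (F : I -> cps C N) :
  (forall i, P i -> dep (F i)) -> dep (\sum_(i <- r | P i) F i).
Proof. by move=> h; apply: big_ind => // f g; apply: depD. Qed.
Lemma depM f g : dep f -> dep g -> dep (f * g).
Proof.
move=> hf hg m hm; apply: coefM_eq0 => k l e.
have [k0|/hf ->] := eqVneq (mx k) 0%MM; last by rewrite mul0r.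
by rewrite hg ?mulr0 //; move: hm; rewrite -e mxD k0 add0m.
Qed.

Fact sp_convergent f : convergent (fun m => if mp m == 0%MM then f m else 0).
Proof.
have [r [M [r0 hM]]] := convergent_bdw (coef_convergent f).
apply: (@bdw_convergent _ _ (fun=> r) (1 * M)) => [_|] //.
apply: (@bdw_inj _ _ _ _ _ (fun m => mp m == 0%MM) id _ _ _ _ ler01 _ _ _ hM) => //.
  by move=> m /negPf ->.
by move=> m ->; rewrite mul1r.
Qed.

(** Restriction to the fibre over 0 when the variables in [T] are the parameters. *)
Definition sp f : cps C N := Cps (sp_convergent f).

Lemma coef_sp f m : sp f m = if mp m == 0%MM then f m else 0.
Proof. by []. Qed.

Lemma pord_sp f : pord 1 (f - sp f).
Proof. by move=> m; rewrite ltnS leqn0 mdeg_eq0 coefB coef_sp => ->; rewrite subrr. Qed.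

Section Parts.
Variable N0 : nat.

Lemma cut_exists m : exists k, (k <= mx m)%MM /\ mdeg k = minn N0 (mdeg (mx m)).
Proof. by apply: submonomial; rewrite geq_minr. Qed.

(** The part of [m] outside [T] if its degree is at most [N0], otherwise a divisor of it of degree
    [N0], chosen once and for all. As the choice is made on exponents, [part] is linear. *)
Definition cut m := sval (cid (cut_exists m)).

Lemma cut_le m : (cut m <= m)%MM.
Proof. by rewrite /cut; case: cid => k /= [h _]; apply: lepm_trans h (mx_le m). Qed.
Lemma mdeg_cut m : mdeg (cut m) = minn N0 (mdeg (mx m)).
Proof. by rewrite /cut; case: cid => k /= []. Qed.
Lemma mp_cut m : mp (cut m) = 0%MM.
Proof.
rewrite /cut; case: cid => k /= [h _]; apply/mnmP => i; rewrite mnmE mnm0E.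
case: ifP => iT //; apply/eqP; rewrite -leqn0; apply: leq_trans (mnm_lepP h i) _.
by rewrite mnmE iT.
Qed.
Lemma cut_eq m : (mdeg (cut m) < N0)%N -> cut m = mx m.
Proof.
rewrite mdeg_cut gtn_min ltnn /= => hm.
have := mdeg_cut m; rewrite (minn_idPr (ltnW hm)) /cut; case: cid => k /= [h _] e.
rewrite -[RHS](submK h); suff -> : (mx m - k = 0)%MM by rewrite add0m.
apply/eqP; rewrite -mdeg_eq0 -(eqn_add2r (mdeg k)) -mdegD submK // e.
by rewrite add0n.
Qed.

Fact part_convergent mu f :
  convergent (fun k => if cut (k + mu)%MM == mu then f (k + mu)%MM else 0).
Proof.
have [r [M [r0 hM]]] := convergent_bdw (coef_convergent f).
apply: (@bdw_convergent _ _ (fun=> r) (r ^- mdeg mu * M)) => [_|] //.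
apply: (@bdw_inj _ _ _ _ _ (fun k => cut (k + mu)%MM == mu) (fun k => k + mu)%MM _ _ _ _ _ _ _ _ hM).
- by rewrite invr_ge0 exprn_ge0 // ltW.
- by move=> k l _ _ /addIm.
- by move=> k /negPf ->.
- by move=> k ->; rewrite !wt_const mdegD exprD mulrCA [r ^+ mdeg k * _]mulrC mulKf // expf_neq0 // gt_eqF.
Qed.

(* The part of [f] made of the monomials cut down to [mu], divided by [mu]. *)
Definition part mu f : cps C N := Cps (part_convergent mu f).

Lemma coef_part mu f k :
  part mu f k = if cut (k + mu)%MM == mu then f (k + mu)%MM else 0.
Proof. by []. Qed.

Lemma part_lin mu : lin (part mu).
Proof.
move=> c f g; apply: cpsP => m; rewrite coefD coefZ !coef_part coefD coefZ.
by case: ifP => // _; rewrite mulr0 addr0.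
Qed.

Lemma part_eq0 mu f : mp mu != 0%MM -> part mu f = 0.
Proof.
move=> h; apply: cpsP => k; rewrite coef_part coef0; case: eqP => // e.
by move: h; rewrite -e mp_cut eqxx.
Qed.

Lemma sum_part f : f = \sum_(mu : 'X_{1..N < N0.+1}) zm mu * part mu f.
Proof.
apply: cpsP => m; rewrite coef_sum.
have hm : (mdeg (cut m) < N0.+1)%N by rewrite mdeg_cut ltnS geq_minl.
rewrite (bigD1 (BMultinom hm)) // big1 => [|mu hmu].
  by rewrite [RHS]addr0 -[bmnm _]/(cut m) coef_zmM cut_le coef_part submK ?cut_le // eqxx.
rewrite coef_zmM; case: ifP => // h; rewrite coef_part submK //; case: eqP => // e.
by move/eqP: hmu => []; apply: val_inj.
Qed.

Lemma bdw_part rho M mu f : (forall i, 0 < rho i) -> bdw rho M f ->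
  bdw rho ((wt rho mu)^-1 * M) (part mu f).
Proof.
move=> r0; have w0 m : 0 < wt rho m by apply: wt_gt0.
apply: (@bdw_inj _ _ _ _ _ (fun k => cut (k + mu)%MM == mu) (fun k => k + mu)%MM).
- by rewrite invr_ge0 ltW.
- by move=> k l _ _ /addIm.
- by move=> k /negPf; rewrite coef_part => ->.
- by move=> k; rewrite coef_part => ->; rewrite wtD mulrCA [wt rho k * _]mulrC mulKf // gt_eqF.
Qed.

Lemma pord_part d mu f : pord d f -> pord d (part mu f).
Proof.
move=> h m md; rewrite coef_part; case: eqP => // e; rewrite h // mpD.
by have := mp_cut (m + mu)%MM; rewrite e => ->; rewrite addm0.
Qed.

(** A [mu] of degree below [N0] has not been cut: it is the whole part outside [T] of the monomials
    concerned, so that only parameters remain in the quotient. *)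
Lemma dep_part mu f : (mdeg mu < N0)%N -> dep (part mu f).
Proof.
move=> h m hm; rewrite coef_part; case: eqP => // e.
have := cut_eq (m := (m + mu)%MM); rewrite e h => /(_ isT).
rewrite mxD => e1; case/eqP: hm.
have e2 : mx mu = mu.
  have := mp_cut (m + mu)%MM; rewrite e => e2.
  by rewrite [RHS]mxp e2 addm0.
by move: e1; rewrite e2 -{1}[mu]add0m => /addIm <-.
Qed.

End Parts.
End ParameterVariables.

Lemma geometric_bound {C : numClosedFieldType} (B : C) d : 0 <= B ->
  \sum_(n < d) B * 2^-1 ^+ n <= B * 2.
Proof.
move=> B0; rewrite -mulr_sumr ler_wpM2l //.
suff -> : \sum_(n < d) 2^-1 ^+ n = 2 - 2 * 2^-1 ^+ d :> C.
  by rewrite gerBl mulr_ge0 // exprn_ge0 // invr_ge0 ler0n.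
elim: d => [|d ih]; first by rewrite big_ord0 expr0 mulr1 subrr.
rewrite big_ord_recr /= ih exprS mulVKf ?pnatr_eq0 // [in LHS]mulr_natl mulr2n; ring.
Qed.

Section Division.
Context {C : numClosedFieldType} {N : nat} (T : {set 'I_N}) (N0 : nat).
Context {I : finType} (G : I -> cps C N) (A : 'X_{1..N} -> I -> cps C N).
Hypothesis zmA : forall mu, (mdeg mu <= N0)%N -> mp T mu = 0%MM ->
  zm mu = \sum_i A mu i * sp T (G i).

(** On the special fibre a linear section of [a |-> sum a i * sp (G i)]: [u] is split into parts and
    each [zm mu] is replaced by its expression in [zmA]. *)
Definition quot (u : cps C N) i : cps C N :=
  \sum_(mu : 'X_{1..N < N0.+1}) A mu i * part T N0 mu u.

Local Notation D u := (\sum_i quot u i * (G i - sp T (G i))).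

Lemma quot_lin i : lin (fun u => quot u i).
Proof.
move=> c f g; rewrite /quot scaler_sumr -big_split; apply: eq_bigr => mu _ /=.
by rewrite part_lin mulrDr -scalerAr.
Qed.

Let Dlin : lin (fun u => D u).
Proof.
move=> c f g; rewrite scaler_sumr -big_split; apply: eq_bigr => i _ /=.
by rewrite quot_lin mulrDl -scalerAl.
Qed.

Let Dpord d u : pord T d u -> pord T d.+1 (D u).
Proof.
move=> h; apply: pord_sum => i _; rewrite -addn1; apply: pordM; last exact: pord_sp.
apply: pord_sum => mu _; rewrite -[d]add0n; apply: pordM => //; exact: pord_part.
Qed.

Let quot_sp u : \sum_i quot u i * sp T (G i) = u.
Proof.
rewrite [RHS](sum_part T N0) /quot; under eq_bigr do rewrite mulr_suml.
rewrite exchange_big; apply: eq_bigr => mu _ /=.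
under eq_bigr do rewrite mulrAC; rewrite -mulr_suml.
have [e|/part_eq0 ->] := eqVneq (mp T mu) 0%MM; last by rewrite !mulr0.
by rewrite -zmA // -ltnS bmdeg.
Qed.

(* Neumann series for [1 + D]: it converges for a small radius in the
   parameters, since every monomial of [G i - sp (G i)] involves one. *)
Lemma division (w : cps C N) : exists u, w = \sum_i quot u i * G i.
Proof.
pose fam (x : (I * 'X_{1..N < N0.+1}) + (I + unit)) := match x with
  | inl p => A p.2 p.1 | inr (inl i) => G i | inr (inr _) => w end.
have [r [B [r0 B0 hB]]] := common_radius fam.
pose Q : C := \sum_(mu : 'X_{1..N < N0.+1}) (r ^+ mdeg mu)^-1.
have Q0 : 0 <= Q by apply: sumr_ge0 => mu _; rewrite invr_ge0 exprn_ge0 // ltW.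
pose X := \sum_(i : I) B * Q * B.
have X0 : 0 <= X by apply: sumr_ge0 => i _; rewrite !mulr_ge0.
(* [X * eps] bounds the norm of [D]: each term of [G i - sp T (G i)] contains a parameter and gains
   a factor [eps]. This choice makes the bound at most 1/2. *)
pose eps := (1 + 2 * X)^-1.
have e0 : 0 < eps by rewrite invr_gt0 ltr_wpDr // mulr_ge0.
have e1 : eps <= 1 by rewrite invf_le1 ?lerDl ?ltr_wpDr // mulr_ge0.
have eX : X * eps <= 2^-1.
  rewrite ler_pdivrMr ?ltr_wpDr ?mulr_ge0 // mulrDr mulr1 mulKf ?pnatr_eq0 //.
  by rewrite lerDr invr_ge0 ler0n.
pose rho (i : 'I_N) := if i \in T then eps * r else r.
have rho0 i : 0 < rho i by rewrite /rho; case: ifP; rewrite ?mulr_gt0.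
have rho0' i : 0 <= rho i by apply: ltW.
have rhor i : 0 <= rho i <= r.
  by rewrite rho0' /rho; case: ifP => _; rewrite /= ?ger_pMl.
have wtE m : wt rho m = eps ^+ mdeg (mp T m) * r ^+ mdeg m.
  rewrite -!wt_const /wt -big_split; apply: eq_bigr => i _ /=.
  by rewrite mnmE /rho; case: ifP => _; rewrite ?exprMn ?expr0 ?mul1r.
have hB' x : bdw rho B (fam x) by apply: bdw_le (hB x).
have bG i : bdw rho (eps * B) (G i - sp T (G i)).
  apply: (@bdw_inj _ _ _ (fun=> r) _ (fun m => mp T m != 0%MM) id _ _ (G i)) => //.
  - exact: ltW.
  - by move=> m; rewrite negbK coefB coef_sp => ->; rewrite subrr.
  - move=> m hm; rewrite coefB coef_sp (negPf hm) subr0 wtE wt_const.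
    rewrite mulrCA mulrA mulrA ler_wpM2r ?exprn_ge0 ?(ltW r0) // ler_wpM2r //.
    rewrite -[mdeg _]prednK ?lt0n ?mdeg_eq0 // exprS ger_pMr // exprn_ile1 //.
    exact: ltW.
  - exact: (hB (inr (inl i))).
have bq M (u : cps C N) i : bdw rho M u -> bdw rho (B * Q * M) (quot u i).
  move=> hu; have M0 := bdw_ge0 hu.
  rewrite /Q mulr_sumr mulr_suml; apply: bdw_sum => // mu _.
  have [e|/part_eq0 ->] := eqVneq (mp T mu) 0%MM; last first.
    rewrite mulr0; apply: bdw_leM (@bdw0 _ _ rho).
    by rewrite !mulr_ge0 // invr_ge0 exprn_ge0 // ltW.
  rewrite -mulrA; apply: bdwM => //; first exact: (hB' (inl (i, mu))).
  have -> : r ^+ mdeg mu = wt rho mu by rewrite wtE e mdeg0 expr0 mul1r.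
  exact: bdw_part.
have bD M (u : cps C N) : bdw rho M u -> bdw rho (2^-1 * M) (D u).
  move=> hu; have M0 := bdw_ge0 hu.
  apply: (@bdw_leM _ _ _ (\sum_(i : I) (B * Q * M) * (eps * B))).
    rewrite (eq_bigr (fun=> (B * Q * B) * (eps * M))) => [|i _]; last by ring.
    by rewrite -mulr_suml -/X mulrA ler_wpM2r.
  by apply: bdw_sum => // i _; apply: bdwM => //; apply: bq.
pose h n : cps C N := iter n (fun u => - D u) w.
have hp n : pord T n (h n).
  by elim: n => [|n ih] // ; apply: pordN; apply: Dpord.
have hb n : bdw rho (B * 2^-1 ^+ n) (h n).
  elim: n => [|n ih]; first by rewrite expr0 mulr1; apply: (hB' (inr (inr tt))).
  by rewrite exprS mulrCA; apply: bdwN; apply: bD.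
have [u [hu _]] := formal_sum rho0 (fun n => pord_mt_ge (hp n)) hb
  (fun d => geometric_bound d B0).
(* [formal_sum] gives the total order of the remainder only; [D] raises the order in the parameters,
   which has to be recovered from the tail of the series. *)
have hup d : pord T d (u - \sum_(n < d) h n).
  move=> m md; pose d' := maxn d (mdeg m).+1.
  have := hu d' m; rewrite leq_max ltnSn orbT => /(_ isT).
  have -> : \sum_(n < d') h n = \sum_(n < d) h n + \sum_(d <= n < d') h n.
    by rewrite -!(big_mkord xpredT h) -big_cat_nat // leq_maxl.
  have z : (\sum_(d <= n < d') h n) m = 0.
    rewrite coef_sum big_nat_cond big1 // => n; rewrite andbT => /andP[dn _].
    by apply: hp; apply: leq_trans dn.
  by rewrite !coefB coefD z addr0.
exists u; apply/eqP; rewrite -subr_eq0; apply/eqP/mt_ge_eq0 => d; apply: pord_mt_ge (T) _ _ _.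
have -> : \sum_i quot u i * G i = u + D u.
  rewrite -{2}[u]quot_sp -big_split; apply: eq_bigr => i _ /=.
  by rewrite -mulrDr addrC subrK.
set U := \sum_(n < d) h n.
have -> : D u = D (u - U) + D U by rewrite -(linD _ _ Dlin) subrK.
have -> : D U = w - h d - U.
  rewrite /U; elim: (d) => [|e ih]; first by rewrite big_ord0 subr0 subrr (lin0 Dlin).
  rewrite big_ord_recr /= (linD _ _ Dlin) ih /h /= -/(h e).
  by rewrite opprK; ring.
have -> : w - (u + (D (u - U) + (w - h d - U))) = - (u - U) - D (u - U) + h d by ring.
apply: pordD => //; apply: pordD; apply: pordN => //.
by apply: pord_le (Dpord (hup d)).
Qed.

End Division.

Lemma sum_unit (V : nmodType) (F : unit -> V) : \sum_(i : unit) F i = F tt.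
Proof. by apply: big_pred1 => -[]. Qed.

(** * Units and integrality *)

Section Units.
Context {C : numClosedFieldType} {N : nat}.
Implicit Types f g : cps C N.

(** Division of 1 by [f] with all variables as parameters: the special fibre of [f] is its constant
    term. *)
Lemma cps_inverse f : f 0%MM != 0 -> exists g, g * f = 1.
Proof.
move=> f0; have zmA mu : (mdeg mu <= 0)%N -> mp setT mu = 0%MM ->
    zm mu = \sum_(i : unit) (f 0%MM)^-1%:A * sp setT f.
  rewrite leqn0 mdeg_eq0 => /eqP -> _; rewrite sum_unit zm0.
  apply: cpsP => m; rewrite -scalerAl mul1r coefZ coef_sp coef1.
  have -> : mp setT m = m by apply/mnmP => i; rewrite mnmE inE.
  by case: eqP => [->|_]; rewrite ?mulr0 // mulVf.
have [u] := division (I := unit) (G := fun=> f) (A := fun _ _ => (f 0%MM)^-1%:A) zmA 1.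
by rewrite sum_unit => e; exists (quot setT 0 (fun _ _ => (f 0%MM)^-1%:A) u tt).
Qed.

Definition cps_unit : {pred cps C N} := fun f => f 0%MM != 0.
Definition cps_inv f : cps C N :=
  if pselect (f 0%MM != 0) is left h then sval (cid (cps_inverse h)) else f.

Fact cps_mulVf : {in cps_unit, left_inverse 1 cps_inv *%R}.
Proof.
move=> f hf; rewrite /cps_inv; case: pselect => [h|]; last by [].
by case: cid.
Qed.
Fact cps_unitP f g : g * f = 1 -> cps_unit f.
Proof.
move/(congr1 (fun h : cps C N => h 0%MM)); rewrite coefM0 coef1 eqxx => e.
by apply: contraTneq isT => f0; move: e; rewrite f0 mulr0 => /eqP; rewrite eq_sym oner_eq0.
Qed.
Fact cps_inv_out : {in [predC cps_unit], cps_inv =1 id}.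
Proof. by move=> f; rewrite inE => /negP hf; rewrite /cps_inv; case: pselect. Qed.

HB.instance Definition _ := GRing.ComNzRing_hasMulInverse.Build (cps C N)
  cps_mulVf cps_unitP cps_inv_out.
HB.instance Definition _ := GRing.ComUnitRing_isIntegral.Build (cps C N) cps_mulf_eq0.

Lemma unit_cpsE f : (f \is a GRing.unit) = (f 0%MM != 0). Proof. by []. Qed.

End Units.

Section Division2.
Context {C : numClosedFieldType} {N : nat} (T : {set 'I_N}).

(** A preparation theorem: if on the special fibre the [F i] generate an ideal with complement
    spanned by the [e j], the same decomposition holds over the ring of the parameters. Only the
    parts of degree below [N0] are free of the other variables; this is why the [c j] have to vanish
    in degree [N0]. *)
Lemma division_dep N0 (I J : finType) (F : I -> cps C N) (e : J -> cps C N) :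
  (forall mu, (mdeg mu <= N0)%N -> mp T mu = 0%MM ->
    exists (a : I -> cps C N) (c : J -> C), (mdeg mu = N0 -> forall j, c j = 0) /\
      zm mu = \sum_i a i * sp T (F i) + \sum_j c j *: sp T (e j)) ->
  forall w, exists (a c : _ -> cps C N),
    (forall j, dep T (c j)) /\ w = \sum_i a i * F i + \sum_j c j * e j.
Proof.
move=> H.
have /choice[ac hac] : forall mu, exists ac : (I -> cps C N) * (J -> C),
    (mdeg mu <= N0)%N -> mp T mu = 0%MM -> (mdeg mu = N0 -> forall j, ac.2 j = 0) /\
      zm mu = \sum_i ac.1 i * sp T (F i) + \sum_j ac.2 j *: sp T (e j).
  move=> mu; have [h1|h1] := boolP (mdeg mu <= N0)%N; last first.
    by exists (fun=> 0, fun=> 0) => h; case/negP: h1.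
  have [h2|h2] := pselect (mp T mu = 0%MM); last by exists (fun=> 0, fun=> 0).
  by have [a [c h]] := H mu h1 h2; exists (a, c).
pose G (x : I + J) := match x with inl i => F i | inr j => e j end.
pose A mu (x : I + J) := match x with inl i => (ac mu).1 i | inr j => ((ac mu).2 j)%:A end.
have zmA mu : (mdeg mu <= N0)%N -> mp T mu = 0%MM -> zm mu = \sum_x A mu x * sp T (G x).
  move=> h1 h2; have [_ ->] := hac mu h1 h2; rewrite big_sumType /=; congr (_ + _).
  by apply: eq_bigr => j _; rewrite -scalerAl mul1r.
move=> w; have [u hu] := division zmA w.
exists (fun i => quot T N0 A u (inl i)), (fun j => quot T N0 A u (inr j)); split; last first.
  by rewrite {1}hu big_sumType.
move=> j; apply: dep_sum => mu _ /=.
have [p0|/part_eq0 ->] := eqVneq (mp T mu) 0%MM; last by rewrite mulr0; apply: dep0.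
rewrite -scalerAl mul1r; have [lt|ge] := ltnP (mdeg mu) N0.
  by apply: depZ; apply: dep_part.
have muN : mdeg mu = N0 by apply/eqP; rewrite eqn_leq ge andbT -ltnS bmdeg.
have [-> // _] := hac mu (eq_leq muN) p0.
by rewrite scale0r; apply: dep0.
Qed.

Lemma sp_lin : lin (sp T : cps C N -> cps C N).
Proof.
move=> c f g; apply: cpsP => m; rewrite coefD coefZ !coef_sp coefD coefZ.
by case: ifP => // _; rewrite mulr0 addr0.
Qed.

Lemma sp1 : sp T 1 = 1 :> cps C N.
Proof.
apply: cpsP => m; rewrite coef_sp coef1; case: (m =P 0%MM) => [->|_]; last by rewrite if_same.
by case: eqP => // -[]; apply/mnmP => i; rewrite !mnmE if_same.
Qed.

Lemma spM (f g : cps C N) : sp T (f * g) = sp T f * sp T g.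
Proof.
apply: cpsP => m; rewrite coef_sp; case: (mp T m =P 0%MM) => [h|h]; last first.
  apply/esym/coefM_eq0 => k l e; rewrite !coef_sp; case: eqP => [k0|]; last by rewrite mul0r.
  case: eqP => [l0|]; last by rewrite mulr0.
  by case: h; rewrite -e mpD k0 l0 addm0.
rewrite !(coefM _ _ (ltnSn _)); apply: eq_bigr => -[k l] /= /eqP e.
move/eqP: h; rewrite (congr1 (mp T) e) mpD mnmD_eq0 => /andP[/eqP k0 /eqP l0].
by rewrite k0 l0 eqxx.
Qed.

Lemma sp_sum I (r : seq I) P (F : I -> cps C N) :
  sp T (\sum_(i <- r | P i) F i) = \sum_(i <- r | P i) sp T (F i).
Proof. exact: lin_sum sp_lin. Qed.

End Division2.

Section Dep.
Context {C : numClosedFieldType} {N : nat}.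
Implicit Types (f g : cps C N) (J : {set 'I_N}).

Lemma dep_sp J f : dep (~: J) (sp J f).
Proof.
move=> m; have -> : mx (~: J) m = mp J m.
  by apply/mnmP => i; rewrite !mnmE inE; case: (i \in J).
by rewrite coef_sp => /negPf ->.
Qed.

Lemma sp_dep J f : dep (~: J) f -> sp J f = f.
Proof.
move=> h; apply: cpsP => m; rewrite coef_sp; case: eqP => // /eqP e; rewrite h //.
have -> // : mx (~: J) m = mp J m.
by apply/mnmP => i; rewrite !mnmE inE; case: (i \in J).
Qed.

Lemma depP J f : dep J f <-> forall (m : 'X_{1..N}) i, i \notin J -> m i != 0%N -> f m = 0.
Proof.
split=> [h m i iJ mi|h m hm].
  by apply: h; apply: contraNneq mi => /mnmP/(_ i); rewrite mnmE mnm0E (negPf iJ) => ->.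
apply/eqP; apply: contraPT isT => fm _; case/eqP: hm; apply/mnmP => i.
rewrite mnmE mnm0E; case: ifPn => // iJ; apply/eqP; apply: contraNT fm => mi.
by rewrite (h _ _ iJ).
Qed.

Lemma depC1 i f (m : 'X_{1..N}) : dep [set~ i] f -> m i != 0%N -> f m = 0.
Proof. by move=> /depP h; apply: h; rewrite !inE eqxx. Qed.

Lemma dep_sub J J' f : J \subset J' -> dep J f -> dep J' f.
Proof. by move=> /subsetP s /depP h; apply/depP => m i iJ; apply: h; apply: contra iJ; apply: s. Qed.

Lemma dep_spI J J' f : dep J' f -> dep (J' :\: J) (sp J f).
Proof.
move=> /depP h; apply/depP => m i; rewrite !inE negb_and negbK coef_sp.
case: ifP => // /eqP e /orP[iJ|]; last exact: h.
by move/mnmP: e => /(_ i); rewrite mnmE iJ mnm0E => ->.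
Qed.

Lemma dep_cvar J i : i \in J -> dep J (cvar i : cps C N).
Proof.
move=> iJ; apply/depP => m j jJ mj; rewrite cvarE coef_zm; case: eqP => // e.
by move: mj; rewrite e mnm1E; case: (i =P j) => // ij; rewrite -ij iJ in jJ.
Qed.

Lemma dep_cvarX J i n : i \in J -> dep J (cvar i ^+ n : cps C N).
Proof.
move=> iJ; elim: n => [|n ih]; first by rewrite expr0; apply: dep1.
by rewrite exprS; apply: depM => //; apply: dep_cvar.
Qed.

Lemma cvarX (i : 'I_N) n : cvar i ^+ n = zm (U_(i) *+ n)%MM :> cps C N.
Proof. by elim: n => [|n ih]; rewrite ?mulm0n ?zm0 // exprS ih mulmS zmD. Qed.

Fact shift_convergent mu f : convergent (fun k => f (k + mu)%MM).
Proof.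
have [r [M [r0 hM]]] := convergent_bdw (coef_convergent f).
apply: (@bdw_convergent _ _ (fun=> r) (r ^- mdeg mu * M)) => [_|] //.
apply: (@bdw_inj _ _ _ _ _ xpredT (fun k => k + mu)%MM _ _ _ _ _ _ _ _ hM) => //.
- by rewrite invr_ge0 exprn_ge0 // ltW.
- by move=> k l _ _ /addIm.
- by move=> k _; rewrite !wt_const mdegD exprD mulrCA [r ^+ mdeg k * _]mulrC mulKf // expf_neq0 // gt_eqF.
Qed.
Definition shift mu f : cps C N := Cps (shift_convergent mu f).
Lemma coef_shift mu f k : shift mu f k = f (k + mu)%MM. Proof. by []. Qed.

Lemma shiftK mu f : (forall m, ~~ (mu <= m)%MM -> f m = 0) -> f = zm mu * shift mu f.
Proof.
move=> h; apply: cpsP => m; rewrite coef_zmM coef_shift; case: ifP => hm; last by rewrite h ?hm.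
by rewrite submK.
Qed.

Lemma zmM_inj mu f g : zm mu * f = zm mu * g -> f = g.
Proof. by move=> e; apply: cpsP => m; rewrite -(coef_zmMD mu) e coef_zmMD. Qed.

Lemma cvarM_inj (i : 'I_N) f g : cvar i * f = cvar i * g -> f = g.
Proof. exact: zmM_inj. Qed.

End Dep.

(** * Weierstrass division *)

Section Weierstrass.
Context {C : numClosedFieldType} {N : nat} (i : 'I_N) (b : nat) (a : cps C N).

Definition regular := (forall c, (c < b)%N -> a (U_(i) *+ c)%MM = 0) /\ a (U_(i) *+ b)%MM != 0.

Hypothesis reg : regular.
Let T := [set~ i].

Lemma mp_set1C (m : 'X_{1..N}) : mp T m = 0%MM -> m = (U_(i) *+ m i)%MM.
Proof.
move=> /mnmP h; apply/mnmP => j; rewrite mulmnE mnm1E; case: eqP => [<-|ne]; first by rewrite mul1n.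
by have := h j; rewrite mnmE !inE mnm0E mul0n eq_sym; case: eqP.
Qed.

Lemma mp_U n : mp T (U_(i) *+ n)%MM = 0%MM.
Proof.
apply/mnmP => j; rewrite mnmE !inE mnm0E mulmnE mnm1E eq_sym.
by case: eqP => //= _; rewrite mul0n.
Qed.

Lemma sp_regular : exists2 v : cps C N, v \is a GRing.unit & sp T a = cvar i ^+ b * v.
Proof.
exists (shift (U_(i) *+ b)%MM (sp T a)).
  by rewrite unit_cpsE coef_shift add0m coef_sp mp_U eqxx; case: reg.
rewrite cvarX; apply: shiftK => m hm; rewrite coef_sp; case: eqP => // /mp_set1C e.
rewrite e; apply: (proj1 reg); rewrite ltnNge; apply: contra hm => hb; rewrite e.
by apply/mnm_lepP => j; rewrite !mulmnE leq_mul2l hb orbT.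
Qed.

(** [division_dep] with every variable but [i] as a parameter and [N0 = b]: on the special fibre [a]
    is a unit times the power [b] of the variable [i]. *)
Lemma weierstrass_division (w : cps C N) : exists q (r : 'I_b -> cps C N),
  (forall j, dep T (r j)) /\ w = q * a + \sum_j r j * cvar i ^+ j.
Proof.
have sz n : sp T (cvar i ^+ n : cps C N) = cvar i ^+ n.
  by apply: sp_dep; rewrite setCK; apply: dep_cvarX; rewrite inE.
have H mu : (mdeg mu <= b)%N -> mp T mu = 0%MM ->
    exists (x : unit -> cps C N) (c : 'I_b -> C), (mdeg mu = b -> forall j, c j = 0) /\
      zm mu = \sum_u x u * sp T a + \sum_j c j *: sp T (cvar i ^+ j).
  move=> h1 h2; have e : mu = (U_(i) *+ mdeg mu)%MM.
    by rewrite {1}(mp_set1C h2) {2}(mp_set1C h2) mdegMn mdeg1 mul1n.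
  move: h1; rewrite leq_eqVlt => /predU1P[mb|mb].
    have [v vu va] := sp_regular; exists (fun=> v^-1), (fun=> 0); split=> //.
    rewrite [X in _ + X]big1 ?addr0 => [|j _]; last by rewrite scale0r.
    by rewrite sum_unit va mulrCA mulVr // mulr1 cvarX -mb -e.
  exists (fun=> 0), (fun j => (j == mdeg mu :> nat)%:R); split=> [h|].
    by rewrite h ltnn in mb.
  rewrite big1 ?add0r => [|u _]; last by rewrite mul0r.
  rewrite (bigD1 (Ordinal mb)) // big1 => [|j hj]; last first.
    suff /negPf -> : (j != mdeg mu :> nat) by rewrite scale0r.
    by apply: contra hj => /eqP e'; apply/eqP/val_inj.
  by rewrite [RHS]addr0 eqxx scale1r sz cvarX -e.
have [q [r [hr ->]]] := division_dep H w; exists (q tt), r; split=> //.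
by rewrite sum_unit.
Qed.

(** Take a monomial of [q] of least degree in the parameters and, among these, of least exponent of
    the variable [i]. Its product with the power [b] of that variable in [a] cannot cancel in
    [q * a], but the right side has no exponent of [i] above [b - 1]. *)
Lemma weierstrass_unique q (r : 'I_b -> cps C N) : (forall j, dep T (r j)) ->
  q * a = \sum_j r j * cvar i ^+ j -> q = 0 /\ forall j, r j = 0.
Proof.
move=> hr e.
have q0 : q = 0.
  apply/eqP; apply: contraPT isT => /eqP qn _.
  have [m0 [m0q _]] := lead_exists qn.
  have E : exists d, `[< exists m, mdeg (mp T m) = d /\ q m != 0 >].
    by exists (mdeg (mp T m0)); apply/asboolP; exists m0.
  case: (ex_minnP E) => d /asboolP[m1 [m1d m1q]] hd {E}.
  have E : exists c, `[< exists m : 'X_{1..N}, [/\ m i = c, mdeg (mp T m) = d & q m != 0] >].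
    by exists (m1 i); apply/asboolP; exists m1.
  case: (ex_minnP E) => c /asboolP[m [mc md mq]] hc {E}.
  have : (q * a) (m + U_(i) *+ b)%MM = q m * a (U_(i) *+ b)%MM.
    apply: coefM_single => k l ekl km; apply/eqP; rewrite mulf_eq0 -implyNb; apply/implyP => kq.
    have /hd dk : `[< exists n, mdeg (mp T n) = mdeg (mp T k) /\ q n != 0 >].
      by apply/asboolP; exists k.
    have ekl' : (mp T k + mp T l)%MM = mp T m by rewrite -mpD ekl mpD mp_U addm0.
    have l0 : mp T l = 0%MM.
      apply/eqP; rewrite -mdeg_eq0 -leqn0 -(leq_add2l (mdeg (mp T k))) addn0 -mdegD ekl'.
      by rewrite md.
    have kd : mdeg (mp T k) = d by rewrite -md -ekl' l0 addm0.
    have /hc ck : `[< exists n : 'X_{1..N}, [/\ n i = k i, mdeg (mp T n) = d & q n != 0] >].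
      by apply/asboolP; exists k.
    have eki : (k i + l i = m i + b)%N.
      by move/mnmP: ekl => /(_ i); rewrite !mnmDE mulmnE mnm1E eqxx mul1n.
    have [lb|lb] := ltnP (l i) b; first by rewrite (mp_set1C l0); apply/eqP/(proj1 reg).
    have ki : k i = m i.
      by apply/eqP; rewrite eqn_leq -{1}(leq_add2r b) -eki leq_add2l lb mc.
    case: km; apply/mnmP => j; have [->//|ji] := eqVneq j i.
    by move/mnmP: ekl' => /(_ j); rewrite l0 addm0 !mnmE !inE ji.
  rewrite e coef_sum big1 => [/esym/eqP|j _].
    by rewrite mulf_eq0 (negPf mq) (negPf (proj2 reg)).
  rewrite mulrC cvarX coef_zmM; case: ifP => // _; apply: (depC1 (hr j)).
  rewrite mnmBE mnmDE !mulmnE mnm1E eqxx !mul1n -lt0n subn_gt0.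
  by apply: leq_trans (ltn_ord j) _; rewrite leq_addl.
split=> // j; move: e; rewrite q0 mul0r => e; apply: cpsP => k; rewrite coef0.
have [ki|ki] := eqVneq (k i) 0%N; last exact: (depC1 (hr j)).
move/(congr1 (fun f : cps C N => f (k + U_(i) *+ j)%MM)): e; rewrite coef0 coef_sum.
rewrite (bigD1 j) // big1 => [|l lj].
  rewrite mulrC cvarX [in X in X -> _]addmC coef_zmMD => e.
  by rewrite -[LHS]addr0 -e.
rewrite mulrC cvarX coef_zmM; case: ifP => // /mnm_lepP /(_ i).
rewrite mnmDE !mulmnE mnm1E eqxx ki !mul1n add0n => lj'.
apply: (depC1 (hr l)).
rewrite mnmBE mnmDE !mulmnE mnm1E eqxx ki !mul1n add0n -lt0n subn_gt0 ltn_neqAle lj' andbT.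
by apply: contra lj => /eqP h; apply/eqP/val_inj.
Qed.

End Weierstrass.

Lemma nonroot_exists {C : numClosedFieldType} (p : {poly C}) : p != 0 -> exists c, p.[c] != 0.
Proof.
move=> p0; pose s : seq C := [seq i%:R | i <- iota 0 (size p)].
have us : uniq s.
  by rewrite map_inj_uniq ?iota_uniq // => x y /eqP; rewrite eqr_nat => /eqP.
have [h|] := boolP (all (root p) s).
  by have := max_poly_roots p0 h us; rewrite size_map size_iota ltnn.
by case/allPn=> c _ hc; exists c.
Qed.

(** * Linear changes of coordinates making a series regular *)

Section Regularization.
Context {C : numClosedFieldType} {N : nat}.
Implicit Types (f g : cps C N).

Lemma zm_prod m : zm m = \prod_i cvar i ^+ m i :> cps C N.
Proof.
under eq_bigr do rewrite cvarX.
rewrite {1}(multinomUE_id m); apply: (big_morph (@zm C N) _ zm0) => x y; exact: zmD.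
Qed.

Lemma subst_prod K (phi : 'I_N -> cps C K) I (r : seq I) P (F : I -> cps C N) :
  subst (\prod_(i <- r | P i) F i) phi = \prod_(i <- r | P i) subst (F i) phi.
Proof. by apply: (big_morph (fun f => subst f phi)) => [f g|]; rewrite ?substM ?subst1. Qed.

Lemma subst_zm K (phi : 'I_N -> cps C K) m : (forall i, max_ideal (phi i)) ->
  subst (zm m) phi = \prod_i phi i ^+ m i.
Proof.
by move=> h; rewrite zm_prod subst_prod; apply: eq_bigr => i _; rewrite substX subst_cvar.
Qed.

(** Identifying the variable [j] with [c] times the variable [i] turns a suitable coefficient into a
    nonzero polynomial in [c]; any value that is not a root will do. *)
Lemma restrict_variable f (i j : 'I_N) : f <> 0 -> j != i ->
  exists c : C, subst f (fun k => if k == j then c *: cvar i else cvar k) <> 0 :> cps C N.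
Proof.
move=> f0 ji; have [m [fm _]] := lead_exists f0.
(* The exponent of the monomial [k] after the identification: the exponent of [j] is added to that
   of [i]. *)
pose mv (k : 'X_{1..N}) : 'X_{1..N} :=
  [multinom if l == j then 0%N else (k l + (l == i) * k j)%N | l < N].
pose n := (mdeg (mv m)).+1.
pose p : {poly C} := \sum_(k : 'X_{1..N < n} | mv k == mv m) f k *: 'X^(k j).
have inj k : mv k = mv m -> k j = m j -> k = m.
  move=> /mnmP e ej; apply/mnmP => l; have := e l; rewrite !mnmE.
  by case: eqP => [-> //|_]; rewrite ej => /addIn.
have dmv k : mdeg (mv k) = mdeg k.
  rewrite !mdegE (bigD1 i) // [RHS](bigD1 i) //= mnmE eq_sym (negPf ji) eqxx mul1n.
  rewrite (bigD1 j) //= [in RHS](bigD1 j) //= mnmE eqxx add0n addnA; congr (_ + _)%N.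
  by apply: eq_bigr => l /andP[/negPf li /negPf lj]; rewrite mnmE lj li mul0n addn0.
have [c hc] : exists c, p.[c] != 0.
  apply: nonroot_exists; apply: contraNneq fm => p0.
  have hm : (mdeg m < n)%N by rewrite /n dmv.
  move/(congr1 (fun p : {poly C} => p`_(m j))): p0; rewrite poly.coef0 poly.coef_sum /=.
  rewrite (bigD1 (BMultinom hm)) //= big1 => [|k /andP[/eqP hk nk]].
    by rewrite addr0 poly.coefZ coefXn eqxx mulr1 => ->.
  rewrite poly.coefZ coefXn; case: eqP => [e|_]; last by rewrite mulr0.
  by case/eqP: nk; apply/val_inj/inj.
pose phi k : cps C N := if k == j then c *: cvar i else cvar k.
exists c; rewrite -/phi => E; have {E} : subst f phi (mv m) = 0 by rewrite E.
have hphi k : max_ideal (phi k).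
  rewrite /phi; case: eqP => _; last exact: max_cvar.
  by rewrite /max_ideal coefZ max_cvar mulr0.
have -> : subst f phi (mv m) = subst (jet n f) phi (mv m).
  apply/eqP; rewrite -subr_eq0 -coefB -substB; apply/eqP.
  apply: (@mt_ge_subst _ _ _ n _ phi); [exact: jet_rest|exact: ltnSn].
rewrite subst_sum coef_sum => e; case/eqP: hc; rewrite -[RHS]e /p horner_sum big_mkcond.
apply: eq_bigr => k _; rewrite substZ coefZ subst_zm //.
have -> : \prod_l phi l ^+ bmnm k l = c ^+ k j *: zm (mv k).
  rewrite (bigD1 j) //= {1}/phi eqxx exprZn -scalerAl; congr (_ *: _).
  rewrite zm_prod [RHS](bigD1 j) //= mnmE eqxx expr0 mul1r (bigD1 i) 1?eq_sym //=.
  rewrite [RHS](bigD1 i) 1?eq_sym //= mnmE eq_sym (negPf ji) eqxx mul1n /phi eq_sym (negPf ji).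
  rewrite mulrA -exprD addnC; congr (_ * _); apply: eq_bigr => l /andP[lj li].
  by rewrite (negPf lj) mnmE (negPf lj) (negPf li) mul0n addn0.
rewrite coefZ coef_zm eq_sym; case: eqP => _; last by rewrite !mulr0.
by rewrite hornerZ hornerXn mulr1.
Qed.

Lemma restrict_all f (i : 'I_N) : f <> 0 -> exists c : 'I_N -> C,
  subst f (fun k => if k == i then cvar i else c k *: cvar i) <> 0 :> cps C N.
Proof.
move=> f0; suff [c hc] : exists c : 'I_N -> C, subst f (fun k =>
    if k \in [seq j <- enum 'I_N | j != i] then c k *: cvar i else cvar k) <> 0 :> cps C N.
  exists c => e; apply: hc; rewrite -{}[RHS]e; apply: eq_subst => k.
  by rewrite mem_filter mem_enum andbT if_neg; case: eqP => [->|].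
elim: [seq _ <- _ | _] (filter_all (fun j => j != i) (enum 'I_N)) => [_|j s ih /= /andP[ji hs]].
  by exists (fun=> 0); rewrite subst_id.
have is0 : i \notin s by apply/negP => /(allP hs); rewrite eqxx.
have [c hc] := ih hs; have [js|js] := boolP (j \in s).
  by exists c => e; apply: hc; rewrite -{}[RHS]e; apply: eq_subst => k; rewrite inE; case: eqP => [->|//]; rewrite js.
have [d hd] := restrict_variable hc ji.
exists (fun k => if k == j then d else c k) => e; apply: hd; rewrite -{}[RHS]e subst_subst.
apply: eq_subst => k; have [->|kj] := eqVneq k j.
  rewrite (negPf js) subst_cvar ?eqxx ?mem_head //.
  by rewrite /max_ideal coefZ max_cvar mulr0.
rewrite inE (negPf kj) /=; case: ifP => ks.
  by rewrite substZ subst_cvar eq_sym (negPf ji) //; apply: max_cvar.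
by rewrite subst_cvar (negPf kj) //; apply: max_cvar.
Qed.

Lemma sp_subst (T : {set 'I_N}) f : sp T f = subst f (fun k => if k \in T then 0 else cvar k).
Proof.
move: f; apply: subst_linear => [|e f he m me|k||k f].
- exact: sp_lin.
- by rewrite coef_sp he ?if_same // addn0.
- by case: ifP => _ //; apply: max_cvar.
- exact: sp1.
rewrite spM; congr (_ * _); apply: cpsP => m; rewrite coef_sp cvarE coef_zm.
case kT: (k \in T).
  rewrite coef0; case: eqP => // /mnmP/(_ k); rewrite mnmE kT mnm0E.
  by case: (m =P U_(k)%MM) => // ->; rewrite mnm1E eqxx.
rewrite coef_zm; case: (m =P U_(k)%MM) => [->|_]; last by rewrite if_same.
rewrite (_ : mp T _ = 0%MM) ?eqxx //; apply/mnmP => l; rewrite mnmE mnm0E mnm1E.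
by case: ifP => // lT; case: eqP => // kl; rewrite -kl kT in lT.
Qed.

Lemma eq_subst_dep (J : {set 'I_N}) K f (phi psi : 'I_N -> cps C K) : dep J f ->
  {in J, phi =1 psi} -> subst f phi = subst f psi.
Proof.
rewrite -[J in dep J]setCK => /sp_dep <- h; rewrite sp_subst !subst_subst; apply: eq_subst => k.
rewrite inE; case: ifPn => [_|]; rewrite ?subst0 // negbK => kJ.
by rewrite !subst_cvar_drop h.
Qed.

Lemma dep_subst (J : {set 'I_N}) f (phi : 'I_N -> cps C N) : dep J f ->
  (forall k, k \in J -> dep J (phi k)) -> dep J (subst f phi).
Proof.
move=> hf hp; rewrite (eq_subst_dep (psi := fun k => sp (~: J) (phi k)) hf) => [|k kJ].
  have -> : subst f (fun k => sp (~: J) (phi k)) = sp (~: J) (subst f phi).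
    by rewrite sp_subst subst_subst; apply: eq_subst => k; rewrite sp_subst.
  by rewrite -[J in dep J]setCK; apply: dep_sp.
by rewrite sp_dep // setCK; apply: hp.
Qed.

Definition shear (i : 'I_N) (c : 'I_N -> C) k : cps C N := cvar k + c k *: cvar i.

Lemma max_shear i c k : max_ideal (shear i c k).
Proof. by rewrite /max_ideal coefD coefZ !max_cvar mulr0 addr0. Qed.

Lemma shearK i c f : c i = 0 -> subst (subst f (shear i c)) (shear i (fun k => - c k)) = f.
Proof.
move=> ci; rewrite subst_subst -[RHS]subst_id; apply: eq_subst => k.
rewrite [shear i c k]/shear substD substZ !subst_cvar; [|exact: max_shear..].
by rewrite /shear ci oppr0 scale0r addr0 scaleNr subrK.
Qed.

(** There is a line on which [f] does not vanish; the shear turns it into the axis of the variable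
    [i]. Coefficients outside [J] are zero, so that the shear leaves the other variables alone. *)
Lemma regularize (J : {set 'I_N}) f (i : 'I_N) : f <> 0 -> dep J f -> i \in J ->
  exists c b, [/\ c i = 0, forall k, k \notin J -> c k = 0
    & regular i b (subst f (shear i c))].
Proof.
move=> f0 hf iJ; have [c hc] := restrict_all i f0.
pose c' k := if (k == i) || (k \notin J) then 0 else c k.
have c'i : c' i = 0 by rewrite /c' eqxx.
suff [b hb] : exists b, regular i b (subst f (shear i c')).
  by exists c', b; split=> // k kJ; rewrite /c' kJ orbT.
pose g := subst f (shear i c').
have g0 : sp [set~ i] g <> 0.
  move=> e; apply: hc; rewrite -{}[RHS]e sp_subst subst_subst; apply: eq_subst_dep hf _ => k kJ.
  rewrite /shear substD substZ !subst_cvar; try by case: ifP => // _; apply: max_cvar.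
  rewrite !inE eqxx /= /c' kJ orbF; have [->|ki] := eqVneq k i; first by rewrite scale0r addr0.
  by rewrite add0r.
have [m [gm _]] := lead_exists g0.
have E : exists n, g (U_(i) *+ n)%MM != 0.
  move: gm; rewrite coef_sp; case: (mp _ _ =P 0%MM) => [/mp_set1C e gm|_]; last by rewrite eqxx.
  by exists (m i); rewrite -e.
case: (ex_minnP E) => b gb hb; exists b; split=> // c0 cb; apply/eqP; apply: contraLR cb.
by move=> /hb; rewrite -leqNgt.
Qed.

End Regularization.

(** * Flatness *)

Section Relations.
Context {C : numClosedFieldType} {N : nat}.

(* Flatness of the ring of all series over the series in the variables [J], in
   equational form. *)
Definition rel_generated (J : {set 'I_N}) := forall (n q : finType) (s : seq q)
    (m : n -> cps C N) (a : n -> q -> cps C N),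
  (forall k l, dep J (a k l)) -> (forall l, l \in s -> \sum_k m k * a k l = 0) ->
  exists (L : finType) (b : L -> n -> cps C N) (w : L -> cps C N),
    [/\ forall x k, dep J (b x k), forall k, m k = \sum_x w x * b x k
      & forall x l, l \in s -> \sum_k b x k * a k l = 0].

Definition rel_generated1 (J : {set 'I_N}) := forall (n : finType)
    (m : n -> cps C N) (a : n -> cps C N),
  (forall k, dep J (a k)) -> \sum_k m k * a k = 0 ->
  exists (L : finType) (b : L -> n -> cps C N) (w : L -> cps C N),
    [/\ forall x k, dep J (b x k), forall k, m k = \sum_x w x * b x k
      & forall x, \sum_k b x k * a k = 0].

Lemma sum_delta (n : finType) (F : n -> cps C N) k : \sum_x F x * (x == k)%:R = F k.
Proof.
by rewrite (bigD1 k) //= eqxx mulr1 big1 ?addr0 // => x /negPf ->; rewrite mulr0.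
Qed.

(** The relations are treated one by one: the multipliers [w] which solve the first are the unknowns
    for the others. *)
Lemma rel_generated_all J : rel_generated1 J -> rel_generated J.
Proof.
move=> h1 n q s; elim: s n => [|l s ih] n m a ha hm.
  exists n, (fun x k => (x == k)%:R), m; split=> // [x k|k].
    by case: eqP => _; [apply: dep1|apply: dep0].
  by rewrite sum_delta.
have [L [b [w [hb hw hr]]]] := h1 n m (a^~ l) (fun k => ha k l) (hm l (mem_head l s)).
pose a' (x : L) l' := \sum_k b x k * a k l'.
have [x l'|l' l's|L' [b' [w' [hb' hw' hr']]]] := ih L w a'.
- by apply: dep_sum => k _; apply: depM.
- rewrite -[RHS](hm l'); last by rewrite inE l's orbT.
  under eq_bigr do rewrite mulr_sumr; rewrite exchange_big; apply: eq_bigr => k _ /=.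
  by rewrite hw mulr_suml; apply: eq_bigr => x _; rewrite mulrA.
exists L', (fun y k => \sum_x b' y x * b x k), w'; split=> [y k|k|y l'].
- by apply: dep_sum => x _; apply: depM.
- rewrite hw; under [RHS]eq_bigr do rewrite mulr_sumr; rewrite exchange_big.
  apply: eq_bigr => x _ /=; rewrite hw' mulr_suml; apply: eq_bigr => y _; by rewrite mulrA.
have E : \sum_k (\sum_x b' y x * b x k) * a k l' = \sum_x b' y x * a' x l'.
  under eq_bigr do rewrite mulr_suml; rewrite exchange_big; apply: eq_bigr => x _ /=.
  by rewrite mulr_sumr; apply: eq_bigr => k _; rewrite mulrA.
rewrite E inE => /predU1P[->|]; last exact: hr'.
by rewrite big1 // => x _; rewrite /a' hr mulr0.
Qed.

(** The Koszul relations between [a k0] and the other coefficients suffice. *)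
Lemma rel_generated_unit J (n : finType) (m a : n -> cps C N) k0 :
  (forall k, dep J (a k)) -> \sum_k m k * a k = 0 -> a k0 \is a GRing.unit ->
  exists (L : finType) (b : L -> n -> cps C N) (w : L -> cps C N),
    [/\ forall x k, dep J (b x k), forall k, m k = \sum_x w x * b x k
      & forall x, \sum_k b x k * a k = 0].
Proof.
move=> ha hm u0.
exists n, (fun x k => (x == k)%:R * a k0 - (k == k0)%:R * a x), (fun x => m x / a k0).
have d x y : dep J ((x == y)%:R : cps C N) by case: (x == y); [apply: dep1|apply: dep0].
split=> [x k|k|x].
- by apply: depD; [apply: depM|apply/depN/depM] => //; apply: d.
- under eq_bigr => x _ do rewrite mulrBr mulrA (mulrAC _ _ (a k0)) divrK // mulrCA (mulrAC _ _ (a x)).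
  rewrite sumrB sum_delta -mulr_sumr -mulr_suml hm mul0r mulr0 subr0 //.
under eq_bigr do rewrite mulrBl; rewrite sumrB.
have -> : \sum_k (x == k)%:R * a k0 * a k = a k0 * a x.
  by under eq_bigr => k _ do rewrite -mulrA mulrC eq_sym; rewrite sum_delta.
have -> : \sum_k (k == k0)%:R * a x * a k = a x * a k0.
  by under eq_bigr => k _ do rewrite -mulrA mulrC; rewrite sum_delta.
by rewrite mulrC subrr.
Qed.

Lemma dep_nat J n : dep J (n%:R : cps C N).
Proof. by elim: n => [|n ih]; rewrite ?mulrS; [apply: dep0|apply: depD => //; apply: dep1]. Qed.

(** Modulo the regular coefficient [a k0] all series become remainders of degree below [b] in the
    variable [i]. The relation turns into [b] relations between remainders, with coefficients in one
    variable less, to which the hypothesis on [J :\ i] applies. *)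
Lemma rel_generated_regular (J : {set 'I_N}) i b (n : finType) (m a : n -> cps C N) k0 :
  i \in J -> rel_generated (J :\ i) -> regular i b (a k0) ->
  (forall k, dep J (a k)) -> \sum_k m k * a k = 0 ->
  exists (L : finType) (b : L -> n -> cps C N) (w : L -> cps C N),
    [/\ forall x k, dep J (b x k), forall k, m k = \sum_x w x * b x k
      & forall x, \sum_k b x k * a k = 0].
Proof.
move=> iJ flatJ reg ha hm.
have /choice[qr hqr] : forall k, exists qr : cps C N * ('I_b -> cps C N),
    (forall j, dep [set~ i] (qr.2 j)) /\ m k = qr.1 * a k0 + \sum_j qr.2 j * cvar i ^+ j.
  by move=> k; have [q [r h]] := weierstrass_division reg (m k); exists (q, r).
(* The matrices of multiplication by the [a k] modulo [a k0]. Applying [sp (~: J)] to the division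
   keeps quotients and remainders in the variables of [J]. *)
have /choice[st hst] : forall p : n * 'I_b, exists st : cps C N * ('I_b -> cps C N),
    [/\ dep J st.1, forall j, dep [set~ i] (st.2 j), forall j, dep (J :\ i) (st.2 j)
      & a p.1 * cvar i ^+ p.2 = st.1 * a k0 + \sum_j st.2 j * cvar i ^+ j].
  move=> p; have [q [r [h e]]] := weierstrass_division reg (a p.1 * cvar i ^+ p.2).
  have spi k : sp (~: J) (cvar i ^+ k : cps C N) = cvar i ^+ k.
    by apply: sp_dep; rewrite setCK; apply: dep_cvarX.
  have spa k : sp (~: J) (a k) = a k by apply: sp_dep; rewrite setCK.
  exists (sp (~: J) q, fun j => sp (~: J) (r j)); split=> [|j|j|] /=.
  - by rewrite -[J in dep J]setCK; apply: dep_sp.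
  - by apply: (@dep_sub _ _ _ _ _ _ (@dep_spI _ _ (~: J) _ _ (h j))); apply: subsetDl.
  - apply: (@dep_sub _ _ _ _ _ _ (@dep_spI _ _ (~: J) _ _ (h j))); apply/subsetP => k.
    by rewrite !inE negbK andbC.
  move/(congr1 (sp (~: J))): e; rewrite (linD _ _ (sp_lin _)) !spM spa spi sp_sum => ->.
  by rewrite spa; congr (_ + _); apply: eq_bigr => j _; rewrite spM spi.
pose rho (p : n * 'I_b) := (qr p.1).2 p.2.
have hrel l : \sum_p rho p * (st p).2 l = 0.
  suff : [forall l : 'I_b, \sum_p rho p * (st p).2 l == 0] by move=> /forallP/(_ l)/eqP.
  apply/forallP => {}l; apply/eqP.
  have E : (- (\sum_k (qr k).1 * a k + \sum_p rho p * (st p).1)) * a k0 =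
      \sum_l (\sum_p rho p * (st p).2 l) * cvar i ^+ l.
    apply/eqP; rewrite mulNr eq_sym -subr_eq0 opprK; apply/eqP; rewrite -[RHS]hm.
    transitivity (\sum_k (qr k).1 * a k * a k0 + \sum_p rho p * (a p.1 * cvar i ^+ p.2)).
      rewrite mulrDl !mulr_suml addrCA; congr (_ + _).
      under eq_bigr do rewrite mulr_suml; rewrite exchange_big -big_split /=.
      apply: eq_bigr => p _; have [_ _ _ ->] := hst p.
      rewrite mulrDr addrC mulrA mulr_sumr; congr (_ + _).
      by apply: eq_bigr => j _; rewrite mulrA.
    rewrite -(pair_bigA _ (fun k j => rho (k, j) * (a k * cvar i ^+ j))) -big_split /=.
    apply: eq_bigr => k _; have [_ ->] := hqr k.
    rewrite mulrDl mulr_suml mulrAC; congr (_ + _); apply: eq_bigr => j _.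
    by rewrite [rho _]/((qr k).2 j) [a k * _]mulrC mulrA.
  have [|_ ->//] := weierstrass_unique reg _ E.
  move=> j; apply: dep_sum => p _; apply: depM; first by have [h _] := hqr p.1; apply: h.
  by have [_ h _ _] := hst p.
have [||L [b' [w [hb' hw hr]]]] := flatJ _ 'I_b (enum 'I_b) rho (fun p => (st p).2).
- by move=> p l; have [_ _ h _] := hst p.
- by move=> l _.
pose th x := \sum_p b' x p * (st p).1.
pose be x k := \sum_j b' x (k, j) * cvar i ^+ j.
(* Two kinds of relations: those found over [J :\ i], corrected in the component [k0], and the
   Koszul relations with [a k0], which account for the quotients. *)
pose B (y : L + n) k := match y with
  | inl x => be x k - (k == k0)%:R * th x
  | inr x => (x == k)%:R * a k0 - (k == k0)%:R * a x end.
pose W (y : L + n) := match y with inl x => w x | inr x => (qr x).1 end.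
have b'J x p : dep J (b' x p) by apply: (@dep_sub _ _ _ _ _ _ (hb' x p)); apply: subsetDl.
have relB y : \sum_k B y k * a k = 0.
  case: y => x; rewrite /B; under eq_bigr do rewrite mulrBl; rewrite sumrB.
    have -> : \sum_k (k == k0)%:R * th x * a k = th x * a k0.
      by under eq_bigr => k _ do rewrite -mulrA mulrC; rewrite sum_delta.
    apply/eqP; rewrite subr_eq0; apply/eqP.
    transitivity (\sum_p b' x p * (a p.1 * cvar i ^+ p.2)).
      rewrite [RHS](eq_bigr (fun p => b' x (p.1, p.2) * (a p.1 * cvar i ^+ p.2))) => [|[] //].
      rewrite -(pair_bigA _ (fun k j => b' x (k, j) * (a k * cvar i ^+ j))) /=.
      apply: eq_bigr => k _; rewrite mulr_suml; apply: eq_bigr => j _.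
      by rewrite -mulrA; congr (_ * _); rewrite mulrC.
    transitivity (\sum_p (b' x p * (st p).1 * a k0 + \sum_j b' x p * (st p).2 j * cvar i ^+ j)).
      apply: eq_bigr => p _; have [_ _ _ ->] := hst p; rewrite mulrDr mulrA mulr_sumr.
      by congr (_ + _); apply: eq_bigr => j _; rewrite mulrA.
    rewrite big_split /= exchange_big /= [X in _ + X]big1 ?addr0 => [|j _].
      by rewrite /th mulr_suml.
    by rewrite -mulr_suml hr ?mul0r // mem_enum.
  have -> : \sum_k (x == k)%:R * a k0 * a k = a k0 * a x.
    by under eq_bigr => k _ do rewrite -mulrA mulrC eq_sym; rewrite sum_delta.
  have -> : \sum_k (k == k0)%:R * a x * a k = a x * a k0.
    by under eq_bigr => k _ do rewrite -mulrA mulrC; rewrite sum_delta.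
  by rewrite mulrC subrr.
exists (L + n)%type, B, W; split=> //.
  move=> [x|x] k; apply: depD; try apply: depN.
  - by apply: dep_sum => j _; apply: depM => //; apply: dep_cvarX.
  - apply: depM; first exact: dep_nat.
    by apply: dep_sum => p _; apply: depM => //; have [h] := hst p.
  - by apply: depM => //; apply: dep_nat.
  - by apply: depM => //; apply: dep_nat.
have a0 : a k0 != 0.
  by case: reg => _; apply: contraNneq => ->; rewrite coef0.
(* The formula is checked in the components other than [k0]. Both sides satisfy the relation and
   [a k0] is not a zero divisor, which forces the remaining component. *)
have E k : exists z, m k = \sum_y W y * B y k + (k == k0)%:R * z /\ (k = k0 \/ z = 0).
  have [ek|ne] := eqVneq k k0; last first.
    exists 0; split; last by right.
    rewrite mulr0 addr0 big_sumType /= (negPf ne).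
    have [_ ->] := hqr k; rewrite addrC; congr (_ + _).
      by under eq_bigr do rewrite mul0r subr0 mulrCA mulrC; rewrite sum_delta.
    under [RHS]eq_bigr do rewrite mul0r subr0 /be mulr_sumr; rewrite exchange_big.
    apply: eq_bigr => j _ /=; rewrite -[(qr k).2 j]/(rho (k, j)) hw mulr_suml.
    by apply: eq_bigr => x _; rewrite mulrA.
  exists (m k - \sum_y W y * B y k); split; last by left.
  by rewrite mul1r addrC subrK.
have /choice[z hz] := E.
have z0 : z k0 * a k0 = 0.
  rewrite -[RHS]hm; apply/eqP; rewrite eq_sym -subr_eq0; apply/eqP.
  have -> : \sum_k m k * a k = \sum_k (\sum_y W y * B y k) * a k + \sum_k (k == k0)%:R * z k * a k.
    by rewrite -big_split; apply: eq_bigr => k _ /=; rewrite -mulrDl; have [<-] := hz k.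
  have -> : \sum_k (k == k0)%:R * z k * a k = z k0 * a k0.
    by under eq_bigr => k _ do rewrite -mulrA mulrC; rewrite sum_delta.
  rewrite addrK; under eq_bigr do rewrite mulr_suml; rewrite exchange_big big1 //= => y _.
  by under eq_bigr do rewrite -mulrA; rewrite -mulr_sumr relB mulr0.
move=> k; have [-> [ek|->]] := hz k; last by rewrite mulr0 addr0.
move/eqP: z0; rewrite mulf_eq0 (negPf a0) orbF ek => /eqP ->.
by rewrite mulr0 addr0.
Qed.

(** Induction on the number of variables in [J]. For empty [J] a nonzero coefficient is a constant,
    hence a unit; otherwise a shear within [J] makes it regular. *)
Lemma relations_generated (J : {set 'I_N}) : rel_generated J.
Proof.
have [d] := ubnP #|J|; elim: d J => // d ih J; rewrite ltnS => Jd.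
apply: rel_generated_all => n m a ha hm.
have [[k0 ak0]|a0] := pselect (exists k0, a k0 <> 0); last first.
  exists n, (fun x k => (x == k)%:R), m; split=> [x k|k|x]; first exact: dep_nat.
    by rewrite sum_delta.
  by rewrite big1 // => k _; apply/eqP; rewrite mulf_eq0; apply/orP; right; apply/eqP; apply: contrapT => h; apply: a0; exists k.
have [J0|[i iJ]] := set_0Vmem J.
  apply: (rel_generated_unit (k0 := k0)) => //; rewrite unit_cpsE.
  have [l [al _]] := lead_exists ak0; have -> // : 0%MM = l.
  apply/mnmP => i; rewrite mnm0E; apply/esym/eqP; apply: contraNT al => li.
  by move/depP: (ha k0) => /(_ l i) -> //; rewrite J0 inE.
have [c [b [ci cJ reg]]] := regularize ak0 (ha k0) iJ.
have hs c' : (forall k, k \notin J -> c' k = 0) -> forall f, dep J f -> dep J (subst f (shear i c')).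
  move=> hc f hf; apply: dep_subst => // k kJ; apply: depD; first exact: dep_cvar.
  by apply: depZ; apply: dep_cvar.
have flatJ : rel_generated (J :\ i) by apply: ih; rewrite (cardsD1 i) iJ in Jd.
have [k||L [b' [w [hb' hw hr]]]] := @rel_generated_regular J i b n
    (fun k => subst (m k) (shear i c)) (fun k => subst (a k) (shear i c)) k0 iJ flatJ reg.
- exact: hs.
- have := congr1 (fun f => subst f (shear i c)) hm; rewrite subst0 subst_sum => e; rewrite -[RHS]e.
  by apply: eq_bigr => k _; rewrite substM.
pose c' k := - c k.
have c'J k : k \notin J -> c' k = 0 by move=> /cJ h; rewrite /c' h oppr0.
exists L, (fun x k => subst (b' x k) (shear i c')), (fun x => subst (w x) (shear i c')).
split=> [x k|k|x]; first exact: hs.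
  rewrite -[LHS](shearK (m k) ci) hw subst_sum; apply: eq_bigr => x _.
  by rewrite substM.
have := congr1 (fun f => subst f (shear i c')) (hr x); rewrite subst0 subst_sum => e; rewrite -[RHS]e.
by apply: eq_bigr => k _; rewrite substM shearK.
Qed.

End Relations.

(** In the exponential series for a flow, the [n ^ n] produced by [n] Cauchy estimates on polydiscs
    shrinking by steps of order [1 / n] is absorbed by the factorial. *)
Lemma expn_self_le n : (n ^ n <= 4 ^ n * n`!)%N.
Proof.
have h1 : (n ^ n <= (2 * n) ^_ n)%N.
  rewrite ffact_prod -[X in (_ ^ X)%N]card_ord -prod_nat_const; apply: leq_prod => i _.
  by rewrite mul2n -addnn -addnBA ?leq_addr // ltnW.
apply: leq_trans h1 _; rewrite -bin_ffact leq_mul2r; apply/orP; right.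
have -> : (4 ^ n = 2 ^ (2 * n))%N by rewrite expnM.
have := expnDn 1 1 (2 * n); rewrite addn1 => ->.
have hn : (n < (2 * n).+1)%N by rewrite ltnS mul2n -addnn leq_addr.
by rewrite (bigD1 (Ordinal hn)) //= !exp1n !muln1 leq_addr.
Qed.

(** * Flows *)

Section VectorFields.
Context {C : numClosedFieldType} {N : nat} (V : 'I_N -> cps C N).
Implicit Types (f g u al : cps C N).

Definition vf f : cps C N := \sum_i V i * pderiv i f.

Lemma vf_lin : lin vf.
Proof.
move=> c f g; rewrite scaler_sumr -big_split; apply: eq_bigr => i _ /=.
by rewrite pderivL mulrDr scalerAr.
Qed.

Lemma vf_lowering : order_lowering 1 vf.
Proof.
by move=> e f h; apply: mt_ge_sum => i _; apply: mt_geMl; apply: pderiv_lowering.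
Qed.

Lemma vfM f g : vf (f * g) = vf f * g + f * vf g.
Proof.
rewrite mulr_suml mulr_sumr -big_split; apply: eq_bigr => i _ /=; rewrite pderivM; ring.
Qed.

Lemma vf1 : vf 1 = 0.
Proof. by apply: big1 => i _; rewrite pderiv1 mulr0. Qed.

Lemma vf_cvar i : vf (cvar i) = V i.
Proof.
rewrite /vf (bigD1 i) //= pderiv_cvar eqxx mulr1 big1 ?addr0 // => j /negPf ji.
by rewrite pderiv_cvar ji mulr0.
Qed.

Lemma vf_subst K (phi : 'I_K -> cps C N) (f : cps C K) :
  vf (subst f phi) = \sum_j subst (pderiv j f) phi * vf (phi j).
Proof.
rewrite /vf; under eq_bigr do rewrite chain_rule mulr_sumr.
rewrite exchange_big; apply: eq_bigr => j _ /=.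
by rewrite mulr_sumr; apply: eq_bigr => i _; rewrite mulrCA.
Qed.

Lemma bdw_zm rho m : (forall i, 0 <= rho i) -> bdw rho (wt rho m) (zm m : cps C N).
Proof.
move=> r0 s us; have [h|h] := boolP (m \in s).
  rewrite (bigD1_seq m) // coef_zm eqxx normr1 mul1r big1 => [|k n]; first by rewrite /= addr0.
  by rewrite coef_zm (negPf n) normr0 mul0r.
rewrite big1_seq ?wt_ge0 // => k /andP[_ ks]; rewrite coef_zm; case: eqP => [e|_].
  by move: h; rewrite -e ks.
by rewrite normr0 mul0r.
Qed.

Lemma power_gap (r r' : C) d : 0 <= r' -> r' <= r ->
  d.+1%:R * r' ^+ d * (r - r') + r' ^+ d.+1 <= r ^+ d.+1.
Proof.
move=> r0 rr; have r0' := le_trans r0 rr.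
elim: d => [|d ih]; first by rewrite expr0 !expr1 !mul1r subrK.
rewrite [leRHS]exprS; apply: le_trans (ler_wpM2l r0' ih).
have -> : d.+2%:R * r' ^+ d.+1 * (r - r') + r' ^+ d.+2 =
    d.+1%:R * r' ^+ d.+1 * (r - r') + r * r' ^+ d.+1.
  by rewrite -[d.+2%:R]natr1 !exprS; ring.
rewrite [leRHS]mulrDr lerD2r [leRHS]mulrC.
have -> : d.+1%:R * r' ^+ d.+1 * (r - r') = d.+1%:R * r' ^+ d * (r - r') * r' by rewrite exprS; ring.
by rewrite ler_wpM2l // !mulr_ge0 ?exprn_ge0 ?subr_ge0.
Qed.

(** Cauchy's inequality: [power_gap] compares the factor produced by the derivative with the gain
    between the radii [r - d] and [r]. *)
Lemma bdw_pderiv r d M i f : 0 < d -> d <= r -> bdw (fun=> r) M f ->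
  bdw (fun=> r - d) (d^-1 * M) (pderiv i f).
Proof.
move=> d0 dr; apply: (@bdw_inj _ _ _ _ _ xpredT (fun m => m + U_(i))%MM) => //.
- by rewrite invr_ge0 ltW.
- by move=> x y _ _; apply: addIm.
move=> m _; rewrite coef_pderiv !wt_const normrM normr_nat mdegD mdeg1 addn1.
rewrite [in leRHS]mulrCA [_%:R * _]mulrC -mulrA ler_wpM2l // [leRHS]mulrC ler_pdivlMr //.
have h0 : 0 <= r - d by rewrite subr_ge0.
have h1 : r - d <= r by rewrite gerBl ltW.
apply: le_trans (power_gap (mdeg m) h0 h1).
have -> : r - (r - d) = d by ring.
apply: (@le_trans _ _ ((mdeg m).+1%:R * (r - d) ^+ mdeg m * d)); last by rewrite lerDl exprn_ge0.
rewrite ler_wpM2r ?(ltW d0) // ler_wpM2r ?exprn_ge0 // ler_nat ltnS mdegE (bigD1 i) //=.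
exact: leq_addr.
Qed.

Section Cauchy.
Context (s : 'I_N) (al : cps C N).
Hypothesis Vs : V s = 1.

Let W f := vf f + al * f.

Let Wlin : lin W.
Proof. by move=> c f g; rewrite /W vf_lin mulrDr scalerDr scalerAr addrACA. Qed.

Lemma bdw_vf_step (r0 B r d M : C) f : 0 <= B -> 0 <= r0 -> (forall i, bdw (fun=> r0) B (V i)) ->
  bdw (fun=> r0) B al -> r <= r0 -> 0 < d -> d <= r ->
  bdw (fun=> r) M f -> bdw (fun=> r - d) (B * (N%:R + r0) / d * M) (W f).
Proof.
move=> B0 r00 hV ha rr0 d0 dr hf; have M0 := bdw_ge0 hf.
have rd0 : 0 <= r - d by rewrite subr_ge0.
have rdr : r - d <= r by rewrite gerBl ltW.
have sub (f' : cps C N) M' : bdw (fun=> r0) M' f' -> bdw (fun=> r - d) M' f'.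
  by apply: bdw_le => _; rewrite rd0 (le_trans rdr).
apply: (@bdw_leM _ _ _ (\sum_(i < N) B * (d^-1 * M) + B * M)); last first.
  apply: bdwD => //; last by apply: bdwM => //; [apply: sub|apply: bdw_le hf => _; rewrite rd0 rdr].
  by apply: bdw_sum => // i _; apply: bdwM => //; [apply: sub|apply: bdw_pderiv].
rewrite sumr_const card_ord -[(B * _) *+ N]mulr_natl.
have -> : B * (N%:R + r0) / d * M = N%:R * (B * (d^-1 * M)) + B * M * (r0 / d) by ring.
rewrite lerD2l ler_peMr ?mulr_ge0 // ler_pdivlMr // mul1r; exact: le_trans rr0.
Qed.

(** The terms [h f n] are those of [exp(- z_s W) f]. As [V s = 1], [vf] sends [z_s ^ n] to
    [n z_s ^ (n - 1)], so that [W] of a partial sum telescopes to a single term of high order. *)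
Let tc n : C := (-1) ^+ n / n`!%:R.
Let h f n : cps C N := tc n *: (cvar s ^+ n * iter n W f).

Lemma vf_cvarX n : vf (cvar s ^+ n) = n%:R * cvar s ^+ n.-1.
Proof.
elim: n => [|n ih]; first by rewrite expr0 vf1 mul0r.
rewrite exprS vfM vf_cvar Vs ih mul1r; case: n ih => [|n] _; first by rewrite expr0; ring.
by rewrite -[n.+2%:R]natr1 exprS /=; ring.
Qed.

Let W_partial f n : W (\sum_(k < n.+1) h f k) = tc n *: (cvar s ^+ n * iter n.+1 W f).
Proof.
have Wh k : W (h f k) = tc k *: (k%:R * cvar s ^+ k.-1 * iter k W f + cvar s ^+ k * iter k.+1 W f).
  by rewrite (linZ _ _ Wlin) {1}/W vfM vf_cvarX iterS /W; congr (_ *: _); ring.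
elim: n => [|n ih].
  by rewrite big_ord1 Wh mul0r mul0r add0r.
rewrite big_ord_recr /= (linD _ _ Wlin) ih Wh /= scalerDr addrA.
have -> : tc n.+1 *: (n.+1%:R * cvar s ^+ n * W (iter n W f)) =
    (- tc n) *: (cvar s ^+ n * W (iter n W f)).
  rewrite -mulrA mulr_natl -scaler_nat scalerA; congr (_ *: _).
  by rewrite /tc exprS factS natrM; field; rewrite pnatr_eq0 -lt0n fact_gt0 /= addrC natr1 pnatr_eq0.
by rewrite -scalerDl subrr scale0r add0r.
Qed.

Lemma cauchy_problem f : exists u : cps C N,
  vf u + al * u = 0 /\ forall m : 'X_{1..N}, m s = 0%N -> u m = f m.
Proof.
pose fam (x : option (option 'I_N)) := match x with
  | None => f | Some None => al | Some (Some i) => V i end.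
have [r0 [B [r0p B0 hB]]] := common_radius fam.
pose K := B * (N%:R + r0); have K0 : 0 <= K by rewrite mulr_ge0 // addr_ge0 // ltW.
(* The term of index [n] will be bounded by [B * (8 K r' / r0) ^ n]; this radius makes the ratio at
   most 1/2 and is itself at most [r0 / 2]. *)
pose r' := r0 / (2 + 16 * K).
have D0 : 0 < 2 + 16 * K by rewrite ltr_wpDr // mulr_ge0.
have r'0 : 0 < r' by rewrite divr_gt0.
have r'h : r' <= r0 / 2.
  by rewrite ler_pM2l // lef_pV2 ?posrE // lerDl mulr_ge0.
have r'K : r' * (8 * K / r0) <= 2^-1.
  have -> : r' * (8 * K / r0) = (8 * K) / (2 + 16 * K).
    by rewrite /r'; field; rewrite !gt_eqF.
  rewrite ler_pdivrMr // mulrDr mulVf ?pnatr_eq0 //.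
  have -> : 2^-1 * (16 * K) = 8 * K by field.
  by rewrite lerDr.
(* The loss of radius [r0 / 2] is divided into [n] equal steps, each costing a factor
   [K / (r0 / (2 n))]. *)
have hit n k : (k <= n)%N -> (0 < n)%N ->
    bdw (fun=> r0 - k%:R * (r0 / (2 * n)%:R)) ((K / (r0 / (2 * n)%:R)) ^+ k * B) (iter k W f).
  move=> + n0; have n20 : 0 < (2 * n)%:R :> C by rewrite ltr0n muln_gt0.
  have dp : 0 < r0 / (2 * n)%:R by rewrite divr_gt0.
  elim: k => [_|k ih kn]; first by rewrite mul0r subr0 mul1r; apply: (hB None).
  have -> : r0 - k.+1%:R * (r0 / (2 * n)%:R) = r0 - k%:R * (r0 / (2 * n)%:R) - r0 / (2 * n)%:R.
    by rewrite -natr1; ring.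
  rewrite exprS -mulrA; apply: (bdw_vf_step (r0 := r0)) => //.
  - exact: ltW.
  - by move=> i; apply: (hB (Some (Some i))).
  - exact: (hB (Some None)).
  - by rewrite gerBl mulr_ge0 // ltW.
  - rewrite lerBrDl.
    have -> : k%:R * (r0 / (2 * n)%:R) + r0 / (2 * n)%:R = r0 * (k.+1%:R / (2 * n)%:R).
      by rewrite -natr1; ring.
    rewrite ger_pMr // ler_pdivrMr // mul1r ler_nat (leq_trans kn) // leq_pmull //.
  by apply: ih; apply: ltnW.
have hb n : bdw (fun=> r') (B * 2^-1 ^+ n) (h f n).
  have [->|n0] := posnP n.
    rewrite expr0 mulr1 /h /tc fact0 expr0 divr1 scale1r mul1r.
    apply: bdw_le (hB None) => _; rewrite ltW //=; apply: le_trans r'h _.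
    by rewrite ler_pdivrMr ?ltr0n // ler_peMr ?(ltW r0p) // ler1n.
  have n20 : (2 * n)%:R != 0 :> C by rewrite pnatr_eq0 -lt0n muln_gt0.
  have hn := hit n n (leqnn n) n0.
  have e : r0 - n%:R * (r0 / (2 * n)%:R) = r0 / 2.
    by rewrite natrM; field; rewrite !pnatr_eq0 -lt0n n0.
  rewrite e in hn.
  have hn' : bdw (fun=> r') ((K / (r0 / (2 * n)%:R)) ^+ n * B) (iter n W f).
    by apply: bdw_le hn => _; rewrite ltW.
  have hz : bdw (fun=> r') (r' ^+ n) (cvar s ^+ n : cps C N).
    have := @bdw_zm (fun=> r') (U_(s) *+ n)%MM (fun=> ltW r'0).
    by rewrite wt_const mdegMn mdeg1 mul1n cvarX.
  have := bdwZ (tc n) (bdwM (fun=> ltW r'0) hz hn').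
  apply: bdw_leM; rewrite mulrCA [leLHS]mulrCA [leLHS]mulrC [leRHS]mulrC.
  rewrite mulrA mulrC mulrA ler_wpM2r //.
  have f0 : 0 < n`!%:R :> C by rewrite ltr0n fact_gt0.
  have -> : `|tc n| = n`!%:R^-1.
    by rewrite /tc normrM normrX normrN1 expr1n mul1r normfV normr_nat.
  rewrite -exprMn mulrC ler_pdivrMr //.
  pose y := r' * (8 * K / r0).
  have y0 : 0 <= y by rewrite mulr_ge0 ?(ltW r'0) // divr_ge0 ?(ltW r0p) // mulr_ge0.
  have -> : r' * (K / (r0 / (2 * n)%:R)) = y * (n%:R / 4).
    by rewrite /y natrM; field; rewrite !gt_eqF ?ltr0n.
  rewrite exprMn; apply: ler_pM; rewrite ?exprn_ge0 ?divr_ge0 ?ler0n //.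
    by rewrite lerXn2r ?nnegrE ?invr_ge0 ?ler0n.
  rewrite expr_div_n ler_pdivrMr ?exprn_gt0 ?ltr0n // -!natrX -natrM ler_nat mulnC.
  exact: expn_self_le.
have hm n g : mt_ge n (tc n *: (cvar s ^+ n * g)).
  apply: mt_geZ; apply: mt_geMr; have := @mt_geX _ _ 1 (cvar s : cps C N) n.
  by rewrite mul1n; apply; apply/mt_ge1P/max_cvar.
have [u [hu _]] := formal_sum (fun=> r'0) (fun n => hm n _) hb (fun d => geometric_bound d B0).
exists u; split=> [|m ms].
  apply: mt_ge_eq0 => d; rewrite -/(W u).
  have -> : W u = W (u - \sum_(n < d.+1) h f n) + W (\sum_(n < d.+1) h f n).
    by rewrite -(linD _ _ Wlin) subrK.
  rewrite W_partial; apply: mt_geD; last exact: hm.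
  apply: mt_geD; last by apply: mt_geMl; apply: mt_ge_le (hu d.+1).
  by apply: vf_lowering; rewrite addn1.
have := hu (mdeg m).+1 m (ltnSn _); rewrite coefB => /eqP; rewrite subr_eq0 => /eqP ->.
rewrite big_ord_recl coefD coef_sum big1 ?addr0 => [|n _].
  by rewrite /h /tc fact0 expr0 divr1 scale1r mul1r.
by rewrite coefZ exprS -mulrA coef_cvarM ms eqxx mulr0.
Qed.

Lemma cauchy_unique u : vf u = 0 -> (forall m : 'X_{1..N}, m s = 0%N -> u m = 0) -> u = 0.
Proof.
move=> hu h0; suff H k (m : 'X_{1..N}) : (m s < k)%N -> u m = 0.
  by apply: cpsP => m; apply: (H (m s).+1).
elim: k m => // k ih m; rewrite ltnS leq_eqVlt => /predU1P[mk|]; last exact: ih.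
have [m0|m0] := eqVneq (m s) 0%N; first exact: h0.
pose m' := (m - U_(s))%MM; have em : m = (m' + U_(s))%MM by rewrite submK // lep1mP.
have ms' : m s = (m' s).+1 by rewrite em mnmDE mnm1E eqxx addn1.
have : vf u m' = 0 by rewrite hu.
rewrite /vf coef_sum (bigD1 s) // big1 => [|i /negPf is_]; last first.
  apply: coefM_eq0 => a c e; rewrite coef_pderiv ih ?mulr0 //.
  rewrite mnmDE mnm1E is_ addn0 -mk ms' ltnS.
  by move/mnmP: e => /(_ s); rewrite mnmDE => <-; rewrite leq_addl.
rewrite Vs mul1r coef_pderiv -em => /eqP.
by rewrite [X in X == _]addr0 mulf_eq0 pnatr_eq0 /= => /eqP.
Qed.

End Cauchy.

Lemma mp_set1 (s : 'I_N) (m : 'X_{1..N}) : (mp [set s] m == 0%MM) = (m s == 0%N).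
Proof.
apply/eqP/eqP => [/mnmP/(_ s)|h]; first by rewrite mnmE inE eqxx mnm0E.
by apply/mnmP => i; rewrite mnmE inE mnm0E; case: eqP => // ->.
Qed.

(* A series [F] with [V F = al F] is carried by the flow of [V]: pulling back
   its restriction to [z_s = 0] along the first integrals [Z] recovers it up to
   a unit. *)
Lemma flow_transport (s : 'I_N) (al F : cps C N) (Z : 'I_N -> cps C N) : V s = 1 ->
  vf F = al * F -> (forall i, vf (Z i) = 0) ->
  (forall i (m : 'X_{1..N}), m s = 0%N -> Z i m = (if i == s then 0 else cvar i) m) ->
  exists2 u : cps C N, u \is a GRing.unit & subst F Z = u * F.
Proof.
(* With [V u = - al u] the product [u * F] is a first integral, as is [subst F Z]; both agree on
   [z_s = 0], where [u = 1]. *)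
move=> Vs hF hV hZ; have [u [hu u1]] := cauchy_problem al Vs 1.
have u0 : u \is a GRing.unit by rewrite unit_cpsE u1 ?mnm0E // coef1 eqxx oner_eq0.
exists u => //; apply/eqP; rewrite -subr_eq0; apply/eqP/(cauchy_unique Vs).
  rewrite (linB _ _ vf_lin) vf_subst big1 => [|j _]; last by rewrite hV mulr0.
  have e : vf u = - (al * u) by apply/eqP; rewrite -subr_eq0 opprK hu.
  by rewrite vfM hF e; ring.
move=> m ms; rewrite coefB; apply/eqP; rewrite subr_eq0; apply/eqP.
have E (g : cps C N) : g m = sp [set s] g m by rewrite coef_sp mp_set1 ms eqxx.
rewrite E [RHS]E; congr (coef _ m).
have -> : sp [set s] (u * F) = sp [set s] F.
  rewrite spM (_ : sp _ u = 1) ?mul1r //; apply: cpsP => k; rewrite coef_sp mp_set1.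
  case: eqP => ks; first by rewrite u1.
  by rewrite coef1; case: eqP => // k0; case: ks; rewrite k0 mnm0E.
rewrite [LHS]sp_subst subst_subst [RHS]sp_subst; apply: eq_subst => i; rewrite -sp_subst.
apply: cpsP => k; rewrite coef_sp mp_set1 inE; case: eqP => ks; first exact: hZ.
case: (i =P s) => // si; rewrite cvarE coef_zm; case: (k =P U_(i)%MM) => // ki.
by case: ks; rewrite ki mnm1E; case: eqP.
Qed.

End VectorFields.

(** * Generated ideals and restriction of supports *)

Section Ideals.
Context {A : comNzRingType}.
Implicit Types (S I J : A -> Prop) (a b h : A).

Lemma ideal_gen_mem S h : S h -> ideal_gen S h.
Proof. by move=> hS; exists 1%N, (fun=> 1), (fun=> h); rewrite big_ord1 mul1r. Qed.

Lemma ideal_gen0 S : ideal_gen S 0.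
Proof. by exists 0%N, (fun=> 0), (fun=> 0); split=> [[]//|]; rewrite big_ord0. Qed.

Lemma ideal_genD S a b : ideal_gen S a -> ideal_gen S b -> ideal_gen S (a + b).
Proof.
move=> [n [c [s [hs ->]]]] [m [d [t [ht ->]]]].
exists (n + m)%N, (fun i => match split i with inl j => c j | inr j => d j end).
exists (fun i => match split i with inl j => s j | inr j => t j end); split.
  by move=> i; case: (split i).
rewrite big_split_ord /=; congr (_ + _); apply: eq_bigr => i _.
  by rewrite (unsplitK (inl i)).
by rewrite (unsplitK (inr i)).
Qed.

Lemma ideal_genM S a b : ideal_gen S b -> ideal_gen S (a * b).
Proof.
move=> [n [c [s [hs ->]]]]; exists n, (fun i => a * c i), s; split=> //.
by rewrite mulr_sumr; apply: eq_bigr => i _; rewrite mulrA.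
Qed.

Lemma ideal_genN S a : ideal_gen S a -> ideal_gen S (- a).
Proof. by rewrite -mulN1r; apply: ideal_genM. Qed.

Lemma ideal_genB S a b : ideal_gen S a -> ideal_gen S b -> ideal_gen S (a - b).
Proof. by move=> ha hb; apply: ideal_genD => //; apply: ideal_genN. Qed.

Lemma ideal_gen_sum S T (r : seq T) (P : pred T) (F : T -> A) :
  (forall i, P i -> ideal_gen S (F i)) -> ideal_gen S (\sum_(i <- r | P i) F i).
Proof. by move=> h; apply: big_ind => //; [apply: ideal_gen0|move=> a b; apply: ideal_genD]. Qed.

Lemma ideal_gen_sub S I h : (forall a, S a -> ideal_gen I a) -> ideal_gen S h -> ideal_gen I h.
Proof.
move=> hS [n [c [s [hs ->]]]]; apply: ideal_gen_sum => i _; apply: ideal_genM.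
exact: hS.
Qed.

Lemma principalP a h : principal a h <-> exists b, h = b * a.
Proof.
split=> [[n [c [s [hs ->]]]]|[b ->]]; last by apply/ideal_genM/ideal_gen_mem.
by exists (\sum_i c i); rewrite mulr_suml; apply: eq_bigr => i _; rewrite hs.
Qed.

End Ideals.

Section Mask.
Context {C : numClosedFieldType} {N : nat} (P : pred 'X_{1..N}).

Fact mask_convergent (f : cps C N) : convergent (fun m => if P m then f m else 0).
Proof.
have [r [M [r0 hM]]] := convergent_bdw (coef_convergent f).
apply: (@bdw_convergent _ _ (fun=> r) (1 * M)) => [_|] //.
apply: (@bdw_inj _ _ _ _ _ P id _ _ _ _ ler01 _ _ _ hM) => //.
  by move=> m /negPf ->.
by move=> m ->; rewrite mul1r.
Qed.
Definition mask f : cps C N := Cps (mask_convergent f).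
Lemma coef_mask f m : mask f m = if P m then f m else 0. Proof. by []. Qed.

End Mask.

Lemma mask_split {C : numClosedFieldType} {N} (P : pred 'X_{1..N}) (f : cps C N) :
  f = mask P f + mask (predC P) f.
Proof. by apply: cpsP => m; rewrite coefD !coef_mask /=; case: (P m); rewrite ?addr0 ?add0r. Qed.

Lemma cps_mulrn_eq0 {C : numClosedFieldType} {N} (f : cps C N) n :
  (f *+ n.+1 == 0) = (f == 0).
Proof.
apply/eqP/eqP => [e|->]; last by rewrite mul0rn.
apply: cpsP => m; have := congr1 (fun f : cps C N => f m) e.
have -> : f *+ n.+1 = n.+1%:R *: f by rewrite scaler_nat.
by rewrite coefZ coef0 => /eqP; rewrite mulf_eq0 pnatr_eq0 /= => /eqP.
Qed.

(** * Finiteness of the Tjurina algebra *)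

Section Jacobian.
Context {C : numClosedFieldType}.
Implicit Types (f g h : cps C 2) (a : cps C 1) (p q : {poly (cps C 1)}).

Local Notation x := (cvar ord0 : cps C 2).
Local Notation y := (cvar ord_max : cps C 2).

Lemma ord2P (P : 'I_2 -> Prop) : P ord0 -> P ord_max -> forall i, P i.
Proof.
move=> h0 h1 i; have [->//|i0] := eqVneq i ord0.
have -> // : i = ord_max.
by apply: val_inj => /=; move: i0 (ltn_ord i); rewrite -val_eqE /=; case: (val i) => [|[|]].
Qed.

Lemma sum2 (V : nmodType) (F : 'I_2 -> V) : \sum_i F i = F ord0 + F ord_max.
Proof. by rewrite big_ord_recl big_ord1; congr (_ + F _); apply: val_inj. Qed.

Definition iota a : cps C 2 := subst a (fun=> x).
Fact iota_zmod : zmod_morphism iota. Proof. by move=> a b; apply: substB. Qed.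
Fact iota_monoid : monoid_morphism iota.
Proof. by split=> [|a b]; [apply: subst1|apply: substM]. Qed.
HB.instance Definition _ := GRing.isZmodMorphism.Build (cps C 1) (cps C 2) iota iota_zmod.
HB.instance Definition _ := GRing.isMonoidMorphism.Build (cps C 1) (cps C 2) iota iota_monoid.

Definition retr f : cps C 1 := subst f (fun i => if i == ord0 then cvar ord0 else 0).

Lemma iotaK a : retr (iota a) = a.
Proof.
rewrite /retr /iota subst_subst -[RHS]subst_id; apply: eq_subst => i.
by rewrite subst_cvar ?eqxx ?ord1 //; apply: max_cvar.
Qed.

Lemma retrK f : dep [set~ ord_max] f -> iota (retr f) = f.
Proof.
move=> hf; rewrite /retr /iota subst_subst -[RHS]subst_id.
apply: eq_subst_dep hf _; apply: ord2P; last by rewrite !inE eqxx.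
by move=> _; rewrite subst_cvar //; apply: max_cvar.
Qed.

Lemma dep_iota a : dep [set~ ord_max] (iota a).
Proof.
have -> : iota a = sp [set ord_max] (iota a).
  rewrite sp_subst /iota subst_subst; apply: eq_subst => i.
  by rewrite subst_cvar inE //; apply: max_cvar.
exact: dep_sp.
Qed.

Definition pol p : cps C 2 := (map_poly iota p).[y].

Lemma polM p q : pol (p * q) = pol p * pol q.
Proof. by rewrite /pol rmorphM hornerM. Qed.
Lemma polD p q : pol (p + q) = pol p + pol q.
Proof. by rewrite /pol rmorphD hornerD. Qed.
Lemma polC a : pol a%:P = iota a.
Proof. by rewrite /pol map_polyC hornerC. Qed.
Lemma polX : pol 'X = y.
Proof. by rewrite /pol map_polyX hornerX. Qed.
Lemma pol_sum n p : (size p <= n)%N -> pol p = \sum_(j < n) iota p`_j * y ^+ j.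
Proof.
move=> hp; rewrite /pol (@horner_coef_wide _ n); last first.
  by rewrite (leq_trans (size_poly _ _)).
by apply: eq_bigr => j _; rewrite coef_map.
Qed.

Lemma pderiv_pol p : pderiv ord_max (pol p) = pol p^`().
Proof.
have hi a : pderiv ord_max (iota a) = 0.
  by rewrite chain_rule big1 // => j _; rewrite pderiv_cvar mulr0.
elim/poly_ind: p => [|p a ih]; first by rewrite deriv0 /pol rmorph0 horner0 pderiv0.
rewrite derivD derivM derivX derivC addr0 mulr1 !polD !polM polX polC pderivD hi addr0.
by rewrite pderivM pderiv_cvar eqxx ih mulr1 /=.
Qed.

(** The Weierstrass polynomial of [g] is separable because [g] is reduced. Its discriminant, a
    resultant, is then a nonzero series in [x], that is a unit times a power of [x], and it is a
    combination of the polynomial and its derivative. *)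
Lemma reduced_regular g b : (forall h n, principal g (h ^+ n) -> principal g h) ->
  (1 < b)%N -> regular ord_max b g ->
  exists n (u v : cps C 2), x ^+ n = u * g + v * pderiv ord_max g.
Proof.
move=> rad b1 reg.
have [q [r [hr e]]] := weierstrass_division reg (y ^+ b).
(* The power [y ^ b] minus its remainder: the Weierstrass polynomial, a unit times [g]. *)
pose P : {poly (cps C 1)} := 'X^b - \poly_(j < b) (if insub j is Some i then retr (r i) else 0).
have b0 : (0 < b)%N by apply: ltnW.
have sP : size P = b.+1.
  by rewrite size_polyDl size_polyXn // size_polyN ltnS size_poly.
have P0 : P != 0 by rewrite -size_poly_eq0 sP.
have PE : pol P = q * g.
  rewrite (@pol_sum b.+1) ?sP // big_ord_recr /= poly.coefB coefXn eqxx coef_poly ltnn subr0 rmorph1.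
  rewrite mul1r e addrC -[RHS]addr0 -addrA; congr (_ + _); rewrite -big_split big1 //= => j _.
  rewrite poly.coefB coefXn coef_poly ltn_ord (ltn_eqF (ltn_ord j)) sub0r valK rmorphN /= retrK //.
  by rewrite mulNr subrr.
have q0 : q \is a GRing.unit.
  rewrite unit_cpsE; have := congr1 (fun f : cps C 2 => f (U_(ord_max) *+ b)%MM) e.
  rewrite cvarX coef_zm eqxx coefD coef_sum big1 => [|j _].
    rewrite addr0 -{1}[(U_(_) *+ b)%MM]add0m coefM_single => [|k l ekl k0].
      by apply: contra_eqN => /eqP ->; rewrite mul0r oner_eq0.
    have lb : (l ord_max < b)%N.
      have /mnmP ekl' := ekl; have := ekl' ord_max; rewrite mnmDE add0m mulmnE mnm1E eqxx mul1n => <-.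
      rewrite -[X in (X < _)%N]add0n ltn_add2r lt0n; apply/eqP => km; apply: k0; apply/mnmP.
      apply: ord2P; last by rewrite km mnm0E.
      by have /eqP := ekl' ord0; rewrite mnmDE add0m mulmnE mnm1E /= mul0n addn_eq0 mnm0E => /andP[/eqP].
    have -> : l = (U_(ord_max) *+ l ord_max)%MM.
      apply/mnmP; apply: ord2P; last by rewrite mulmnE mnm1E eqxx mul1n.
      have /mnmP/(_ ord0)/eqP := ekl; rewrite mnmDE add0m !mulmnE mnm1E /= !mul0n addn_eq0.
      by move=> /andP[_ /eqP].
    by rewrite (proj1 reg) ?mulr0.
  rewrite mulrC cvarX coef_zmM; case: ifP => // _; apply: (depC1 (hr j)).
  by rewrite mnmBE !mulmnE mnm1E eqxx !mul1n -lt0n subn_gt0.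
have radP p p' : pol p ^+ 2 = pol p' * pol P -> exists z, pol p = z * pol P.
  move=> e2; have /principalP[z ->] : principal g (pol p).
    by apply: (rad _ 2%N); apply/principalP; exists (pol p' * q); rewrite e2 PE mulrA.
  by exists (z / q); rewrite PE mulrA divrK.
(* A polynomial of degree below [b] that is a multiple of [P] vanishes, by uniqueness of Weierstrass
   division. *)
have small p z : (size p < size P)%N -> pol p = z * pol P -> p = 0.
  rewrite sP ltnS => hp; rewrite PE mulrA (pol_sum hp) => e2.
  have [_ hz] := weierstrass_unique reg (fun j : 'I_b => dep_iota p`_j) (esym e2).
  apply/polyP => j; rewrite poly.coef0; have [jb|jb] := ltnP j b; last by rewrite nth_default // (leq_trans hp).
  by rewrite -[LHS]iotaK (hz (Ordinal jb)) /retr subst0.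
(* If [w * w] divides [P] up to a scalar, with cofactor [S], then [P] divides the square of [w * S],
   hence [w * S] itself by reducedness, although the degree of [w * S] is smaller. *)
have sepP : separable_poly P.
  apply/separable_polyP; split=> [u v uvP|u uP su].
    rewrite coprimep_def; apply: contraT => sg.
    pose w := gcdp u v.
    have /Pdiv.Idomain.dvdpP[[c S] /= c0 cP] : w * w %| P.
      by apply: dvdp_trans uvP; apply: dvdp_mul; [apply: dvdp_gcdl|apply: dvdp_gcdr].
    have wS0 : S * (w * w) != 0 by rewrite -cP -mul_polyC mulf_eq0 polyC_eq0 negb_or c0.
    have [S0 w0] : S != 0 /\ w != 0 by move: wS0; rewrite !mulf_eq0 !negb_or => /and3P[].
    have [z hz] : exists z, pol (w * S) = z * pol P.
      apply: (radP _ (c *: S)); rewrite expr2 -!polM; congr pol.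
      by rewrite -scalerAl [S * P]mulrC scalerAl cP; ring.
    suff : w * S = 0 by move/eqP; rewrite mulf_eq0 (negPf w0) (negPf S0).
    apply: small hz.
    have := size_scale P c0; rewrite cP => <-.
    have -> : size (w * S) = (size w + size S).-1 by apply: size_mul.
    have -> : size (S * (w * w)) = (size S + (size w + size w).-1).-1.
      by rewrite !size_mul ?mulf_neq0.
    have s1 : size w != 1%N by [].
    have s2 : (0 < size w)%N by rewrite size_poly_gt0.
    have s3 : (0 < size S)%N by rewrite size_poly_gt0.
    lia.
  apply/eqP => /polyP u'0; have := su; rewrite ltnNge => /negP[]; apply/leq_sizeP => j.
  case: j => // j _; have /eqP := u'0 j; rewrite poly.coef0 coef_deriv.
  by rewrite cps_mulrn_eq0 => /eqP.
have sP' : (1 < size P^`())%N.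
  have : P^`()`_b.-1 != 0.
    rewrite coef_deriv prednK // poly.coefB coefXn eqxx coef_poly ltnn subr0.
    by case: (b) b0 => // b' _; rewrite cps_mulrn_eq0 oner_eq0.
  apply: contraNT; rewrite -leqNgt => h; apply/eqP/nth_default; apply: leq_trans h _.
  by rewrite -ltnS prednK.
have sP1 : (1 < size P)%N by rewrite sP ltnS.
have [[u v] /= _ res] := resultant_in_ideal sP1 sP'.
have D0 : resultant P P^`() != 0.
  by move: sepP; rewrite resultant_eq0 unlock coprimep_def => /eqP ->.
have [m [Dm hm]] := lead_exists (elimN eqP D0).
set D := resultant P P^`() in res D0 Dm hm.
have mE (k : 'X_{1..1}) : k = (U_(ord0) *+ k ord0)%MM.
  by apply/mnmP => i; rewrite ord1 mulmnE mnm1E mul1n.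
have DE : D = zm m * shift m D.
  apply: shiftK => k hk; apply: hm; apply: lt_mdeg_ltmc; rewrite ltnNge; apply: contra hk.
  rewrite [m]mE [k]mE !mdegMn mdeg1 !mul1n => h; apply/mnm_lepP => i.
  by rewrite !mulmnE leq_mul2l h orbT.
have uD : shift m D \is a GRing.unit by rewrite unit_cpsE coef_shift add0m.
have xD : x ^+ m ord0 = iota D / iota (shift m D).
  rewrite {1}DE [iota (_ * _)]rmorphM mulrK ?rmorph_unit // [m in RHS]mE -cvarX.
  rewrite [RHS]rmorphXn; congr (_ ^+ _); rewrite /= /iota subst_cvar //; exact: max_cvar.
have := congr1 pol res; rewrite polC polD !polM PE -pderiv_pol PE pderivM => resE.
exists (m ord0), ((pol u * q + pol v * pderiv ord_max q) / iota (shift m D)).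
exists (pol v * q / iota (shift m D)).
by rewrite xD resE; ring.
Qed.

(** After a shear, a power of [x] lies in the ideal of [g] and its [y]-derivative, and [y ^ b] lies
    in the ideal of [g] and [x]; together they contain a power of the maximal ideal. *)
Lemma jacobian_finite f : reduced_singularity f -> exists N, forall h, mt_ge N h ->
  exists u v w, h = u * f + v * pderiv ord0 f + w * pderiv ord_max f.
Proof.
move=> [f0 f2 rad].
have fT : dep setT f by apply/depP => m i; rewrite inE.
have [c [b [cy _ reg]]] := regularize (i := ord_max) f0 fT (in_setT _).
set g := subst f (shear ord_max c) in reg.
pose c' k := - c k; have cy' : c' ord_max = 0 by rewrite /c' cy oppr0.
have gK h : subst (subst h (shear ord_max c)) (shear ord_max c') = h by apply: shearK.
have gK' h : subst (subst h (shear ord_max c')) (shear ord_max c) = h.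
  have := shearK h cy'; suff -> : (fun k => - c' k) = c by [].
  by apply/funext => k; rewrite opprK.
have radg h n : principal g (h ^+ n) -> principal g h.
  move=> /principalP[z hz]; have /principalP[z' hz'] : principal f (subst h (shear ord_max c')).
    apply: (rad _ n); apply/principalP; exists (subst z (shear ord_max c')).
    by rewrite -substX hz substM gK.
  apply/principalP; exists (subst z' (shear ord_max c)).
  by rewrite -[LHS]gK' hz' substM.
have b1 : (1 < b)%N.
  rewrite ltnNge; apply/negP => hb; case/eqP: (proj2 reg).
  by apply: (mt_ge_subst (shear ord_max c) f2); rewrite mdegMn mdeg1 mul1n ltnS.
have [n [u [v xn]]] := reduced_regular radg b1 reg.
have [vv vu va] := sp_regular reg.
have yb : exists u1 c1, y ^+ b = u1 * g + c1 * x.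
  have hx : g - sp [set~ ord_max] g = x * shift U_(ord0) (g - sp [set~ ord_max] g).
    apply: shiftK => m; rewrite lep1mP negbK => /eqP hm0; rewrite coefB coef_sp.
    suff -> : mp [set~ ord_max] m = 0%MM by rewrite eqxx subrr.
    apply/mnmP; apply: ord2P; by rewrite mnmE !inE mnm0E.
  exists vv^-1, (- (vv^-1 * shift U_(ord0) (g - sp [set~ ord_max] g))).
  rewrite mulNr -mulrA [_ * x]mulrC -hx -mulrBr opprB addrC subrK va.
  by rewrite mulrCA mulVr ?mulr1.
have [u1 [c1 hyb]] := yb.
have ybn k : exists u2, y ^+ (b * k) = u2 * g + c1 ^+ k * x ^+ k.
  elim: k => [|k [u2 ih]]; first by exists 0; rewrite muln0 !expr0; ring.
  exists (u2 * y ^+ b + c1 ^+ k * x ^+ k * u1).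
  by rewrite mulnS exprD ih {1}hyb [y ^+ b in RHS]hyb !exprS; ring.
have [u2 hyn] := ybn n.
(* A monomial of this degree is divisible by [x ^ n] or by [y ^ (b * n)]. *)
exists (n + b * n)%N => h hh.
have [a1 [a2 hg]] : exists a1 a2 : cps C 2, subst h (shear ord_max c) = a1 * g + a2 * pderiv ord_max g.
  have := mt_ge_subst (shear ord_max c) hh; move: (subst h _) => {}h {}hh.
  rewrite [h](mask_split (fun m : 'X_{1..2} => n <= m ord0)%N).
  set h1 := mask _ h; set h2 := mask _ h.
  have -> : h1 = x ^+ n * shift (U_(ord0) *+ n)%MM h1.
    rewrite cvarX; apply: shiftK => m hm; rewrite coef_mask; case: ifP => // nm.
    case/mnm_lepP: hm; apply: ord2P; rewrite mulmnE mnm1E ?eqxx ?mul1n //.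
  have -> : h2 = y ^+ (b * n) * shift (U_(ord_max) *+ (b * n))%MM h2.
    rewrite cvarX; apply: shiftK => m hm; rewrite coef_mask /=; case: ifPn => // nm.
    apply: hh; rewrite -ltnNge in nm.
    rewrite mdegE sum2 -addSn leq_add // ltnW // ltnNge; apply: contra hm => hm.
    by apply/mnm_lepP; apply: ord2P; rewrite mulmnE mnm1E ?eqxx ?mul1n //.

  rewrite hyn xn; set z1 := shift _ h1; set z2 := shift _ h2.
  exists (u * z1 + (u2 + c1 ^+ n * u) * z2), (v * z1 + c1 ^+ n * v * z2).
  ring.
have gy : pderiv ord_max g =
    c ord0 *: subst (pderiv ord0 f) (shear ord_max c) + subst (pderiv ord_max f) (shear ord_max c).
  rewrite chain_rule sum2 /shear cy scale0r addr0 pderivD pderivZ !pderiv_cvar /=.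
  by rewrite add0r mulr1 -scalerAr mulr1.
set l' := shear ord_max c' in gK.
exists (subst a1 l'), (c ord0 *: subst a2 l'), (subst a2 l').
have := congr1 (fun h => subst h l') hg; rewrite gK substD !substM gy substD substZ !gK => ->.
by rewrite -addrA; congr (_ + _); rewrite mulrDr -scalerAr -scalerAl.
Qed.

End Jacobian.

(** * Substitution of monomials *)

Section MonomialSubstitution.
Context {C : numClosedFieldType} {N K : nat} (mu : 'I_N -> 'X_{1..K}).

Definition mono (k : 'X_{1..N}) : 'X_{1..K} := (\big[+%MM/0%MM]_i (mu i *+ k i))%MM.

Hypotheses (mu0 : forall i, mu i != 0%MM) (mono_inj : injective mono).

Lemma zm_mulm n m : zm m ^+ n = zm (m *+ n)%MM :> cps C K.
Proof. by elim: n => [|n ih]; rewrite ?mulm0n ?zm0 // exprS ih mulmS zmD. Qed.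

Lemma subst_mono k : subst (zm k) (fun i => zm (mu i)) = zm (mono k) :> cps C K.
Proof.
rewrite subst_zm => [|i]; last by rewrite /max_ideal coef_zm eq_sym (negPf (mu0 i)).
under eq_bigr do rewrite zm_mulm.
by rewrite /mono (big_morph (@zm C K) (fun x y => zmD x y) zm0).
Qed.

Lemma mdeg_mono k : (mdeg k <= mdeg (mono k))%N.
Proof.
rewrite /mono mdeg_sum mdegE; apply: leq_sum => i _; rewrite mdegMn leq_pmull //.
by rewrite lt0n mdeg_eq0.
Qed.

Lemma coef_subst_sum (g : cps C N) m n : (mdeg m < n)%N ->
  subst g (fun i => zm (mu i)) m = \sum_(k : 'X_{1..N < n}) g k * (m == mono k)%:R.
Proof.
move=> mn; transitivity (subst (jet n g) (fun i => zm (mu i)) m).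
  apply/eqP; rewrite -subr_eq0 -coefB -substB; apply/eqP.
  by apply: (@mt_ge_subst _ _ _ n) => //; apply: jet_rest.
by rewrite subst_sum coef_sum; apply: eq_bigr => k _; rewrite substZ coefZ subst_mono coef_zm.
Qed.

Lemma coef_subst_mono (g : cps C N) k : subst g (fun i => zm (mu i)) (mono k) = g k.
Proof.
rewrite (coef_subst_sum _ (ltnSn _)).
have hk : (mdeg k < (mdeg (mono k)).+1)%N by rewrite ltnS mdeg_mono.
rewrite (bigD1 (BMultinom hk)) //= eqxx mulr1 big1 ?addr0 // => l /negPf nl.
case: eqP => [/mono_inj e|]; last by rewrite mulr0.
by move: nl; rewrite -val_eqE /= -e eqxx.
Qed.

Lemma coef_subst_mono0 (g : cps C N) m : (forall k, mono k <> m) ->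
  subst g (fun i => zm (mu i)) m = 0.
Proof.
move=> h; rewrite (coef_subst_sum _ (ltnSn _)) big1 // => k _.
by case: eqP => [e|]; rewrite ?mulr0 //; case: (h k).
Qed.

End MonomialSubstitution.

(** * Infinitely near points *)

Section Blowups.
Context {C : numClosedFieldType}.
Implicit Types (f g h : cps C 2) (d : direction C) (q : infinitely_near C).

Local Notation x := (cvar ord0 : cps C 2).
Local Notation y := (cvar ord_max : cps C 2).

Definition mn2 (i j : nat) : 'X_{1..2} := [multinom if k == ord0 then i else j | k < 2].

Lemma mn2_0 i j : mn2 i j ord0 = i. Proof. by rewrite mnmE. Qed.
Lemma mn2_1 i j : mn2 i j ord_max = j. Proof. by rewrite mnmE. Qed.
Lemma mn2E (m : 'X_{1..2}) : m = mn2 (m ord0) (m ord_max).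
Proof. by apply/mnmP; apply: ord2P; rewrite mnmE. Qed.
Lemma mdeg2 (m : 'X_{1..2}) : mdeg m = (m ord0 + m ord_max)%N.
Proof. by rewrite mdegE sum2. Qed.
Lemma mdeg_mn2 i j : mdeg (mn2 i j) = (i + j)%N.
Proof. by rewrite mdeg2 mn2_0 mn2_1. Qed.
Lemma mn2D i j k l : (mn2 i j + mn2 k l)%MM = mn2 (i + k) (j + l).
Proof. by apply/mnmP; apply: ord2P; rewrite mnmDE !(mn2_0, mn2_1). Qed.
Lemma U0E n : (U_(ord0) *+ n)%MM = mn2 n 0.
Proof. by apply/mnmP; apply: ord2P; rewrite mulmnE mnm1E (mn2_0, mn2_1) ?mul1n ?mul0n. Qed.
Lemma U1E n : (U_(ord_max) *+ n)%MM = mn2 0 n.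
Proof. by apply/mnmP; apply: ord2P; rewrite mulmnE mnm1E (mn2_0, mn2_1) ?mul1n ?mul0n. Qed.

(* Pull-back along (x, x y); the other charts differ from it by linear changes
   of coordinates. *)
Definition pb0 g : cps C 2 := subst g (fun i => if i == ord0 then x else x * y).
Definition shc (c : C) : 'I_2 -> cps C 2 := shear ord0 (fun k => if k == ord0 then 0 else c).
Definition sw g : cps C 2 := subst g (fun i => if i == ord0 then y else x).

Lemma max_ifc (i j : 'I_2) (P : bool) : max_ideal (if P then cvar i else cvar j : cps C 2).
Proof. by case: P; apply: max_cvar. Qed.

Lemma swK g : sw (sw g) = g.
Proof.
rewrite /sw subst_subst -[RHS]subst_id; apply: eq_subst.
by apply: ord2P; rewrite subst_cvar //=; apply: max_cvar.
Qed.

Lemma shcK c g : subst (subst g (shc c)) (shc (- c)) = g.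
Proof.
have -> : shc (- c) = shear ord0 (fun k => - (if k == ord0 then 0 else c)).
  by apply/funext; apply: ord2P; rewrite /shc /shear /= ?oppr0.
by apply: shearK; rewrite eqxx.
Qed.

Lemma pullback_slope c g : pullback (Slope c) g = pb0 (subst g (shc c)).
Proof.
have hm i : max_ideal (if i == ord0 then x else x * y : cps C 2).
  by case: ifP => _; [apply: max_cvar|apply/max_idealMl/max_cvar].
rewrite /pullback /pb0 subst_subst; apply: eq_subst => i.
rewrite /shc /shear substD substZ !subst_cvar //.
move: i; apply: ord2P => /=; first by rewrite scale0r addr0.
by rewrite mulrDr -scalerAr mulr1 addrC.
Qed.

Lemma pullback_vertical g : pullback (@Vertical C) g = sw (pb0 (sw g)).
Proof.
have hm i : max_ideal (if i == ord0 then x else x * y : cps C 2).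
  by case: ifP => _; [apply: max_cvar|apply/max_idealMl/max_cvar].
rewrite /pullback /pb0 /sw !subst_subst; apply: eq_subst; apply: ord2P => /=.
  rewrite subst_cvar; last by apply: max_ideal_subst; apply/max_idealMl/max_cvar.
  by rewrite /= substM !subst_cvar /=; [rewrite mulrC|exact: max_cvar..].
rewrite subst_cvar; last by apply: max_ideal_subst; apply: max_cvar.
by rewrite /= subst_cvar /=; [|exact: max_cvar].
Qed.

Let mu0 (i : 'I_2) : 'X_{1..2} := if i == ord0 then mn2 1 0 else mn2 1 1.

Lemma mono_mu0 (k : 'X_{1..2}) : mono mu0 k = mn2 (k ord0 + k ord_max) (k ord_max).
Proof.
rewrite /mono big_ord_recl big_ord1 /mu0 /=.
have -> : lift ord0 ord0 = ord_max :> 'I_2 by apply: val_inj.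
by apply/mnmP; apply: ord2P; rewrite mnmDE !mulmnE !(mn2_0, mn2_1) ?mul1n ?mul0n.
Qed.

Lemma coef_pb0 g (m : 'X_{1..2}) :
  pb0 g m = if (m ord_max <= m ord0)%N then g (mn2 (m ord0 - m ord_max) (m ord_max)) else 0.
Proof.
have -> : pb0 g = subst g (fun i => zm (mu0 i)).
  have e10 : mn2 1 0 = U_(ord0)%MM by rewrite -(U0E 1) mulm1n.
  apply: eq_subst; apply: ord2P; rewrite /= /mu0 /= ?e10 // cvarE cvarE -zmD; congr zm.
  by apply/mnmP; apply: ord2P; rewrite mnmDE !mnm1E (mn2_0, mn2_1).
have h0 i : mu0 i != 0%MM.
  by rewrite -mdeg_eq0 /mu0; case: (i == ord0); rewrite mdeg_mn2.
have inj : injective (mono mu0).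
  move=> k l; rewrite !mono_mu0 => /mnmP e; apply/mnmP.
  have := e ord_max; have := e ord0; rewrite !(mn2_0, mn2_1) => e0 e1.
  by apply: ord2P => //; lia.
case: ifP => hm.
  have {1}-> : m = mono mu0 (mn2 (m ord0 - m ord_max) (m ord_max)).
    by rewrite mono_mu0 !(mn2_0, mn2_1) subnK // -mn2E.
  exact: coef_subst_mono.
apply: coef_subst_mono0 => // k; rewrite mono_mu0 => e.
by move: hm; rewrite -e !(mn2_0, mn2_1) leq_addl.
Qed.

Lemma coef_sw g (m : 'X_{1..2}) : sw g m = g (mn2 (m ord_max) (m ord0)).
Proof.
pose mu (i : 'I_2) : 'X_{1..2} := if i == ord0 then mn2 0 1 else mn2 1 0.
have mE (k : 'X_{1..2}) : mono mu k = mn2 (k ord_max) (k ord0).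
  rewrite /mono big_ord_recl big_ord1 /mu /=.
  have -> : lift ord0 ord0 = ord_max :> 'I_2 by apply: val_inj.
  by apply/mnmP; apply: ord2P; rewrite mnmDE !mulmnE !(mn2_0, mn2_1) ?mul1n ?mul0n ?addn0.
have -> : sw g = subst g (fun i => zm (mu i)).
  by apply: eq_subst; apply: ord2P; rewrite /= /mu /= -?(U0E 1) -?(U1E 1) mulm1n.
have {1}-> : m = mono mu (mn2 (m ord_max) (m ord0)).
  by rewrite mE !(mn2_0, mn2_1) -mn2E.
apply: coef_subst_mono => [i|k l]; first by rewrite -mdeg_eq0 /mu; case: ifP; rewrite mdeg_mn2.
rewrite !mE => /mnmP e; apply/mnmP; have := e ord_max; have := e ord0.
by rewrite !(mn2_0, mn2_1) => e0 e1; apply: ord2P.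
Qed.

Lemma swM g h : sw (g * h) = sw g * sw h. Proof. exact: substM. Qed.
Lemma swX g n : sw (g ^+ n) = sw g ^+ n. Proof. exact: substX. Qed.
Lemma sw_x : sw x = y. Proof. by rewrite /sw subst_cvar //; apply: max_cvar. Qed.
Lemma sw_y : sw y = x. Proof. by rewrite /sw subst_cvar //; apply: max_cvar. Qed.
Lemma mt_ge_sw n g : mt_ge n (sw g) <-> mt_ge n g.
Proof. by split=> h; [rewrite -(swK g)|]; apply: mt_ge_subst. Qed.
Lemma mt_ge_shc n c g : mt_ge n (subst g (shc c)) <-> mt_ge n g.
Proof. by split=> h; [rewrite -(shcK c g)|]; apply: mt_ge_subst. Qed.
Lemma has_mt_sw n g : has_mt (sw g) n <-> has_mt g n.
Proof. by rewrite /has_mt !mt_ge_sw. Qed.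
Lemma has_mt_shc n c g : has_mt (subst g (shc c)) n <-> has_mt g n.
Proof. by rewrite /has_mt !mt_ge_shc. Qed.

(* Strict transform in the chart (x, x y) of a series of multiplicity [m]. *)
Definition st0 m g : cps C 2 := shift (mn2 m 0) (pb0 g).

Lemma coef_st0 m g (k : 'X_{1..2}) : st0 m g k =
  if (k ord_max <= k ord0 + m)%N then g (mn2 (k ord0 + m - k ord_max) (k ord_max)) else 0.
Proof. by rewrite coef_shift coef_pb0 !mnmDE !(mn2_0, mn2_1) addn0. Qed.

Lemma pb0_st0 m g : mt_ge m g -> pb0 g = x ^+ m * st0 m g.
Proof.
move=> h; rewrite cvarX U0E; apply: shiftK => k hk; rewrite coef_pb0; case: ifP => // le.
apply: h; rewrite mdeg_mn2 subnK // ltnNge; apply: contra hk => mk.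
by apply/mnm_lepP; apply: ord2P; rewrite ?mn2_0 ?mn2_1.
Qed.

(** A monomial of degree [m] of [g] turns into a power of [y] with exponent at most [m]. *)
Lemma st0_mt m g : has_mt g m -> exists2 e, (e <= m)%N & has_mt (st0 m g) e.
Proof.
move=> /has_mtP[h [k kd gk]].
have hk : st0 m g (mn2 0 (k ord_max)) != 0.
  rewrite coef_st0 !(mn2_0, mn2_1) add0n -kd mdeg2 leq_addl addnK.
  by rewrite -mn2E.
have n0 : st0 m g <> 0 by move=> e; move: hk; rewrite e coef0 eqxx.
have [e he] := has_mt_exists n0; exists e => //.
have [hle _] := he; rewrite leqNgt; apply: contra hk => me; apply/eqP; apply: hle.
by rewrite mdeg_mn2 add0n (leq_ltn_trans _ me) // -kd mdeg2 leq_addl.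
Qed.

(** The pull-back divided by the power [m] of the exceptional equation, for any [m] not above the
    multiplicity of [g]; it is the strict transform when [m] equals the multiplicity. *)
Definition strict d m g : cps C 2 :=
  match d with Slope c => st0 m (subst g (shc c)) | Vertical => sw (st0 m (sw g)) end.

Lemma pullback_strict d m g : mt_ge m g -> pullback d g = exceptional d ^+ m * strict d m g.
Proof.
case: d => [c|] h; first by rewrite pullback_slope (pb0_st0 (m := m)) ?mt_ge_shc.
rewrite pullback_vertical (pb0_st0 (m := m)); last by apply/mt_ge_sw.
by rewrite swM swX sw_x.
Qed.

Lemma strict_mt d m g : has_mt g m -> exists2 e, (e <= m)%N & has_mt (strict d m g) e.
Proof.
case: d => [c|] h /=; first by apply: st0_mt; apply/has_mt_shc.
have [e em he] := st0_mt (proj2 (has_mt_sw m g) h); exists e => //.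
by apply/has_mt_sw.
Qed.

Lemma exceptionalX_inj d m g h : exceptional d ^+ m * g = exceptional d ^+ m * h -> g = h.
Proof. by case: d => [c|] /=; rewrite cvarX; apply: zmM_inj. Qed.

Lemma has_mt_cvar (i : 'I_2) : has_mt (cvar i : cps C 2) 1.
Proof.
apply/has_mtP; split; first by apply/mt_ge1P/max_cvar.
by exists U_(i)%MM; rewrite ?mdeg1 // cvarE coef_zm eqxx oner_eq0.
Qed.

Lemma has_mt_exc d : has_mt (exceptional d) 1.
Proof. by case: d => [c|]; apply: has_mt_cvar. Qed.

Lemma has_mtX n g m : has_mt g m -> has_mt (g ^+ n) (n * m).
Proof.
move=> h; elim: n => [|n ih]; last by rewrite exprS mulSn; apply: has_mtM.
rewrite expr0; apply/has_mtP; split=> //; exists 0%MM; rewrite ?mdeg0 //.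
by rewrite coef1 eqxx oner_eq0.
Qed.

Lemma pullback_mt d g m : has_mt g m ->
  exists2 e, (m <= e <= 2 * m)%N & has_mt (pullback d g) e.
Proof.
move=> h; have [e em he] := strict_mt d h; exists (m + e)%N.
  by rewrite leq_addr mul2n -addnn leq_add2l.
rewrite (pullback_strict d (proj1 h)); apply: has_mtM => //.
by rewrite -[X in has_mt _ X]muln1; apply: has_mtX (has_mt_exc d).
Qed.

Lemma pullbackL d c g h : pullback d (c *: g + h) = c *: pullback d g + pullback d h.
Proof. by case: d => [c'|]; apply: substL. Qed.
Lemma pullbackM d g h : pullback d (g * h) = pullback d g * pullback d h.
Proof. by case: d => [c|]; apply: substM. Qed.
Lemma pullbackX d g n : pullback d (g ^+ n) = pullback d g ^+ n.
Proof. by case: d => [c|]; apply: substX. Qed.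
Lemma mt_ge_pullback d n g : mt_ge n g -> mt_ge n (pullback d g).
Proof. by case: d => [c|]; apply: mt_ge_subst. Qed.

Lemma total_rcons g q d : total_transform g (rcons q d) = pullback d (total_transform g q).
Proof. by rewrite /total_transform foldl_rcons. Qed.

Lemma totalL q c g h :
  total_transform (c *: g + h) q = c *: total_transform g q + total_transform h q.
Proof. by elim/last_ind: q => // q d ih; rewrite !total_rcons ih pullbackL. Qed.
Lemma totalM q g h : total_transform (g * h) q = total_transform g q * total_transform h q.
Proof. by elim/last_ind: q => // q d ih; rewrite !total_rcons ih pullbackM. Qed.
Lemma mt_ge_total q n g : mt_ge n g -> mt_ge n (total_transform g q).
Proof. by move=> h; elim/last_ind: q => // q d ih; rewrite total_rcons; apply: mt_ge_pullback. Qed.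

Lemma total_mt g q m : has_mt g m ->
  exists2 e, (e <= 2 ^ size q * m)%N & has_mt (total_transform g q) e.
Proof.
move=> h; elim/last_ind: q => [|q d [e em he]]; first by exists m; rewrite ?mul1n.
have [e' /andP[_ e'm] he'] := pullback_mt d he; exists e'; rewrite ?total_rcons //.
by rewrite size_rcons expnS -mulnA (leq_trans e'm) // leq_mul2l em orbT.
Qed.

Lemma reduced_transform_rconsE f q d h : reduced_transform f (rcons q d) h ->
  exists h0 m g, [/\ reduced_transform f q h0, has_mt h0 m,
    exceptional d ^+ m * g = pullback d h0 & h = exceptional d * g].
Proof.
move E : (rcons q d) => q' H; case: H E => [|p d' h0 m g H1 H2 H3]; first by case: q.
by move=> /rcons_inj[-> ->]; exists h0, m, g.
Qed.

Lemma reduced_transform_uniq f q h h' :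
  reduced_transform f q h -> reduced_transform f q h' -> h = h'.
Proof.
elim/last_ind: q h h' => [|q d ih] h h'.
  move E : [::] => q H; case: H E => [_|p d h0 m g _ _ _]; last by case: p.
  move E : [::] => q' H; case: H E => [//|p d h0 m g _ _ _]; by case: p.
move=> /reduced_transform_rconsE[h0 [m [g [H1 H2 H3 ->]]]].
move=> /reduced_transform_rconsE[h0' [m' [g' [H1' H2' H3' ->]]]].
have e := ih _ _ H1 H1'; rewrite -e in H2' H3'; have em := has_mt_uniq H2 H2'.
by rewrite -em -H3 in H3'; rewrite (exceptionalX_inj H3').
Qed.

Lemma reduced_transform_step f q d h m : reduced_transform f q h -> has_mt h m ->
  reduced_transform f (rcons q d) (exceptional d * strict d m h).
Proof.
move=> H1 H2; apply: (reduced_transform_blowup H1 H2).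
by rewrite -(pullback_strict d (proj1 H2)).
Qed.

Lemma reduced_transform_exists f q : f <> 0 ->
  exists h m, reduced_transform f q h /\ has_mt h m.
Proof.
move=> f0; elim/last_ind: q => [|q d [h [m [H1 H2]]]].
  by have [m hm] := has_mt_exists f0; exists f, m; split=> //; apply: reduced_transform_root.
have [e _ he] := strict_mt d H2.
exists (exceptional d * strict d m h), (1 + e)%N; split.
  exact: reduced_transform_step.
by apply: has_mtM => //; apply: has_mt_exc.
Qed.

Lemma essential_tree_rconsE f q d : essential_tree f (rcons q d) ->
  essential_tree f q /\ exists h, [/\ reduced_transform f (rcons q d) h, mt_ge 2 h & ~ node h].
Proof.
move E : (rcons q d) => q' H; case: H E => [|p d' h H1 H2 H3 H4]; first by case: q.
by move=> /rcons_inj[-> _]; split=> //; exists h.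
Qed.

Lemma reduced_transform_step_eq f q d h h' m : reduced_transform f q h -> has_mt h m ->
  reduced_transform f (rcons q d) h' -> h' = exceptional d * strict d m h.
Proof. by move=> H1 H2 H3; apply: reduced_transform_uniq H3 _; apply: reduced_transform_step. Qed.

End Blowups.

(** * The Tjurina ideal along chains of blow-ups *)

Section TreeChains.
Context {C : numClosedFieldType}.
Implicit Types (f g h e : cps C 2) (d : direction C) (q : infinitely_near C).

Local Notation x := (cvar ord0 : cps C 2).
Local Notation y := (cvar ord_max : cps C 2).

(** Membership in the Tjurina ideal of [g]; in [jlog] the [x]-derivative is logarithmic along the
    exceptional curve [x = 0]. *)
Definition jac g e := exists a b c : cps C 2, e = a * g + b * pderiv ord0 g + c * pderiv ord_max g.
Definition jlog g e := exists a b c : cps C 2,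
  e = a * g + b * (x * pderiv ord0 g) + c * pderiv ord_max g.

Lemma jacM g e z : jac g e -> jac g (z * e).
Proof. by move=> [a [b [c ->]]]; exists (z * a), (z * b), (z * c); ring. Qed.

Lemma jac_sw g e : jac g e -> jac (sw g) (sw e).
Proof.
have d0 : pderiv ord0 (sw g) = sw (pderiv ord_max g).
  by rewrite /sw chain_rule sum2 !pderiv_cvar /= mulr0 mulr1 add0r.
have d1 : pderiv ord_max (sw g) = sw (pderiv ord0 g).
  by rewrite /sw chain_rule sum2 !pderiv_cvar /= mulr0 mulr1 addr0.
move=> [a [b [c ->]]]; exists (sw a), (sw c), (sw b); rewrite d0 d1.
by rewrite /sw !substD !substM; ring.
Qed.

Lemma pderiv_exceptional_mul m (i : 'I_2) (z g : cps C 2) :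
  jac g (pderiv i (z ^+ m * g)) .
Proof.
exists (pderiv i (z ^+ m)), (if i == ord0 then z ^+ m else 0), (if i == ord0 then 0 else z ^+ m).
rewrite pderivM; move: i; apply: ord2P => /=; ring.
Qed.

Lemma pderiv_slope (c : C) g :
  (pderiv ord0 (pullback (Slope c) g) =
     pullback (Slope c) (pderiv ord0 g) + pullback (Slope c) (pderiv ord_max g) * (c%:A + y)) *
  (pderiv ord_max (pullback (Slope c) g) = pullback (Slope c) (pderiv ord_max g) * x).
Proof.
rewrite /pullback !chain_rule !sum2 /= !pderivM !pderivD !pderivA !pderiv_cvar /=.
by split; ring.
Qed.

Lemma pderiv_vertical g :
  (pderiv ord0 (pullback (@Vertical C) g) = pullback (@Vertical C) (pderiv ord0 g) * y) *
  (pderiv ord_max (pullback (@Vertical C) g) =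
     pullback (@Vertical C) (pderiv ord0 g) * x + pullback (@Vertical C) (pderiv ord_max g)).
Proof.
rewrite /pullback !chain_rule !sum2 /= !pderivM !pderiv_cvar /=.
by split; ring.
Qed.

(** By the chain rule the pulled-back derivatives, multiplied by the exceptional equation, are
    combinations of derivatives of the pull-back, and the latter is a multiple of the strict
    transform. *)
Lemma jac_strict d m g e : mt_ge m g -> jac g e ->
  jac (strict d m g) (exceptional d * pullback d e).
Proof.
move=> hm [a [b [c ->]]].
have jD e1 e2 : jac (strict d m g) e1 -> jac (strict d m g) e2 -> jac (strict d m g) (e1 + e2).
  by move=> [a1 [b1 [c1 ->]]] [a2 [b2 [c2 ->]]]; exists (a1 + a2), (b1 + b2), (c1 + c2); ring.
have hg : jac (strict d m g) (pullback d g).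
  by rewrite (pullback_strict d hm); exists (exceptional d ^+ m), 0, 0; ring.
have hp i : jac (strict d m g) (pderiv i (pullback d g)).
  by rewrite (pullback_strict d hm); apply: pderiv_exceptional_mul.
have h0 : jac (strict d m g) (exceptional d * pullback d (pderiv ord0 g)).
  case: d jD hg hp => [c'|] jD hg hp.
    have -> : exceptional (Slope c') * pullback (Slope c') (pderiv ord0 g) =
        x * pderiv ord0 (pullback (Slope c') g) + (- (c'%:A + y)) * pderiv ord_max (pullback (Slope c') g).
      by rewrite !pderiv_slope /=; ring.
    by apply: jD; apply: jacM.
  have -> : exceptional (@Vertical C) * pullback (@Vertical C) (pderiv ord0 g) =
      pderiv ord0 (pullback (@Vertical C) g) by rewrite !pderiv_vertical mulrC.
  exact: hp.
have h1 : jac (strict d m g) (exceptional d * pullback d (pderiv ord_max g)).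
  case: d jD hg hp {h0} => [c'|] jD hg hp.
    have -> : exceptional (Slope c') * pullback (Slope c') (pderiv ord_max g) =
        pderiv ord_max (pullback (Slope c') g) by rewrite !pderiv_slope mulrC.
    exact: hp.
  have -> : exceptional (@Vertical C) * pullback (@Vertical C) (pderiv ord_max g) =
      y * pderiv ord_max (pullback (@Vertical C) g) + (- x) * pderiv ord0 (pullback (@Vertical C) g).
    by rewrite !pderiv_vertical /=; ring.
  by apply: jD; apply: jacM.
have pD u v : pullback d (u + v) = pullback d u + pullback d v.
  by have := pullbackL d 1 u v; rewrite !scale1r.
rewrite !pD !pullbackM !mulrDr; apply: (jD); first apply: (jD).
- by rewrite mulrA; apply: jacM.
- by rewrite mulrCA; apply: jacM.
- by rewrite mulrCA; apply: jacM.
Qed.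

(** The chain rule costs one factor [x], while the pull-back of [g] contains [x ^ m]. A logarithmic
    derivative keeps this factor, so it can be cancelled; the exponent becomes [k + 1 - m], which is
    smaller than [k] as [m > 1]. *)
Lemma jlog_strict (c : C) m g k : has_mt g m -> (1 < m)%N -> jlog g (x ^+ k) ->
  exists2 k', (k' < k)%N & jlog (strict (Slope c) m g) (x ^+ k').
Proof.
move=> [hm _] m1 [a [b [e hk]]]; set g' := strict _ _ _.
have pg : pullback (Slope c) g = x ^+ m * g' := pullback_strict (Slope c) hm.
have px : pullback (Slope c) x = x by rewrite /pullback subst_cvar //=; apply: max_cvar.
pose al := x * pullback (Slope c) a; pose be := x * pullback (Slope c) b.
pose ga := pullback (Slope c) e - be * (c%:A + y).
have pD u v : pullback (Slope c) (u + v) = pullback (Slope c) u + pullback (Slope c) v.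
  by have := pullbackL (Slope c) 1 u v; rewrite !scale1r.
have E : x ^+ k.+1 = x ^+ m * ((al + be * m%:R) * g' + be * (x * pderiv ord0 g') + ga * pderiv ord_max g').
  have -> : x ^+ k.+1 = x * pullback (Slope c) (x ^+ k) by rewrite pullbackX px exprS.
  rewrite hk !pD !pullbackM px.
  transitivity (al * pullback (Slope c) g + be * (x * pderiv ord0 (pullback (Slope c) g)) +
      ga * pderiv ord_max (pullback (Slope c) g)).
    by rewrite /ga /be /al !pderiv_slope; ring.
  rewrite pg !pderivM !pderivX !pderiv_cvar /=.
  by case: (m) m1 => // m' _; rewrite /= exprS; ring.
(* If [m] exceeded [k + 1], cancelling [x ^ (k + 1)] would put 1 into the maximal ideal. *)
have [km|km] := ltnP k.+1 m.
  have : x ^+ k.+1 * 1 = x ^+ k.+1 * (x ^+ (m - k.+1) * ((al + be * m%:R) * g' + be * (x * pderiv ord0 g') + ga * pderiv ord_max g')).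
    by rewrite mulr1 [RHS]mulrA -exprD subnKC // ltnW.
  rewrite cvarX => /zmM_inj /(congr1 (fun f : cps C 2 => f 0%MM)).
  rewrite coefM0 coefX0 max_cvar expr0n subn_eq0 leqNgt km mul0r coef1 eqxx => /eqP.
  by rewrite oner_eq0.
exists (k.+1 - m)%N; first by lia.
exists (al + be * m%:R), be, ga.
have : x ^+ m * x ^+ (k.+1 - m) = x ^+ m * ((al + be * m%:R) * g' + be * (x * pderiv ord0 g') + ga * pderiv ord_max g').
  by rewrite -exprD subnKC.
by rewrite [x ^+ m]cvarX => /zmM_inj.
Qed.

Lemma node_sw h : node (sw h) -> node h.
Proof.
move=> [u [v [hu hv D E]]]; exists (sw u), (sw v); split; try exact: max_ideal_subst.
  rewrite !coef_sw !mnm1E /= -!(U0E 1) -!(U1E 1) !mulm1n.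
  by rewrite -[X in X != 0]opprK oppr_eq0 opprB.
by rewrite -(swK h) E swM.
Qed.

Lemma coefM_linear (u v : cps C 2) (i : 'I_2) : max_ideal v ->
  (u * v) U_(i)%MM = u 0%MM * v U_(i)%MM.
Proof.
move=> hv; rewrite -[in LHS](add0m U_(i)%MM); apply: coefM_single => k l e k0.
have [l0|l0] := eqVneq l 0%MM; first by rewrite l0 hv mulr0.
have := congr1 (@mdeg 2) e; rewrite !mdegD mdeg0 mdeg1 => D.
have : (0 < mdeg k)%N by rewrite lt0n mdeg_eq0; apply/eqP.
have : (0 < mdeg l)%N by rewrite lt0n mdeg_eq0.
lia.
Qed.

Lemma node_xM (u : cps C 2) : max_ideal u -> u U_(ord_max)%MM != 0 -> node (x * u).
Proof.
move=> hu u1; exists x, u; split=> //; first exact: max_cvar.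
by rewrite cvarE !coef_zm eqxx mul1r eq_mnm1 /= mul0r subr0.
Qed.

(* Along such a chain some [x ^ k] stays in the ideal generated by [g n], its
   logarithmic [x]-derivative and its [y]-derivative, and [k] decreases. *)
Lemma no_slope_chain mu (g h v : nat -> cps C 2) (c : nat -> C) (e : nat -> bool) :
  (0 < mu)%N -> (forall n, has_mt (g n) mu) ->
  (forall n, g n.+1 = strict (Slope (c n)) mu (g n)) ->
  (forall n, v n \is a GRing.unit) -> (forall n, h n = v n * x * y ^+ e n * g n) ->
  (forall n, ~ node (h n)) -> (forall n, e n.+1 = e n && (c n == 0)) ->
  (forall n, g n (mn2 0 mu) != 0) -> (e 0%N -> exists i, g 0%N (mn2 i 0) != 0) ->
  (exists a b, (~~ e 0%N -> b = 0%N) /\ jac (g 0%N) (x ^+ a * y ^+ b)) -> False.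
Proof.
move=> mu0 hg hS hv hh hn he gy gx hj.
have hJ n : exists a b, (~~ e n -> b = 0%N) /\ jac (g n) (x ^+ a * y ^+ b).
  elim: n => // n [a [b [hb hab]]].
  have := jac_strict (Slope (c n)) (proj1 (hg n)) hab; rewrite -hS /= => J.
  have E : x * subst (x ^+ a * y ^+ b) (fun i : 'I_2 => if i == ord0 then x else x * ((c n)%:A + y)) =
      x ^+ (a + b).+1 * ((c n)%:A + y) ^+ b.
    rewrite substM !substX !subst_cvar /=; [|exact/max_idealMr/max_cvar|exact: max_cvar].
    by rewrite exprMn exprS exprD; ring.
  rewrite {}E in J; have [c0|c0] := eqVneq (c n) 0.
    by exists (a + b).+1, b; rewrite he c0 eqxx andbT; split=> //; rewrite c0 scale0r add0r in J.
  exists (a + b).+1, 0%N; split=> //; rewrite expr0 mulr1.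
  have u : (c n)%:A + y \is a GRing.unit.
    by rewrite unit_cpsE coefD coefA eqxx max_cvar addr0.
  have := jacM ((((c n)%:A + y) ^+ b)^-1) J; rewrite mulrCA mulVr ?mulr1 //.
  exact: unitrX.
(* If the component [y = 0] never disappears, all directions are 0. Each blow-up then lowers the
   exponents of the pure powers of [x] in [g] by [mu], until one of them is below the
   multiplicity. *)
have [[n en]|alle] := pselect (exists n, e n = false); last first.
  have e1 n : e n = true by case E : (e n) => //; case: alle; exists n.
  have c0 n : c n = 0 by have := e1 n.+1; rewrite he => /andP[_ /eqP].
  have [i hi] := gx (e1 0%N).
  have id0 f : subst f (shc 0) = f.
    rewrite -[RHS]subst_id; apply: eq_subst; apply: ord2P; rewrite /shc /shear /= scale0r addr0 //.
  have hk n j : g n (mn2 j 0) = g 0%N (mn2 (j + n * mu) 0).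
    elim: n j => [|n ih] j; first by rewrite mul0n addn0.
    by rewrite hS /strict c0 id0 coef_st0 !(mn2_0, mn2_1) /= subn0 ih; congr (g 0%N (mn2 _ 0)); lia.
  have := hk (i %/ mu)%N (i %% mu)%N; rewrite addnC -divn_eq => E.
  move: hi; rewrite -E (proj1 (hg _)) ?eqxx // mdeg_mn2 addn0 ltn_mod //.
have en' k : e (n + k)%N = false.
  by elim: k => [|k ih]; rewrite ?addn0 // addnS he ih.
(* For [mu = 1] the strict transform is smooth and transversal to the only exceptional curve
   [x = 0], which makes the point a node. *)
have [mu1|mu1] := leqP mu 1.
  have mu1' : mu = 1%N by apply/eqP; rewrite eqn_leq mu1.
  apply: (hn n); rewrite hh en expr0 mulr1 [v n * x]mulrC -mulrA; apply: node_xM.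
    by apply: max_idealMl; apply/mt_ge1P; apply: mt_ge_le mu0 (proj1 (hg n)).
  rewrite coefM_linear; last by apply/mt_ge1P; apply: mt_ge_le mu0 (proj1 (hg n)).
  apply: mulf_neq0; first by rewrite -unit_cpsE hv.
  by have := gy n; rewrite mu1' -(U1E 1) mulm1n.
have [a [b [hb [a1 [b1 [c1 E]]]]]] := hJ n; rewrite hb ?en // expr0 mulr1 in E.
have J0 : jlog (g n) (x ^+ a.+1).
  by exists (x * a1), b1, (x * c1); rewrite exprS E; ring.
suff H k l : jlog (g (n + l)%N) (x ^+ k) -> False by apply: (H a.+1 0%N); rewrite addn0.
elim/ltn_ind: k l => k ih l hl.
have [k' k'k J] := jlog_strict (c (n + l)%N) (hg _) mu1 hl.
by apply: (ih k' k'k l.+1); rewrite addnS hS.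
Qed.

Definition mtf g : nat := if pselect (exists m, has_mt g m) is left p then sval (cid p) else 0%N.

Lemma has_mt_mtf g : g <> 0 -> has_mt g (mtf g).
Proof.
by move/has_mt_exists => h; rewrite /mtf; case: pselect => // p; case: cid.
Qed.

Lemma coef_shc_row (c : C) h m :
  subst h (shc c) (mn2 m 0) = \sum_(j < m.+1) h (mn2 (m - j) j) * c ^+ j.
Proof.
have sx : subst x (shc c) = x :> cps C 2.
  by rewrite subst_cvar; [rewrite /shc /shear /= scale0r addr0|exact: max_shear].
have sy : subst y (shc c) = y + c *: x :> cps C 2 by rewrite subst_cvar //; apply: max_shear.
have cxy b n : ((y + c *: x) ^+ b) (mn2 n 0) = (n == b)%:R * c ^+ b.
  elim: b n => [|b ih] n.
    rewrite !expr0 mulr1 coef1; congr (nat_of_bool _)%:R.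
    by apply/eqP/eqP => [/mnmP/(_ ord0)|->]; rewrite ?mn2_0 ?mnm0E // -(U0E 0).
  rewrite exprS mulrDl coefD -scalerAl coefZ !coef_cvarM mn2_0 mn2_1 eqxx add0r.
  case: n => [|n]; rewrite ?mulr0 ?mul0r //=.
  have -> : (mn2 n.+1 0 - U_(ord0) = mn2 n 0)%MM.
    by apply/mnmP; apply: ord2P; rewrite mnmBE mnm1E !(mn2_0, mn2_1) ?subn1.
  by rewrite ih eqSS exprS mulrCA.
have cm k : subst (zm k) (shc c) (mn2 m 0) = (m == mdeg k)%:R * c ^+ k ord_max.
  rewrite zm_prod big_ord_recl big_ord1 (_ : lift ord0 ord0 = ord_max); last exact: val_inj.
  rewrite substM !substX sx sy cvarX coef_zmM U0E.
  have [km|km] := leqP (k ord0) m; last first.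
    rewrite ifF; last first.
      by apply/negP => /mnm_lepP/(_ ord0); rewrite !mn2_0 leqNgt km.
    by rewrite mdeg2; case: eqP => [e|]; rewrite ?mul0r //; lia.
  rewrite ifT; last by apply/mnm_lepP; apply: ord2P; rewrite ?mn2_0 ?mn2_1.
  have -> : (mn2 m 0 - mn2 (k ord0) 0 = mn2 (m - k ord0) 0)%MM.
    by apply/mnmP; apply: ord2P; rewrite mnmBE !(mn2_0, mn2_1) ?subnn.
  rewrite cxy mdeg2; congr (_ * _); congr (nat_of_bool _)%:R.
  by apply/eqP/eqP => [<-|->]; rewrite ?addKn // subnKC.
transitivity (subst (jet m.+1 h) (shc c) (mn2 m 0)).
  apply/eqP; rewrite -subr_eq0 -coefB -substB; apply/eqP.
  apply: (@mt_ge_subst _ _ _ m.+1); [exact: jet_rest|by rewrite mdeg_mn2 addn0].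
rewrite subst_sum coef_sum.
under eq_bigr do rewrite substZ coefZ cm mulrCA.
under eq_bigr => k _ do rewrite mulr_natl mulrb.
rewrite -big_mkcond /=.
pose F (j : 'I_m.+1) : 'X_{1..2 < m.+1} := BMultinom (n := 2) (bmnm := mn2 (m - j) j) (bound := m.+1)
  (eq_ind_r (fun z => z < m.+1)%N (ltnSn m) (etrans (mdeg_mn2 (m - j) j) (subnK (ltn_ord j : (j <= m)%N)))).
rewrite (reindex_onto F (fun k : 'X_{1..2 < m.+1} => inord (bmnm k ord_max))) /=; last first.
  move=> k /eqP km; apply: val_inj => /=; apply/mnmP.
  have hk : (bmnm k ord_max <= m)%N by have := mdeg2 (bmnm k); lia.
  by apply: ord2P; rewrite ?mn2_0 ?mn2_1 inordK //; have := mdeg2 (bmnm k); lia.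
apply: eq_big => [j|j _]; last by rewrite mn2_1.
apply/andP; split; apply/eqP; first by rewrite mdeg_mn2 subnK // -ltnS ltn_ord.
by rewrite mn2_1 inord_val.
Qed.

(** The strict transform passes through the direction [c] only if the tangent cone vanishes at
    [(1, c)]. In the variable [c] this is a nonzero polynomial; the vertical direction is added in
    any case. *)
Lemma finitely_many_directions h m : has_mt h m -> exists s : seq (direction C),
  forall d, max_ideal (strict d m h) -> List.In d s.
Proof.
move=> /has_mtP[hm [k kd hk]].
pose p : {poly C} := \poly_(j < m.+1) h (mn2 (m - j) j).
have p0 : p != 0.
  apply: contraNneq hk => /(congr1 (fun p : {poly C} => p`_(k ord_max))).
  have kd' := kd; rewrite mdeg2 in kd'.
  rewrite coef_poly poly.coef0 ifT; last by rewrite ltnS -kd' leq_addl.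
  by rewrite -kd' addnK -mn2E => ->.
have [r pr] := closed_field_poly_normal p.
exists (@Vertical C :: map (@Slope C) r) => -[c|] hd; [right|by left].
suff : c \in r.
  elim: (r) => //= a l ih; rewrite inE => /predU1P[->|/ih]; [by left|by right].
have e : st0 m (subst h (shc c)) 0%MM = 0 by exact: hd.
have : root p c.
  rewrite coef_st0 !mnm0E leq0n add0n subn0 coef_shc_row in e.
  by rewrite /root horner_poly e.
by rewrite pr rootZ ?lead_coef_eq0 // root_prod_XsubC.
Qed.

End TreeChains.

(** * Bounded height of the essential tree *)

Section TreeBound.
Context {C : numClosedFieldType}.
Implicit Types (f g h e : cps C 2) (d : direction C) (q : infinitely_near C).

Local Notation x := (cvar ord0 : cps C 2).
Local Notation y := (cvar ord_max : cps C 2).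

Lemma shc0 g : subst g (shc 0) = g.
Proof.
by rewrite -[RHS]subst_id; apply: eq_subst; apply: ord2P; rewrite /shc /shear /= scale0r addr0.
Qed.

Lemma strict_vertical m g : strict (@Vertical C) m g = sw (strict (Slope 0) m (sw g)).
Proof. by rewrite /strict shc0. Qed.

Lemma strict_slope_contact (c : C) m g : has_mt g m ->
  exists2 j, (j <= m)%N & strict (Slope c) m g (mn2 0 j) != 0.
Proof.
move=> h; have /has_mtP[_ [k kd hk]] := proj2 (has_mt_shc m c g) h.
have k1 : (k ord_max <= m)%N by rewrite -kd mdeg2 leq_addl.
exists (k ord_max) => //; rewrite /strict coef_st0 !(mn2_0, mn2_1) add0n k1.
by rewrite (_ : (m - k ord_max)%N = k ord0) -?mn2E // -kd mdeg2 addnK.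
Qed.

Lemma strict_slope0_row m g i : mt_ge m g -> g (mn2 i 0) != 0 ->
  (m <= i)%N /\ strict (Slope 0) m g (mn2 (i - m) 0) != 0.
Proof.
move=> h gi; have mi : (m <= i)%N.
  by rewrite leqNgt; apply: contra gi => im; rewrite h // mdeg_mn2 addn0.
by split=> //; rewrite /strict shc0 coef_st0 !(mn2_0, mn2_1) leq0n subn0 subnK.
Qed.

(** The flags tell whether the curves [x = 0] and [y = 0] of the chart are exceptional curves
    through the point. *)
Definition stage : Type := (bool * bool)%type.
Definition next (d : direction C) (s : stage) : stage :=
  match d with
  | Slope c => (true, s.2 && (c == 0))
  | Vertical => (s.1, true)
  end.

Lemma pullback_unit d (v : cps C 2) : v \is a GRing.unit -> pullback d v \is a GRing.unit.
Proof. by rewrite !unit_cpsE; case: d => [c|]; rewrite /pullback coef_subst0. Qed.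

(** The reduced total transform keeps the shape unit, exceptional axes, strict transform. A
    direction of slope [c != 0] leaves the curve [y = 0], whose pull-back contributes the unit
    [c + y]. *)
Lemma next_stage d v s g m : v \is a GRing.unit -> has_mt g m ->
  let h := v * x ^+ (s : stage).1 * y ^+ s.2 * g in
  exists M v', [/\ has_mt h M, v' \is a GRing.unit &
    exceptional d * strict d M h =
      v' * x ^+ (next d s).1 * y ^+ (next d s).2 * strict d m g].
Proof.
move=> hv hg h.
have hv0 : has_mt v 0.
  by apply/has_mtP; split=> //; exists 0%MM; rewrite ?mdeg0 // -unit_cpsE.
have hh : has_mt h (0 + s.1 * 1 + s.2 * 1 + m).
  by apply: (has_mtM (has_mtM (has_mtM hv0 _) _) hg); apply: has_mtX; apply: has_mt_cvar.
have pS := pullback_strict d (proj1 hh).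
exists (0 + s.1 * 1 + s.2 * 1 + m)%N.
rewrite !muln1 add0n in hh pS *.
have pE : pullback d h = pullback d v * pullback d x ^+ s.1 * pullback d y ^+ s.2 *
    (exceptional d ^+ m * strict d m g).
  by rewrite /h !pullbackM !pullbackX -(pullback_strict d (proj1 hg)).
case: d pS pE => [c|] pS pE.
  have px : pullback (Slope c) x = x by rewrite /= subst_cvar //; apply: max_cvar.
  have py : pullback (Slope c) y = x * (c%:A + y).
    by rewrite /= subst_cvar //; apply: max_idealMr; apply: max_cvar.
  exists (if c == 0 then pullback (Slope c) v else pullback (Slope c) v * (c%:A + y) ^+ s.2).
  split=> //.
    case: ifP => c0; first exact: pullback_unit.
    rewrite unitrM pullback_unit // unitrX // unit_cpsE coefD coefA eqxx max_cvar addr0.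
    by rewrite c0.
  change (exceptional (Slope c)) with x; rewrite /next expr1 [RHS](_ : _ = x * (pullback (Slope c) v * (c%:A + y) ^+ s.2 * strict (Slope c) m g)).
    congr (_ * _); apply: (@exceptionalX_inj C (Slope c) (s.1 + s.2 + m)).
    by rewrite -pS pE px py exprMn !exprD; change (exceptional (Slope c)) with x; ring.
  case: eqP => [->|_]; last by rewrite andbF expr0; ring.
  rewrite andbT scale0r add0r; ring.
have px : pullback (@Vertical C) x = x * y.
  by rewrite /= subst_cvar //; apply: max_idealMr; apply: max_cvar.
have py : pullback (@Vertical C) y = y by rewrite /= subst_cvar //; apply: max_cvar.
exists (pullback (@Vertical C) v); split=> //; first exact: pullback_unit.
rewrite [LHS](_ : _ = y * (pullback (@Vertical C) v * x ^+ s.1 * strict (@Vertical C) m g)).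
  by change (exceptional (@Vertical C)) with y; rewrite /next expr1; ring.
congr (_ * _); apply: (@exceptionalX_inj C (@Vertical C) (s.1 + s.2 + m)).
by rewrite -pS pE px py exprMn !exprD; change (exceptional (@Vertical C)) with y; ring.
Qed.

Lemma jac_next d (s : stage) g m : mt_ge m g ->
  (exists a b, [/\ ~~ s.1 -> a = 0%N, ~~ s.2 -> b = 0%N & jac g (x ^+ a * y ^+ b)]) ->
  exists a b, [/\ ~~ (next d s).1 -> a = 0%N, ~~ (next d s).2 -> b = 0%N &
    jac (strict d m g) (x ^+ a * y ^+ b)].
Proof.
move=> hm [a [b [ha hb hab]]]; have := jac_strict d hm hab.
rewrite pullbackM !pullbackX; case: d => [c|].
  have -> : pullback (Slope c) x = x by rewrite /= subst_cvar //; apply: max_cvar.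
  have -> : pullback (Slope c) y = x * (c%:A + y).
    by rewrite /= subst_cvar //; apply: max_idealMr; apply: max_cvar.
  move=> J; have {}J : jac (strict (Slope c) m g) (x ^+ (a + b).+1 * (c%:A + y) ^+ b).
    move: J; congr (jac _ _); change (exceptional (Slope c)) with x.
    by rewrite exprMn exprS exprD; ring.
  have [c0|c0] := eqVneq c 0.
    exists (a + b).+1, b; rewrite /= c0 eqxx andbT; split=> //.
    by rewrite c0 scale0r add0r in J.
  exists (a + b).+1, 0%N; split=> //; rewrite expr0 mulr1.
  have u : c%:A + y \is a GRing.unit by rewrite unit_cpsE coefD coefA eqxx max_cvar addr0.
  have := jacM (((c%:A + y) ^+ b)^-1) J; rewrite mulrCA mulVr ?mulr1 //.
  exact: unitrX.
have -> : pullback (@Vertical C) x = x * y.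
  by rewrite /= subst_cvar //; apply: max_idealMr; apply: max_cvar.
have -> : pullback (@Vertical C) y = y by rewrite /= subst_cvar //; apply: max_cvar.
move=> J; exists a, (a + b).+1; split=> //.
move: J; congr (jac _ _); change (exceptional (@Vertical C)) with y.
by rewrite exprMn exprS exprD; ring.
Qed.

(* By Koenig's lemma an unbounded tree has an infinite branch; the multiplicity
   of the strict transforms along it is eventually constant, and the branch
   eventually follows a smooth curve. *)
Theorem essential_tree_bounded f : reduced_singularity f ->
  exists B, forall q, essential_tree f q -> (size q <= B)%N.
Proof.
move=> hf; have [f0 f2 _] := hf; apply: contrapT => nb.
pose unb q := essential_tree f q /\
  forall B, exists r, (B <= size r)%N /\ essential_tree f (q ++ r).
have u0 : unb [::].
  split=> [|B]; first exact: essential_tree_root.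
  apply: contrapT => h; apply: nb; exists B => q hq; rewrite leqNgt; apply/negP => Bq.
  by apply: h; exists q; split => //; apply: ltnW.
have pre q r : essential_tree f (q ++ r) -> essential_tree f q.
  elim/last_ind: r => [|r d ih]; rewrite ?cats0 // -rcons_cat.
  by move=> /essential_tree_rconsE[/ih].
have step q : exists d, unb q -> unb (rcons q d).
  have [uq|] := pselect (unb q); last by exists (@Vertical C).
  have [hq hB] := uq; apply: contrapT => hn.
  have nd d : exists B, forall r, essential_tree f (rcons q d ++ r) -> (size r <= B)%N.
    apply: contrapT => hd; apply: hn; exists d => _.
    have key B : exists r, (B <= size r)%N /\ essential_tree f (rcons q d ++ r).
      apply: contrapT => h; apply: hd; exists B => r hr; rewrite leqNgt; apply/negP => Br.
      by apply: h; exists r; split => //; apply: ltnW.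
    by split=> //; have [r [_ /pre]] := key 0%N.
  have [h [m [H1 H2]]] := reduced_transform_exists q f0.
  (* A successor in the tree has multiplicity at least 2, of which the exceptional curve accounts
     for 1; so it lies on the strict transform, and only finitely many directions occur. *)
  have [s hs] := finitely_many_directions H2.
  have [B hBs] : exists B, forall d r, List.In d s ->
      essential_tree f (rcons q d ++ r) -> (size r <= B)%N.
    elim: s {hs} => [|d s [B ih]]; first by exists 0%N.
    have [B' h'] := nd d; exists (maxn B B') => d' r [<-|hd] hr; rewrite leq_max.
      by rewrite (h' _ hr) orbT.
    by rewrite (ih _ _ hd hr).
  have [r [Br hr]] := hB B.+2; case: r Br hr => [//|d r] Br; rewrite -cat_rcons => hr.
  have [_ [h' [H3 H4 _]]] := essential_tree_rconsE (pre _ _ hr).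
  rewrite (reduced_transform_step_eq H1 H2 H3) in H4.
  have ds : List.In d s.
    apply: hs; have [e _ he] := strict_mt d H2.
    have e2 := has_mt_le (has_mtM (has_mt_exc d) he) H4.
    by apply/mt_ge1P; apply: mt_ge_le (proj1 he).
  by have := hBs _ _ ds hr; rewrite /= in Br; lia.
have [D hD] := choice step.
pose Q n := iter n (fun q => rcons q (D q)) [::].
have QU n : unb (Q n) by elim: n => // n ih; apply: hD.
pose dn n := D (Q n).
pose fs := fix fs n := if n is n'.+1 then strict (dn n') (mtf (fs n')) (fs n') else f.
pose st := fix st n := if n is n'.+1 then next (dn n') (st n') else (false, false).
have fm n : has_mt (fs n) (mtf (fs n)).
  apply: has_mt_mtf; elim: n => // n ih.
  by have [e _ he] := strict_mt (dn n) (has_mt_mtf ih); apply: has_mt_neq0 he.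
have inv n : exists v, v \is a GRing.unit /\
    reduced_transform f (Q n) (v * x ^+ (st n).1 * y ^+ (st n).2 * fs n).
  elim: n => [|n [v [hv H]]].
    by exists 1; rewrite unitr1 /= !expr0 !mul1r; split=> //; apply: reduced_transform_root.
  have [M [v' [hM hv' E]]] := next_stage (dn n) (st n) hv (fm n).
  by exists v'; split=> //; rewrite -E; apply: reduced_transform_step.
have [vn hvn] := choice inv.
pose h n := vn n * x ^+ (st n).1 * y ^+ (st n).2 * fs n.
have bad n : mt_ge 2 (h n.+1) /\ ~ node (h n.+1).
  have [/essential_tree_rconsE[_ [h' [H' h2 hn]]] _] := QU n.+1.
  have e : h n.+1 = h' := reduced_transform_uniq (proj2 (hvn n.+1)) H'.
  by rewrite e.
have ct n : ((st n).1 -> exists j, fs n (mn2 0 j) != 0) /\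
            ((st n).2 -> exists i, fs n (mn2 i 0) != 0).
  elim: n => [|n [ih1 ih2]]; first by split.
  rewrite [fs n.+1]/= [st n.+1]/=; case E : (dn n) => [c|].
    split=> [_|]; first by have [j _ hj] := strict_slope_contact c (fm n); exists j.
    move=> /andP[/ih2[i hi] /eqP c0]; rewrite c0.
    by have [_ hi'] := strict_slope0_row (proj1 (fm n)) hi; exists (i - mtf (fs n))%N.
  have fm' := proj2 (has_mt_sw _ _) (fm n); rewrite strict_vertical; split=> [/ih1[j hj]|_].
    have hj' : sw (fs n) (mn2 j 0) != 0 by rewrite coef_sw !(mn2_0, mn2_1).
    have [_ hi'] := strict_slope0_row (proj1 fm') hj'; exists (j - mtf (fs n))%N.
    by rewrite coef_sw !(mn2_0, mn2_1).
  have [j _ hj] := strict_slope_contact 0 fm'; exists j.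
  by rewrite coef_sw !(mn2_0, mn2_1).
(* Since the Tjurina algebra is finite, powers of [x] and of [y] lie in the Tjurina ideal of [f].
   The first blow-up turns the appropriate one into a power of the exceptional equation, and
   [jac_next] carries it on. *)
have jc n : exists a b, [/\ ~~ (st n.+1).1 -> a = 0%N, ~~ (st n.+1).2 -> b = 0%N &
    jac (fs n.+1) (x ^+ a * y ^+ b)].
  elim: n => [|n ih]; last exact: jac_next (proj1 (fm _)) ih.
  have [N hN] := jacobian_finite hf.
  have jN z : mt_ge 1 z -> jac f (z ^+ N).
    move=> z1; have := @mt_geX _ _ 1 z N z1; rewrite mul1n => /hN[u [v [w ->]]].
    by exists u, v, w.
  have jx : jac f (x ^+ N * y ^+ 0) by rewrite expr0 mulr1; apply: jN; apply/mt_ge1P/max_cvar.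
  have jy : jac f (x ^+ 0 * y ^+ N) by rewrite expr0 mul1r; apply: jN; apply/mt_ge1P/max_cvar.
  rewrite [fs 1%N]/= [st 1%N]/=; case: (dn 0%N) => [c|].
    by apply: (jac_next (Slope c) (s := (true, false)) (proj1 (fm 0%N))); exists N, 0%N.
  by apply: (jac_next (@Vertical C) (s := (false, true)) (proj1 (fm 0%N))); exists 0%N, N.
have mdec n : (mtf (fs n.+1) <= mtf (fs n))%N.
  by have [e le he] := strict_mt (dn n) (fm n); rewrite (has_mt_uniq (fm n.+1) he).
have [mu [N0 hmu]] : exists mu N, forall n, mtf (fs (n + N.+1)%N) = mu.
  have ex : exists k, `[< exists n, mtf (fs n.+1) = k >].
    by exists (mtf (fs 1%N)); apply/asboolP; exists 0%N.
  case: (ex_minnP ex) => mu /asboolP[n hn] hmin; exists mu, n => k.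
  apply/eqP; rewrite eqn_leq; apply/andP; split; last first.
    by apply: hmin; apply/asboolP; exists (k + n)%N; rewrite addnS.
  by rewrite -hn; elim: k => // k ih; apply: leq_trans ih; apply: mdec.
pose N1 := N0.+1.
have fmu n : has_mt (fs (n + N1)%N) mu by rewrite -(hmu n); apply: fm.
have hv0 n : has_mt (vn n) 0.
  apply/has_mtP; split=> //; exists 0%MM; rewrite ?mdeg0 // -unit_cpsE.
  exact: (proj1 (hvn n)).
(* For multiplicity 0 the reduced total transform would consist of at most two transversal axes:
   smooth, or a node. *)
have mu0 : (0 < mu)%N.
  rewrite lt0n; apply/eqP => e0; have [h2 hn] := bad N0; apply: hn.
  have hf0 := fmu 0%N; rewrite e0 add0n in hf0.
  have hm := has_mtM (has_mtM (has_mtM (hv0 N1) (has_mtX (st N1).1 (has_mt_cvar ord0)))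
     (has_mtX (st N1).2 (has_mt_cvar ord_max))) hf0.
  have := has_mt_le hm h2; rewrite !muln1 add0n addn0 /h -/N1.
  move: (fs N1) (vn N1) hf0 (hv0 N1) => F V hF hV.
  case: (st N1) => -[] [] //= _.
  rewrite [X in node X](_ : _ = x * (V * F * y)); last by rewrite !expr1; ring.
  apply: node_xM; first exact/max_idealMl/max_cvar.
  rewrite coefM_linear; last exact: max_cvar.
  have := has_mtM hV hF; move/has_mtP => [_ [k]]; rewrite addn0.
  move=> /eqP; rewrite mdeg_eq0 => /eqP -> k0; apply: mulf_neq0 => //.
  by rewrite cvarE coef_zm eqxx oner_neq0.
have contra_row n j : fs (n + N1)%N (mn2 0 j) != 0 -> (j <= mu)%N -> fs (n + N1)%N (mn2 0 mu) != 0.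
  move=> hj le; suff -> : mu = j by [].
  apply/eqP; rewrite eqn_leq le andbT leqNgt; apply: contra hj => lt.
  by rewrite (proj1 (fmu n)) // mdeg_mn2.
have contra_col n j : fs (n + N1)%N (mn2 j 0) != 0 -> (j <= mu)%N -> fs (n + N1)%N (mn2 mu 0) != 0.
  move=> hj le; suff -> : mu = j by [].
  apply/eqP; rewrite eqn_leq le andbT leqNgt; apply: contra hj => lt.
  by rewrite (proj1 (fmu n)) // mdeg_mn2 addn0.
have fS n : fs (n.+1 + N1)%N = strict (dn (n + N1)%N) mu (fs (n + N1)%N).
  by rewrite -(hmu n).
have stS n : st (n.+1 + N1)%N = next (dn (n + N1)%N) (st (n + N1)%N) by [].
(* After a slope the strict transform contains [y ^ mu] with constant [mu], so its tangent cone is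
   not divisible by [x] and the vertical direction cannot follow: from then on all directions are
   slopes. If no slope ever occurs, exchanging the coordinates gives a chain of slopes 0. *)
have [[n [c hnc]]|allv] := pselect (exists n c, dn (n + N1)%N = Slope c).
  have all k : (exists c, dn (k + n + N1)%N = Slope c) /\ fs ((k + n).+1 + N1)%N (mn2 0 mu) != 0.
    have row k' c' : dn (k' + N1)%N = Slope c' -> fs (k'.+1 + N1)%N (mn2 0 mu) != 0.
      move=> E; have [j le hj] := strict_slope_contact c' (fmu k').
      by apply: (contra_row _ j) => //; rewrite fS E.
    elim: k => [|k [[c' hc'] ih]]; first by split; [exists c|exact: row hnc].
    have [c2 E2] : exists c, dn (k.+1 + n + N1)%N = Slope c.
      case E : (dn (k.+1 + n + N1)%N) => [c2|]; first by exists c2.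
      have hj' : sw (fs ((k + n).+1 + N1)%N) (mn2 mu 0) != 0 by rewrite coef_sw !(mn2_0, mn2_1).
      have [_] := strict_slope0_row (proj1 (proj2 (has_mt_sw _ _) (fmu (k + n).+1))) hj'.
      rewrite subnn => hi'; have := fS (k + n).+1; rewrite -[(k + n).+1]/(k.+1 + n)%N E strict_vertical.
      move=> E'; move: (proj1 (fmu (k.+1 + n).+1) 0%MM); rewrite mdeg0 => /(_ mu0).
      rewrite E' coef_sw !mnm0E => /eqP; rewrite (negPf hi') //.
    by split; [exists c2|exact: row E2].
  have [cc hcc] := choice (fun k => proj1 (all k)).
  have e1 k : st (k + n.+1 + N1)%N = (true, (st (k + n.+1 + N1)%N).2).
    by rewrite addnS stS hcc.
  have dS k : dn (k + n.+1 + N1)%N = Slope (cc k.+1) by rewrite addnS -addSn hcc.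
  apply: (@no_slope_chain C mu (fun k => fs (k + n.+1 + N1)%N) (fun k => h (k + n.+1 + N1)%N)
     (fun k => vn (k + n.+1 + N1)%N) (fun k => cc k.+1) (fun k => (st (k + n.+1 + N1)%N).2)) => //.
  - by move=> k; rewrite [(k.+1 + n.+1)%N]addSn fS dS.
  - by move=> k; apply: (proj1 (hvn _)).
  - by move=> k; rewrite /h e1.
  - by move=> k; have := proj2 (bad (k + n.+1 + N0)%N); rewrite -addnS.
  - by move=> k; rewrite [(k.+1 + n.+1)%N]addSn stS dS.
  - by move=> k; have := proj2 (all k); rewrite -addnS.
  - by move=> e0; apply: (proj2 (ct _)); apply: e0.
  - by have [a [b [_ hb J]]] := jc (n.+1 + N0)%N; exists a, b; split; rewrite /N1 addnS.
have dV n : dn (n + N1)%N = @Vertical C.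
  by case E : (dn (n + N1)%N) => [c|] //; case: allv; exists n, c.
have stE n : st (n.+1 + N1)%N = ((st N1).1, true).
  by elim: n => [|n ih]; rewrite stS dV // ih.
apply: (@no_slope_chain C mu (fun k => sw (fs (k.+1 + N1)%N)) (fun k => sw (h (k.+1 + N1)%N))
     (fun k => sw (vn (k.+1 + N1)%N)) (fun k => 0) (fun k => (st N1).1)) => //.
- by move=> k; apply/has_mt_sw.
- by move=> k; rewrite (fS k.+1) dV strict_vertical swK.
- by move=> k; have := proj1 (hvn (k.+1 + N1)%N); rewrite !unit_cpsE coef_sw !mnm0E; have -> : mn2 0 0 = 0%MM by apply/eqP; rewrite -mdeg_eq0 mdeg_mn2.
- by move=> k; rewrite /h !swM stE !swX sw_x sw_y expr1; ring.
- by move=> k /node_sw; apply: (proj2 (bad _)).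
- by move=> k; rewrite eqxx andbT.
- move=> k; rewrite coef_sw !(mn2_0, mn2_1).
  have [j le hj] := strict_slope_contact 0 (proj2 (has_mt_sw _ _) (fmu k)).
  apply: (contra_col k.+1 j) => //; rewrite fS dV strict_vertical coef_sw.
  by rewrite !(mn2_0, mn2_1).
- move=> e1; have [j hj] := proj1 (ct (1 + N1)%N) ltac:(by rewrite (stE 0%N)).
  by exists j; rewrite coef_sw !(mn2_0, mn2_1).
- have [a [b [ha _ J]]] := jc (1 + N0)%N; exists b, a; split.
    by move=> e0; apply: ha; rewrite -[(1 + N0).+1]/(0.+1 + N1)%N stE.
  by have := jac_sw J; rewrite swM !swX sw_x sw_y mulrC.
Qed.

End TreeBound.

(** * Hadamard's lemma *)

Section Hadamard.
Context {C : numClosedFieldType}.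

Lemma sp_ideal {N} (T : {set 'I_N}) (f : cps C N) : exists c : 'I_N -> cps C N,
  f - sp T f = \sum_j (j \in T)%:R * (cvar j * c j).
Proof.
have [n] := ubnP #|T|; elim: n T => // n ih T hT.
have [->|/set0Pn[j jT]] := eqVneq T set0.
  exists (fun=> 0); rewrite big1 => [|j _]; last by rewrite !mulr0.
  apply: cpsP => m; rewrite coefB coef_sp ifT ?subrr //.
  by apply/eqP/mnmP => i; rewrite !mnmE inE.
have [c hc] : exists c : 'I_N -> cps C N,
    f - sp (T :\ j) f = \sum_i (i \in T :\ j)%:R * (cvar i * c i).
  by apply: ih; rewrite (cardsD1 j) jT in hT.
have E : sp (T :\ j) f - sp T f = cvar j * shift U_(j) (sp (T :\ j) f - sp T f).
  rewrite cvarE; apply: shiftK => m hm; rewrite coefB !coef_sp.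
  have mj : m j = 0%N.
    apply/eqP; apply: contraR hm => mj; apply/mnm_lepP => i; rewrite mnm1E.
    by case: eqP => // <-; rewrite lt0n.
  suff -> : mp (T :\ j) m = mp T m by rewrite subrr.
  apply/mnmP => i; rewrite !mnmE in_setD1; have [->|] //= := eqVneq i j.
  by rewrite mj if_same.
exists (fun i => if i == j then shift U_(j) (sp (T :\ j) f - sp T f) else c i).
rewrite -(subrKA (sp (T :\ j) f)) hc {1}E [RHS](bigD1 j) //= jT mul1r eqxx addrC.
congr (_ + _); rewrite (bigD1 j) //= in_setD1 eqxx mul0r add0r.
by apply: eq_bigr => i /negPf ij; rewrite in_setD1 ij.
Qed.

(** [sp_ideal] applied to [f(u + v)], with the variables [v] to be set to zero, and then specialized
    to [u = psi], [v = phi - psi]. *)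
Lemma subst_diff {N K} (f : cps C N) (phi psi : 'I_N -> cps C K) :
  (forall i, max_ideal (phi i)) -> (forall i, max_ideal (psi i)) ->
  exists c : 'I_N -> cps C K, subst f phi - subst f psi = \sum_i c i * (phi i - psi i).
Proof.
move=> hphi hpsi.
pose G := subst f (fun i => cvar (lshift N i) + cvar (rshift N i)) : cps C (N + N).
pose T := [set k : 'I_(N + N) | ~~ split k : bool].
pose Z (k : 'I_(N + N)) := match split k with inl i => psi i | inr i => phi i - psi i end.
have ZL i : Z (lshift N i) = psi i.
  by rewrite /Z; case: splitP => k /= e; [congr psi; apply: val_inj|have := ltn_ord i; lia].
have ZR i : Z (rshift N i) = phi i - psi i.
  rewrite /Z; case: splitP => k /= e; first by have := ltn_ord k; lia.
  by have -> : i = k by apply: val_inj => /=; lia.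
have TL i : (lshift N i \in T) = false.
  by rewrite inE; case: splitP => k //= e; have := ltn_ord i; lia.
have TR i : (rshift N i \in T) = true.
  by rewrite inE; case: splitP => k //= e; have := ltn_ord k; lia.
have mZ k : max_ideal (Z k).
  rewrite /Z; case: split => i //; rewrite /max_ideal coefB hphi hpsi subrr //.
have [c E] := sp_ideal T G.
have := congr1 (fun g => subst g Z) E; rewrite substB subst_sum.
have mG i : max_ideal (cvar (lshift N i) + cvar (rshift N i) : cps C (N + N)).
  by apply: max_idealD; apply: max_cvar.
have -> : subst G Z = subst f phi.
  by rewrite subst_subst; apply: eq_subst => i; rewrite substD !subst_cvar // ZL ZR addrC subrK.
have -> : subst (sp T G) Z = subst f psi.
  have mz (k : 'I_(N + N)) : max_ideal (if k \in T then 0 else cvar k : cps C (N + N)).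
    by case: ifP => // _; apply: max_cvar.
  rewrite sp_subst !subst_subst; apply: eq_subst => i.
  have mW (k : 'I_(N + N)) : max_ideal (subst (if k \in T then 0 else cvar k) Z).
    exact: max_ideal_subst.
  rewrite substD (subst_cvar (i := lshift N i) (mW _)) (subst_cvar (i := rshift N i) (mW _)).
  by rewrite TL TR subst0 addr0 subst_cvar.
move=> ->; exists (fun i => subst (c (rshift N i)) Z); rewrite big_split_ord /= big1 ?add0r.
  by apply: eq_bigr => i _; rewrite TR mul1r substM subst_cvar // mulrC ZR.
by move=> i _; rewrite TL mul0r subst0.
Qed.

End Hadamard.

(** * Lifting coordinate changes to blow-ups *)

Section Automorphisms.
Context {C : numClosedFieldType}.
Implicit Types (f g h : cps C 2) (d : direction C) (q : infinitely_near C).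

Local Notation x := (cvar ord0 : cps C 2).
Local Notation y := (cvar ord_max : cps C 2).

Definition jacobian (P : 'I_2 -> cps C 2) : C :=
  P ord0 U_(ord0)%MM * P ord_max U_(ord_max)%MM - P ord0 U_(ord_max)%MM * P ord_max U_(ord0)%MM.

Definition automorphism (P : 'I_2 -> cps C 2) :=
  (forall i, max_ideal (P i)) /\ jacobian P != 0.

Lemma pderiv_mt_ge n g : max_ideal g -> (forall i, mt_ge n (pderiv i g)) -> mt_ge n.+1 g.
Proof.
move=> g0 h m mn; have [->|m0] := eqVneq m 0%MM; first exact: g0.
have [i mi] : exists i, m i != 0%N.
  apply/existsP; apply: contraNT m0; rewrite negb_exists => /forallP h0.
  by apply/eqP/mnmP => i; have := h0 i; rewrite negbK mnm0E => /eqP.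
have e : m = (m - U_(i) + U_(i))%MM.
  by rewrite submK //; apply/mnm_lepP => j; rewrite mnm1E; case: eqP => // <-; rewrite lt0n.
have := h i (m - U_(i))%MM; rewrite coef_pderiv -e => h1.
have : (mdeg (m - U_(i)) < n)%N.
  by move: mn; rewrite [in mdeg m]e mdegD mdeg1 addn1 ltnS.
by move=> /h1/eqP; rewrite mulf_eq0 pnatr_eq0 /= => /eqP.
Qed.

Lemma coef_pderiv0 i (P : cps C 2) : pderiv i P 0%MM = P U_(i)%MM.
Proof. by rewrite coef_pderiv add0m mnm0E mul1r. Qed.

(** By Cramer's rule the chain rule can be solved for the pull-backs of the derivatives of [g],
    because the Jacobian determinant is a unit; then the order is handled by induction. *)
Lemma mt_ge_automorphism P n g : automorphism P -> mt_ge n (subst g P) -> mt_ge n g.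
Proof.
move=> [mP dP]; elim: n g => // n ih g hg.
apply: pderiv_mt_ge.
  by rewrite /max_ideal -(coef_subst0 g P); apply: hg; rewrite mdeg0.
pose D i j := pderiv i (P j).
pose J := D ord0 ord0 * D ord_max ord_max - D ord_max ord0 * D ord0 ord_max.
have uJ : J \is a GRing.unit.
  by rewrite unit_cpsE coefB !coefM0 !coef_pderiv0.
have E i : mt_ge n (\sum_j subst (pderiv j g) P * D i j).
  by rewrite -chain_rule; apply: mt_ge_pderiv.
have := E ord0; have := E ord_max; rewrite !sum2 => E1 E0.
apply: ord2P; apply: ih.
  rewrite -[X in mt_ge _ X](mulKr uJ); apply: mt_geMl.
  rewrite [X in mt_ge _ X](_ : _ = D ord_max ord_max * (subst (pderiv ord0 g) P * D ord0 ord0 + subst (pderiv ord_max g) P * D ord0 ord_max)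
    - D ord0 ord_max * (subst (pderiv ord0 g) P * D ord_max ord0 + subst (pderiv ord_max g) P * D ord_max ord_max)); last by rewrite /J; ring.
  by apply: mt_geB; apply: mt_geMl.
rewrite -[X in mt_ge _ X](mulKr uJ); apply: mt_geMl.
rewrite [X in mt_ge _ X](_ : _ = D ord0 ord0 * (subst (pderiv ord0 g) P * D ord_max ord0 + subst (pderiv ord_max g) P * D ord_max ord_max)
  - D ord_max ord0 * (subst (pderiv ord0 g) P * D ord0 ord0 + subst (pderiv ord_max g) P * D ord0 ord_max)); last by rewrite /J; ring.
by apply: mt_geB; apply: mt_geMl.
Qed.

Lemma has_mt_automorphism P n g : automorphism P -> has_mt (subst g P) n <-> has_mt g n.
Proof.
move=> hP; split=> -[h1 h2]; split.
- exact: mt_ge_automorphism hP h1.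
- by move=> h; apply: h2; apply: mt_ge_subst.
- exact: mt_ge_subst.
- by move=> h; apply: h2; apply: mt_ge_automorphism hP h.
Qed.

Lemma coef_subst1 g (P : 'I_2 -> cps C 2) i : (forall j, max_ideal (P j)) ->
  (subst g P) U_(i)%MM = g U_(ord0)%MM * P ord0 U_(i)%MM + g U_(ord_max)%MM * P ord_max U_(i)%MM.
Proof.
move=> mP; rewrite -coef_pderiv0 chain_rule sum2 coefD !coefM0 !coef_subst0.
by rewrite !coef_pderiv0.
Qed.

Lemma automorphism_comp P Q : automorphism P -> automorphism Q ->
  automorphism (fun i => subst (P i) Q).
Proof.
move=> [mP dP] [mQ dQ]; split=> [i|]; first exact: max_ideal_subst.
rewrite /jacobian !coef_subst1 //; apply: contraNneq (mulf_neq0 dP dQ) => e.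
by apply/eqP; rewrite -[RHS]e /jacobian; ring.
Qed.

Lemma node_automorphism P h : automorphism P -> node h -> node (subst h P).
Proof.
move=> hP [u [v [hu hv D ->]]].
exists (subst u P), (subst v P); split; [exact: max_ideal_subst|exact: max_ideal_subst| |exact: substM].
have aU : automorphism (fun i => if i == ord0 then u else v).
  by split=> //; apply: ord2P.
by have [_] := automorphism_comp aU hP; rewrite /jacobian /=.
Qed.

Lemma coef_cvarU (i j : 'I_2) : (cvar i : cps C 2) U_(j)%MM = (i == j)%:R.
Proof. by rewrite cvarE coef_zm eq_mnm1 eq_sym. Qed.

Lemma cvarU2 : (x U_(ord0)%MM = 1) * (x U_(ord_max)%MM = 0) *
  (y U_(ord0)%MM = 0) * (y U_(ord_max)%MM = 1).
Proof. by rewrite !coef_cvarU. Qed.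

Lemma automorphism_sw : automorphism (fun i => if i == ord0 then y else x).
Proof.
split=> [i|]; first exact: max_ifc.
have -> : jacobian (fun i => if i == ord0 then y else x) =
    y U_(ord0)%MM * x U_(ord_max)%MM - y U_(ord_max)%MM * x U_(ord0)%MM by [].
by rewrite !cvarU2 mulr0 sub0r mulr1 oppr_eq0 oner_eq0.
Qed.

Lemma pullback_max d g : max_ideal g -> exists2 g1, pullback d g = exceptional d * g1 &
  g1 0%MM = if d is Slope c then g U_(ord0)%MM + c * g U_(ord_max)%MM else g U_(ord_max)%MM.
Proof.
move=> hg; have h1 : mt_ge 1 g by apply/mt_ge1P.
exists (strict d 1 g); first by rewrite (pullback_strict d h1) expr1.
case: d => [c|].
  rewrite /strict coef_st0 !mnm0E leq0n add0n subn0 -(U0E 1) mulm1n coef_subst1; last first.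
    by move=> j; apply: max_shear.
  have -> : shc c ord0 = x by rewrite /shc /shear /= scale0r addr0.
  have -> : shc c ord_max = y + c *: x by [].
  by rewrite coefD coefZ !cvarU2 add0r !mulr1 mulrC.
by rewrite /strict coef_sw coef_st0 !mnm0E !(mn2_0, mn2_1) leq0n add0n subn0 coef_sw !(mn2_0, mn2_1) -(U1E 1) mulm1n.
Qed.

Lemma pullback_slope_dy (c : C) g g1 : pullback (Slope c) g = x * g1 ->
  g1 U_(ord_max)%MM = g U_(ord_max)%MM.
Proof.
move=> e; have := (pderiv_slope c g).2; rewrite e pderivM pderiv_cvar mul0r add0r.
rewrite [RHS]mulrC => /cvarM_inj /(congr1 (fun f : cps C 2 => f 0%MM)).
by rewrite coef_pderiv0 /pullback coef_subst0 coef_pderiv0.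
Qed.

Lemma pullback_automorphism_slope P (c : C) : automorphism P ->
  P ord0 U_(ord0)%MM + c * P ord0 U_(ord_max)%MM != 0 ->
  exists (c' : C) Q v, [/\ automorphism Q, v \is a GRing.unit,
    forall g, pullback (Slope c) (subst g P) = subst (pullback (Slope c') g) Q &
    Q ord0 = v * x].
Proof.
move=> [mP dP] hc.
have [P1 eP P10] := pullback_max (Slope c) (mP ord0).
have [Q1 eQ Q10] := pullback_max (Slope c) (mP ord_max).
rewrite -P10 in hc.
have uP : P1 \is a GRing.unit by rewrite unit_cpsE.
set c' := Q1 0%MM / P1 0%MM.
pose Q (i : 'I_2) := if i == ord0 then P1 * x else Q1 / P1 - c'%:A.
have mQ i : max_ideal (Q i).
  move: i; apply: ord2P; rewrite /Q /=; first exact/max_idealMl/max_cvar.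
  have e : (Q1 / P1) 0%MM * P1 0%MM = Q1 0%MM by rewrite -coefM0 divrK.
  rewrite /max_ideal coefB coefA eqxx /c' -e mulfK ?subrr //.
exists c', Q, P1; split=> //; last first.
  move=> g; rewrite /pullback !subst_subst; apply: eq_subst; apply: ord2P => /=.
    by rewrite -[LHS]/(pullback (Slope c) (P ord0)) eP subst_cvar // mulrC.
  rewrite -[LHS]/(pullback (Slope c) (P ord_max)) eQ substM substD substA !subst_cvar //.
  rewrite /Q /= addrCA subrr addr0 [P1 * x]mulrC -mulrA; congr (_ * _).
  by rewrite mulrC divrK.
split=> //.
have dyP : P1 U_(ord_max)%MM = P ord0 U_(ord_max)%MM := pullback_slope_dy eP.
have dyQ : Q1 U_(ord_max)%MM = P ord_max U_(ord_max)%MM := pullback_slope_dy eQ.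
have q11 : (Q1 / P1) U_(ord_max)%MM * P1 0%MM =
    Q1 U_(ord_max)%MM - c' * P1 U_(ord_max)%MM.
  have : pderiv ord_max (Q1 / P1 * P1) 0%MM = pderiv ord_max Q1 0%MM by rewrite divrK.
  rewrite pderivM coefD (coefM0 _ P1) (coefM0 (Q1 / P1)) !coef_pderiv0 => <-.
  have e : (Q1 / P1) 0%MM * P1 0%MM = Q1 0%MM by rewrite -coefM0 divrK.
  have e' : c' = (Q1 / P1) 0%MM by rewrite /c' -e mulfK.
  by rewrite e'; ring.
have -> : jacobian Q = (P1 * x) U_(ord0)%MM * (Q1 / P1 - c'%:A) U_(ord_max)%MM -
    (P1 * x) U_(ord_max)%MM * (Q1 / P1 - c'%:A) U_(ord0)%MM by [].
rewrite !coefM_linear; try exact: max_cvar.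
rewrite !coefB !coefA !cvarU2 mulr1 mulr0 mul0r subr0.
have -> : (U_(ord_max) == 0 :> 'X_{1..2})%MM = false by rewrite -mdeg_eq0 mdeg1.
rewrite subr0 mulrC q11; apply: contraNneq dP => e.
have := congr1 (fun z => P1 0%MM * z) e; rewrite mulr0 mulrBr /c' mulrA.
rewrite [P1 0%MM * (_ / _)]mulrCA mulfV // mulr1 dyP dyQ P10 Q10 => {}e.
by apply/eqP; rewrite -[RHS]e /jacobian; ring.
Qed.

Lemma exceptional_subst d (Q : 'I_2 -> cps C 2) : (forall i, max_ideal (Q i)) ->
  subst (exceptional d) Q = Q (if d is Slope _ then ord0 else ord_max).
Proof. by case: d => [c|] h; rewrite subst_cvar. Qed.

(** The charts with vertical source or target are reduced to slopes by exchanging the coordinates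
    there. *)
Lemma pullback_automorphism P d : automorphism P ->
  exists d' Q v, [/\ automorphism Q, v \is a GRing.unit,
    forall g, pullback d (subst g P) = subst (pullback d' g) Q &
    subst (exceptional d') Q = v * exceptional d].
Proof.
have slope P' (c : C) : automorphism P' ->
    exists d' Q v, [/\ automorphism Q, v \is a GRing.unit,
    forall g, pullback (Slope c) (subst g P') = subst (pullback d' g) Q &
    subst (exceptional d') Q = v * exceptional (Slope c)].
  move=> hP; have [e|ne] := eqVneq (P' ord0 U_(ord0)%MM + c * P' ord0 U_(ord_max)%MM) 0; last first.
    have [c' [Q [v [hQ hv E q0]]]] := pullback_automorphism_slope hP ne.
    by exists (Slope c'), Q, v; split=> //; rewrite exceptional_subst //; apply: (proj1 hQ).
  pose P2 (i : 'I_2) := if i == ord0 then P' ord_max else P' ord0.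
  have hP2 : automorphism P2.
    split; first by apply: ord2P; apply: (proj1 hP).
    rewrite -oppr_eq0 opprB mulrC [X in _ - X]mulrC; exact: (proj2 hP).
  have ne : P2 ord0 U_(ord0)%MM + c * P2 ord0 U_(ord_max)%MM != 0.
    apply: contraNneq (proj2 hP) => /= e'; rewrite /P2 /= in e'.
    have e1 : P' ord0 U_(ord0)%MM = - (c * P' ord0 U_(ord_max)%MM) by apply/eqP; rewrite -addr_eq0 e.
    have e2 : P' ord_max U_(ord0)%MM = - (c * P' ord_max U_(ord_max)%MM) by apply/eqP; rewrite -addr_eq0 e'.
    by rewrite /jacobian e1 e2; apply/eqP; ring.
  have [c' [Q [v [hQ hv E q0]]]] := pullback_automorphism_slope hP2 ne.
  (* A direction sent to the vertical one by [P'] is sent to slope 0 after the exchange in the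
     target. *)
  have c'0 : c' = 0.
    have Ey : pullback (Slope c) (P' ord0) = subst (pullback (Slope c') y) Q.
      by rewrite -E subst_cvar //; apply: (proj1 hP2).
    have [P1 eP P10] := pullback_max (Slope c) (proj1 hP ord0).
    have py : pullback (Slope c') y = x * (c'%:A + y).
      by rewrite /= subst_cvar //; apply: max_idealMr; apply: max_cvar.
    have mQ := proj1 hQ; move: Ey; rewrite eP py; change (exceptional (Slope c)) with x.
    rewrite substM substD substA !subst_cvar // q0 [v * x]mulrC -mulrA.
    move=> /cvarM_inj /(congr1 (fun f : cps C 2 => f 0%MM)).
    rewrite P10 e coefM0 coefD coefA eqxx mQ addr0 => /esym/eqP.
    rewrite mulf_eq0 => /orP[v0|/eqP //]; move: hv; rewrite unit_cpsE; by rewrite v0.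
  exists (@Vertical C), (fun i => subst (if i == ord0 then y else x) Q), v.
  split=> //.
  - exact: (automorphism_comp automorphism_sw hQ).
  - move=> g; have -> : subst g P' = subst (sw g) P2.
      rewrite /sw subst_subst; apply: eq_subst; apply: ord2P; rewrite /= subst_cvar //; exact: (proj1 hP2).
    rewrite E c'0 -(subst_subst _ (fun i : 'I_2 => if i == ord0 then y else x)).
    by rewrite -[subst (pullback Vertical g) _]/(sw _) pullback_vertical swK pullback_slope shc0.
  rewrite exceptional_subst /=; last by move=> i; apply: max_ideal_subst; apply: max_ifc.
  by rewrite subst_cvar //; apply: (proj1 hQ).
case: d => [c|] hP; first exact: slope.
have [d' [Q [v [hQ hv E eE]]]] := slope _ 0 (automorphism_comp hP automorphism_sw).
exists d', (fun i => sw (Q i)), (sw v); split.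
- exact: automorphism_comp hQ automorphism_sw.
- by rewrite unit_cpsE coef_subst0 -unit_cpsE.
- move=> g; have := E g; rewrite -(subst_subst g P) => /(congr1 sw).
  rewrite pullback_slope shc0 -pullback_vertical => ->.
  by rewrite /sw subst_subst.
- have := congr1 sw eE; rewrite swM sw_x => <-.
  by rewrite /sw subst_subst.
Qed.

End Automorphisms.

(** * Infinitesimal rigidity of the singularity ideal *)

Section InfinitesimalRigidity.
Context {C : numClosedFieldType}.
Implicit Types (f g h : cps C 2) (d : direction C) (q r : infinitely_near C).

Local Notation x := (cvar ord0 : cps C 2).
Local Notation y := (cvar ord_max : cps C 2).

Definition derivation (A B g : cps C 2) : cps C 2 := A * pderiv ord0 g + B * pderiv ord_max g.

Lemma total_cat g q r : total_transform g (q ++ r) = total_transform (total_transform g q) r.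
Proof. exact: foldl_cat. Qed.

Lemma essential_reduced f q : reduced_singularity f -> essential_tree f q ->
  exists h m W, [/\ reduced_transform f q h, has_mt h m, (1 < m)%N & total_transform f q = W * h].
Proof.
move=> [f0 f2 _]; elim/last_ind: q => [_|q d ih].
  have [m hm] := has_mt_exists f0; exists f, m, 1; split=> //.
  - exact: reduced_transform_root.
  - exact: has_mt_le hm f2.
  - by rewrite mul1r.
move=> /essential_tree_rconsE[/ih[h0 [m0 [W [H1 H2 H3 H4]]]] [h [H5 H6 _]]].
have e := reduced_transform_step_eq H1 H2 H5.
have [m hm] : exists m, has_mt h m.
  have [e' _ he] := strict_mt d H2; exists (1 + e')%N; rewrite e.
  by apply: has_mtM => //; apply: has_mt_exc.
exists h, m, (pullback d W * exceptional d ^+ m0.-1); split=> //; first exact: has_mt_le hm H6.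
rewrite total_rcons H4 pullbackM (pullback_strict d (proj1 H2)) e.
have -> : exceptional d ^+ m0 = exceptional d ^+ m0.-1 * exceptional d.
  by rewrite -exprSr prednK // ltnW.
ring.
Qed.

(** The quadratic part of [x * w] is a multiple of [x ^ 2], whereas that of a node is a product of
    two independent linear forms. The comparison is made on second derivatives. *)
Lemma not_node_xM (w : cps C 2) : max_ideal w -> w U_(ord_max)%MM = 0 -> ~ node (x * w).
Proof.
move=> w0 w1 [u [v [u0 v0 D e]]].
have D2 i (g h : cps C 2) : max_ideal g -> max_ideal h ->
    pderiv i (pderiv ord_max (g * h)) 0%MM =
    g U_(ord_max)%MM * h U_(i)%MM + g U_(i)%MM * h U_(ord_max)%MM.
  move=> g0 h0; rewrite !(pderivM, pderivD) !coefD !coefM0 !(coef_pderiv0 i) !(coef_pderiv0 ord_max).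
  by rewrite g0 h0 mulr0 mul0r add0r addr0.
have := D2 ord0 _ _ (max_cvar ord0) w0; have := D2 ord_max _ _ (max_cvar ord0) w0.
rewrite e !D2 // !cvarU2 w1 !(mul0r, mulr0) !addr0 => e1 e2.
have : u U_(ord_max)%MM * v U_(ord_max)%MM = 0.
  apply/eqP; rewrite -[_ == 0](mulrn_eq0 _ 2) /= mulr2n; apply/eqP.
  by rewrite e1.
move=> /eqP; rewrite mulf_eq0 => /orP[] /eqP z; move: D; rewrite z in e2 *.
  by rewrite mul0r add0r in e2; rewrite e2 mul0r subr0 eqxx.
by rewrite mulr0 addr0 in e2; rewrite mulr0 sub0r e2 oppr0 eqxx.
Qed.

Lemma derivation_subst (A B g : cps C 2) (P : 'I_2 -> cps C 2) (A' B' : cps C 2) :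
  (forall i, subst (if i == ord0 then A else B) P = A' * pderiv ord0 (P i) + B' * pderiv ord_max (P i)) ->
  subst (derivation A B g) P = derivation A' B' (subst g P).
Proof.
move=> h; rewrite /derivation substD !substM !chain_rule !sum2.
by have /= -> := h ord0; have /= -> := h ord_max; ring.
Qed.

Lemma straighten_step (A B : cps C 2) n : A 0%MM != 0 ->
  (forall i, (i < n)%N -> B (mn2 i 0) = 0) ->
  exists (P : 'I_2 -> cps C 2) A' B', [/\ automorphism P,
    forall g, subst (derivation A B g) P = derivation A' B' (subst g P), A' 0%MM != 0 &
    forall i, (i < n.+1)%N -> B' (mn2 i 0) = 0].
Proof.
(* In the coordinate [y + c x ^ (n + 1)] the [y]-component loses [c (n + 1) A(0)] in its coefficient
   of [x ^ n]; this [c] cancels it. *)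
move=> A0 hB; pose c := B (mn2 n 0) / (n.+1%:R * A 0%MM).
pose P (i : 'I_2) := if i == ord0 then x else y + c *: x ^+ n.+1.
have m1 : mt_ge 1 (c *: x ^+ n.+1).
  by apply: mt_geZ; rewrite exprS; apply: mt_geMr; apply/mt_ge1P/max_cvar.
have mP i : max_ideal (P i).
  move: i; apply: ord2P; rewrite /P /=; first exact: max_cvar.
  by apply: max_idealD; [exact: max_cvar|apply/mt_ge1P].
have dP0 : pderiv ord0 (P ord_max) = (c * n.+1%:R) *: x ^+ n.
  rewrite /P /= pderivD pderivZ pderivX !pderiv_cvar /= add0r mulr1 mulr_natl.
  by rewrite -scaler_nat scalerA.
have dP1 : pderiv ord_max (P ord_max) = 1.
  by rewrite /P /= pderivD pderivZ pderivX !pderiv_cvar /= mulr0 scaler0 addr0.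
have aP : automorphism P.
  split=> //; have -> : jacobian P = x U_(ord0)%MM * P ord_max U_(ord_max)%MM -
     x U_(ord_max)%MM * P ord_max U_(ord0)%MM by [].
  by rewrite !cvarU2 mul0r subr0 mul1r -coef_pderiv0 dP1 coef1 eqxx oner_eq0.
exists P, (subst A P), (subst B P - (c * n.+1%:R) *: x ^+ n * subst A P); split=> //.
- move=> g; apply: derivation_subst; apply: ord2P.
    by rewrite /P /= !pderiv_cvar /= mulr1 mulr0 addr0.
  by rewrite /= dP0 dP1; ring.
- by rewrite coef_subst0.
have [cc hc] := subst_diff B mP (fun i => max_cvar i).
rewrite subst_id sum2 /= subrr mulr0 add0r [P ord_max]/= addrAC subrr add0r in hc.
move=> i ile; rewrite coefB -[subst B P](subrK B) hc coefD.
have xi (g : cps C 2) k l : (g * x ^+ k) (mn2 l 0) = if (k <= l)%N then g (mn2 (l - k) 0) else 0.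
  rewrite mulrC cvarX U0E; case: leqP => kl.
    have {1}-> : mn2 l 0 = (mn2 k 0 + mn2 (l - k) 0)%MM by rewrite mn2D subnKC.
    by rewrite coef_zmMD.
  rewrite coef_zmM ifF //; apply/negP => /mnm_lepP/(_ ord0).
  by rewrite !mn2_0 leqNgt kl.
rewrite -scalerAr coefZ xi leqNgt ile mulr0 add0r -scalerAl coefZ mulrC.
rewrite mulrC [x ^+ n * _]mulrC xi; move: ile; rewrite ltnS leq_eqVlt => /predU1P[->|ile].
  rewrite leqnn subnn; have -> : mn2 0 0 = 0%MM by apply/eqP; rewrite -mdeg_eq0 mdeg_mn2.
  by rewrite coef_subst0 /c -!mulrA mulVf ?mulr1 ?subrr // mulf_neq0 // pnatr_eq0.
by rewrite leqNgt ile mulr0 subr0 hB.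
Qed.

(** A finite-order flow box: [y = 0] becomes an integral curve up to order [n]. Finite order is
    enough, since only boundedly many points on the curve are followed. *)
Lemma straighten (A B : cps C 2) n : (A 0%MM != 0) || (B 0%MM != 0) ->
  exists (P : 'I_2 -> cps C 2) A' B', [/\ automorphism P,
    forall g, subst (derivation A B g) P = derivation A' B' (subst g P), A' 0%MM != 0 &
    forall i, (i < n)%N -> B' (mn2 i 0) = 0].
Proof.
move=> AB; elim: n => [|n [P [A1 [B1 [hP hd hA hB]]]]].
  have [A0|A0] := eqVneq (A 0%MM) 0; last first.
    exists cvar, A, B; split=> //; last by move=> g; rewrite !subst_id.
    split; first exact: max_cvar.
    by rewrite /jacobian !cvarU2 mul0r subr0 mul1r oner_eq0.
  rewrite A0 eqxx /= in AB.
  exists (fun i => if i == ord0 then y else x), (sw B), (sw A); split=> //.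
  - exact: automorphism_sw.
  - move=> g; apply: derivation_subst; apply: ord2P; rewrite /= !pderiv_cvar /=.
      by rewrite mulr0 mulr1 add0r.
    by rewrite mulr0 mulr1 addr0.
  - by rewrite /sw coef_subst0.
have [P2 [A2 [B2 [hP2 hd2 hA2 hB2]]]] := straighten_step hA hB.
exists (fun i => subst (P i) P2), A2, B2; split=> //; first exact: automorphism_comp.
by move=> g; rewrite -!(subst_subst _ P) hd hd2.
Qed.

Lemma coef_iter_pb0 j g (m : 'X_{1..2}) : iter j (@pb0 C) g m =
  if (j * m ord_max <= m ord0)%N then g (mn2 (m ord0 - j * m ord_max) (m ord_max)) else 0.
Proof.
elim: j m => [|j ih] m; first by rewrite mul0n subn0 -mn2E.
rewrite iterS coef_pb0 ih !(mn2_0, mn2_1) mulSn.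
case: leqP => h; last by rewrite ifF //; apply/negP; lia.
by rewrite leq_subRL // subnDA.
Qed.

(* [y ^ b] is, up to a scalar, the initial form of [g] for the weights [(1, n)]. *)
Definition pure n b g := g (mn2 0 b) != 0 /\
  forall i j, g (mn2 i j) != 0 -> (n * b <= i + n * j)%N /\ ((i + n * j)%N = (n * b)%N -> i = 0%N).

(** A leading monomial for the weights [(1, n)]: least weight, then highest power of [x]. Such
    monomials multiply, which is how [pure_dvd] passes to a factor. *)
Lemma extremal n g : g <> 0 -> exists i j, g (mn2 i j) != 0 /\
  forall k l, g (mn2 k l) != 0 ->
    (i + n * j <= k + n * l)%N /\ ((i + n * j)%N = (k + n * l)%N -> (k <= i)%N).
Proof.
move=> g0.
have ex : exists M, `[< exists i j, g (mn2 i j) != 0 /\ M = (i + n * j)%N >].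
  have [m [gm _]] := lead_exists g0; exists (m ord0 + n * m ord_max)%N; apply/asboolP.
  by exists (m ord0), (m ord_max); rewrite -mn2E.
case: (ex_minnP ex) => M /asboolP[i0 [j0 [g0' M0]]] hM.
have ex2 : exists k, `[< exists i j, [/\ g (mn2 i j) != 0, M = (i + n * j)%N & k = (M - i)%N] >].
  by exists (M - i0)%N; apply/asboolP; exists i0, j0.
case: (ex_minnP ex2) => K /asboolP[i [j [gij Mij Kij]]] hK.
exists i, j; split=> // k l gkl.
have le : (M <= k + n * l)%N by apply: hM; apply/asboolP; exists k, l.
split=> [|e]; first by rewrite -Mij.
have : (K <= M - k)%N by apply: hK; apply/asboolP; exists k, l; split=> //; lia.
lia.
Qed.

Lemma pure_dvd n b (w h : cps C 2) : (0 < n)%N -> pure n b (w * h) -> exists b', pure n b' h.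
Proof.
move=> n0 [wh0 wh].
have w0 : w <> 0 by move=> e; move: wh0; rewrite e mul0r coef0 eqxx.
have h0 : h <> 0 by move=> e; move: wh0; rewrite e mulr0 coef0 eqxx.
have [i [j [wij hw]]] := extremal n w0; have [k [l [hkl hh]]] := extremal n h0.
have P : (w * h) (mn2 (i + k) (j + l)) != 0.
  rewrite -mn2D coefM_single ?mulf_neq0 // => u v e une.
  have [->|wu] := eqVneq (w u) 0; first by rewrite mul0r.
  have [->|hv] := eqVneq (h v) 0; first by rewrite mulr0.
  rewrite [u]mn2E in wu; rewrite [v]mn2E in hv.
  have [a1 a2] := hw _ _ wu; have [b1 b2] := hh _ _ hv.
  have := congr1 (fun m : 'X_{1..2} => m ord0) e; have := congr1 (fun m : 'X_{1..2} => m ord_max) e.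
  rewrite /= !mnmDE !(mn2_0, mn2_1) => e1 e0.
  case: une; rewrite [u]mn2E.
  have ew : (i + n * j + (k + n * l) = u ord0 + n * u ord_max + (v ord0 + n * v ord_max))%N by nia.
  have E1 : (i + n * j = u ord0 + n * u ord_max)%N by lia.
  have E2 : (k + n * l = v ord0 + n * v ord_max)%N by lia.
  have := a2 E1; have := b2 E2 => le1 le2.
  have eu : u ord0 = i by lia.
  rewrite eu in E1 *; congr mn2; apply/eqP; rewrite -(eqn_pmul2l n0); apply/eqP; lia.
have [le1 imp] := wh _ _ P.
have [u [v [e wu hv]]] : exists u v, [/\ (u + v)%MM = mn2 0 b, w u != 0 & h v != 0].
  apply: contrapT => no; move: wh0; rewrite coefM_eq0 ?eqxx // => u v e.
  have [->|wu] := eqVneq (w u) 0; first by rewrite mul0r.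
  have [->|hv] := eqVneq (h v) 0; first by rewrite mulr0.
  by case: no; exists u, v; rewrite e.
rewrite [u]mn2E in wu; rewrite [v]mn2E in hv.
have [a1 _] := hw _ _ wu; have [b1 _] := hh _ _ hv.
have := congr1 (fun m : 'X_{1..2} => m ord0) e; have := congr1 (fun m : 'X_{1..2} => m ord_max) e.
rewrite /= !mnmDE !(mn2_0, mn2_1) => e1 e0.
have ik : (i + k = 0)%N by apply: imp; nia.
have k0 : k = 0%N by lia.
rewrite k0 in hkl hh; exists l; split=> // k' l' hkl'.
by have [h1 h2] := hh _ _ hkl'; split=> [|e2]; [lia|apply/eqP; rewrite -leqn0 h2 //; lia].
Qed.

(** The part of the field given by [A(0)] and the [x]-derivative lowers the weight by 1; all other
    parts preserve or raise it, the [y]-part because every monomial of [B] has weight at least [n].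
    If nothing of weight below [M] appears, the initial form of weight [M] has zero [x]-derivative
    and is a power of [y]. *)
Lemma pure_of_derivation n N M (A B g : cps C 2) : (0 < n)%N -> (n <= N)%N ->
  A 0%MM != 0 -> (forall i, (i < N)%N -> B (mn2 i 0) = 0) ->
  (forall i j, g (mn2 i j) != 0 -> (M <= i + n * j)%N) ->
  (exists i j, (i + n * j)%N = M /\ g (mn2 i j) != 0) ->
  (forall i j, (i + n * j < M)%N -> derivation A B g (mn2 i j) = 0) ->
  exists b, pure n b g.
Proof.
move=> n0 nN A0 hB hM [i0 [j0 [e0 g0]]] hG.
have wt (m : 'X_{1..2}) : g m != 0 -> (M <= m ord0 + n * m ord_max)%N.
  by rewrite {1}[m]mn2E; apply: hM.
have key i j : g (mn2 i j) != 0 -> (i + n * j)%N = M -> i = 0%N.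
  case: i => // i gij e; have := hG i j ltac:(lia).
  rewrite /derivation coefD -[X in (A * _) X]add0m coefM_single; last first.
    move=> u v euv une; rewrite coef_pderiv.
    have [->|gv] := eqVneq (g (v + U_(ord0))%MM) 0; first by rewrite !mulr0.
    have := wt _ gv; rewrite !mnmDE !mnm1E /= => hv.
    have := congr1 (fun m : 'X_{1..2} => m ord0) euv; have := congr1 (fun m : 'X_{1..2} => m ord_max) euv.
    rewrite /= !mnmDE !mnm0E !(mn2_0, mn2_1) => e1 e2.
    case: une; apply/mnmP; apply: ord2P; rewrite mnm0E; nia.
  rewrite [X in _ + X]coefM_eq0 ?addr0; last first.
    move=> u v euv; rewrite coef_pderiv.
    have [->|gv] := eqVneq (g (v + U_(ord_max))%MM) 0; first by rewrite !mulr0.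
    have := wt _ gv; rewrite !mnmDE !mnm1E /= => hv.
    have := congr1 (fun m : 'X_{1..2} => m ord0) euv; have := congr1 (fun m : 'X_{1..2} => m ord_max) euv.
    rewrite /= !mnmDE !(mn2_0, mn2_1) => e1 e2.
    have u1 : u ord_max = 0%N by nia.
    by rewrite [u]mn2E u1 hB ?mul0r //; nia.
  rewrite coef_pderiv mn2_0.
  have -> : (mn2 i j + U_(ord0))%MM = mn2 i.+1 j.
    by rewrite -[U_(ord0)%MM]mulm1n U0E mn2D addn1 addn0.
  by move/eqP; rewrite !mulf_eq0 (negPf A0) pnatr_eq0 (negPf gij).
have i00 := key _ _ g0 e0; rewrite i00 add0n in e0 g0.
exists j0; split=> // i j gij; rewrite e0; split; first exact: hM.
by apply: key.
Qed.

Section NoTangent.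
Variables (f : cps C 2) (q : infinitely_near C) (A B : cps C 2).
Let F := total_transform f q.
Hypotheses (hf : reduced_singularity f) (hq : essential_tree f q).
Hypothesis AB : (A 0%MM != 0) || (B 0%MM != 0).
Hypothesis hxi : forall r m, essential_tree f (q ++ r) ->
  has_mt (total_transform F r) m -> mt_ge m (total_transform (derivation A B F) r).

Lemma pullback_slope0 g : pullback (Slope 0) g = pb0 g.
Proof. by rewrite pullback_slope shc0. Qed.

Lemma pb0M g h : pb0 (g * h) = pb0 g * pb0 h :> cps C 2.
Proof. exact: substM. Qed.

Lemma pb0_x : pb0 x = x.
Proof. by rewrite -pullback_slope0 /= subst_cvar //; apply: max_cvar. Qed.

(* In coordinates straightening the vector field, its integral curve through the
   point is [y = 0].  As long as the points of this curve stay in the tree, the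
   hypothesis forces the initial form of [F] for the weights [(1, n)] to be a
   power of [y]; then so is that of the reduced equation, and the next point of
   the curve is again in the tree.  This contradicts the finiteness of the tree. *)
Lemma no_tangent : False.
Proof.
have [Bd hBd] := essential_tree_bounded hf; pose N := Bd.+2.
have [P [A' [B' [hP hd A0 hB]]]] := straighten N AB.
have [h0 [m0 [W [h0r h0m m02 FW]]]] := essential_reduced hf hq.
pose Ft := subst F P; pose ht := subst h0 P.
have FtE : Ft = subst W P * ht by rewrite /Ft /F FW substM.
have [mF hmF] := has_mt_exists (let: And3 f0 _ _ := hf in f0).
have hFr r : exists M, has_mt (total_transform F r) M.
  by have [e _ he] := total_mt (q ++ r) hmF; exists e; rewrite /F -total_cat.
(* After [j] blow-ups along [y = 0] the monomial [x^i y^l] becomes [x^(i + j l) y^l], of degree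
   [i + (j + 1) l]: the multiplicity there is the order for the weights [(1, j + 1)]. *)
have pureF j r Pj : (j < N)%N -> automorphism Pj -> essential_tree f (q ++ r) ->
    (forall g, iter j (@pb0 C) (subst g P) = subst (total_transform g r) Pj) ->
    exists b, pure j.+1 b Ft.
  move=> jN aPj hr hj; have [M hM] := hFr r.
  have hx := hxi hr hM.
  have hM' : has_mt (iter j (@pb0 C) Ft) M by rewrite hj; apply/has_mt_automorphism.
  have hx' : mt_ge M (iter j (@pb0 C) (derivation A' B' Ft)).
    by rewrite -hd hj; apply: mt_ge_subst.
  have co g i l : iter j (@pb0 C) g (mn2 (i + j * l) l) = g (mn2 i l).
    by rewrite coef_iter_pb0 !(mn2_0, mn2_1) leq_addl addnK.
  have dg i l : mdeg (mn2 (i + j * l) l) = (i + j.+1 * l)%N.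
    by rewrite mdeg_mn2 mulSn; lia.
  apply: (pure_of_derivation (M := M) (N := N) _ _ A0 hB) => //.
  - move=> i l; rewrite -co leqNgt; apply: contra => lt; apply/eqP.
    by apply: (proj1 hM'); rewrite dg.
  - move/has_mtP: hM' => [_ [k kd]]; rewrite coef_iter_pb0; case: ifP; last by rewrite eqxx.
    move=> le hk; exists (k ord0 - j * k ord_max)%N, (k ord_max); split=> //.
    by rewrite -kd mdeg2 mulSn; lia.
  - by move=> i l lt; rewrite -co; apply: hx'; rewrite dg.
have [be hbe] : exists be, pure 1 be ht.
  have [b hb] := @pureF 0%N [::] P isT hP ltac:(by rewrite cats0) (fun=> erefl).
  by apply: (@pure_dvd 1 b (subst W P)); rewrite // -FtE.
have hht : has_mt ht m0 by apply/has_mt_automorphism.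
have be2 : (1 < be)%N.
  rewrite ltnNge; apply/negP => le; move: (proj1 hbe); rewrite (proj1 hht) ?eqxx // mdeg_mn2.
  by apply: leq_ltn_trans le m02.
have pureH j r Pj : (j < N)%N -> automorphism Pj -> essential_tree f (q ++ r) ->
    (forall g, iter j (@pb0 C) (subst g P) = subst (total_transform g r) Pj) ->
    pure j.+1 be ht.
  move=> jN aPj hr hj; have [b hb] := pureF j r Pj jN aPj hr hj.
  rewrite FtE in hb; have [b' hb'] := pure_dvd (ltn0Sn j) hb.
  suff -> : be = b' by [].
  have [le1 _] := proj2 hbe _ _ (proj1 hb'); have [le2 _] := proj2 hb' _ _ (proj1 hbe).
  by rewrite !add0n !mul1n leq_pmul2l // in le1 le2; lia.
(* [r] is the path of the curve in the charts of the tree, [Pj] compares these charts with the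
   straightened coordinates, [H] is the reduced equation at the end of the path, and [s] is the
   transform of [ht] with the exceptional powers removed. *)
pose inv j := exists r Pj H v s, [/\ size r = j, automorphism Pj,
  forall g, iter j (@pb0 C) (subst g P) = subst (total_transform g r) Pj,
  essential_tree f (q ++ r) & [/\ reduced_transform f (q ++ r) H, v \is a GRing.unit,
  subst H Pj = v * x ^+ (j != 0%N) * s & x ^+ (j * be) * s = iter j (@pb0 C) ht]].
suff all j : (j <= N)%N -> inv j.
  have [r [_ [_ [_ [_ [sr _ _ hr _]]]]]] := all N (leqnn N).
  by have := hBd _ hr; rewrite size_cat sr /N; lia.
elim: j => [_|j ih jN].
  exists [::], P, h0, 1, ht; rewrite cats0; split=> //; split=> //.
  - by rewrite unitr1.
  - by rewrite expr0 !mul1r.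
  - by rewrite mul0n expr0 mul1r.
have [r [Pj [H [v [s [sr aPj hj hr [Hr hv HE sE]]]]]]] := ih (ltnW jN).
have hp := pureH j r Pj jN aPj hr hj.
have wt i l : ht (mn2 i l) != 0 -> (j.+1 * be <= i + j.+1 * l)%N by move=> /(proj2 hp)[].
have sco i l : s (mn2 i l) = if (j * l <= i + j * be)%N then ht (mn2 (i + j * be - j * l) l) else 0.
  have -> : s (mn2 i l) = (x ^+ (j * be) * s) (mn2 (j * be + i) l).
    by rewrite cvarX U0E -(add0n l) -mn2D coef_zmMD add0n.
  by rewrite sE coef_iter_pb0 !(mn2_0, mn2_1) [(j * be + i)%N]addnC.
have hs : has_mt s be.
  apply/has_mtP; split; last first.
    exists (mn2 0 be); first by rewrite mdeg_mn2.
    by rewrite sco add0n leqnn subnn; apply: (proj1 hp).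
  move=> m; rewrite [m]mn2E sco mdeg_mn2; case: ifP => // le lt.
  apply/eqP; apply: contraTT lt => /wt; rewrite -leqNgt mulSn mulSn; lia.
pose s' := st0 be s.
have s'E : pb0 s = x ^+ be * s' := pb0_st0 (proj1 hs).
have s'I : x ^+ (j.+1 * be) * s' = iter j.+1 (@pb0 C) ht.
  rewrite iterS -sE pb0M [pb0 (x ^+ _)]substX -/(pb0 x) pb0_x s'E mulrA -exprD.
  by rewrite mulSn addnC.
have s'co i l : s' (mn2 i l) = if (j.+1 * l <= i + j.+1 * be)%N then ht (mn2 (i + j.+1 * be - j.+1 * l) l) else 0.
  have -> : s' (mn2 i l) = (x ^+ (j.+1 * be) * s') (mn2 (j.+1 * be + i) l).
    by rewrite cvarX U0E -(add0n l) -mn2D coef_zmMD add0n.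
  by rewrite s'I coef_iter_pb0 !(mn2_0, mn2_1) [(j.+1 * be + i)%N]addnC.
have s'0 : max_ideal s'.
  rewrite /max_ideal; have -> : 0%MM = mn2 0 0 by apply/esym/eqP; rewrite -mdeg_eq0 mdeg_mn2.
  rewrite s'co muln0 leq0n add0n subn0; apply/eqP; apply: contraT => /(proj2 hp)[_].
  by rewrite muln0 addn0 => /(_ erefl); lia.
have s'1 : s' U_(ord_max)%MM = 0.
  rewrite -[U_(ord_max)%MM]mulm1n U1E s'co; case: ifP => // le.
  apply/eqP; apply: contraT => /(proj2 hp)[_]; nia.
have [d [Q [u [aQ hu hQ eQ]]]] := pullback_automorphism (Slope 0) aPj.
have [MH hMH] : exists MH, has_mt H MH.
  by have [h' [M [h'r h'm]]] := reduced_transform_exists (q ++ r) (let: And3 f0 _ _ := hf in f0);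
    exists M; rewrite (reduced_transform_uniq Hr h'r).
have MHE : MH = ((j != 0%N) + be)%N.
  have hv0 : has_mt v 0.
    by apply/has_mtP; split=> //; exists 0%MM; rewrite ?mdeg0 // -unit_cpsE.
  have h1 : has_mt (subst H Pj) MH by apply/has_mt_automorphism.
  rewrite HE in h1; rewrite (has_mt_uniq h1 (has_mtM (has_mtM hv0 (has_mtX _ (has_mt_cvar ord0))) hs)).
  by rewrite muln1.
have uX n : u ^+ n \is a GRing.unit by apply: unitrX.
pose v' := u * ((u ^+ MH)^-1 * pb0 v).
have hv' : v' \is a GRing.unit.
  by rewrite !unitrM hu unitrV uX unit_cpsE /pb0 coef_subst0 -unit_cpsE.
have SE : subst (exceptional d * strict d MH H) Q = v' * x * s'.
  have E : x ^+ MH * (u ^+ MH * subst (strict d MH H) Q) = x ^+ MH * (pb0 v * s').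
    rewrite [LHS]mulrA -[x ^+ MH * u ^+ MH]exprMn [x * u]mulrC -[x in u * x]/(exceptional (Slope 0)) -eQ -substX -substM.
    rewrite -(pullback_strict d (proj1 hMH)) -hQ HE pullback_slope0 !pb0M [pb0 (x ^+ _)]substX -/(pb0 x) pb0_x s'E.
    by rewrite MHE exprD; ring.
  rewrite [x ^+ MH]cvarX in E; have {}E := zmM_inj E.
  rewrite substM eQ -[subst (strict d MH H) Q](mulKr (uX MH)) E /v'.
  change (exceptional (Slope 0)) with x; ring.
exists (rcons r d), Q, (exceptional d * strict d MH H), v', s'.
have Hr' := reduced_transform_step d Hr hMH.
split=> //.
- by rewrite size_rcons sr.
- by move=> g; rewrite iterS hj -pullback_slope0 hQ total_rcons.
- rewrite -rcons_cat; apply: essential_tree_blowup Hr' _ _ => //.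
    apply: (mt_ge_automorphism aQ); rewrite SE -mulrA; apply: mt_geMl.
    by apply: (@mt_geM _ _ 1 1); apply/mt_ge1P => //; apply: max_cvar.
  move=> /(node_automorphism aQ); rewrite SE [v' * x]mulrC -mulrA; apply: not_node_xM.
    exact: max_idealMl.
  by rewrite coefM_linear // s'1 mulr0.
- by rewrite -rcons_cat; split=> //; rewrite SE expr1.
Qed.

End NoTangent.

Lemma derivation_mt_ge (A B g : cps C 2) m : max_ideal A -> max_ideal B -> mt_ge m g ->
  mt_ge m (derivation A B g).
Proof.
case: m => // m A0 B0 hg.
by apply: mt_geD; apply: (@mt_geM _ _ 1 m); try exact/mt_ge1P; apply: mt_ge_pderiv.
Qed.

(** The components pull back to multiples of the exceptional equation, which cancels the denominator
    in the transformed field. *)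
Lemma derivation_lift (A B : cps C 2) d : max_ideal A -> max_ideal B ->
  exists A' B', forall g, pullback d (derivation A B g) = derivation A' B' (pullback d g).
Proof.
move=> A0 B0; have [A1 eA _] := pullback_max d A0; have [B1 eB _] := pullback_max d B0.
have pD u v : pullback d (u + v) = pullback d u + pullback d v.
  by have := pullbackL d 1 u v; rewrite !scale1r.
case: d eA eB pD => [c|] eA eB pD.
  exists (x * A1), (B1 - (c%:A + y) * A1) => g.
  by rewrite /derivation pD !pullbackM eA eB !pderiv_slope; change (exceptional (Slope c)) with x; ring.
exists (A1 - x * B1), (y * B1) => g.
by rewrite /derivation pD !pullbackM eA eB !pderiv_vertical; change (exceptional (@Vertical C)) with y; ring.
Qed.

(** Along the tree the field lifts point by point: at each point [no_tangent] makes it vanish, which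
    is the condition for lifting it once more. A field vanishing at a point does not lower
    multiplicities there. *)
Theorem singularity_ideal_derivation f (A B : cps C 2) : reduced_singularity f ->
  singularity_ideal f (derivation A B f) ->
  [/\ max_ideal A, max_ideal B &
    forall g, singularity_ideal f g -> singularity_ideal f (derivation A B g)].
Proof.
move=> hf hI.
have lifts q : essential_tree f q -> exists A' B', [/\ max_ideal A', max_ideal B' &
    forall g, total_transform (derivation A B g) q = derivation A' B' (total_transform g q)].
  have vanish q' A' B' : essential_tree f q' ->
      (forall g, total_transform (derivation A B g) q' = derivation A' B' (total_transform g q')) ->
      max_ideal A' /\ max_ideal B'.
    move=> hq' E; have [|nz] := boolP ((A' 0%MM != 0) || (B' 0%MM != 0)); last first.
      by move: nz; rewrite negb_or !negbK => /andP[/eqP ? /eqP ?].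
    move=> AB; case: (no_tangent hf hq' AB) => r m hr hm.
    by rewrite -E -total_cat; apply: hI => //; rewrite total_cat.
  elim/last_ind: q => [hq|q d ih hqd].
    by have [A0 B0] := vanish [::] A B hq (fun=> erefl); exists A, B.
  have [hq _] := essential_tree_rconsE hqd; have [A' [B' [A0 B0 E]]] := ih hq.
  have [A2 [B2 E2]] := derivation_lift d A0 B0.
  have E3 g : total_transform (derivation A B g) (rcons q d) =
      derivation A2 B2 (total_transform g (rcons q d)) by rewrite !total_rcons E E2.
  by have [A20 B20] := vanish _ _ _ hqd E3; exists A2, B2.
have [A' [B' [A0 B0 E]]] := lifts [::] (essential_tree_root f).
have eA : A = A'.
  have := E x; rewrite /= /derivation !pderiv_cvar /=.
  by rewrite !mulr1 !mulr0 !addr0.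
have eB : B = B'.
  have := E y; rewrite /= /derivation !pderiv_cvar /=.
  by rewrite !mulr1 !mulr0 !add0r.
split; [by rewrite eA|by rewrite eB|] => g hg q m hq hm; have [A2 [B2 [A20 B20 ->]]] := lifts q hq.
by apply: derivation_mt_ge => //; apply: hg hm.
Qed.

End InfinitesimalRigidity.

(** * Families *)

Section FamilyTools.
Context {C : numClosedFieldType}.

Local Notation x := (cvar ord0 : cps C 2).
Local Notation y := (cvar ord_max : cps C 2).

Lemma ord2kP k (P : 'I_(2 + k) -> Prop) : P (lshift k ord0) -> P (lshift k ord_max) ->
  (forall j, P (rshift 2 j)) -> forall i, P i.
Proof.
move=> h0 h1 hr i; rewrite -(splitK i); case: (split i) => j /=; last exact: hr.
by move: j; apply: ord2P.
Qed.

Lemma split_l k (i : 'I_2) : split (lshift k i) = inl i.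
Proof. exact: (unsplitK (inl i)). Qed.

Lemma split_r k (j : 'I_k) : split (rshift 2 j) = inr j.
Proof. exact: (unsplitK (inr j)). Qed.

Definition arg {k n} (a b : cps C n) (c : 'I_k -> cps C n) (i : 'I_(2 + k)) : cps C n :=
  match split i with
  | inl j => if j == ord0 then a else b
  | inr j => c j
  end.

Lemma evalE {k n} (F : cps C (2 + k)) (a b : cps C n) c : eval F a b c = subst F (arg a b c).
Proof. by []. Qed.

Lemma arg_l {k n} (a b : cps C n) (c : 'I_k -> cps C n) i :
  arg a b c (lshift k i) = if i == ord0 then a else b.
Proof. by rewrite /arg split_l. Qed.
Lemma arg_x {k n} (a b : cps C n) (c : 'I_k -> cps C n) : arg a b c (lshift k ord0) = a.
Proof. by rewrite arg_l. Qed.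
Lemma arg_y {k n} (a b : cps C n) (c : 'I_k -> cps C n) : arg a b c (lshift k ord_max) = b.
Proof. by rewrite arg_l. Qed.
Lemma arg_t {k n} (a b : cps C n) (c : 'I_k -> cps C n) j : arg a b c (rshift 2 j) = c j.
Proof. by rewrite /arg split_r. Qed.

Section Arg.
Context {k n : nat} (a b : cps C n) (c : 'I_k -> cps C n).

Lemma max_arg : max_ideal a -> max_ideal b -> (forall j, max_ideal (c j)) ->
  forall i, max_ideal (arg a b c i).
Proof.
move=> ha hb hc; apply: (@ord2kP _ (fun i => max_ideal (arg a b c i))) => [||j];
  by rewrite (arg_x, arg_y, arg_t).
Qed.

Lemma eval_subst m (F : cps C (2 + k)) (psi : 'I_n -> cps C m) :
  subst (eval F a b c) psi = eval F (subst a psi) (subst b psi) (fun j => subst (c j) psi).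
Proof.
rewrite evalE subst_subst evalE; apply: eq_subst.
by apply: ord2kP => [||j]; rewrite ?arg_x ?arg_y ?arg_t.
Qed.

Lemma eval_liftT (u : cps C k) : (forall j, max_ideal (c j)) -> eval (liftT u) a b c = subst u c.
Proof.
move=> hc; rewrite /liftT evalE subst_subst; apply: eq_subst => j.
by rewrite subst_cvar arg_t.
Qed.

Lemma eval_liftS (g : cps C 2) : max_ideal a -> max_ideal b ->
  eval (liftS g) a b c = subst g (fun i => if i == ord0 then a else b).
Proof.
move=> ha hb; rewrite /liftS evalE subst_subst; apply: eq_subst => i.
by rewrite subst_cvar arg_l //; case: ifP.
Qed.

Lemma eval_x : max_ideal a -> eval xvar a b c = a.
Proof. by move=> h; rewrite /xvar evalE subst_cvar arg_x. Qed.
Lemma eval_y : max_ideal b -> eval yvar a b c = b.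
Proof. by move=> h; rewrite /yvar evalE subst_cvar arg_y. Qed.
Lemma eval_t j : max_ideal (c j) -> eval (tvar j) a b c = c j.
Proof. by move=> h; rewrite /tvar evalE subst_cvar arg_t. Qed.
End Arg.

Lemma eval_ext {k n} (F : cps C (2 + k)) (a b a' b' : cps C n) (c c' : 'I_k -> cps C n) :
  a = a' -> b = b' -> c =1 c' -> eval F a b c = eval F a' b' c'.
Proof.
move=> -> -> e; rewrite !evalE; apply: eq_subst.
by apply: ord2kP => [||j]; rewrite ?arg_x ?arg_y ?arg_t.
Qed.

Section Monomials.
Context {k : nat}.
Implicit Types (F G : cps C (2 + k)) (a b : 'X_{1..2}) (al be : 'X_{1..k}) (m : 'X_{1..2 + k}).

Definition xm a : 'X_{1..2 + k} := [multinom if split i is inl j then a j else 0%N | i < 2 + k].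
Definition tm al : 'X_{1..2 + k} := [multinom if split i is inr j then al j else 0%N | i < 2 + k].
Definition xpart m : 'X_{1..2} := [multinom m (lshift k i) | i < 2].
Definition tpart m : 'X_{1..k} := [multinom m (rshift 2 j) | j < k].
Definition tset : {set 'I_(2 + k)} := [set i | if split i is inr _ then true else false].

Lemma xm_l a i : xm a (lshift k i) = a i. Proof. by rewrite mnmE split_l. Qed.
Lemma xm_r a j : xm a (rshift 2 j) = 0%N. Proof. by rewrite mnmE split_r. Qed.
Lemma tm_l al i : tm al (lshift k i) = 0%N. Proof. by rewrite mnmE split_l. Qed.
Lemma tm_r al j : tm al (rshift 2 j) = al j. Proof. by rewrite mnmE split_r. Qed.
Lemma tset_l i : (lshift k i \in tset) = false. Proof. by rewrite inE split_l. Qed.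
Lemma tset_r j : (rshift 2 j \in tset) = true. Proof. by rewrite inE split_r. Qed.

Lemma xtE m : m = (xm (xpart m) + tm (tpart m))%MM.
Proof.
by apply/mnmP; apply: ord2kP => [||j]; rewrite mnmDE ?xm_l ?xm_r ?tm_l ?tm_r mnmE ?addn0 ?add0n.
Qed.

Lemma xmD a b : xm (a + b)%MM = (xm a + xm b)%MM.
Proof. by apply/mnmP; apply: ord2kP => [||j]; rewrite mnmDE ?xm_l ?xm_r ?mnmDE. Qed.
Lemma xpartE a al : xpart (xm a + tm al)%MM = a.
Proof. by apply/mnmP => i; rewrite mnmE mnmDE xm_l tm_l addn0. Qed.
Lemma tpartE a al : tpart (xm a + tm al)%MM = al.
Proof. by apply/mnmP => i; rewrite mnmE mnmDE xm_r tm_r. Qed.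
Lemma xm0 : xm 0%MM = 0%MM.
Proof. by apply/mnmP; apply: ord2kP => [||j]; rewrite ?xm_l ?xm_r !mnm0E. Qed.
Lemma tm0 : tm 0%MM = 0%MM.
Proof. by apply/mnmP; apply: ord2kP => [||j]; rewrite ?tm_l ?tm_r !mnm0E. Qed.
Lemma mdeg_xm a : mdeg (xm a) = mdeg a.
Proof.
rewrite !mdegE big_split_ord /= [X in (_ + X)%N]big1 ?addn0 => [|j _]; last by rewrite xm_r.
by apply: eq_bigr => i _; rewrite xm_l.
Qed.
Lemma mdeg_tm al : mdeg (tm al) = mdeg al.
Proof.
rewrite !mdegE big_split_ord /= [X in (X + _)%N]big1 ?add0n => [|j _]; last by rewrite tm_l.
by apply: eq_bigr => i _; rewrite tm_r.
Qed.
Lemma xpartD m m' : xpart (m + m')%MM = (xpart m + xpart m')%MM.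
Proof. by apply/mnmP => i; rewrite !mnmE. Qed.
Lemma mp_tset m : mp tset m = tm (tpart m).
Proof.
by apply/mnmP; apply: ord2kP => [||j]; rewrite mnmE ?tset_l ?tset_r ?tm_l ?tm_r ?mnmE.
Qed.
Lemma mx_tset m : mx tset m = xm (xpart m).
Proof.
by apply/mnmP; apply: ord2kP => [||j]; rewrite mnmE ?tset_l ?tset_r ?xm_l ?xm_r ?mnmE.
Qed.
Lemma mp_xset m : mp (~: tset) m = xm (xpart m).
Proof.
apply/mnmP; apply: ord2kP => [||j]; rewrite mnmE in_setC ?tset_l ?tset_r ?xm_l ?xm_r ?mnmE //.
Qed.

Lemma max_xvar : max_ideal (xvar : cps C (2 + k)). Proof. exact: max_cvar. Qed.
Lemma max_yvar : max_ideal (yvar : cps C (2 + k)). Proof. exact: max_cvar. Qed.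
Lemma max_tvar j : max_ideal (tvar j : cps C (2 + k)). Proof. exact: max_cvar. Qed.

Lemma subst_arg_id F : eval F xvar yvar tvar = F.
Proof.
rewrite evalE -[RHS]subst_id; apply: eq_subst.
by apply: ord2kP => [||j]; rewrite ?arg_x ?arg_y ?arg_t.
Qed.

Lemma liftS_special F : liftS (special F) = sp tset F.
Proof.
rewrite /liftS /special eval_subst sp_subst evalE; apply: eq_subst.
by apply: ord2kP => [||j]; rewrite ?arg_x ?arg_y ?arg_t ?tset_l ?tset_r ?subst0 // subst_cvar //;
  apply: max_cvar.
Qed.

Lemma liftT_ots F : liftT (on_trivial_section F) = sp (~: tset) F.
Proof.
rewrite /liftT /on_trivial_section eval_subst sp_subst evalE; apply: eq_subst.
apply: ord2kP => [||j]; rewrite ?arg_x ?arg_y ?arg_t in_setC ?tset_l ?tset_r ?subst0 //= subst_cvar //.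
exact: max_cvar.
Qed.

Lemma coef_liftS (g : cps C 2) m : liftS g m = if tpart m == 0%MM then g (xpart m) else 0.
Proof.
pose mu i : 'X_{1..2 + k} := U_(lshift k i)%MM.
have mE a : mono mu a = xm a.
  apply/mnmP => i; rewrite /mono mnm_sumE; move: i.
  have lr (i : 'I_2) (j : 'I_k) : (lshift k i == rshift 2 j) = false.
    by apply/eqP => /(congr1 val) /=; have := ltn_ord i; lia.
  have key (i0 : 'I_2) : (\sum_i (mu i *+ a i)%MM (lshift k i0) = a i0)%N.
    rewrite (bigD1 i0) //= mulmnE mnm1E eqxx mul1n big1 ?addn0 // => i /negPf ne.
    by rewrite mulmnE mnm1E (inj_eq (@lshift_inj _ _)) ne.
  apply: ord2kP => [||j]; rewrite ?xm_l ?xm_r ?key //.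
  by rewrite big1 // => i _; rewrite mulmnE mnm1E lr.
have -> : liftS g = subst g (fun i => zm (mu i)) by apply: eq_subst => i; rewrite cvarE.
case: eqP => [e|ne].
  have {1}-> : m = mono mu (xpart m) by rewrite mE {1}[m]xtE e tm0 addm0.
  apply: coef_subst_mono => [i|a b]; first by rewrite -mdeg_eq0 mdeg1.
  by rewrite !mE => /(congr1 xpart); rewrite -[xm a]addm0 -[xm b]addm0 -tm0 !xpartE.
apply: coef_subst_mono0 => [i|a e]; first by rewrite -mdeg_eq0 mdeg1.
by apply: ne; rewrite -e mE -[xm a]addm0 -tm0 tpartE.
Qed.

Lemma coef_liftT (u : cps C k) m : liftT u m = if xpart m == 0%MM then u (tpart m) else 0.
Proof.
pose mu j : 'X_{1..2 + k} := U_(rshift 2 j)%MM.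
have mE al : mono mu al = tm al.
  apply/mnmP => i; rewrite /mono mnm_sumE; move: i.
  have rl (i : 'I_2) (j : 'I_k) : (rshift 2 j == lshift k i) = false.
    by apply/eqP => /(congr1 val) /=; have := ltn_ord i; lia.
  apply: ord2kP => [||j]; rewrite ?tm_l ?tm_r; try by rewrite big1 // => j _; rewrite mulmnE mnm1E rl.
  rewrite (bigD1 j) //= mulmnE mnm1E eqxx mul1n big1 ?addn0 // => j' /negPf ne.
  by rewrite mulmnE mnm1E (inj_eq (@rshift_inj _ _)) ne.
have -> : liftT u = subst u (fun i => zm (mu i)) by apply: eq_subst => i; rewrite /tvar cvarE.
case: eqP => [e|ne].
  have {1}-> : m = mono mu (tpart m) by rewrite mE {1}[m]xtE e xm0 add0m.
  apply: coef_subst_mono => [i|a b]; first by rewrite -mdeg_eq0 mdeg1.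
  by rewrite !mE => /(congr1 tpart); rewrite -[tm a]add0m -[tm b]add0m -xm0 !tpartE.
apply: coef_subst_mono0 => [i|a e]; first by rewrite -mdeg_eq0 mdeg1.
by apply: ne; rewrite -e mE -[tm a]add0m -xm0 xpartE.
Qed.

Lemma coef_special F a : special F a = F (xm a).
Proof.
have := congr1 (fun G : cps C (2 + k) => G (xm a)) (liftS_special F).
rewrite coef_liftS coef_sp mp_tset -{1 2}[xm a]addm0 -{1 2}tm0 tpartE xpartE eqxx.
by rewrite -[in tpart _](addm0 (xm a)) -{1}tm0 tpartE tm0 eqxx.
Qed.

Lemma coef_ots F al : on_trivial_section F al = F (tm al).
Proof.
have := congr1 (fun G : cps C (2 + k) => G (tm al)) (liftT_ots F).
rewrite coef_liftT coef_sp mp_xset -{1 2}[tm al]add0m -{1 2}xm0 tpartE xpartE eqxx.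
by rewrite -[in xpart _](add0m (tm al)) -{1}xm0 xpartE xm0 eqxx.
Qed.

(** [slice al] is the coefficient of the monomial [al] in the parameters, a series in [x], [y];
    [coslice a] is the coefficient of the monomial [a] in [x], [y], a series in the parameters. *)
Definition slice al F : cps C 2 := special (shift (tm al) F).
Definition coslice a F : cps C k := on_trivial_section (shift (xm a) F).

Lemma coef_slice al F a : slice al F a = F (xm a + tm al)%MM.
Proof. by rewrite coef_special coef_shift. Qed.
Lemma coef_coslice a F al : coslice a F al = F (xm a + tm al)%MM.
Proof. by rewrite coef_ots coef_shift addmC. Qed.
Lemma slice0 F : slice 0%MM F = special F.
Proof. by apply: cpsP => a; rewrite coef_slice coef_special tm0 addm0. Qed.

Lemma slice_lin al : lin (slice al).
Proof. by move=> c F G; apply: cpsP => a; rewrite !(coef_slice, coefD, coefZ). Qed.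
Lemma coslice_lin a : lin (coslice a).
Proof. by move=> c F G; apply: cpsP => al; rewrite !(coef_coslice, coefD, coefZ). Qed.

Lemma liftTB (u v : cps C k) : liftT (u - v) = liftT u - liftT v. Proof. exact: substB. Qed.
Lemma liftTM (u v : cps C k) : liftT (u * v) = liftT u * liftT v. Proof. exact: substM. Qed.
Lemma liftT_sum I (r : seq I) P (u : I -> cps C k) :
  liftT (\sum_(i <- r | P i) u i) = \sum_(i <- r | P i) liftT (u i).
Proof. exact: subst_sum. Qed.
Lemma liftSM (u v : cps C 2) : liftS (u * v) = liftS u * liftS v :> cps C (2 + k).
Proof. exact: substM. Qed.
Lemma liftT_inj : injective (liftT : cps C k -> cps C (2 + k)).
Proof.
move=> u v e; apply: cpsP => al; have := congr1 (fun G : cps C (2 + k) => G (tm al)) e.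
by rewrite !coef_liftT -[tm al]add0m -xm0 xpartE eqxx tpartE.
Qed.
Lemma otsD (F G : cps C (2 + k)) : on_trivial_section (F + G) = on_trivial_section F + on_trivial_section G.
Proof. exact: substD. Qed.
Lemma otsB (F G : cps C (2 + k)) : on_trivial_section (F - G) = on_trivial_section F - on_trivial_section G.
Proof. exact: substB. Qed.
Lemma otsM (F G : cps C (2 + k)) : on_trivial_section (F * G) = on_trivial_section F * on_trivial_section G.
Proof. exact: substM. Qed.
Lemma ots_liftT (u : cps C k) : on_trivial_section (liftT u) = u.
Proof. by apply: liftT_inj; rewrite liftT_ots; apply: cpsP => m; rewrite coef_sp mp_xset coef_liftT;
  rewrite -[_ == 0%MM]mdeg_eq0 mdeg_xm mdeg_eq0; case: eqP. Qed.
Lemma ots_liftS (g : cps C 2) : on_trivial_section (liftS g : cps C (2 + k)) = (g 0%MM)%:A.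
Proof.
apply: cpsP => al; rewrite coef_ots coef_liftS coefA -[tm al]add0m -xm0 tpartE xpartE.
by case: eqP.
Qed.
Lemma specialD (F G : cps C (2 + k)) : special (F + G) = special F + special G. Proof. exact: substD. Qed.
Lemma specialB (F G : cps C (2 + k)) : special (F - G) = special F - special G. Proof. exact: substB. Qed.
Lemma specialM (F G : cps C (2 + k)) : special (F * G) = special F * special G. Proof. exact: substM. Qed.
Lemma special_sum I (r : seq I) P (F : I -> cps C (2 + k)) :
  special (\sum_(i <- r | P i) F i) = \sum_(i <- r | P i) special (F i).
Proof. exact: subst_sum. Qed.
Lemma special_liftS (g : cps C 2) : special (liftS g : cps C (2 + k)) = g.
Proof.
apply: cpsP => a; rewrite coef_special coef_liftS -[xm a]addm0 -tm0 tpartE eqxx xpartE //.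
Qed.
Lemma special_liftT (u : cps C k) : special (liftT u) = (u 0%MM)%:A.
Proof.
apply: cpsP => a; rewrite coef_special coef_liftT coefA -[xm a]addm0 -tm0 tpartE xpartE.
by case: eqP.
Qed.
Lemma special_x : special (xvar : cps C (2 + k)) = x.
Proof. by apply: eval_x; apply: max_cvar. Qed.
Lemma special_y : special (yvar : cps C (2 + k)) = y.
Proof. by apply: eval_y; apply: max_cvar. Qed.
Lemma special_t j : special (tvar j : cps C (2 + k)) = 0.
Proof. by apply: eval_t. Qed.

Lemma coslice_lowering a : order_lowering (mdeg a) (coslice a).
Proof.
move=> e F hF al hal; rewrite coef_coslice; apply: hF.
by rewrite mdegD mdeg_xm mdeg_tm addnC ltn_add2r.
Qed.
Lemma slice_lowering al : order_lowering (mdeg al) (slice al).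
Proof.
move=> e F hF a ha; rewrite coef_slice; apply: hF.
by rewrite mdegD mdeg_xm mdeg_tm ltn_add2r.
Qed.

Lemma U_r j : U_(rshift 2 j)%MM = tm U_(j)%MM.
Proof.
apply/mnmP => i; rewrite mnm1E; move: i.
have rl (i : 'I_2) : (rshift 2 j == lshift k i) = false.
  by apply/eqP => /(congr1 val) /=; have := ltn_ord i; lia.
by apply: ord2kP => [||i]; rewrite ?tm_l ?tm_r ?rl // mnm1E (inj_eq (@rshift_inj _ _)).
Qed.
Lemma U_l i : U_(lshift k i)%MM = xm U_(i)%MM.
Proof.
apply/mnmP => i'; rewrite mnm1E; move: i'.
have li (i1 i2 : 'I_2) : (lshift k i1 == lshift k i2) = (i1 == i2) by rewrite (inj_eq (@lshift_inj _ _)).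
apply: ord2kP => [||j]; rewrite ?xm_l ?xm_r ?li ?mnm1E //.
by have -> : (lshift k i == rshift 2 j) = false; first by apply/eqP => /(congr1 val) /=; have := ltn_ord i; lia.
Qed.
Lemma liftT_zm al : liftT (zm al : cps C k) = zm (tm al).
Proof.
apply: cpsP => m; rewrite coef_liftT !coef_zm; case: eqP => [e|ne].
  by rewrite {2}[m]xtE e xm0 add0m; congr (nat_of_bool _)%:R; apply/eqP/eqP => [->//|];
     move=> /(congr1 tpart); rewrite -[tm (tpart m)]add0m -[tm al]add0m -xm0 !tpartE.
case: eqP => // e; case: ne; by rewrite e -[tm al]add0m -xm0 xpartE.
Qed.
Lemma liftS_zm a : liftS (zm a : cps C 2) = zm (xm a) :> cps C (2 + k).
Proof.
apply: cpsP => m; rewrite coef_liftS !coef_zm; case: eqP => [e|ne].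
  by rewrite {2}[m]xtE e tm0 addm0; congr (nat_of_bool _)%:R; apply/eqP/eqP => [->//|];
     move=> /(congr1 xpart); rewrite -[xm (xpart m)]addm0 -[xm a]addm0 -tm0 !xpartE.
case: eqP => // e; case: ne; by rewrite e -[xm a]addm0 -tm0 tpartE.
Qed.

Lemma slice_liftS_mul al (g : cps C 2) F : slice al (liftS g * F) = g * slice al F.
Proof.
move: g; apply: (@lin_ext _ _ _ (mdeg al)) => [c g h|c g h|e g hg|e g hg||i g e].
- by rewrite /liftS substD substZ mulrDl -scalerAl slice_lin.
- by rewrite mulrDl -scalerAl.
- by apply: slice_lowering; apply: mt_geMr; apply: mt_ge_subst.
- by apply: mt_geMr; apply: mt_ge_le hg; rewrite leq_addr.
- by rewrite /liftS subst1 !mul1r.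
- rewrite liftSM -!mulrA -e [liftS (cvar i)]subst_cvar; last exact: max_cvar.
  apply: cpsP => a; rewrite coef_slice !coef_cvarM mnmDE xm_l tm_l addn0; case: eqP => // ai.
  rewrite coef_slice; congr (coef _ _); apply/mnmP => j; rewrite U_l mnmBE !mnmDE; move: j.
  have xb (a1 a2 : 'X_{1..2}) : (xm a1 - xm a2)%MM = xm (a1 - a2)%MM.
    by apply/mnmP; apply: ord2kP => [||j]; rewrite mnmBE ?xm_l ?xm_r // mnmBE.
  by apply: ord2kP => [||j]; rewrite ?xm_l ?xm_r ?tm_l ?tm_r ?addn0 ?mnmBE ?subn0.
Qed.

Lemma coslice_liftT_mul a (u : cps C k) F : coslice a (liftT u * F) = u * coslice a F.
Proof.
move: u; apply: (@lin_ext _ _ _ (mdeg a)) => [c g h|c g h|e g hg|e g hg||i g e].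
- by rewrite /liftT substD substZ mulrDl -scalerAl coslice_lin.
- by rewrite mulrDl -scalerAl.
- by apply: coslice_lowering; apply: mt_geMr; apply: mt_ge_subst.
- by apply: mt_geMr; apply: mt_ge_le hg; rewrite leq_addr.
- by rewrite /liftT subst1 !mul1r.
- rewrite liftTM -!mulrA -e [liftT (cvar i)]subst_cvar; last exact: max_tvar.
  apply: cpsP => al; rewrite coef_coslice !coef_cvarM mnmDE xm_r tm_r add0n; case: eqP => // ai.
  rewrite coef_coslice; congr (coef _ _); apply/mnmP => j; rewrite U_r mnmBE !mnmDE; move: j.
  by apply: ord2kP => [||j]; rewrite ?xm_l ?xm_r ?tm_l ?tm_r ?addn0 ?mnmBE ?subn0.
Qed.

Lemma slice_liftT al (u : cps C k) : slice al (liftT u) = (u al)%:A.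
Proof. by apply: cpsP => a; rewrite coef_slice coef_liftT tpartE xpartE coefA; case: eqP. Qed.
Lemma slice_liftST al (g : cps C 2) (u : cps C k) : slice al (liftS g * liftT u) = u al *: g.
Proof. by rewrite slice_liftS_mul slice_liftT mulrC -scalerAl mul1r. Qed.
Lemma coslice_liftS a (g : cps C 2) : coslice a (liftS g : cps C (2 + k)) = (g a)%:A.
Proof. by apply: cpsP => al; rewrite coef_coslice coef_liftS tpartE xpartE coefA; case: eqP. Qed.
Lemma coslice_liftST a (g : cps C 2) (u : cps C k) : coslice a (liftS g * liftT u) = g a *: u.
Proof. by rewrite mulrC coslice_liftT_mul coslice_liftS mulrC -scalerAl mul1r. Qed.
Lemma coslice_split n F : exists R, F = \sum_(a : 'X_{1..2 < n}) liftS (zm a) * liftT (coslice a F) + R /\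
  forall a, (mdeg a < n)%N -> coslice a R = 0.
Proof.
exists (F - \sum_(a : 'X_{1..2 < n}) liftS (zm a) * liftT (coslice a F)); split.
  by rewrite addrC subrK.
move=> b bn; rewrite (linB _ _ (coslice_lin b)) lin_sum; last exact: coslice_lin.
rewrite (bigD1 (BMultinom bn)) //= coslice_liftST coef_zm eqxx scale1r big1 ?addr0 ?subrr //.
move=> a ab; rewrite coslice_liftST coef_zm; case: eqP => [e|]; last by rewrite scale0r.
by move: ab; rewrite -val_eqE /= e eqxx.
Qed.

Lemma slice_split n F : exists R, F = \sum_(al : 'X_{1..k < n}) liftT (zm al) * liftS (slice al F) + R /\
  forall al, (mdeg al < n)%N -> slice al R = 0.
Proof.
exists (F - \sum_(al : 'X_{1..k < n}) liftT (zm al) * liftS (slice al F)); split.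
  by rewrite addrC subrK.
move=> b bn; rewrite (linB _ _ (slice_lin b)) lin_sum; last exact: slice_lin.
rewrite (bigD1 (BMultinom bn)) //= mulrC slice_liftST coef_zm eqxx scale1r big1 ?addr0 ?subrr //.
move=> a ab; rewrite mulrC slice_liftST coef_zm; case: eqP => [e|]; last by rewrite scale0r.
by move: ab; rewrite -val_eqE /= e eqxx.
Qed.

Lemma slice_mul_eq0 n F G al : (forall be, (mdeg be < n)%N -> slice be F = 0) ->
  (mdeg al < n)%N -> slice al (F * G) = 0.
Proof.
move=> h aln.
have p m : (mdeg (mp tset m) < n)%N -> F m = 0.
  by rewrite mp_tset mdeg_tm => mn; rewrite [m]xtE -coef_slice h.
have q := @pordM C (2 + k) tset n 0 F G p (fun _ _ => ltac:(done)).
apply: cpsP => a; rewrite coef_slice; apply: q.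
by rewrite addn0 mp_tset tpartE mdeg_tm.
Qed.

Lemma slice_zmM al be F : slice al (liftT (zm be) * F) =
  if (be <= al)%MM then slice (al - be)%MM F else 0.
Proof.
apply: cpsP => a; rewrite coef_slice liftT_zm coef_zmM.
have -> : (tm be <= xm a + tm al)%MM = (be <= al)%MM.
  apply/mnm_lepP/mnm_lepP => h i; first by have := h (rshift 2 i); rewrite mnmDE xm_r !tm_r.
  by move: i; apply: ord2kP => [||j]; rewrite mnmDE ?tm_l ?tm_r ?xm_r //; apply: h.
case: ifP => // le; rewrite coef_slice; congr (coef _ _); apply/mnmP.
by apply: ord2kP => [||j]; rewrite mnmBE !mnmDE ?xm_l ?xm_r ?tm_l ?tm_r ?subn0 // mnmBE.
Qed.

Lemma sliceM al F G : slice al (F * G) =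
  \sum_(be : 'X_{1..k < (mdeg al).+1} | (be <= al)%MM) slice be F * slice (al - be)%MM G.
Proof.
have [R [{1}-> hR]] := slice_split (mdeg al).+1 F.
rewrite mulrDl (linD _ _ (slice_lin al)) (slice_mul_eq0 _ hR) // addr0.
rewrite mulr_suml lin_sum; last exact: slice_lin.
rewrite [RHS]big_mkcond; apply: eq_bigr => be _.
by rewrite -mulrA slice_zmM slice_liftS_mul; case: ifP.
Qed.

End Monomials.
End FamilyTools.

(** * Straight families and the singularity ideal *)

Section StraightFamilies.
Context {C : numClosedFieldType}.
Implicit Types (f g h : cps C 2) (d : direction C) (q : infinitely_near C).

Section SingularityIdeal.
Variable f : cps C 2.

Lemma singularity_ideal0 : singularity_ideal f 0.
Proof.
move=> q m _ _; have -> : total_transform 0 q = 0 :> cps C 2; last exact: mt_ge_zero.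
by have := totalL q 1 0 0 => /=; rewrite !scale1r addr0 => /eqP; rewrite -subr_eq0 opprD addNKr oppr_eq0 => /eqP.
Qed.

Lemma singularity_ideal_lin c g h : singularity_ideal f g -> singularity_ideal f h ->
  singularity_ideal f (c *: g + h).
Proof.
move=> hg hh q m hq hm; rewrite totalL.
by apply: mt_geD; [apply: mt_geZ; apply: hg hm|apply: hh hm].
Qed.

Lemma singularity_idealD g h : singularity_ideal f g -> singularity_ideal f h ->
  singularity_ideal f (g + h).
Proof. by move=> hg hh; rewrite -[g]scale1r; apply: singularity_ideal_lin. Qed.

Lemma singularity_idealZ c g : singularity_ideal f g -> singularity_ideal f (c *: g).
Proof. by move=> hg; rewrite -[_ *: _]addr0; apply: singularity_ideal_lin => //; apply: singularity_ideal0. Qed.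

Lemma singularity_idealM g h : singularity_ideal f h -> singularity_ideal f (g * h).
Proof. by move=> hh q m hq hm; rewrite totalM; apply: mt_geMl; apply: hh hm. Qed.

Lemma singularity_idealN g : singularity_ideal f g -> singularity_ideal f (- g).
Proof. by move=> h; rewrite -scaleN1r; apply: singularity_idealZ. Qed.

Lemma singularity_idealB g h : singularity_ideal f g -> singularity_ideal f h ->
  singularity_ideal f (g - h).
Proof. by move=> hg hh; apply: singularity_idealD => //; apply: singularity_idealN. Qed.

Lemma singularity_ideal_sum I (r : seq I) (P : pred I) (F : I -> cps C 2) :
  (forall i, P i -> singularity_ideal f (F i)) -> singularity_ideal f (\sum_(i <- r | P i) F i).
Proof.
move=> h; apply: big_ind => //; first exact: singularity_ideal0.
by move=> *; apply: singularity_idealD.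
Qed.

(** A blow-up at most doubles the multiplicity of the total transform, so bounded height of the tree
    bounds all multiplicities that occur. Pull-back does not lower the order, hence a power of the
    maximal ideal satisfies all conditions. *)
Lemma singularity_ideal_power : reduced_singularity f -> exists N,
  (forall g, mt_ge N g -> singularity_ideal f g) /\
  forall q m, essential_tree f q -> has_mt (total_transform f q) m -> (m <= N)%N.
Proof.
move=> hf; have [B hB] := essential_tree_bounded hf; have [f0 _ _] := hf.
have [mf hmf] := has_mt_exists f0; exists (2 ^ B * mf)%N.
have le q m : essential_tree f q -> has_mt (total_transform f q) m -> (m <= 2 ^ B * mf)%N.
  move=> hq hm; have [e el he] := total_mt q hmf; rewrite (has_mt_uniq hm he).
  by apply: leq_trans el _; rewrite leq_mul2r leq_exp2l // hB // orbT.
split=> // g hg q m hq hm; apply: mt_ge_total; exact: mt_ge_le (le _ _ hq hm) hg.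
Qed.

End SingularityIdeal.

Section Relative.
Context {k : nat}.
Implicit Types (F G : cps C (2 + k)) (T : germ C k).

Definition xord n F := forall m, (mdeg (xpart m) < n)%N -> F m = 0.

Lemma xordE n F : xord n F <-> pord (~: tset) n F.
Proof. by split=> h m hm; apply: h; move: hm; rewrite mp_xset mdeg_xm. Qed.

Lemma xordD n F G : xord n F -> xord n G -> xord n (F + G).
Proof. by rewrite !xordE; apply: pordD. Qed.
Lemma xordM n n' F G : xord n F -> xord n' G -> xord (n + n') (F * G).
Proof. by rewrite !xordE; apply: pordM. Qed.
Lemma xordMl n F G : xord n G -> xord n (F * G).
Proof. by move=> h; rewrite -[n]add0n; apply: xordM. Qed.
Lemma xord_liftS n (g : cps C 2) : mt_ge n g -> xord n (liftS g).
Proof. by move=> h m hm; rewrite coef_liftS; case: ifP => // _; apply: h. Qed.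
Lemma xord_coslice n F a : xord n F -> (mdeg a < n)%N -> coslice a F = 0.
Proof. by move=> h an; apply: cpsP => al; rewrite coef_coslice h ?xpartE. Qed.
Lemma coslice_xord n F : (forall a, (mdeg a < n)%N -> coslice a F = 0) -> xord n F.
Proof. by move=> h m hm; rewrite [m]xtE -coef_coslice h. Qed.

Lemma liftS_x : liftS (cvar ord0) = xvar :> cps C (2 + k).
Proof. by rewrite /liftS subst_cvar //; apply: max_cvar. Qed.
Lemma liftS_y : liftS (cvar ord_max) = yvar :> cps C (2 + k).
Proof. by rewrite /liftS subst_cvar //; apply: max_cvar. Qed.

Lemma xord_x : xord 1 (xvar : cps C (2 + k)).
Proof. by rewrite -liftS_x; apply: xord_liftS; apply/mt_ge1P/max_cvar. Qed.
Lemma xord_y : xord 1 (yvar : cps C (2 + k)).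
Proof. by rewrite -liftS_y; apply: xord_liftS; apply/mt_ge1P/max_cvar. Qed.

Lemma xord_split n F : xord n.+1 F -> exists F0 F1,
  [/\ F = xvar * F0 + yvar * F1, xord n F0 & xord n F1].
Proof.
move=> h; pose P m := (m : 'X_{1..2 + k}) (lshift k ord0) != 0%N.
exists (shift U_(lshift k ord0) (mask P F)), (shift U_(lshift k ord_max) (mask (predC P) F)).
have up i : xpart U_(lshift k i)%MM = U_(i)%MM by rewrite U_l -[xm _]addm0 -tm0 xpartE.
split; last 2 first.
- move=> m hm; rewrite coef_shift /mask /=; case: ifP => // _.
  by apply: h; rewrite xpartD up mdegD mdeg1 addn1.
- move=> m hm; rewrite coef_shift /mask /=; case: ifP => // _.
  by apply: h; rewrite xpartD up mdegD mdeg1 addn1.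
rewrite /xvar /yvar !cvarE -!shiftK -?mask_split // => m; rewrite lep1mP negbK => /eqP m0.
  rewrite /mask /=; case: ifP => // /negPn p; apply: h.
  by rewrite mdeg2 !mnmE m0 (eqP p).
by rewrite /mask /P /= m0 eqxx.
Qed.

Lemma xord_ideal_exp n F : xord n F ->
  ideal_exp (ideal_gen (fun h : cps C (2 + k) => h = xvar - liftT 0 \/ h = yvar - liftT 0)) n F.
Proof.
elim: n F => // n ih F /xord_split[F0 [F1 [-> h0 h1]]].
have l0 : liftT (0 : cps C k) = 0 by rewrite /liftT subst0.
apply: ideal_genD; apply: ideal_gen_mem.
  exists xvar, F0; split=> //; last exact: ih.
  by apply: ideal_gen_mem; left; rewrite l0 subr0.
exists yvar, F1; split=> //; last exact: ih.
by apply: ideal_gen_mem; right; rewrite l0 subr0.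
Qed.

Lemma ideal_exp_xord n F :
  ideal_exp (ideal_gen (fun h : cps C (2 + k) => h = xvar - liftT 0 \/ h = yvar - liftT 0)) n F ->
  xord n F.
Proof.
have l0 : liftT (0 : cps C k) = 0 by rewrite /liftT subst0.
have gen S n' G : (forall a, S a -> xord n' a) -> ideal_gen S G -> xord n' G.
  move=> hS [l [a [s [hs ->]]]]; apply: (big_ind (xord n')) => // [u v|i _]; first exact: xordD.
  by apply: xordMl; apply: hS.
elim: n F => // n ih F hF; apply: (gen _ n.+1 F _ hF) => _ [a [b [ha hb ->]]]; rewrite -add1n; apply: xordM.
  by apply: (gen _ 1%N a _ ha) => z [] ->; rewrite l0 subr0; first [exact: xord_x | exact: xord_y].
exact: ih.
Qed.

Section Ideals.
Variable T : germ C k.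

Lemma gideal0 : gideal T 0. Proof. exact/gideal_ideal/ideal_gen0. Qed.
Lemma gidealD a b : gideal T a -> gideal T b -> gideal T (a + b).
Proof. by move=> ha hb; apply/gideal_ideal/ideal_genD; apply: ideal_gen_mem. Qed.
Lemma gidealM a b : gideal T b -> gideal T (a * b).
Proof. by move=> hb; apply/gideal_ideal/ideal_genM; apply: ideal_gen_mem. Qed.
Lemma gidealZ c b : gideal T b -> gideal T (c *: b).
Proof. by move=> hb; rewrite -[b]mul1r scalerAl; apply: gidealM. Qed.
Lemma gidealN a : gideal T a -> gideal T (- a).
Proof. by move=> ha; rewrite -mulN1r; apply: gidealM. Qed.
Lemma gidealB a b : gideal T a -> gideal T b -> gideal T (a - b).
Proof. by move=> ha hb; apply: gidealD => //; apply: gidealN. Qed.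
Lemma gideal_sum I (r : seq I) (P : pred I) (F : I -> cps C k) :
  (forall i, P i -> gideal T (F i)) -> gideal T (\sum_(i <- r | P i) F i).
Proof. by move=> h; apply: big_ind => //; [apply: gideal0|apply: gidealD]. Qed.

Lemma idealM_liftT u : gideal T u -> idealM T (liftT u).
Proof. by move=> h; apply: ideal_gen_mem; exists u. Qed.

Lemma idealM_coslice F a : idealM T F -> gideal T (coslice a F).
Proof.
move=> [n [c [s [hs ->]]]]; rewrite lin_sum; last exact: coslice_lin.
apply: gideal_sum => i _; have [u hu ->] := hs i.
by rewrite mulrC coslice_liftT_mul mulrC; apply: gidealM.
Qed.

Lemma idealM_subst F (phi : 'I_(2 + k) -> cps C (2 + k)) : idealM T F ->
  (forall j, phi (rshift 2 j) = tvar j) -> idealM T (subst F phi).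
Proof.
move=> [n [c [s [hs ->]]]] hphi; rewrite subst_sum; apply: ideal_gen_sum => i _.
rewrite substM; apply: ideal_genM; have [u hu ->] := hs i.
suff -> : subst (liftT u) phi = liftT u by apply: idealM_liftT.
rewrite /liftT subst_subst; apply: eq_subst => j; rewrite /tvar subst_cvar_drop hphi /tvar.
by rewrite max_cvar scale0r subr0.
Qed.

End Ideals.

Definition parg d : 'I_(2 + k) -> cps C (2 + k) := match d with
  | Slope c => arg xvar (xvar * (c%:A + yvar)) tvar
  | Vertical => arg (xvar * yvar) yvar tvar
  end.

Lemma max_parg d i : max_ideal (parg d i).
Proof.
have l z : max_ideal (xvar * z : cps C (2 + k)) by apply: max_idealMr; apply: max_xvar.
case: d => [c|]; apply: max_arg => //; by [apply: max_xvar|apply: max_yvar|apply: max_tvar].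
Qed.

Lemma pullback_relE d F : pullback_rel d (0, 0) F = subst F (parg d).
Proof.
have l0 : liftT (0 : cps C k) = 0 by rewrite /liftT subst0.
by case: d => [c|]; rewrite /= l0 !add0r.
Qed.

Lemma pullback_rel_liftS d g : pullback_rel d (0, 0) (liftS g) = liftS (pullback d g) :> cps C (2 + k).
Proof.
rewrite pullback_relE /liftS subst_subst.
have mx : forall i : 'I_2, max_ideal (cvar (lshift k i) : cps C (2 + k)) by move=> i; apply: max_cvar.
case: d => [c|]; rewrite /pullback subst_subst; apply: eq_subst => i;
  rewrite subst_cvar ?arg_l; try exact: (max_parg (Slope c)); try exact: (max_parg (@Vertical C)).
  move: i; apply: ord2P; rewrite /= arg_l ?substM ?substD ?substA !subst_cvar //.
by move: i; apply: ord2P; rewrite /= arg_l ?substM !subst_cvar.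
Qed.

Lemma pullback_rel_liftT d (u : cps C k) : pullback_rel d (0, 0) (liftT u) = liftT u.
Proof.
rewrite pullback_relE /liftT subst_subst; apply: eq_subst => j; rewrite /tvar subst_cvar.
  by case: d => [c|]; rewrite /= arg_t.
exact: max_parg.
Qed.

Lemma xord_pullback_rel d n F : xord n F -> xord n (pullback_rel d (0, 0) F).
Proof.
elim: n F => // n ih F /xord_split[F0 [F1 [-> h0 h1]]].
have mt_pb (i : 'I_2) : xord 1 (pullback_rel d (0, 0) (liftS (cvar i) : cps C (2 + k))).
  rewrite pullback_rel_liftS; apply/xord_liftS/mt_ge_pullback; apply/mt_ge1P/max_cvar.
rewrite -liftS_x -liftS_y; have := ih _ h0; have := ih _ h1; have := mt_pb ord0; have := mt_pb ord_max.
rewrite !pullback_relE substD !substM => a1 a2 a3 a4.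
by apply: xordD; [exact: (@xordM 1 n _ _ a2 a4)|exact: (@xordM 1 n _ _ a1 a3)].
Qed.

Definition total_rel F q := foldl (fun G d => pullback_rel d (0, 0) G) F q.

Lemma total_rel_rcons F q d : total_rel F (rcons q d) = pullback_rel d (0, 0) (total_rel F q).
Proof. by rewrite /total_rel foldl_rcons. Qed.
Lemma total_relD q F G : total_rel (F + G) q = total_rel F q + total_rel G q.
Proof. by elim/last_ind: q => // q d ih; rewrite !total_rel_rcons ih !pullback_relE substD. Qed.
Lemma total_relM q F G : total_rel (F * G) q = total_rel F q * total_rel G q.
Proof. by elim/last_ind: q => // q d ih; rewrite !total_rel_rcons ih !pullback_relE substM. Qed.
Lemma total_rel0 q : total_rel 0 q = 0.
Proof. by elim/last_ind: q => // q d ih; rewrite !total_rel_rcons ih !pullback_relE subst0. Qed.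
Lemma total_rel_sum q I (r : seq I) P (F : I -> cps C (2 + k)) :
  total_rel (\sum_(i <- r | P i) F i) q = \sum_(i <- r | P i) total_rel (F i) q.
Proof. by apply: (big_morph (fun F => total_rel F q)) => [F' G'|]; [apply: total_relD|apply: total_rel0]. Qed.
Lemma total_rel_liftS q g : total_rel (liftS g) q = liftS (total_transform g q).
Proof. by elim/last_ind: q => // q d ih; rewrite total_rel_rcons total_rcons ih pullback_rel_liftS. Qed.
Lemma total_rel_liftT q (u : cps C k) : total_rel (liftT u) q = liftT u.
Proof. by elim/last_ind: q => // q d ih; rewrite total_rel_rcons ih pullback_rel_liftT. Qed.
Lemma xord_total_rel q n F : xord n F -> xord n (total_rel F q).
Proof. by elim/last_ind: q => // q d ih h; rewrite total_rel_rcons; apply: xord_pullback_rel; apply: ih. Qed.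

(** Modulo the ideal of the base, the total transform of [F] is the reduced one times a factor [W]
    that is constant along the base. Equimultiplicity of the reduced transform thus passes to the
    total transform. *)
Lemma straight_coslice f T F q m a : reduced_singularity f -> straight_es f T F ->
  essential_tree f q -> has_mt (total_transform f q) m -> (mdeg a < m)%N ->
  gideal T (coslice a (total_rel F q)).
Proof.
move=> hf [Ft hes] hq hm am.
have excE d : exceptional_rel d = liftS (exceptional d) :> cps C (2 + k).
  by case: d => [c|]; rewrite /= ?liftS_x ?liftS_y.
have main : exists W h n, [/\ reduced_transform f q h, has_mt h n, (1 < n)%N,
    total_transform f q = W * h & idealM T (total_rel F q - liftS W * Ft q)].
  elim/last_ind: q hq {hm} => [_|q d ih hqd].
    have [h [n [W [h1 h2 h3 h4]]]] := essential_reduced hf (essential_tree_root f).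
    have e : h = f := reduced_transform_uniq h1 (reduced_transform_root f).
    rewrite e in h1 h2; exists 1, f, n; split=> //; first by rewrite mul1r.
    rewrite (es_root hes) /= /liftS subst1 mul1r subrr; exact: ideal_gen0.
  have [hq [h [Hh h2 _]]] := essential_tree_rconsE hqd.
  have [W [h0 [n [h0r h0m n1 WE hI]]]] := ih hq.
  have [G hG1 hG2] := es_blowup hes hqd h0r h0m.
  have [n' hn'] : exists n', has_mt h n'.
    rewrite (reduced_transform_step_eq h0r h0m Hh); have [e _ he] := strict_mt d h0m.
    by exists (1 + e)%N; apply: has_mtM => //; apply: has_mt_exc.
  exists (pullback d W * exceptional d ^+ n.-1), h, n'; split=> //; first exact: has_mt_le hn' h2.
    rewrite total_rcons WE pullbackM (pullback_strict d (proj1 h0m)).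
    rewrite (reduced_transform_step_eq h0r h0m Hh).
    have -> : exceptional d ^+ n = exceptional d ^+ n.-1 * exceptional d.
      by rewrite -exprSr prednK // ltnW.
    by ring.
  rewrite total_rel_rcons.
  set p := pullback_rel d (0, 0).
  have -> : p (total_rel F q) - liftS (pullback d W * exceptional d ^+ n.-1) * Ft (rcons q d) =
    p (total_rel F q - liftS W * Ft q) - liftS (pullback d W) * (exceptional_rel d ^+ n * G - p (Ft q))
     - liftS (pullback d W * exceptional d ^+ n.-1) * (Ft (rcons q d) - exceptional_rel d * G).
    rewrite /p excE !pullback_relE substB substM -!pullback_relE pullback_rel_liftS.
    have -> : liftS (exceptional d) ^+ n = liftS (exceptional d ^+ n.-1) * liftS (exceptional d) :> cps C (2 + k).
      by rewrite -liftSM -exprSr prednK ?(ltnW n1) // [RHS]substX.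
    by rewrite !liftSM; ring.
  apply: ideal_genB; first apply: ideal_genB.
  - rewrite /p pullback_relE; apply: idealM_subst => // j.
    by case: (d) => [c|]; rewrite /= arg_t.
  - exact: ideal_genM.
  - exact: ideal_genM.
have [W [h [n [h1 h2 _ WE hI]]]] := main.
have [_ [A [B [hA hB FtE]]]] := es_deformation hes hq h1 h2.
have {}hA := ideal_exp_xord hA.
have [w hw] : exists w, has_mt W w.
  by apply: has_mt_exists => e; apply: (has_mt_neq0 hm); rewrite WE e mul0r.
have mE : m = (w + n)%N by apply: has_mt_uniq hm _; rewrite WE; apply: has_mtM.
have -> : total_rel F q = liftS W * A + (liftS W * B + (total_rel F q - liftS W * Ft q)).
  by rewrite FtE; ring.
rewrite (linD _ _ (coslice_lin a)).
rewrite (@xord_coslice m) // ?add0r; last by rewrite mE; apply: xordM => //; apply/xord_liftS/(proj1 hw).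
by apply: idealM_coslice; apply: ideal_genD => //; apply: ideal_genM.
Qed.

End Relative.

(** A basis of the span of [L] consisting of members of [L], so that what is known about the members
    applies to the basis. *)
Lemma maximal_family D (L : 'rV[C]_D -> Prop) : exists r (A : 'M[C]_(r, D)),
  [/\ row_free A, forall i, L (row i A) & forall l, L l -> (l <= A)%MS].
Proof.
have ex : exists r, `[< exists A : 'M[C]_(r, D), row_free A /\ forall i, L (row i A) >].
  by exists 0%N; apply/asboolP; exists 0; split=> [|[]//]; rewrite /row_free mxrank0.
have bd r : `[< exists A : 'M[C]_(r, D), row_free A /\ forall i, L (row i A) >] -> (r <= D)%N.
  by move=> /asboolP[A [/eqP e _]]; rewrite -e; apply: rank_leq_col.
case: (ex_maxnP ex bd) => r /asboolP[A [fA hA]] hmax; exists r, A; split=> // l hl.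
apply: contraT => nl; suff : (r + 1 <= r)%N by rewrite addn1 ltnn.
apply: hmax; apply/asboolP; exists (col_mx A l); split; last first.
  move=> i; rewrite -(splitK i); case: (split i) => j /=; first by rewrite rowKu.
  by rewrite rowKd row_id.
rewrite /row_free eqn_leq rank_leq_row /= -addsmxE addn1.
have e : \rank A = r := eqP fA; have : (A < A + l)%MS by rewrite /ltmx addsmxSl /=; apply: contra nl; apply: submx_trans (addsmxSr _ _).
by rewrite ltmxErank e => /andP[].
Qed.

(* The conditions defining the topological singularity ideal are finitely many
   independent linear forms on jets; straightness says that they take values in
   the ideal of the base, so a dual family corrects [F]. *)
Theorem straight_reduction f k (T : germ C k) (F : cps C (2 + k)) : reduced_singularity f ->
  straight_es f T F -> exists Fm, idealM T (F - Fm) /\ forall al, singularity_ideal f (slice al Fm).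
Proof.
move=> hf hF; have [N [hN bN]] := singularity_ideal_power hf.
pose I := 'X_{1..2 < N}; pose D := #|{: I}|.
pose mi (i : 'I_D) : 'X_{1..2} := bmnm (enum_val i : I).
have mi_lt i : (mdeg (mi i) < N)%N by rewrite /mi bmdeg.
have reidx (V : nmodType) (G : I -> V) : \sum_(a : I) G a = \sum_(i < D) G (enum_val i).
  by rewrite (reindex (fun i : 'I_D => enum_val i)) //; apply: onW_bij; apply: enum_val_bij.
(* Linear forms on jets of order [N]: a coefficient of the total transform at a point of the tree,
   in a degree below the required multiplicity. *)
pose Lam (l : 'rV[C]_D) := exists q m a, [/\ essential_tree f q, has_mt (total_transform f q) m,
  (mdeg a < m)%N & forall i, l 0 i = total_transform (zm (mi i)) q a].
have tot0 q : total_transform 0 q = 0 :> cps C 2.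
  by have := totalL q 1 0 0; rewrite !scale1r addr0 => /eqP; rewrite -subr_eq0 opprD addNKr oppr_eq0 => /eqP.
have totS q (J : Type) (r : seq J) (c : J -> C) (G : J -> cps C 2) :
    total_transform (\sum_(j <- r) c j *: G j) q = \sum_(j <- r) c j *: total_transform (G j) q.
  by elim: r => [|j r ih]; rewrite ?big_nil ?tot0 // !big_cons totalL ih.
have jetE (g : cps C 2) q a : (mdeg a < N)%N ->
    total_transform g q a = \sum_(i < D) g (mi i) * total_transform (zm (mi i)) q a.
  move=> aN; rewrite -[g in LHS](subrK (jet N g)) -[g - _]scale1r totalL coefD coefZ mul1r.
  rewrite (mt_ge_total q (jet_rest g)) // add0r /jet totS coef_sum reidx.
  by apply: eq_bigr => i _; rewrite coefZ.
have [r [L [fL hL mL]]] := maximal_family Lam.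
have inI (g : cps C 2) : (forall j, \sum_i L j i * g (mi i) = 0) -> singularity_ideal f g.
  move=> h q m hq hm a am; rewrite jetE; last exact: leq_trans am (bN _ _ hq hm).
  pose l : 'rV[C]_D := \row_i total_transform (zm (mi i)) q a.
  have /submxP[z lz] : (l <= L)%MS by apply: mL; exists q, m, a; split=> // i; rewrite mxE.
  transitivity (\sum_i l 0 i * g (mi i)); first by apply: eq_bigr => i _; rewrite mxE mulrC.
  under eq_bigr => i _ do rewrite lz mxE mulr_suml.
  rewrite exchange_big /= big1 // => j _.
  by under eq_bigr => i _ do rewrite -mulrA; rewrite -mulr_sumr h mulr0.
(* A right inverse of [L] gives polynomials [e j] dual to the chosen forms; [u j] is the value of
   the form [j] on [F], a series in the parameters. *)
have [E LE] := row_freeP fL.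
pose e (j : 'I_r) : cps C 2 := \sum_i E i j *: zm (mi i).
pose u (j : 'I_r) : cps C k := \sum_i L j i *: coslice (mi i) F.
have hu j : gideal T (u j).
  have [q [m [a [hq hm am hl]]]] := hL j.
  suff -> : u j = coslice a (total_rel F q) by apply: straight_coslice hf hF hq hm am.
  have [R [FE hR]] := coslice_split N F; rewrite {1}FE.
  have aN : (mdeg a < N)%N := leq_trans am (bN _ _ hq hm).
  rewrite total_relD (linD _ _ (coslice_lin a)).
  rewrite (xord_coslice (xord_total_rel q (coslice_xord hR)) aN) addr0.
  rewrite total_rel_sum lin_sum; last exact: coslice_lin.
  rewrite reidx; apply: eq_bigr => i _.
  rewrite total_relM total_rel_liftS total_rel_liftT coslice_liftST -hl mxE //.
exists (F - \sum_j liftS (e j) * liftT (u j)); split.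
  rewrite opprB addrC subrK; apply: ideal_gen_sum => j _; apply: ideal_genM.
  exact: idealM_liftT.
move=> al; apply: inI => j'.
have coe (j : 'I_r) i : e j (mi i) = E i j.
  rewrite /e coef_sum (bigD1 i) // coefZ coef_zm eqxx mulr1 big1; first exact: addr0.
  move=> i' ne; rewrite coefZ coef_zm; case: eqP => [e'|]; last by rewrite mulr0.
  by case/eqP: ne; apply: enum_val_inj; apply: val_inj; rewrite /= -/(mi i) e'.
transitivity (\sum_i (L j' i * coslice (mi i) F al - \sum_j L j' i * E i j * u j al)).
  apply: eq_bigr => i _; rewrite (linB _ _ (slice_lin al)) coefB mulrBr; congr (_ - _).
    by rewrite coef_slice coef_coslice.
  rewrite lin_sum; last exact: slice_lin.
  rewrite coef_sum mulr_sumr; apply: eq_bigr => j _.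
  by rewrite slice_liftST coefZ coe mulrCA mulrC.
rewrite sumrB exchange_big /=.
have -> : \sum_(j < r) \sum_(i < D) L j' i * E i j * u j al = \sum_j (j' == j)%:R * u j al.
  apply: eq_bigr => j _; rewrite -mulr_suml; congr (_ * _).
  by have := congr1 (fun M : 'M_r => M j' j) LE; rewrite !mxE.
rewrite (bigD1 j') //= eqxx mul1r [X in _ - (_ + X)]big1 ?addr0 => [|j /negPf ne]; last first.
  by rewrite eq_sym ne mul0r.
apply/eqP; rewrite subr_eq0; apply/eqP; rewrite /u coef_sum; apply: eq_bigr => i _.
by rewrite coefZ.
Qed.

End StraightFamilies.

(** * Flatness and straightness of unfoldings along the singularity ideal *)

Section StraightUnfoldings.
Context {C : numClosedFieldType}.
Implicit Types (f h : cps C 2) (d : direction C) (q : infinitely_near C).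

Lemma idealC_affine k (F h : cps C (2 + k)) :
  idealC (affine_germ k) F h <-> exists b, h = b * F.
Proof.
split=> [[n [c [s [hs ->]]]]|[b ->]]; last first.
  by apply: ideal_genM; apply: ideal_gen_mem; left.
elim/big_ind: _ => [|u v [a ->] [b ->]|i _].
- by exists 0; rewrite mul0r.
- by exists (a + b); rewrite mulrDl.
have [->|[a a0 ->]] := hs i; first by exists (c i).
by exists 0; rewrite a0 /liftT subst0 mulr0 mul0r.
Qed.

Lemma liftT_dep k (b : cps C (2 + k)) : dep tset b -> liftT (on_trivial_section b) = b.
Proof. by move=> h; rewrite liftT_ots; apply: sp_dep; rewrite setCK. Qed.

Lemma dep_liftT k (u : cps C k) : dep tset (liftT u).
Proof.
by move=> m hm; rewrite coef_liftT; case: eqP => // e; move: hm; rewrite mx_tset e xm0 eqxx.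
Qed.

(** A shear in [x], [y] makes [F] regular, and division by it represents classes modulo [F] by
    remainders of bounded degree. A relation modulo [F] becomes an exact relation between
    remainders, to which [relations_generated] applies with the parameters as [J]. *)
Lemma flat_affine k (F : cps C (2 + k)) : special F <> 0 ->
  flat (affine_germ k) (idealC (affine_germ k) F).
Proof.
move=> F0 n a m /idealC_affine[b0 E].
pose iy : 'I_(2 + k) := lshift k ord_max.
have sF0 : sp tset F <> 0.
  move=> e; apply: F0; rewrite -liftS_special in e.
  by rewrite -(@special_liftS _ k (special F)) e /special evalE subst0.
have iyT : iy \in ~: (@tset k) by rewrite in_setC tset_l.
have depF : dep (~: (@tset k)) (sp tset F) by apply: dep_sp.
have [c [b [ci cT reg]]] := regularize sF0 depF iyT.
pose sh := shear iy c; pose sh' := shear iy (fun k => - c k).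
have shK g : subst (subst g sh) sh' = g by apply: shearK.
have ct j : c (rshift 2 j) = 0 by apply: cT; rewrite in_setC tset_r.
have sht j : sh (rshift 2 j) = tvar j by rewrite /sh /shear ct scale0r addr0.
have shT u : subst (liftT u) sh = liftT u.
  by rewrite /liftT subst_subst; apply: eq_subst => j; rewrite subst_cvar ?sht //; apply: max_cvar.
have sht' j : sh' (rshift 2 j) = tvar j by rewrite /sh' /shear ct oppr0 scale0r addr0.
have shT' u : subst (liftT u) sh' = liftT u.
  by rewrite /liftT subst_subst; apply: eq_subst => j; rewrite subst_cvar ?sht' //; apply: max_cvar.
have reg' : regular iy b (subst F sh).
  have e : sp tset (subst F sh) = subst (sp tset F) sh.
    have mz (j : 'I_(2 + k)) : max_ideal (if j \in tset then 0 else cvar j : cps C (2 + k)).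
      by case: ifP => // _; apply: max_cvar.
    rewrite !sp_subst !subst_subst; apply: eq_subst => j.
    case: ifP => [jT|jT]; last first.
      rewrite [RHS]subst_cvar; last exact: max_shear.
      rewrite /sh /shear substD substZ !subst_cvar // jT.
      by rewrite (_ : (iy \in tset) = false) // tset_l.
    by rewrite subst0 /sh /shear cT ?in_setC ?jT // scale0r addr0 subst_cvar // jT.
  have co l : (subst F sh) (U_(iy) *+ l)%MM = (subst (sp tset F) sh) (U_(iy) *+ l)%MM.
    rewrite -e coef_sp ifT //; apply/eqP/mnmP => j; rewrite mnmE mnm0E.
    case: ifP => // jT; rewrite mulmnE mnm1E; have [e'|ne] := eqVneq iy j; last by rewrite mul0n.
    by move: jT; rewrite -e' tset_l.
  by split=> [l lb|]; rewrite co; [apply: (proj1 reg)|exact: (proj2 reg)].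
pose F' := subst F sh.
have wd i : exists qr : cps C (2 + k) * ('I_b -> cps C (2 + k)), (forall j, dep [set~ iy] (qr.2 j)) /\
    subst (m i) sh = qr.1 * F' + \sum_j qr.2 j * cvar iy ^+ j.
  by have [q [r [h1 h2]]] := weierstrass_division reg' (subst (m i) sh); exists (q, r).
have [qr hqr] := choice wd.
pose M i := subst (m i) sh - (qr i).1 * F'.
have ME i : M i = \sum_j (qr i).2 j * cvar iy ^+ j by rewrite /M (proj2 (hqr i)) addrC addKr.
(* The combination is a remainder and at the same time a multiple of [F'], hence zero by uniqueness
   of the division. *)
have sumM : \sum_i M i * liftT (a i) = 0.
  have E' : \sum_i liftT (a i) * subst (m i) sh = subst b0 sh * F'.
    rewrite -substM -E subst_sum; apply: eq_bigr => i _.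
    by rewrite substM shT.
  have E2 : (subst b0 sh - \sum_i liftT (a i) * (qr i).1) * F' =
      \sum_j (\sum_i liftT (a i) * (qr i).2 j) * cvar iy ^+ j.
    rewrite mulrBl -E' mulr_suml -sumrB.
    transitivity (\sum_i liftT (a i) * M i).
      by apply: eq_bigr => i _; rewrite /M mulrBr mulrA.
    under [RHS]eq_bigr do rewrite mulr_suml.
    rewrite exchange_big; apply: eq_bigr => i _; rewrite ME mulr_sumr.
    by apply: eq_bigr => j _; rewrite mulrA.
  have hd j : dep [set~ iy] (\sum_i liftT (a i) * (qr i).2 j).
    apply: dep_sum => i _; apply: depM; last exact: (proj1 (hqr i)).
    apply: (@dep_sub _ _ tset) (dep_liftT (a i)); apply/subsetP => j' hj'.
    by rewrite in_setC in_set1; apply: contraL hj' => /eqP ->; rewrite tset_l.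
  have [_ r0] := weierstrass_unique reg' hd E2.
  transitivity (\sum_j (\sum_i liftT (a i) * (qr i).2 j) * cvar iy ^+ j); last first.
    by rewrite big1 // => j _; rewrite r0 mul0r.
  under [RHS]eq_bigr do rewrite mulr_suml.
  rewrite exchange_big; apply: eq_bigr => i _; rewrite ME mulrC mulr_sumr.
  by apply: eq_bigr => j _; rewrite mulrA.
have [L [B [w [hB hM hBa]]]] := @relations_generated C (2 + k) tset 'I_n unit [:: tt] M
  (fun i _ => liftT (a i)) (fun i _ => dep_liftT (a i)) (fun _ _ => sumM).
have reL (V : nmodType) (G : L -> V) : \sum_x G x = \sum_(i < #|L|) G (enum_val i).
  by rewrite (reindex (fun i : 'I_#|L| => enum_val i)) //; apply: onW_bij; apply: enum_val_bij.
exists #|L|, (fun i j => on_trivial_section (B (enum_val j) i)), (fun j => subst (w (enum_val j)) sh').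
split=> [i|j].
  apply/idealC_affine; exists (subst (qr i).1 sh').
  rewrite -[in LHS](shK (m i)) -[F in RHS]shK -substM.
  have -> : \sum_(j < #|L|) liftT (on_trivial_section (B (enum_val j) i)) * subst (w (enum_val j)) sh' =
      subst (M i) sh'.
    rewrite hM reL subst_sum; apply: eq_bigr => j _; rewrite substM mulrC; congr (_ * _).
    by rewrite -[in RHS](liftT_dep (hB (enum_val j) i)) shT' .
  by rewrite -substB /M opprB addrC subrK.
apply: liftT_inj; rewrite [RHS]/liftT subst0 -[RHS](hBa (enum_val j) tt (mem_head _ _)).
rewrite liftT_sum; apply: eq_bigr => i _; rewrite liftTM liftT_dep // mulrC //.
Qed.

Lemma special_unfolding f n (g : 'I_n -> cps C 2) : special (unfolding f g) = f.
Proof.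
rewrite /unfolding specialD special_liftS special_sum big1 ?addr0 // => i _.
by rewrite specialM special_t mul0r.
Qed.

Lemma mt_geM_inv (W g : cps C 2) w m : has_mt W w -> mt_ge (w + m) (W * g) -> mt_ge m g.
Proof.
move=> hW h; have [->|/eqP g0] := eqVneq g 0; first exact: mt_ge_zero.
have [e he] := has_mt_exists g0; have := has_mt_le (has_mtM hW he) h.
by rewrite leq_add2l => le; apply: mt_ge_le le (proj1 he).
Qed.

Section UnfoldingTree.
Variables (f : cps C 2) (n : nat) (g : 'I_n -> cps C 2).
Hypotheses (hf : reduced_singularity f) (hg : forall i, singularity_ideal f (g i)).

(** The [g i] are divided by the same exceptional power as the reduced equation, so that the reduced
    transform of an unfolding is again an unfolding. *)
Definition blowup_step (s : cps C 2 * ('I_n -> cps C 2)) d :=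
  (exceptional d * strict d (mtf s.1) s.1, fun i => exceptional d * strict d (mtf s.1) (s.2 i)).
Definition blowup_tree q := foldl blowup_step (f, g) q.

Lemma blowup_tree_rcons q d : blowup_tree (rcons q d) = blowup_step (blowup_tree q) d.
Proof. by rewrite /blowup_tree foldl_rcons. Qed.

(** The total transforms of [f] and of the [g i] contain the same cofactor [W]; cancelling it turns
    the condition on total transforms in [singularity_ideal] into one on the transforms computed
    here. *)
Lemma blowup_treeP q : essential_tree f q ->
  [/\ reduced_transform f q (blowup_tree q).1, has_mt (blowup_tree q).1 (mtf (blowup_tree q).1),
    (1 < mtf (blowup_tree q).1)%N & forall i, mt_ge (mtf (blowup_tree q).1) ((blowup_tree q).2 i)].
Proof.
move=> hq.
suff [W [h1 h2 WE gE]] : exists W, [/\ reduced_transform f q (blowup_tree q).1,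
    mt_ge 2 (blowup_tree q).1, total_transform f q = W * (blowup_tree q).1 &
    forall i, total_transform (g i) q = W * (blowup_tree q).2 i].
  have [f0 _ _] := hf; have [mf hmf] := has_mt_exists f0.
  have [e _ he] := total_mt q hmf.
  have h0 : (blowup_tree q).1 <> 0 by move=> z; apply: (has_mt_neq0 he); rewrite WE z mulr0.
  have W0 : W <> 0 by move=> z; apply: (has_mt_neq0 he); rewrite WE z mul0r.
  have hm := has_mt_mtf h0; have [w hw] := has_mt_exists W0.
  split=> //; first exact: has_mt_le hm h2.
  move=> i; apply: (mt_geM_inv hw); rewrite -gE; apply: hg hq _.
  by rewrite WE; apply: has_mtM.
elim/last_ind: q hq => [_|q d ih hqd].
  have [f0 f2 _] := hf; exists 1; split=> //; first exact: reduced_transform_root.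
    by rewrite mul1r.
  by move=> i; rewrite mul1r.
have [hq [h [Hh h2 _]]] := essential_tree_rconsE hqd.
have [W [h0r h0m WE gE]] := ih hq.
have [f0 _ _] := hf; have [mf hmf] := has_mt_exists f0; have [e _ he] := total_mt q hmf.
have h0 : (blowup_tree q).1 <> 0 by move=> z; apply: (has_mt_neq0 he); rewrite WE z mulr0.
have W0 : W <> 0 by move=> z; apply: (has_mt_neq0 he); rewrite WE z mul0r.
have hm := has_mt_mtf h0; have [w hw] := has_mt_exists W0.
have hgi i : mt_ge (mtf (blowup_tree q).1) ((blowup_tree q).2 i).
  by apply: (mt_geM_inv hw); rewrite -gE; apply: hg hq _; rewrite WE; apply: has_mtM.
have m1 : (0 < mtf (blowup_tree q).1)%N by apply: ltnW; apply: has_mt_le hm h0m.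
have eX : exceptional d ^+ mtf (blowup_tree q).1 =
    exceptional d ^+ (mtf (blowup_tree q).1).-1 * exceptional d by rewrite -exprSr prednK.
exists (pullback d W * exceptional d ^+ (mtf (blowup_tree q).1).-1).
rewrite blowup_tree_rcons /blowup_step /=; split.
- exact: reduced_transform_step.
- by rewrite -(reduced_transform_step_eq h0r hm Hh).
- rewrite total_rcons WE pullbackM (pullback_strict d (proj1 hm)) eX.
  by rewrite -!mulrA.
- move=> i; rewrite total_rcons gE pullbackM (pullback_strict d (hgi i)) eX.
  by rewrite -!mulrA.
Qed.

Lemma embedded_unfolding h (g' : 'I_n -> cps C 2) : h <> 0 ->
  embedded_deformation h (affine_germ n) (unfolding h g').
Proof.
by move=> h0; split=> [h'|]; [|apply: flat_affine]; rewrite special_unfolding.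
Qed.

Lemma xord_unfolding m h (g' : 'I_n -> cps C 2) : mt_ge m h -> (forall i, mt_ge m (g' i)) ->
  xord m (unfolding h g').
Proof.
move=> hh hg'; apply: xordD; first exact: xord_liftS.
apply: (big_ind (xord m)) => // [u v|i _]; first exact: xordD.
by apply: xordMl; apply: xord_liftS.
Qed.

Lemma pullback_rel_unfolding d h (g' : 'I_n -> cps C 2) :
  pullback_rel d (0, 0) (unfolding h g') = unfolding (pullback d h) (fun i => pullback d (g' i)).
Proof.
have tv i : tvar i = liftT (cvar i) :> cps C (2 + n).
  by rewrite /liftT subst_cvar //; apply: max_cvar.
rewrite pullback_relE /unfolding substD -pullback_relE pullback_rel_liftS subst_sum; congr (_ + _).
apply: eq_bigr => i _; rewrite substM -!pullback_relE pullback_rel_liftS; congr (_ * _).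
by rewrite tv pullback_rel_liftT.
Qed.

Lemma unfoldingM z h (g' : 'I_n -> cps C 2) :
  unfolding (z * h) (fun i => z * g' i) = liftS z * unfolding h g'.
Proof.
rewrite /unfolding mulrDr liftSM mulr_sumr; congr (_ + _).
by apply: eq_bigr => i _; rewrite liftSM mulrCA.
Qed.

Lemma eq_unfolding h h' (g1 g2 : 'I_n -> cps C 2) : h = h' -> g1 =1 g2 ->
  unfolding h g1 = unfolding h' g2.
Proof. by move=> -> e; rewrite /unfolding; congr (_ + _); apply: eq_bigr => i _; rewrite e. Qed.

Theorem straight_unfolding : straight_es f (affine_germ n) (unfolding f g).
Proof.
exists (fun q => unfolding (blowup_tree q).1 (blowup_tree q).2).
have excE d : exceptional_rel d = liftS (exceptional d) :> cps C (2 + n).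
  by case: d => [c|]; rewrite /= ?liftS_x ?liftS_y.
split=> //.
- move=> q h m hq hh hm; have [h1 h2 h3 h4] := blowup_treeP hq.
  have e := reduced_transform_uniq hh h1; rewrite e in hh hm *.
  rewrite (has_mt_uniq hm h2); split; first exact: embedded_unfolding (has_mt_neq0 h2).
  exists (unfolding (blowup_tree q).1 (blowup_tree q).2), 0; split; last by rewrite addr0.
    by apply: xord_ideal_exp; apply: xord_unfolding => //; apply: (proj1 h2).
  exact: ideal_gen0.
- move=> p d h m hpd hh hm; have [hp _] := essential_tree_rconsE hpd.
  have [h1 h2 h3 h4] := blowup_treeP hp.
  have e := reduced_transform_uniq hh h1; rewrite e in hm.
  have em := has_mt_uniq hm h2; rewrite em in hm *.
  exists (unfolding (strict d (mtf (blowup_tree p).1) (blowup_tree p).1)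
    (fun i => strict d (mtf (blowup_tree p).1) ((blowup_tree p).2 i))).
    rewrite pullback_rel_unfolding excE.
    have -> : liftS (exceptional d) ^+ mtf (blowup_tree p).1 =
        liftS (exceptional d ^+ mtf (blowup_tree p).1) :> cps C (2 + n) by rewrite /liftS substX.
    rewrite -unfoldingM (@eq_unfolding (exceptional d ^+ _ * _) (pullback d (blowup_tree p).1) _
      (fun i => pullback d ((blowup_tree p).2 i))).
    - by rewrite subrr; apply: ideal_gen0.
    - by rewrite -(pullback_strict d (proj1 h2)).
    - by move=> i; rewrite -(pullback_strict d (h4 i)).
  by rewrite blowup_tree_rcons excE -unfoldingM subrr; apply: ideal_gen0.
Qed.

End UnfoldingTree.
End StraightUnfoldings.

(** * Bases modulo the trivial deformations *)

Section Bases.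
Context {C : numClosedFieldType}.
Implicit Types (f g h : cps C 2).

Lemma basis_mod_exists (W J : cps C 2 -> Prop) N : J 0 ->
  (forall c g h, J g -> J h -> J (c *: g + h)) -> (forall h, mt_ge N h -> J h) ->
  exists n (g : 'I_n -> cps C 2), basis_mod W J g.
Proof.
move=> J0 Jlin JN.
pose ind n := exists g : 'I_n -> cps C 2, (forall i, W (g i)) /\
  forall c : 'I_n -> C, J (\sum_i c i *: g i) -> forall i, c i = 0.
pose D := #|{: 'X_{1..2 < N}}|; pose mi (i : 'I_D) : 'X_{1..2} := bmnm (enum_val i).
have bd n : `[< ind n >] -> (n <= D)%N.
  move=> /asboolP[g [_ hg]]; pose G : 'M[C]_(n, D) := \matrix_(j, i) g j (mi i).
  have /eqP <- : row_free G; last exact: rank_leq_col.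
  apply: inj_row_free => v vG; apply/rowP => j; rewrite mxE; apply: (hg (fun j => v 0 j)).
  apply: JN => m mN; have := congr1 (fun A : 'rV_D => A 0 (enum_rank (BMultinom mN))) vG.
  rewrite !mxE coef_sum => e; rewrite -[RHS]e; apply: eq_bigr => i _.
  by rewrite mxE /mi enum_rankK coefZ.
have ex : exists n, `[< ind n >].
  by exists 0%N; apply/asboolP; exists (fun=> 0); split=> [[]//|c _ []].
case: (ex_maxnP ex bd) => n /asboolP[g [Wg ig]] hmax; exists n, g; split=> // h Wh.
apply: contrapT => no; suff : (n.+1 <= n)%N by rewrite ltnn.
apply: hmax; apply/asboolP.
exists (fun i => if unlift ord_max i is Some j then g j else h); split=> [i|c].
  by case: unliftP.
rewrite big_ord_recr /= unlift_none.
have -> : \sum_(i < n) c (widen_ord (leqnSn n) i) *: (if unlift ord_max (widen_ord (leqnSn n) i) is Some j then g j else h)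
    = \sum_(i < n) c (widen_ord (leqnSn n) i) *: g i.
  apply: eq_bigr => i _; have -> : widen_ord (leqnSn n) i = lift ord_max i.
    by apply: val_inj => /=; rewrite /bump leqNgt ltn_ord.
  by rewrite liftK.
have [c0|c0] := eqVneq (c ord_max) 0.
  rewrite c0 scale0r addr0 => /ig ci i; case: (unliftP ord_max i) => [j ->|-> //].
  have <- : widen_ord (leqnSn n) j = lift ord_max j; last exact: ci.
  by apply: val_inj => /=; rewrite /bump leqNgt ltn_ord.
move=> hJ; case: no; exists (fun i => - (c ord_max)^-1 * c (widen_ord (leqnSn n) i)).
have := Jlin (c ord_max)^-1 _ _ hJ J0; rewrite addr0 scalerDr scalerA mulVf // scale1r addrC.
congr (J (_ + _)); rewrite scaler_sumr -sumrN; apply: eq_bigr => i _.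
by rewrite scalerA mulNr scaleNr opprK.
Qed.

Lemma mt_ge_split n g : mt_ge n.+1 g ->
  exists g0 g1, [/\ g = cvar ord0 * g0 + cvar ord_max * g1, mt_ge n g0 & mt_ge n g1].
Proof.
move=> hg; have [F0 [F1 [e h0 h1]]] := @xord_split C 0 n (liftS g) (xord_liftS hg).
have sp (F : cps C (2 + 0)) : xord n F -> mt_ge n (special F).
  by move=> h m hm; rewrite coef_special; apply: h; rewrite -[xm m]addm0 -tm0 xpartE.
exists (special F0), (special F1); split; try exact: sp.
by rewrite -(@special_liftS C 0 g) e specialD !specialM special_x special_y.
Qed.

Section TangentSpaces.
Variables (f : cps C 2) (sec : bool).

(* [sec] stands for deformations with section: their infinitesimal
   automorphisms fix the origin. *)
Definition admissible (A : cps C 2) := sec -> max_ideal A.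

(** The tangent space to the orbit of [f] under coordinate changes and multiplication by units:
    [<f, m j(f)>] or [<f, j(f)>] according to [sec]. *)
Definition trivial_ideal h := exists u A B,
  [/\ admissible A, admissible B & h = u * f + derivation A B f].

Lemma trivial_ideal0 : trivial_ideal 0.
Proof. by exists 0, 0, 0; split=> //; rewrite /derivation !mul0r !addr0. Qed.

Lemma admissible_lin c A B : admissible A -> admissible B -> admissible (c *: A + B).
Proof. by move=> hA hB s; rewrite /max_ideal coefD coefZ hA // hB // mulr0 addr0. Qed.

Lemma admissibleM g A : admissible A -> admissible (g * A).
Proof. by move=> hA s; apply: max_idealMl; apply: hA. Qed.

Lemma trivial_ideal_lin c g h : trivial_ideal g -> trivial_ideal h -> trivial_ideal (c *: g + h).
Proof.
move=> [u [A [B [hA hB ->]]]] [u' [A' [B' [hA' hB' ->]]]].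
exists (c *: u + u'), (c *: A + A'), (c *: B + B'); split; try exact: admissible_lin.
by rewrite /derivation !mulrDl -!scalerAl !scalerDr; ring.
Qed.

Lemma trivial_idealM g h : trivial_ideal h -> trivial_ideal (g * h).
Proof.
move=> [u [A [B [hA hB ->]]]]; exists (g * u), (g * A), (g * B); split; try exact: admissibleM.
by rewrite /derivation; ring.
Qed.

Lemma trivial_idealD g h : trivial_ideal g -> trivial_ideal h -> trivial_ideal (g + h).
Proof. by move=> hg hh; rewrite -[g]scale1r; apply: trivial_ideal_lin. Qed.

Lemma trivial_ideal_self u : trivial_ideal (u * f).
Proof. by exists u, 0, 0; split=> //; rewrite /derivation !mul0r !addr0. Qed.

Lemma trivial_ideal_derivation A B : admissible A -> admissible B -> trivial_ideal (derivation A B f).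
Proof. by move=> hA hB; exists 0, A, B; split=> //; rewrite mul0r add0r. Qed.

(** One degree more than in [jacobian_finite]: the extra factor [x] or [y] makes the components of
    the vector field vanish at the origin. *)
Lemma trivial_ideal_power : reduced_singularity f -> exists N, forall h, mt_ge N h -> trivial_ideal h.
Proof.
move=> hf; have [N hN] := jacobian_finite hf; exists N.+1 => h /mt_ge_split[h0 [h1 [-> m0 m1]]].
have part (i : 'I_2) g : mt_ge N g -> trivial_ideal (cvar i * g).
  move=> /hN[u [v [w ->]]]; exists (cvar i * u), (cvar i * v), (cvar i * w); split.
  - by move=> _; apply/max_idealMr/max_cvar.
  - by move=> _; apply/max_idealMr/max_cvar.
  - by rewrite /derivation; ring.
by apply: trivial_idealD; apply: part.
Qed.

Lemma trivial_ideal_gen S h : (forall s, S s -> trivial_ideal s) -> ideal_gen S h -> trivial_ideal h.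
Proof.
move=> hS [n [a [s [hs ->]]]]; elim/big_ind: _ => [||i _]; first exact: trivial_ideal0.
  by move=> *; apply: trivial_idealD.
by apply: trivial_idealM; apply: hS.
Qed.

Definition tangent_sum h := exists a b, [/\ trivial_ideal a, singularity_ideal f b & h = a + b].

(** The [e j] are independent modulo the sum of both ideals, not merely modulo the trivial one: this
    is what excludes them from a straight family later. *)
Lemma bases_exist : reduced_singularity f -> exists n (g : 'I_n -> cps C 2) r (e : 'I_r -> cps C 2),
  [/\ basis_mod (singularity_ideal f) trivial_ideal g,
    forall c : 'I_r -> C, tangent_sum (\sum_i c i *: e i) -> forall i, c i = 0 &
    forall h, exists (c : 'I_n -> C) (d : 'I_r -> C),
      trivial_ideal (h - \sum_i c i *: g i - \sum_i d i *: e i)].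
Proof.
move=> hf; have [N hN] := trivial_ideal_power hf.
have [n [g hg]] := basis_mod_exists (singularity_ideal f) trivial_ideal0 trivial_ideal_lin hN.
have [||h hh|r [e [_ ie se]]] := @basis_mod_exists (fun=> True) tangent_sum N.
- by exists 0, 0; split; rewrite ?addr0 //; [apply: trivial_ideal0|apply: singularity_ideal0].
- move=> c u v [a [b [ha hb ->]]] [a' [b' [ha' hb' ->]]].
  exists (c *: a + a'), (c *: b + b'); split; [exact: trivial_ideal_lin|exact: singularity_ideal_lin|].
  by rewrite scalerDr addrACA.
- by exists h, 0; split; rewrite ?addr0 //; [apply: hN|apply: singularity_ideal0].
exists n, g, r, e; split=> // h; have [d [a [b [ha hb hE]]]] := se h I.
have [_ _ sg] := hg; have [c hc] := sg b hb; exists c, d.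
have -> : h - \sum_i c i *: g i - \sum_i d i *: e i = a + (b - \sum_i c i *: g i).
  by rewrite addrAC hE addrA.
exact: trivial_idealD.
Qed.

End TangentSpaces.

Lemma derivation_jacobian f A B : jacobian_ideal f (derivation A B f).
Proof.
by apply: ideal_genD; apply: ideal_genM; apply: ideal_gen_mem; [left|right].
Qed.

Lemma trivial_ideal_sec f h : trivial_ideal f true h <->
  ideal_gen (fun h => h = f \/ ideal_mul max_ideal (jacobian_ideal f) h) h.
Proof.
split=> [[u [A [B [hA hB ->]]]]|].
  apply: ideal_genD; first by apply: ideal_genM; apply: ideal_gen_mem; left.
  apply: ideal_gen_mem; right; apply: ideal_genD; apply: ideal_gen_mem.
    exists A, (pderiv ord0 f); split=> //; first exact: hA.
    by apply: ideal_gen_mem; left.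
  exists B, (pderiv ord_max f); split=> //; first exact: hB.
  by apply: ideal_gen_mem; right.
apply: trivial_ideal_gen => s [->|]; first by rewrite -[f in trivial_ideal _ _ f]mul1r; apply: trivial_ideal_self.
apply: trivial_ideal_gen => _ [a [b [ha hb ->]]].
have [n [c [s' [hs ->]]]] := hb; rewrite mulr_sumr.
elim/big_ind: _ => [||i _]; first exact: trivial_ideal0.
  by move=> *; apply: trivial_idealD.
have hac : admissible true (a * c i) by move=> _; apply: max_idealMr.
rewrite mulrA; case: (hs i) => ->.
  exists 0, (a * c i), 0; split=> //; by rewrite /derivation !mul0r addr0 add0r.
by exists 0, 0, (a * c i); split=> //; rewrite /derivation !mul0r !add0r.
Qed.

Lemma trivial_ideal_nosec f h : trivial_ideal f false h <->
  ideal_gen (fun h => h = f \/ jacobian_ideal f h) h.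
Proof.
split=> [[u [A [B [hA hB ->]]]]|].
  apply: ideal_genD; first by apply: ideal_genM; apply: ideal_gen_mem; left.
  by apply: ideal_gen_mem; right; apply: derivation_jacobian.
apply: trivial_ideal_gen => s [->|]; first by rewrite -[f in trivial_ideal _ _ f]mul1r; apply: trivial_ideal_self.
apply: trivial_ideal_gen => _ [->|->].
  exists 0, 1, 0; split=> //; by rewrite /derivation !mul0r mul1r addr0 add0r.
by exists 0, 0, 1; split=> //; rewrite /derivation !mul0r mul1r !add0r.
Qed.

End Bases.

(** * Trivialization along flows *)

Section FlowTrivialization.
Context {C : numClosedFieldType}.

Local Notation x := (cvar ord0 : cps C 2).
Local Notation y := (cvar ord_max : cps C 2).

Lemma sum_bool2 (V : nmodType) (G : bool * bool -> V) : \sum_p G p =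
  G (true, true) + G (true, false) + (G (false, true) + G (false, false)).
Proof.
rewrite (eq_bigr (fun p => G (p.1, p.2))) => [|[] //].
by rewrite -(pair_bigA _ (fun a b => G (a, b))) !big_bool.
Qed.

Section Setting.
Variables (f : cps C 2) (sec : bool) (l : nat) (e : 'I_l -> cps C 2).
Hypothesis span : exists N, forall h, exists u A B (c : 'I_l -> C),
  [/\ admissible sec A, admissible sec B, h = u * f + derivation A B f + \sum_i c i *: e i &
    mt_ge N h -> forall i, c i = 0].

Lemma max_decomp (A : cps C 2) : max_ideal A -> exists a0 a1, A = x * a0 + y * a1.
Proof.
by move=> hA; have [a0 [a1 [-> _ _]]] := @mt_ge_split C 0 A ltac:(by apply/mt_ge1P); exists a0, a1.
Qed.

(** Generators of the ideal of admissible components: [x], [y] with section; without, 1 padded by 0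
    so that both cases share the index type. *)
Definition generator (b : bool) : cps C 2 := if sec then (if b then x else y) else (if b then 1 else 0).

Lemma admissible_decomp A : admissible sec A -> exists a : bool -> cps C 2, A = \sum_b a b * generator b.
Proof.
rewrite /admissible /generator; case: sec => hA.
  have [a0 [a1 ->]] := max_decomp (hA isT); exists (fun b => if b then a0 else a1).
  by rewrite big_bool /= mulrC [y * _]mulrC.
by exists (fun=> A); rewrite big_bool /= mulr1 mulr0 addr0.
Qed.

Lemma admissible_generator b : admissible sec (generator b).
Proof. by rewrite /admissible /generator; case: sec => // _; case: b; apply: max_cvar. Qed.

Section Field.
Variables (k : nat) (H : cps C (2 + k)) (s : 'I_k) (v : 'I_l -> 'I_k).
Hypotheses (Hf : special H = f) (vs : forall i, v i != s).
Hypothesis He : forall i, special (pderiv (rshift 2 (v i)) H) = e i.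

Lemma special_pderiv i (F : cps C (2 + k)) :
  special (pderiv (lshift k i) F) = pderiv i (special F).
Proof.
apply: cpsP => m; rewrite coef_special !coef_pderiv coef_special xm_l U_l -xmD //.
Qed.

(** [span] is spread from the special fibre over the base by [division_dep]. The coefficients of the
    parameter derivatives of [H] come out free of [x], [y], as the components of a vector field on
    the base must be. *)
Lemma infinitesimal_trivialization w : exists (al X Y : cps C (2 + k)) (eta : 'I_l -> cps C k),
  [/\ w = al * H + X * pderiv (lshift k ord0) H + Y * pderiv (lshift k ord_max) H +
        \sum_i liftT (eta i) * pderiv (rshift 2 (v i)) H,
    sec -> on_trivial_section X = 0 & sec -> on_trivial_section Y = 0].
Proof.
have [N hN] := span.
pose F (z : option (bool * bool)) := match z with
  | None => H
  | Some (b, i) => liftS (generator b) * pderiv (lshift k (if i then ord0 else ord_max)) H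
  end.
have spE G : sp tset G = liftS (special G) by rewrite liftS_special.
have spF z : sp tset (F z) = liftS (match z with None => f
  | Some (b, i) => generator b * pderiv (if i then ord0 else ord_max) f end).
  case: z => [[b i]|]; rewrite spE /= ?Hf // specialM special_liftS special_pderiv Hf //.
have main mu : (mdeg mu <= N)%N -> mp tset mu = 0%MM ->
    exists (a : option (bool * bool) -> cps C (2 + k)) (c : 'I_l -> C),
    (mdeg mu = N -> forall j, c j = 0) /\
    zm mu = \sum_i a i * sp tset (F i) + \sum_j c j *: sp tset (pderiv (rshift 2 (v j)) H).
  rewrite mp_tset => _ mu0.
  have mE : mu = xm (xpart mu) by rewrite {1}[mu]xtE mu0 addm0.
  have [u [A [B [c [hA hB E c0]]]]] := hN (zm (xpart mu)).
  have [a hA'] := admissible_decomp hA; have [b hB'] := admissible_decomp hB.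
  exists (fun z => match z with None => liftS u | Some (z1, z2) => liftS (if z2 then a z1 else b z1) end), c.
  split=> [muN|].
    apply: c0; have := @mt_ge_zm C 2 (xpart mu).
    by rewrite -muN {3}mE mdeg_xm.
  rewrite {1}mE -liftS_zm E /liftS !substD; congr (_ + _); last first.
    by rewrite subst_sum; apply: eq_bigr => i _; rewrite substZ spE He.
  rewrite (bigD1 None) // spF -/(liftS (u * f)) liftSM; congr (_ + _).
  transitivity (\sum_(p : bool * bool) liftS (if p.2 then a p.1 else b p.1) * sp tset (F (Some p))).
    rewrite sum_bool2 !spF /= /derivation hA' hB' !big_bool /= /liftS !(substD, substM).
    ring.
  rewrite [RHS](reindex_omap (@Some _) id) /=; last by case.
  by apply: eq_big => [[z1 z2]|[z1 z2] _]; rewrite ?eqxx.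
have [a [c [hc wE]]] := division_dep main w.
exists (a None), (\sum_b a (Some (b, true)) * liftS (generator b)),
  (\sum_b a (Some (b, false)) * liftS (generator b)), (fun j => on_trivial_section (c j)).
have ots0 (z : bool -> cps C (2 + k)) : sec -> on_trivial_section (\sum_b z b * liftS (generator b)) = 0.
  move=> hs; have h b : on_trivial_section (liftS (generator b) : cps C (2 + k)) = 0.
    by rewrite ots_liftS (admissible_generator b hs) scale0r.
  by rewrite big_bool /= otsD !otsM !h !mulr0 addr0.
split; try exact: ots0.
rewrite wE; congr (_ + _); last by apply: eq_bigr => j _; rewrite liftT_dep.
rewrite (bigD1 None) //= -addrA; congr (_ + _).
transitivity (\sum_(p : bool * bool) a (Some p) * F (Some p)).
  rewrite (reindex_omap (@Some _) id) /=; last by case.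
  by apply: eq_big => [[z1 z2]|[z1 z2] _]; rewrite ?eqxx.
by rewrite sum_bool2 !big_bool /=; ring.
Qed.

Lemma sp_pderiv_t j (P : cps C (2 + k)) :
  sp (~: tset) (pderiv (rshift 2 j) P) = pderiv (rshift 2 j) (sp (~: tset) P).
Proof.
apply: cpsP => m; rewrite coef_sp !coef_pderiv coef_sp !mp_xset xpartD.
have -> : xpart U_(rshift 2 j)%MM = 0%MM by rewrite U_r -[tm _]add0m -xm0 xpartE.
by rewrite addm0; case: ifP; rewrite ?mulr0.
Qed.

Lemma pderiv_sp_x i (P : cps C (2 + k)) : pderiv (lshift k i) (sp (~: tset) P) = 0.
Proof.
apply: cpsP => m; rewrite coef_pderiv coef_sp mp_xset xpartD ifF ?mulr0 //.
by rewrite -mdeg_eq0 mdeg_xm mdegD U_l -[xm _]addm0 -tm0 xpartE mdeg1 addn1.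
Qed.

Lemma vf_arg (X Y : cps C (2 + k)) (t : 'I_k -> cps C (2 + k)) P : vf (arg X Y t) P =
  X * pderiv (lshift k ord0) P + Y * pderiv (lshift k ord_max) P +
  \sum_j t j * pderiv (rshift 2 j) P.
Proof.
rewrite /vf big_split_ord sum2 /= !arg_l /=; congr (_ + _).
by apply: eq_bigr => j _; rewrite arg_t.
Qed.

(** A field whose components [X], [Y] vanish on the trivial section is tangent to it, so first
    integrals restrict to it. *)
Lemma vf_sp (X Y X' Y' P : cps C (2 + k)) (t : 'I_k -> cps C k) :
  sp (~: tset) X = 0 -> sp (~: tset) Y = 0 ->
  vf (arg X Y (fun j => liftT (t j))) P = 0 ->
  vf (arg X' Y' (fun j => liftT (t j))) (sp (~: tset) P) = 0.
Proof.
move=> hX hY; rewrite !vf_arg !pderiv_sp_x !mulr0 !add0r => /(congr1 (sp (~: tset))).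
rewrite (linD _ _ (sp_lin _)) (linD _ _ (sp_lin _)) !spM hX hY !mul0r !add0r (lin0 (sp_lin _)).
move=> h; rewrite -[RHS]h sp_sum; apply: eq_bigr => j _.
by rewrite spM sp_pderiv_t -(liftT_ots (liftT (t j))) ots_liftT.
Qed.

(** Decomposing the [s]-derivative of [H] gives a field with [s]-component 1 that multiplies [H] by
    a series. Its first integrals extending the coordinates of the hyperplane [s = 0] define a map
    which pulls [H] back to a unit multiple of itself and has [n s = 0]: the family is induced from
    its restriction to this hyperplane. *)
Lemma flow_trivialization : exists (u P Q : cps C (2 + k)) (n : 'I_k -> cps C k),
  [/\ u \is a GRing.unit, eval H P Q (fun j => liftT (n j)) = u * H,
    exists P1, P = xvar + tvar s * P1, exists Q1, Q = yvar + tvar s * Q1 &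
    [/\ sec -> on_trivial_section P = 0, sec -> on_trivial_section Q = 0,
    forall j, exists n1, n j = (if j == s then 0 else cvar j) + cvar s * n1,
    n s = 0 & forall j, (forall i, v i != j) -> j != s -> n j = cvar j]].
Proof.
have [al [X [Y [eta [wE hX hY]]]]] := infinitesimal_trivialization (pderiv (rshift 2 s) H).
pose eta' j := \sum_i (v i == j)%:R * eta i.
pose t j : cps C k := (j == s)%:R - eta' j.
have eta's : eta' s = 0 by rewrite /eta' big1 // => i _; rewrite (negPf (vs i)) mul0r.
have ts : t s = 1 by rewrite /t eta's eqxx subr0.
pose V := arg (- X) (- Y) (fun j => liftT (t j)).
(* The base components of the map are solved with the base part of the field and then restricted to
   the trivial section, which makes them series in the parameters alone. *)
pose V' := arg 0 0 (fun j => liftT (t j)).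
have l1 : liftT (1 : cps C k) = 1 by rewrite /liftT subst1.
have Vs : V (rshift 2 s) = 1 by rewrite /V arg_t ts l1.
have V's : V' (rshift 2 s) = 1 by rewrite /V' arg_t ts l1.
have VH : vf V H = al * H.
  rewrite vf_arg; have -> : \sum_j liftT (t j) * pderiv (rshift 2 j) H =
      pderiv (rshift 2 s) H - \sum_i liftT (eta i) * pderiv (rshift 2 (v i)) H.
    rewrite /t; under eq_bigr do rewrite liftTB mulrBl.
    rewrite sumrB (bigD1 s) //= eqxx l1 mul1r big1 ?addr0 => [|j /negPf js]; last first.
      by rewrite js /liftT subst0 mul0r.
    congr (_ - _); under eq_bigr do rewrite /eta' liftT_sum mulr_suml.
    rewrite exchange_big; apply: eq_bigr => i _; rewrite (bigD1 (v i)) //= eqxx mul1r.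
    by rewrite big1 ?addr0 // => j /negPf jv; rewrite eq_sym jv mul0r /liftT subst0 mul0r.
  by rewrite wE; ring.
have solve V0 (h : cps C (2 + k)) : V0 (rshift 2 s) = 1 ->
    exists u, vf V0 u = 0 /\ forall m : 'X_{1..2 + k}, m (rshift 2 s) = 0%N -> u m = h m.
  by move=> h0; have [u [h1 h2]] := cauchy_problem 0 h0 h; exists u; rewrite mul0r addr0 in h1.
have [P [VP P0]] := solve V xvar Vs; have [Q [VQ Q0]] := solve V yvar Vs.
have solveN j := solve V' (if j == s then 0 else tvar j) V's.
have [M hM] := choice solveN.
pose n j := on_trivial_section (M j).
have nE j : liftT (n j) = sp (~: tset) (M j) by rewrite liftT_ots.
have sp0 : sp (~: tset) (0 : cps C (2 + k)) = 0 := lin0 (sp_lin _).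
have Vn j : vf V (liftT (n j)) = 0.
  by rewrite nE; apply: (@vf_sp 0 0) => //; apply: (proj1 (hM j)).
have n0 j (m : 'X_{1..2 + k}) : m (rshift 2 s) = 0%N -> liftT (n j) m = (if j == s then 0 else tvar j : cps C (2 + k)) m.
  move=> m0; rewrite nE coef_sp mp_xset (proj2 (hM j)) //; case: eqP => // ne.
  case: eqP => // _; rewrite /tvar cvarE coef_zm; case: eqP => // em.
  by case: ne; rewrite em U_r -[tm _]add0m -xm0 xpartE.
have uniq u : vf V u = 0 -> (forall m : 'X_{1..2 + k}, m (rshift 2 s) = 0%N -> u m = 0) -> u = 0.
  exact: cauchy_unique.
have otsP (R z : cps C (2 + k)) : sec -> vf V R = 0 ->
    (forall m : 'X_{1..2 + k}, m (rshift 2 s) = 0%N -> R m = z m) ->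
    sp (~: tset) z = 0 -> on_trivial_section R = 0.
  move=> hs VR R0 z0; apply: liftT_inj; rewrite liftT_ots [RHS]/liftT subst0.
  have spN (Z : cps C (2 + k)) : on_trivial_section Z = 0 -> sp (~: tset) (- Z) = 0.
    by move=> Z0; rewrite (linN _ (sp_lin _)) -liftT_ots Z0 /liftT subst0 oppr0.
  apply: uniq; first by apply: (vf_sp _ _ (spN _ (hX hs)) (spN _ (hY hs)) VR).
  move=> m m0; have := congr1 (fun g : cps C (2 + k) => g m) z0.
  by rewrite !coef_sp R0.
have spx i : sp (~: tset) (cvar (lshift k i) : cps C (2 + k)) = 0.
  apply: cpsP => m; rewrite coef_sp mp_xset; case: eqP => // e0.
  have xU : xpart U_(lshift k i)%MM = U_(i)%MM by rewrite U_l -[xm _]addm0 -tm0 xpartE.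
  rewrite cvarE coef_zm; case: eqP => // em; move: e0; rewrite em xU.
  by move/eqP; rewrite -mdeg_eq0 mdeg_xm mdeg1.
have divs (R z : cps C (2 + k)) : (forall m : 'X_{1..2 + k}, m (rshift 2 s) = 0%N -> R m = z m) ->
    exists R1, R = z + tvar s * R1.
  move=> h; exists (shift U_(rshift 2 s) (R - z)).
  rewrite /tvar cvarE -shiftK ?[z + _]addrC ?subrK // => m; rewrite lep1mP negbK => /eqP m0.
  by rewrite coefB h // subrr.
have liftTs (z : cps C k) : liftT (cvar s * z) = tvar s * liftT z.
  by rewrite liftTM; congr (_ * _); rewrite /liftT subst_cvar //; apply: max_tvar.
have lcv (j : 'I_k) : liftT (cvar j) = tvar j :> cps C (2 + k).
  by rewrite /liftT subst_cvar //; apply: max_tvar.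
have l0 : liftT (0 : cps C k) = 0 by rewrite /liftT subst0.
have nuniq j (z : cps C k) : vf V (liftT z) = 0 ->
    (forall m : 'X_{1..2 + k}, m (rshift 2 s) = 0%N -> liftT z m = (if j == s then 0 else tvar j : cps C (2 + k)) m) ->
    n j = z.
  move=> Vz z0; apply: liftT_inj; apply/eqP; rewrite -subr_eq0; apply/eqP/uniq.
    by rewrite (linB _ _ (vf_lin _)) Vn Vz subrr.
  by move=> m m0; rewrite coefB n0 // z0 // subrr.
have mZ : forall i, vf V (arg P Q (fun j => liftT (n j)) i) = 0.
  by apply: (@ord2kP _ (fun i => vf V (arg P Q (fun j => liftT (n j)) i) = 0)) => [||j];
    rewrite (arg_x, arg_y, arg_t).
have ls (i : 'I_2) : (lshift k i == rshift 2 s) = false.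
  by apply/eqP => /(congr1 val) /=; have := ltn_ord i; lia.
have [u hu uE] := @flow_transport C (2 + k) V (rshift 2 s) al H
  (arg P Q (fun j => liftT (n j))) Vs VH mZ ltac:(
   apply: (@ord2kP _ (fun i => forall m : 'X_{1..2 + k}, m (rshift 2 s) = 0%N -> arg P Q (fun j => liftT (n j)) i m =
     (if i == rshift 2 s then 0 else cvar i : cps C (2 + k)) m)) => [||j] m m0;
   [by rewrite arg_x ls P0|by rewrite arg_y ls Q0|by rewrite arg_t n0 // (inj_eq (@rshift_inj _ _))]).
exists u, P, Q, n; split=> //; try exact: divs.
split.
- by move=> hs; apply: otsP hs VP P0 (spx _).
- by move=> hs; apply: otsP hs VQ Q0 (spx _).
- move=> j; have [R1 e1] := divs _ _ (n0 j).
  exists (on_trivial_section R1); rewrite -[LHS]ots_liftT e1 otsD otsM.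
  by rewrite -!lcv; case: ifP => _; rewrite -?l0 !ots_liftT.
- apply: nuniq; rewrite ?l0 ?(lin0 (vf_lin _)) // eqxx //.
- move=> j jv js; apply: nuniq; last by move=> m _; rewrite (negPf js) lcv.
  rewrite lcv /tvar vf_cvar /V arg_t /t (negPf js) /eta' big1 ?subrr //.
  by move=> i _; rewrite (negPf (jv i)) mul0r.
Qed.

End Field.
End Setting.
End FlowTrivialization.

(** * Absorbing a perturbation *)

Section Absorption.
Context {C : numClosedFieldType}.

Local Notation x := (cvar ord0 : cps C 2).
Local Notation y := (cvar ord_max : cps C 2).

Definition at_point {n} (g : cps C 2) (X Y : cps C n) : cps C n :=
  subst g (fun i => if i == ord0 then X else Y).

Lemma at_point_subst {n m} g (X Y : cps C n) (phi : 'I_n -> cps C m) :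
  subst (at_point g X Y) phi = at_point g (subst X phi) (subst Y phi).
Proof. by rewrite /at_point subst_subst; apply: eq_subst; apply: ord2P. Qed.

Lemma at_point_id (g : cps C 2) : at_point g x y = g.
Proof. by rewrite -[RHS]subst_id; apply: eq_subst; apply: ord2P. Qed.

Lemma eval_unfolding n m f (g : 'I_m -> cps C 2) (X Y : cps C n) c :
  max_ideal X -> max_ideal Y -> (forall i, max_ideal (c i)) ->
  eval (unfolding f g) X Y c = at_point f X Y + \sum_i c i * at_point (g i) X Y.
Proof.
move=> hX hY hc; rewrite evalE /unfolding substD -evalE eval_liftS // subst_sum; congr (_ + _).
by apply: eq_bigr => i _; rewrite substM -!evalE eval_t // eval_liftS.
Qed.

Lemma max_special k (F : cps C (2 + k)) : max_ideal (special F) -> max_ideal F.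
Proof. by rewrite /max_ideal /special evalE coef_subst0. Qed.

Section Absorb.
Variables (f : cps C 2) (sec : bool) (l : nat) (e : 'I_l -> cps C 2).
Hypothesis span : exists N, forall h, exists u A B (c : 'I_l -> C),
  [/\ admissible sec A, admissible sec B, h = u * f + derivation A B f + \sum_i c i *: e i &
    mt_ge N h -> forall i, c i = 0].

(* The perturbation is absorbed by the flow of the vector field which lifts
   [d/ds] to the family with equation [F0 + s w]. *)
Lemma absorb k (X0 Y0 w : cps C (2 + k)) (phi : 'I_l -> cps C k) (a : cps C k) :
  special X0 = x -> special Y0 = y -> (forall i, max_ideal (phi i)) -> max_ideal a ->
  (sec -> on_trivial_section X0 = 0) -> (sec -> on_trivial_section Y0 = 0) ->
  exists u X1 Y1 phi1, [/\ u \is a GRing.unit,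
    eval (unfolding f e) X1 Y1 (fun i => liftT (phi1 i)) =
      u * (eval (unfolding f e) X0 Y0 (fun i => liftT (phi i)) + liftT a * w),
    (exists X2, X1 = X0 + liftT a * X2) /\ (exists Y2, Y1 = Y0 + liftT a * Y2),
    forall i, exists z, phi1 i = phi i + a * z &
    (sec -> on_trivial_section X1 = 0) /\ (sec -> on_trivial_section Y1 = 0)].
Proof.
move=> sX sY hphi ha oX oY.
have mX : max_ideal X0 by apply: max_special; rewrite sX; apply: max_cvar.
have mY : max_ideal Y0 by apply: max_special; rewrite sY; apply: max_cvar.
(* The base is enlarged by a time [s] and one free parameter [v i] for each [e i]; in the family [H]
   over it, the derivatives by the [v i] restrict to the [e i], as the trivialization requires. *)
pose k' := (k + 1 + l)%N.
pose tE (j : 'I_k) : 'I_k' := lshift l (lshift 1 j).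
pose s : 'I_k' := lshift l (rshift k ord0).
pose v (i : 'I_l) : 'I_k' := rshift (k + 1) i.
have vs i : v i != s by apply/eqP => /(congr1 val) /=; lia.
have vt i j : v i != tE j by apply/eqP => /(congr1 val) /=; have := ltn_ord j; lia.
have ts j : tE j != s by apply/eqP => /(congr1 val) /=; have := ltn_ord j; lia.
pose io (F : cps C (2 + k)) : cps C (2 + k') := eval F xvar yvar (fun j => tvar (tE j)).
pose H : cps C (2 + k') := io (at_point f X0 Y0) +
  \sum_i tvar (v i) * io (at_point (e i) X0 Y0) + tvar s * io w.
have sio F : special (io F) = special F.
  rewrite /special /io [LHS]evalE eval_subst; apply: eval_ext => [||j]; first exact: special_x.
    exact: special_y.
  exact: special_t.
have sat g : special (at_point g X0 Y0) = g.
  have -> : special (at_point g X0 Y0) = at_point g (special X0) (special Y0).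
    exact: at_point_subst.
  by rewrite sX sY at_point_id.
have Hf : special H = f.
  rewrite /H !specialD sio sat specialM special_t mul0r addr0 special_sum big1 ?addr0 // => i _.
  by rewrite specialM special_t mul0r.
have dio i F : pderiv (rshift 2 (v i)) (io F) = 0.
  rewrite /io evalE chain_rule big1 // => j _.
  suff -> : pderiv (rshift 2 (v i)) (arg xvar yvar (fun j => tvar (tE j)) j) = 0 :> cps C (2 + k') by rewrite mulr0.
  have lr (a1 : 'I_2) (b1 : 'I_k') : (rshift 2 b1 == lshift k' a1) = false.
    by apply/eqP => /(congr1 val) /=; have := ltn_ord a1; lia.
  move: j; apply: ord2kP => [||j]; rewrite (arg_x, arg_y, arg_t) pderiv_cvar ?lr //.
  by rewrite (inj_eq (@rshift_inj _ _)) (negPf (vt i j)).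
have He i : special (pderiv (rshift 2 (v i)) H) = e i.
  rewrite /H !pderivD dio pderivM dio mulr0 addr0 pderiv_cvar (inj_eq (@rshift_inj _ _)) (negPf (vs i)).
  rewrite mul0r addr0 add0r pderiv_sum (bigD1 i) //= pderivM dio mulr0 addr0 pderiv_cvar eqxx mul1r.
  rewrite big1 ?addr0 ?sio ?sat // => j ji.
  rewrite pderivM dio mulr0 addr0 pderiv_cvar (inj_eq (@rshift_inj _ _)) (inj_eq (@rshift_inj _ _)).
  by rewrite eq_sym (negPf ji) mul0r.
have [u [P [Q [n [hu uE [P1 PE] [Q1 QE] [oP oQ n1 ns nt]]]]]] :=
  flow_trivialization span Hf vs He.
(* The specialization [s = a], [v i = phi i] of the enlarged base recovers the perturbed family;
   since [a] divides the displacement of the flow, it will divide all corrections. *)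
pose psi (j : 'I_k') : cps C k := match split j with
  | inl j1 => match split j1 with inl j2 => cvar j2 | inr _ => a end
  | inr i => phi i end.
have psi_t j : psi (tE j) = cvar j.
  rewrite /psi /tE; case: splitP => j1 /= e1; last by have := ltn_ord j; lia.
  case: splitP => j2 /= e2; last by have := ltn_ord j; lia.
  by congr cvar; apply: val_inj; rewrite /= -e2 -e1.
have psi_s : psi s = a.
  rewrite /psi /s; case: splitP => j1 /= e1; last by lia.
  by case: splitP => j2 /= e2 //; have := ltn_ord j2; lia.
have psi_v i : psi (v i) = phi i.
  rewrite /psi /v; case: splitP => j1 /= e1; first by have := ltn_ord j1; lia.
  by congr phi; apply: val_inj => /=; lia.
have mpsi j : max_ideal (psi j).
  rewrite /psi; case: splitP => j1 _ //; case: splitP => j2 _ //; exact: max_cvar.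
have mlT k1 (z : cps C k1) : max_ideal z -> max_ideal (liftT z) by apply: max_ideal_subst.
pose sg (F : cps C (2 + k')) : cps C (2 + k) := eval F xvar yvar (fun j => liftT (psi j)).
have sgT z : sg (liftT z) = liftT (subst z psi).
  rewrite /sg eval_liftT => [|j]; last exact: mlT.
  by rewrite /liftT subst_subst.
have sgM F G : sg (F * G) = sg F * sg G by apply: substM.
have sgD F G : sg (F + G) = sg F + sg G by apply: substD.
have sgt j : sg (tvar j) = liftT (psi j) by rewrite /sg eval_t //; apply: mlT.
have sgx : sg xvar = xvar by rewrite /sg eval_x //; apply: max_xvar.
have sgy : sg yvar = yvar by rewrite /sg eval_y //; apply: max_yvar.
pose A := sg P; pose B := sg Q.
have AE : A = xvar + liftT a * sg P1 by rewrite /A PE sgD sgM sgx sgt psi_s.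
have BE : B = yvar + liftT a * sg Q1 by rewrite /B QE sgD sgM sgy sgt psi_s.
have mA : max_ideal A.
  by rewrite AE; apply: max_idealD; [apply: max_xvar|apply: max_idealMr; apply: mlT].
have mB : max_ideal B.
  by rewrite BE; apply: max_idealD; [apply: max_yvar|apply: max_idealMr; apply: mlT].
(* The given maps [X0], [Y0] are transported by the specialized flow in [x], [y]; it fixes the old
   parameters. *)
pose rho (F : cps C (2 + k)) := eval F A B tvar.
pose m j := subst (n j) psi.
have lcv (j : 'I_k) : liftT (cvar j) = tvar j :> cps C (2 + k).
  by rewrite /liftT subst_cvar //; apply: max_tvar.
have m_t j : m (tE j) = cvar j by rewrite /m nt // subst_cvar // psi_t.
have m_s : m s = 0 by rewrite /m ns subst0.
have m_v i : exists z, m (v i) = phi i + a * z.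
  have [z zE] := n1 (v i); exists (subst z psi).
  by rewrite /m zE (negPf (vs i)) substD substM !subst_cvar // psi_v psi_s.
have mm j : max_ideal (m j).
  rewrite /m; apply: max_ideal_subst; have [z ->] := n1 j.
  by apply: max_idealD; [case: ifP => // _; apply: max_cvar|apply: max_idealMr; apply: max_cvar].
have eio F A' B' c : max_ideal A' -> max_ideal B' -> (forall j, max_ideal (c j)) ->
    eval (io F) A' B' c = eval F A' B' (fun j => c (tE j)) :> cps C (2 + k).
  move=> hA' hB' hc; rewrite [LHS]eval_subst; apply: eval_ext => [||j]; first exact: eval_x.
    exact: eval_y.
  exact: eval_t.
have eH A' B' c : max_ideal A' -> max_ideal B' -> (forall j, max_ideal (c j)) ->
    eval H A' B' c = eval (at_point f X0 Y0) A' B' (fun j => c (tE j)) +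
      \sum_i c (v i) * eval (at_point (e i) X0 Y0) A' B' (fun j => c (tE j)) +
      c s * eval w A' B' (fun j => c (tE j)) :> cps C (2 + k).
  move=> hA' hB' hc; rewrite -!(eio _ _ _ c) // {1}/H evalE !substD substM subst_sum -!evalE.
  rewrite eval_t //; congr (_ + _ + _); apply: eq_bigr => i _.
  by rewrite substM -!evalE eval_t // eio.
have rat g : rho (at_point g X0 Y0) = at_point g (rho X0) (rho Y0) by apply: at_point_subst.
have mrho F : max_ideal F -> max_ideal (rho F) by apply: max_ideal_subst.
exists (sg u), (rho X0), (rho Y0), (fun i => m (v i)); split.
- by rewrite unit_cpsE /sg evalE coef_subst0 -unit_cpsE.
- rewrite !eval_unfolding //; try exact: mrho; try by move=> i; apply: mlT.
  have := congr1 sg uE; rewrite sgM.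
  have -> : sg (eval H P Q (fun j => liftT (n j))) = eval H A B (fun j => sg (liftT (n j))).
    exact: eval_subst.
  have -> : eval H A B (fun j => sg (liftT (n j))) = eval H A B (fun j => liftT (m j)).
    by apply: eval_ext => // j; apply: sgT.
  rewrite eH //; last by move=> j; apply: mlT.
  have er F : eval F A B (fun j => liftT (m (tE j))) = rho F.
    by apply: eval_ext => // j; rewrite m_t lcv.
  rewrite !er rat m_s [liftT 0]subst0 mul0r addr0.
  under eq_bigr do rewrite er rat.
  move=> ->; congr (_ * _).
  rewrite {1}/sg eH; try exact: max_cvar; last by move=> j; apply: mlT.
  have ei F : eval F xvar yvar (fun j => liftT (psi (tE j))) = F.
    by rewrite -[RHS]subst_arg_id; apply: eval_ext => // j; rewrite psi_t lcv.
  rewrite !ei psi_s; congr (_ + _ + _).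
  by apply: eq_bigr => i _; rewrite ei psi_v.
- have diff (Z : cps C (2 + k)) : exists Z2, rho Z = Z + liftT a * Z2.
    have [c cE] := @subst_diff C (2 + k) (2 + k) Z (arg A B tvar) (arg xvar yvar tvar)
      (max_arg mA mB (fun j => max_tvar j)) (max_arg (@max_xvar _ _) (@max_yvar _ _) (fun j => max_tvar j)).
    exists (c (lshift k ord0) * sg P1 + c (lshift k ord_max) * sg Q1).
    have e1 : rho Z - Z = \sum_i c i * (arg A B tvar i - arg xvar yvar tvar i).
      by rewrite -cE; congr (_ - _); rewrite -[LHS]subst_arg_id.
    apply/eqP; rewrite addrC -subr_eq e1 big_split_ord sum2 /= !(arg_x, arg_y) AE BE.
    rewrite big1 => [|j _]; last by rewrite !arg_t subrr mulr0.
    by apply/eqP; ring.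
  by split; apply: diff.
- by [].
- have ots_eval (Z : cps C (2 + k)) : sec -> on_trivial_section Z = 0 -> on_trivial_section (rho Z) = 0.
    move=> hs Z0.
    have otsg R : on_trivial_section (sg R) = subst (on_trivial_section R) psi.
      transitivity (eval R (on_trivial_section xvar) (on_trivial_section yvar)
        (fun j => on_trivial_section (liftT (psi j)))); first exact: eval_subst.
      transitivity (eval R (subst 0 psi) (subst 0 psi) (fun j => subst (cvar j) psi)); last first.
        by apply/esym; apply: eval_subst.
      apply: eval_ext => [||j]; first by rewrite subst0; apply: eval_x.
        by rewrite subst0; apply: eval_y.
      by rewrite ots_liftT subst_cvar.
    rewrite -Z0; transitivity (eval Z (on_trivial_section A) (on_trivial_section B)
      (fun j => on_trivial_section (tvar j))); first exact: eval_subst.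
    apply: eval_ext => [||j]; first by rewrite otsg oP // subst0.
      by rewrite otsg oQ // subst0.
    by rewrite -lcv ots_liftT.
  by split=> hs; apply: ots_eval => //; [apply: oX|apply: oY].
Qed.

(** The terms are absorbed one at a time; each step multiplies the remaining ones by a unit, which
    is put into the [w j]. *)
Lemma absorb_all k (T : germ C k) d (a : 'I_d -> cps C k) (w : 'I_d -> cps C (2 + k))
    (X0 Y0 : cps C (2 + k)) (phi : 'I_l -> cps C k) :
  special X0 = x -> special Y0 = y -> (forall i, max_ideal (phi i)) -> (forall j, gideal T (a j)) ->
  (sec -> on_trivial_section X0 = 0) -> (sec -> on_trivial_section Y0 = 0) ->
  exists u X1 Y1 phi1, [/\ u \is a GRing.unit,
    eval (unfolding f e) X1 Y1 (fun i => liftT (phi1 i)) =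
      u * (eval (unfolding f e) X0 Y0 (fun i => liftT (phi i)) + \sum_j liftT (a j) * w j),
    [/\ special X1 = x, special Y1 = y, idealM T (X1 - X0) & idealM T (Y1 - Y0)],
    (forall i, gideal T (phi1 i - phi i)) /\ (forall i, max_ideal (phi1 i)) &
    (sec -> on_trivial_section X1 = 0) /\ (sec -> on_trivial_section Y1 = 0)].
Proof.
elim: d a w X0 Y0 phi => [|d ih] a w X0 Y0 phi sX sY hphi ha oX oY.
  exists 1, X0, Y0, phi; rewrite unitr1 mul1r big_ord0 addr0; split=> //; split=> //.
  - by rewrite subrr; apply: ideal_gen0.
  - by rewrite subrr; apply: ideal_gen0.
  - by move=> i; rewrite subrr; apply: gideal0.
have ma := gideal_proper (ha ord_max).
have [u1 [X1 [Y1 [phi1 [hu1 E1 [[X2 XE] [Y2 YE]] p1 [o1 o2]]]]]] :=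
  absorb (w ord_max) sX sY hphi ma oX oY.
have sa : special (liftT (a ord_max)) = 0 by rewrite special_liftT ma scale0r.
have sX1 : special X1 = x by rewrite XE specialD specialM sa mul0r addr0.
have sY1 : special Y1 = y by rewrite YE specialD specialM sa mul0r addr0.
have mp1 i : max_ideal (phi1 i).
  by have [z ->] := p1 i; apply: max_idealD => //; apply: max_idealMr.
have [u2 [X3 [Y3 [phi3 [hu2 E2 [s3 s3' i3 i3'] [p3 m3] o3]]]]] :=
  ih (fun j => a (widen_ord (leqnSn d) j)) (fun j => u1 * w (widen_ord (leqnSn d) j)) X1 Y1 phi1
    sX1 sY1 mp1 (fun j => ha _) o1 o2.
exists (u2 * u1), X3, Y3, phi3; split=> //; first by rewrite unitrM hu2.
- rewrite E2 E1 big_ord_recr /= -mulrA; congr (_ * _).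
  have -> : \sum_(j < d) liftT (a (widen_ord (leqnSn d) j)) * (u1 * w (widen_ord (leqnSn d) j)) =
      u1 * \sum_(j < d) liftT (a (widen_ord (leqnSn d) j)) * w (widen_ord (leqnSn d) j).
    by rewrite mulr_sumr; apply: eq_bigr => j _; rewrite mulrCA.
  by rewrite -mulrDr -addrA [X in _ * (_ + X)]addrC.
- split=> //.
    rewrite -(subrKA X1); apply: ideal_genD => //; rewrite XE addrC addKr mulrC.
    by apply: ideal_genM; apply: idealM_liftT.
  rewrite -(subrKA Y1); apply: ideal_genD => //; rewrite YE addrC addKr mulrC.
  by apply: ideal_genM; apply: idealM_liftT.
- split=> // i; rewrite -(subrKA (phi1 i)); apply: gidealD => //.
  by have [z ->] := p1 i; rewrite addrC addKr mulrC; apply: gidealM.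
Qed.

End Absorb.
End Absorption.

(** * The Euler field of the base *)

Section Euler.
Context {C : numClosedFieldType}.

Local Notation x := (cvar ord0 : cps C 2).
Local Notation y := (cvar ord_max : cps C 2).

Section EulerField.
Context {k : nat}.
Implicit Types (F G X Y : cps C (2 + k)) (al be : 'X_{1..k}).

Definition euler_field : 'I_(2 + k) -> cps C (2 + k) := arg 0 0 tvar.
Definition euler F := vf euler_field F.

Lemma coef_eulerE F m : euler F m = (mdeg (tpart m))%:R * F m.
Proof.
rewrite /euler vf_arg !mul0r !add0r coef_sum mdegE natr_sum mulr_suml.
by apply: eq_bigr => j _; rewrite /tvar coef_euler mnmE.
Qed.

Lemma slice_euler al F : slice al (euler F) = (mdeg al)%:R *: slice al F.
Proof. by apply: cpsP => a; rewrite coefZ !coef_slice coef_eulerE tpartE. Qed.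

Lemma special_euler F : special (euler F) = 0.
Proof. by rewrite -slice0 slice_euler mdeg0 scale0r. Qed.

Lemma ots_euler F : on_trivial_section F = 0 -> on_trivial_section (euler F) = 0.
Proof.
move=> h; apply: cpsP => al; rewrite coef_ots coef_eulerE -coef_ots h.
exact: mulr0.
Qed.

Definition relative_derivation (A B F : cps C (2 + k)) : cps C (2 + k) :=
  A * pderiv (lshift k ord0) F + B * pderiv (lshift k ord_max) F.

Lemma slice_pderiv al i F : slice al (pderiv (lshift k i) F) = pderiv i (slice al F).
Proof.
apply: cpsP => a; rewrite coef_slice !coef_pderiv coef_slice mnmDE xm_l tm_l addn0 U_l xmD.
by rewrite -!addmA [(tm al + _)%MM]addmC.
Qed.

Lemma slice_relative_derivation al A B F : slice al (relative_derivation A B F) =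
  \sum_(be : 'X_{1..k < (mdeg al).+1} | (be <= al)%MM)
    derivation (slice be A) (slice be B) (slice (al - be)%MM F).
Proof.
rewrite (linD _ _ (slice_lin al)) !sliceM -big_split; apply: eq_bigr => be _.
by rewrite !slice_pderiv.
Qed.

Section Coordinates.
Variables (X Y : cps C (2 + k)).
Hypotheses (sX : special X = x) (sY : special Y = y).

Let Xx := pderiv (lshift k ord0) X.
Let Xy := pderiv (lshift k ord_max) X.
Let Yx := pderiv (lshift k ord0) Y.
Let Yy := pderiv (lshift k ord_max) Y.
Let D := Xx * Yy - Xy * Yx.

(** The field in [x], [y] that acts on functions of [X], [Y] as the Euler field of the base does,
    found by Cramer's rule from the Jacobian matrix of [X], [Y]. *)
Definition euler_x := D^-1 * (euler X * Yy - euler Y * Xy).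
Definition euler_y := D^-1 * (euler Y * Xx - euler X * Yx).

Lemma euler_jacobian_unit : D \is a GRing.unit.
Proof.
rewrite unit_cpsE; have -> : D 0%MM = special D 0%MM by rewrite /special evalE coef_subst0.
have -> : special D = 1.
  rewrite /D specialB !specialM /Xx /Xy /Yx /Yy !special_pderiv sX sY !pderiv_cvar /=.
  by rewrite mulr1 mulr0 subr0.
by rewrite coef1 eqxx oner_eq0.
Qed.

Lemma euler_at_point (g : cps C 2) :
  euler (at_point g X Y) = relative_derivation euler_x euler_y (at_point g X Y).
Proof.
rewrite /euler /at_point vf_subst sum2 /relative_derivation !chain_rule !sum2 /=.
set a := subst _ _; set b := subst _ _.
have uD := euler_jacobian_unit.
rewrite /euler_x /euler_y -/(euler X) -/(euler Y) -/Xx -/Xy -/Yx -/Yy.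
transitivity (D^-1 * D * (a * euler X + b * euler Y)); first by rewrite mulVr // mul1r.
by rewrite /D; ring.
Qed.

Lemma special_euler_x : special euler_x = 0.
Proof. by rewrite specialM specialB !specialM !special_euler !mul0r subrr mulr0. Qed.
Lemma special_euler_y : special euler_y = 0.
Proof. by rewrite specialM specialB !specialM !special_euler !mul0r subrr mulr0. Qed.

Lemma ots_euler_xy : on_trivial_section X = 0 -> on_trivial_section Y = 0 ->
  on_trivial_section euler_x = 0 /\ on_trivial_section euler_y = 0.
Proof.
by move=> /ots_euler hX /ots_euler hY; rewrite !otsM !otsB !otsM hX hY !mul0r subrr mulr0.
Qed.

End Coordinates.

Lemma relative_derivation_liftT A B (u : cps C k) F :
  relative_derivation A B (liftT u * F) = liftT u * relative_derivation A B F.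
Proof.
have h i : pderiv (lshift k i) (liftT u) = 0.
  have -> : liftT u = sp (~: tset) (liftT u) by rewrite -liftT_ots ots_liftT.
  exact: pderiv_sp_x.
by rewrite /relative_derivation !pderivM !h !mul0r !add0r; ring.
Qed.

End EulerField.

(* [euler_x], [euler_y] is the vector field induced by the scaling of the base.
   Degree by degree in the parameters, [he] gives the vanishing of [psi], and
   rigidity shows that this field preserves the singularity ideal. *)
Theorem equisingular_parameters f sec n (g : 'I_n -> cps C 2) r (e : 'I_r -> cps C 2)
    k (F X Y : cps C (2 + k)) (phi : 'I_n -> cps C k) (psi : 'I_r -> cps C k) :
  reduced_singularity f -> (forall i, singularity_ideal f (g i)) ->
  (forall c : 'I_r -> C, tangent_sum f sec (\sum_i c i *: e i) -> forall i, c i = 0) ->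
  (forall al, singularity_ideal f (slice al F)) ->
  special X = x -> special Y = y ->
  (sec -> on_trivial_section X = 0) -> (sec -> on_trivial_section Y = 0) ->
  (forall i, max_ideal (phi i)) -> (forall j, max_ideal (psi j)) ->
  F = at_point f X Y + \sum_i liftT (phi i) * at_point (g i) X Y +
    \sum_j liftT (psi j) * at_point (e j) X Y ->
  forall j, psi j = 0.
Proof.
move=> hf hg he hF sX sY oX oY mphi mpsi FE.
set A := euler_x X Y; set B := euler_y X Y.
have ED u v : euler (u + v) = euler u + euler v :> cps C (2 + k) by apply: (linD _ _ (vf_lin _)).
have EM u v : euler (u * v) = euler u * v + u * euler v :> cps C (2 + k) by apply: vfM.
have Esum (I : finType) (G : I -> cps C (2 + k)) : euler (\sum_i G i) = \sum_i euler (G i).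
  by rewrite /euler lin_sum //; apply: vf_lin.
have rD u v : relative_derivation A B (u + v) = relative_derivation A B u + relative_derivation A B v.
  by rewrite /relative_derivation !pderivD; ring.
have rsum (I : finType) (G : I -> cps C (2 + k)) :
    relative_derivation A B (\sum_i G i) = \sum_i relative_derivation A B (G i).
  apply: (big_morph (relative_derivation A B)) => //.
  by rewrite /relative_derivation !pderiv0 !mulr0 addr0.
(* On functions of [X], [Y] the Euler field acts through [A], [B]; only the derivatives of the
   coefficients [phi], [psi] are left over. *)
have EF : euler F = relative_derivation A B F +
    \sum_i euler (liftT (phi i)) * at_point (g i) X Y +
    \sum_j euler (liftT (psi j)) * at_point (e j) X Y.
  rewrite FE !ED !Esum !rD !rsum euler_at_point //.
  have tw m (c : 'I_m -> cps C k) (h : 'I_m -> cps C 2) :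
      \sum_i euler (liftT (c i) * at_point (h i) X Y) =
      \sum_i relative_derivation A B (liftT (c i) * at_point (h i) X Y) +
      \sum_i euler (liftT (c i)) * at_point (h i) X Y.
    rewrite -big_split; apply: eq_bigr => i _ /=.
    by rewrite EM euler_at_point // relative_derivation_liftT addrC.
  by rewrite !tw; ring.
pose preserve al := forall h, singularity_ideal f h ->
  singularity_ideal f (derivation (slice al A) (slice al B) h).
(* The three assertions need each other in lower degree: the first feeds on preservation of I and on
   the coefficients of the [g i (X, Y)], and these in turn on the vanishing of [psi]. *)
suff main : forall m al, (mdeg al <= m)%N -> [/\ forall j, psi j al = 0, preserve al &
    forall i, singularity_ideal f (slice al (at_point (g i) X Y))].
  by move=> j; apply: cpsP => al; have [h _ _] := main (mdeg al) al (leqnn _); apply: h.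
have slE (u : cps C k) be : slice be (euler (liftT u)) = ((mdeg be)%:R * u be)%:A.
  by rewrite slice_euler slice_liftT scalerA.
have sub_lt (al be : 'X_{1..k}) : (be <= al)%MM -> be != 0%MM -> (mdeg (al - be) < mdeg al)%N.
  move=> le b0; rewrite -{2}(submK le) mdegD -addn1 leq_add2l lt0n mdeg_eq0 //.
have zero_case al : mdeg al = 0%N -> [/\ forall j, psi j al = 0, preserve al &
    forall i, singularity_ideal f (slice al (at_point (g i) X Y))].
  move=> /eqP; rewrite mdeg_eq0 => /eqP ->; split.
  - by move=> j; apply: mpsi.
  - move=> h _; rewrite !slice0 special_euler_x special_euler_y /derivation !mul0r addr0.
    exact: singularity_ideal0.
  - move=> i; rewrite slice0.
    have -> : special (at_point (g i) X Y) = at_point (g i) (special X) (special Y).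
      exact: at_point_subst.
    by rewrite sX sY at_point_id.
elim=> [|m ih] al alm; first by apply: zero_case; apply/eqP; rewrite -leqn0.
have [/zero_case //|al0] := eqVneq (mdeg al) 0%N.
have [lt|] := ltnP (mdeg al) m.+1; first by apply: ih; rewrite -ltnS.
move=> ge; have {alm ge} am : mdeg al = m.+1 by apply/eqP; rewrite eqn_leq alm.
have small (be : 'X_{1..k}) : (mdeg be < mdeg al)%N -> (mdeg be <= m)%N by rewrite am ltnS.
have top be : (be <= al)%MM -> ~~ (mdeg be < mdeg al)%N -> be = al.
  move=> le; rewrite -leqNgt => h.
  have : mdeg (al - be) = 0%N.
    by have := congr1 (@mdeg k) (submK le); rewrite mdegD; lia.
  by move/eqP; rewrite mdeg_eq0 => /eqP z; rewrite -(submK le) z add0m.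
have al_lt : (mdeg al < (mdeg al).+1)%N by [].
have subal : (al - al)%MM = 0%MM by apply/mnmP => i; rewrite mnmBE subnn mnm0E.
have sp_at h : special (at_point h X Y) = h.
  have -> : special (at_point h X Y) = at_point h (special X) (special Y) by exact: at_point_subst.
  by rewrite sX sY at_point_id.
have sF : special F = f.
  rewrite FE !specialD !special_sum sp_at !big1 ?addr0 // => j _.
    by rewrite specialM special_liftT mpsi scale0r mul0r.
  by rewrite specialM special_liftT mphi scale0r mul0r.
have sliceEF := congr1 (slice al) EF.
rewrite (linD _ _ (slice_lin al)) (linD (relative_derivation A B F) _ (slice_lin al)) in sliceEF.
rewrite slice_relative_derivation in sliceEF.
have hEF : singularity_ideal f (slice al (euler F)).
  by rewrite slice_euler; apply: singularity_idealZ.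
(* All terms but the top one involve components of the field of smaller degree, which preserve I;
   the top component is applied to the special fibre [f]. *)
have [b1 hb1 E1] : exists2 b, singularity_ideal f b &
    \sum_(be : 'X_{1..k < (mdeg al).+1} | (be <= al)%MM)
      derivation (slice be A) (slice be B) (slice (al - be)%MM F) =
    derivation (slice al A) (slice al B) f + b.
  rewrite (bigD1 (BMultinom al_lt)) ?lepm_refl //=.
  rewrite subal slice0 sF; eexists; last by reflexivity.
  apply: singularity_ideal_sum => be /andP[le ne].
  have lt : (mdeg be < mdeg al)%N.
    by apply: contraNT ne => /(top _ le) e0; apply/eqP/val_inj.
  by have [_ pr _] := ih be (small _ lt); apply: pr.
have hg2 : singularity_ideal f (slice al (\sum_i euler (liftT (phi i)) * at_point (g i) X Y)).
  rewrite lin_sum; last exact: slice_lin.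
  apply: singularity_ideal_sum => i _; rewrite sliceM; apply: singularity_ideal_sum => be le.
  rewrite slE; have [->|b0] := eqVneq (bmnm be) 0%MM.
    by rewrite mdeg0 mul0r scale0r mul0r; apply: singularity_ideal0.
  have [_ _ pg] := ih (al - be)%MM (small _ (sub_lt _ _ le b0)).
  by apply: singularity_idealM; apply: pg.
have E3 : slice al (\sum_j euler (liftT (psi j)) * at_point (e j) X Y) =
    \sum_j ((mdeg al)%:R * psi j al) *: e j.
  rewrite lin_sum; last exact: slice_lin.
  apply: eq_bigr => j _; rewrite sliceM (bigD1 (BMultinom al_lt)) ?lepm_refl //= subal slice0 sp_at.
  rewrite slE mulrC -scalerAr mulr1 big1 ?addr0 // => be /andP[le ne].
  have lt : (mdeg be < mdeg al)%N.
    by apply: contraNT ne => /(top _ le) e0; apply/eqP/val_inj.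
  by have [p0 _ _] := ih be (small _ lt); rewrite slE p0 mulr0 scale0r mul0r.
rewrite E1 E3 in sliceEF.
have adm Z : (sec -> on_trivial_section Z = 0) -> admissible sec (slice al Z).
  move=> h hs; rewrite /max_ideal coef_slice xm0 add0m -coef_ots h //.
have psi0 j : psi j al = 0.
  (* The coefficient of [al] in the Euler equation writes this combination of the [e j] as a
     derivative of [f] plus an element of I. The factor [mdeg al] is nonzero. *)
  have /he/(_ j)/eqP : tangent_sum f sec (\sum_j ((mdeg al)%:R * psi j al) *: e j).
    exists (derivation (- slice al A) (- slice al B) f),
      (slice al (euler F) - b1 - slice al (\sum_i euler (liftT (phi i)) * at_point (g i) X Y)); split.
    - have aN Z : admissible sec Z -> admissible sec (- Z).
        by move=> h; rewrite -mulN1r; apply: admissibleM.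
      apply: trivial_ideal_derivation; apply: aN; apply: adm => hs.
        by have [] := ots_euler_xy (oX hs) (oY hs).
      by have [] := ots_euler_xy (oX hs) (oY hs).
    - by apply: singularity_idealB => //; apply: singularity_idealB.
    - by rewrite sliceEF /derivation; ring.
  by rewrite mulf_eq0 pnatr_eq0 (negPf al0) /= => /eqP.
have pres : preserve al.
  have hd : singularity_ideal f (derivation (slice al A) (slice al B) f).
    have -> : derivation (slice al A) (slice al B) f = slice al (euler F) - b1 -
        slice al (\sum_i euler (liftT (phi i)) * at_point (g i) X Y).
      have S0 : \sum_j ((mdeg al)%:R * psi j al) *: e j = 0.
        by rewrite big1 // => j _; rewrite psi0 mulr0 scale0r.
      by rewrite sliceEF S0; ring.
    by apply: singularity_idealB => //; apply: singularity_idealB.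
  by have [_ _ h] := singularity_ideal_derivation hf hd.
split=> // i.
(* In the Euler equation of [g i (X, Y)] the term of degree 0 of the field vanishes, so only
   coefficients of smaller degree occur on the right; the left side is [mdeg al] times the
   coefficient sought. *)
have hE : singularity_ideal f (slice al (euler (at_point (g i) X Y))).
  rewrite euler_at_point // slice_relative_derivation; apply: singularity_ideal_sum => be le.
  have [->|b0] := eqVneq (bmnm be) 0%MM.
    rewrite !slice0 special_euler_x special_euler_y /derivation !mul0r addr0.
    exact: singularity_ideal0.
  have [_ _ pg] := ih (al - be)%MM (small _ (sub_lt _ _ le b0)).
  have [lt|nlt] := boolP (mdeg be < mdeg al)%N.
    by have [_ pr _] := ih be (small _ lt); apply: pr.
  have pr : preserve (bmnm be) by rewrite (top _ le nlt).
  by apply: pr; apply: pg.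
rewrite slice_euler in hE.
have := singularity_idealZ ((mdeg al)%:R^-1) hE.
by rewrite scalerA mulVf ?scale1r // pnatr_eq0.
Qed.

End Euler.

(** * Semiuniversality *)

Section Semiuniversality.
Context {C : numClosedFieldType}.

Local Notation x := (cvar ord0 : cps C 2).
Local Notation y := (cvar ord_max : cps C 2).

Lemma idealM_decomp k (T : germ C k) h : idealM T h ->
  exists d (a : 'I_d -> cps C k) w, (forall j, gideal T (a j)) /\ h = \sum_j liftT (a j) * w j.
Proof.
move=> [n [c [s [hs ->]]]]; have {hs} hs i : exists a, gideal T a /\ s i = liftT a.
  by have [a ha e] := hs i; exists a.
have [a ha] := choice hs; exists n, a, c; split=> [j|]; first by have [] := ha j.
by apply: eq_bigr => i _; rewrite (proj2 (ha i)) mulrC.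
Qed.

Lemma idealC_decomp k (T : germ C k) F h : idealC T F h -> exists c, idealM T (h - c * F).
Proof.
move=> [n [c [s [hs ->]]]]; elim/big_ind: _ => [|u v [a ha] [b hb]|i _].
- by exists 0; rewrite mul0r subrr; apply: ideal_gen0.
- by exists (a + b); rewrite mulrDl opprD addrACA; apply: ideal_genD.
- case: (hs i) => [->|[a ha ->]]; first by exists (c i); rewrite subrr; apply: ideal_gen0.
  by exists 0; rewrite mul0r subr0; apply: ideal_genM; apply: idealM_liftT.
Qed.

Lemma idealC_self k (T : germ C k) F c : idealC T F (c * F).
Proof. by apply: ideal_genM; apply: ideal_gen_mem; left. Qed.

Lemma idealM_idealC k (T : germ C k) F h : idealM T h -> idealC T F h.
Proof. by apply: ideal_gen_sub => a [u hu ->]; apply: ideal_gen_mem; right; exists u. Qed.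

Lemma idealM_sub k (T T' : germ C k) h : subgerm T' T -> idealM T h -> idealM T' h.
Proof.
by move=> hT; apply: ideal_gen_sub => a [u hu ->]; apply: idealM_liftT; apply: hT.
Qed.

Lemma special_idealM k (T : germ C k) h : idealM T h -> special h = 0.
Proof.
move=> /idealM_decomp[d [a [w [ha ->]]]]; rewrite special_sum big1 // => j _.
by rewrite specialM special_liftT (gideal_proper (ha j)) scale0r mul0r.
Qed.

Lemma ots_coslice k (F : cps C (2 + k)) : on_trivial_section F = coslice 0%MM F.
Proof. by apply: cpsP => al; rewrite coef_ots coef_coslice xm0 add0m. Qed.

Lemma ideal_exp_max2 k (h : cps C k) : mt_ge 2 h -> ideal_exp max_ideal 2 h.
Proof.
move=> hh; have [c E] := sp_ideal setT h.
have sp0 : sp setT h = 0.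
  apply: cpsP => m; rewrite coef_sp; case: eqP => // e; apply: hh.
  have -> : m = 0%MM by apply/mnmP => i; move/mnmP: e => /(_ i); rewrite !mnmE inE.
  by rewrite mdeg0.
rewrite sp0 subr0 in E; rewrite {1}E.
apply: ideal_gen_sum => j _; rewrite in_setT mul1r; apply: ideal_gen_mem.
exists (cvar j), (c j); split=> //; first exact: max_cvar.
apply: ideal_gen_mem; exists (c j), 1; rewrite mulr1; split=> //.
have := hh U_(j)%MM; rewrite mdeg1 => /(_ isT); rewrite E coef_sum (bigD1 j) // in_setT mul1r.
rewrite big1 => [|i ij]; last first.
  by rewrite in_setT mul1r coef_cvarM mnm1E [j == i]eq_sym (negPf ij).
rewrite -[X in coef _ X]addm0 coef_cvarMU => e; by rewrite /max_ideal -[RHS]e /=; rewrite [RHS]addr0.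
Qed.

(** Linear parts of elements of the ideal form a subspace equal to its double annihilator.
    Uniqueness of the cotangent map is thus tested on the tangent vectors [w] of [T]. *)
Lemma linear_duality k (T : germ C k) (v : cps C k) :
  (forall w : 'I_k -> C, (forall a, gideal T a -> \sum_t w t * a U_(t)%MM = 0) ->
    \sum_t w t * v U_(t)%MM = 0) ->
  exists2 a, gideal T a & forall t, a U_(t)%MM = v U_(t)%MM.
Proof.
move=> hv; pose lin1 (a : cps C k) : 'rV[C]_k := \row_t a U_(t)%MM.
have lE a i t : lin1 a i t = a U_(t)%MM by rewrite mxE.
have [r [A [_ hA mA]]] := maximal_family (fun l : 'rV[C]_k => exists2 a, gideal T a & l = lin1 a).
have cok a : (lin1 a <= A)%MS -> forall s, \sum_t cokermx A t s * a U_(t)%MM = 0.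
  rewrite submxE => /eqP/matrixP e s; have := e 0 s; rewrite mxE [in RHS]mxE => {}e; rewrite -[RHS]e.
  by apply: eq_bigr => t _; rewrite lE mulrC.
have : (lin1 v <= A)%MS.
  rewrite submxE; apply/eqP/matrixP => i s; rewrite mxE [RHS]mxE.
  rewrite -[RHS](hv (fun t => cokermx A t s)) => [|a ha].
    by apply: eq_bigr => t _; rewrite lE mulrC.
  by apply: cok; apply: mA; exists a.
move=> /submxP[z zE]; have hA' i : exists a, gideal T a /\ row i A = lin1 a.
  by have [a ha e] := hA i; exists a.
have [a ha] := choice hA'; exists (\sum_i z 0 i *: a i).
  by apply: gideal_sum => i _; apply: gidealZ; apply: (proj1 (ha i)).
move=> t; have := congr1 (fun M : 'rV_k => M 0 t) zE; rewrite !mxE => ->.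
rewrite coef_sum; apply: eq_bigr => i _; rewrite coefZ; congr (_ * _).
by have := congr1 (fun M : 'rV_k => M 0 t) (proj2 (ha i)); rewrite !mxE.
Qed.

Section Unfolding.
Variables (f : cps C 2) (sec : bool) (n r : nat) (g : 'I_n -> cps C 2) (e : 'I_r -> cps C 2).
Hypotheses (hf : reduced_singularity f)
  (hg : basis_mod (singularity_ideal f) (trivial_ideal f sec) g)
  (he : forall c : 'I_r -> C, tangent_sum f sec (\sum_i c i *: e i) -> forall i, c i = 0)
  (hge : forall h, exists (c : 'I_n -> C) (d : 'I_r -> C),
    trivial_ideal f sec (h - \sum_i c i *: g i - \sum_i d i *: e i)).

Let G := unfolding f g.
Let S := affine_germ n : germ C n.

Definition directions (i : 'I_(n + r)) : cps C 2 :=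
  match split i with inl j => g j | inr j => e j end.

Lemma directions_l j : directions (lshift r j) = g j.
Proof. by rewrite /directions (unsplitK (inl j) : split (lshift r j) = inl j). Qed.
Lemma directions_r j : directions (rshift n j) = e j.
Proof. by rewrite /directions (unsplitK (inr j) : split (rshift n j) = inr j). Qed.

Lemma directions_span : exists N, forall h, exists u A B (c : 'I_(n + r) -> C),
  [/\ admissible sec A, admissible sec B,
    h = u * f + derivation A B f + \sum_i c i *: directions i &
    mt_ge N h -> forall i, c i = 0].
Proof.
have [N hN] := trivial_ideal_power sec hf; exists N => h.
have [hh|hh] := pselect (mt_ge N h).
  have [u [A [B [hA hB ->]]]] := hN h hh; exists u, A, B, (fun=> 0); split=> //.
  by rewrite big1 ?addr0 // => i _; rewrite scale0r.
have [c [d [u [A [B [hA hB E]]]]]] := hge h.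
exists u, A, B, (fun i => match split i with inl j => c j | inr j => d j end); split=> //.
rewrite -E big_split_ord /=.
have spl j : split (lshift r j) = inl j := unsplitK (inl j).
have spr j : split (rshift n j) = inr j := unsplitK (inr j).
have -> : \sum_(i < n) (match split (lshift r i) with inl j => c j | inr j => d j end) *: directions (lshift r i) =
    \sum_i c i *: g i by apply: eq_bigr => i _; rewrite directions_l spl.
have -> : \sum_(i < r) (match split (rshift n i) with inl j => c j | inr j => d j end) *: directions (rshift n i) =
    \sum_i d i *: e i by apply: eq_bigr => i _; rewrite directions_r spr.
by ring.
Qed.

Lemma max_liftT k (a : cps C k) : max_ideal a -> max_ideal (liftT a).
Proof. exact: max_ideal_subst. Qed.

Lemma straight_ots k (T : germ C k) F : straight_es f T F -> gideal T (on_trivial_section F).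
Proof.
move=> hF; have [f0 f2 _] := hf; have [m hm] := has_mt_exists f0.
rewrite ots_coslice; apply: (straight_coslice (q := [::]) hf hF (essential_tree_root f) hm).
by rewrite mdeg0; apply: leq_trans (has_mt_le hm f2).
Qed.

Lemma straight_principal k (T : germ C k) F h : straight_es f T F ->
  principal (special F) h <-> principal f h.
Proof.
move=> [Ft hes]; have [f0 _ _] := hf; have [m hm] := has_mt_exists f0.
have [[hp _] _] := es_deformation hes (essential_tree_root f) (reduced_transform_root f) hm.
by rewrite -(es_root hes).
Qed.

(** A morphism is the identity on the special fibre only modulo [f], and respects the section only
    modulo the ideal of [T]. Subtracting a multiple of [F] and the value on the section makes both
    exact without changing the class modulo [idealC T F]. *)
Lemma normalize k (T : germ C k) F X' Y' phi :
  (forall h, principal (special F) h <-> principal f h) ->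
  (sec -> gideal T (on_trivial_section F)) ->
  deformation_morphism f T S F G X' Y' phi ->
  (sec -> gideal T (on_trivial_section X') /\ gideal T (on_trivial_section Y')) ->
  exists X Y, [/\ special X = x, special Y = y,
    (sec -> on_trivial_section X = 0) /\ (sec -> on_trivial_section Y = 0),
    idealC T F (X - X') /\ idealC T F (Y - Y') &
    idealC T F (eval G X Y (fun j => liftT (phi j)))].
Proof.
move=> pF oF [mphi _ hI hX hY] oXY.
have [p pE] : exists p, special F = p * f.
  by apply/principalP; apply/pF; apply/principalP; exists 1; rewrite mul1r.
have [f0 f2 _] := hf.
have mf : max_ideal f by apply/mt_ge1P; apply: mt_ge_le f2.
have norm1 (Z' : cps C (2 + k)) i : principal f (special Z' - cvar i) ->
    (sec -> gideal T (on_trivial_section Z')) ->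
    max_ideal Z' /\ exists Z, [/\ special Z = cvar i, sec -> on_trivial_section Z = 0 & idealC T F (Z - Z')].
  move=> /pF/principalP[a aE] oZ.
  have zE : special Z' = cvar i + a * special F by rewrite -aE addrC subrK.
  split.
    apply: max_special; rewrite zE pE; apply: max_idealD; first exact: max_cvar.
    by do 2!apply: max_idealMl.
  pose Z := Z' - liftS a * F.
  have sZ : special Z = cvar i by rewrite specialB specialM special_liftS zE addrK.
  have cZ : idealC T F (Z - Z') by rewrite /Z addrC addKr; apply: ideal_genN; apply: idealC_self.
  have [hs|ns] := boolP sec; last by exists Z; split=> // hs; rewrite hs in ns.
  have oZ' : gideal T (on_trivial_section Z).
    rewrite /Z otsB otsM; apply: gidealB; first exact: oZ.
    by apply: gidealM; apply: oF.
  exists (Z - liftT (on_trivial_section Z)); split.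
  - by rewrite specialB sZ special_liftT (gideal_proper oZ') scale0r subr0.
  - by move=> _; rewrite otsB ots_liftT subrr.
  - rewrite addrAC; apply: ideal_genB => //.
    by apply: idealM_idealC; apply: idealM_liftT.
have [mX' [X [sX oX cX]]] := norm1 X' ord0 hX (fun hs => proj1 (oXY hs)).
have [mY' [Y [sY oY cY]]] := norm1 Y' ord_max hY (fun hs => proj2 (oXY hs)).
have mX : max_ideal X by apply: max_special; rewrite sX; apply: max_cvar.
have mY : max_ideal Y by apply: max_special; rewrite sY; apply: max_cvar.
exists X, Y; split=> //.
rewrite -[eval G X Y _](subrK (eval G X' Y' (fun j => liftT (phi j)))).
apply: ideal_genD => //.
have mp j : max_ideal (liftT (phi j)) by apply: max_liftT.
have [c ->] := @subst_diff C _ _ G (arg X Y (fun j => liftT (phi j))) (arg X' Y' (fun j => liftT (phi j)))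
  (max_arg mX mY mp) (max_arg mX' mY' mp).
apply: ideal_gen_sum; apply: (@ord2kP _ (fun i => _ -> _)) => [||j] _; rewrite !(arg_x, arg_y, arg_t).
- exact: ideal_genM.
- exact: ideal_genM.
- by rewrite subrr mulr0; apply: ideal_gen0.
Qed.

Lemma special_eval_unfolding k (X Y : cps C (2 + k)) phi : special X = x -> special Y = y ->
  (forall j, max_ideal (phi j)) -> special (eval G X Y (fun j => liftT (phi j))) = f.
Proof.
move=> sX sY mphi.
have mX : max_ideal X by apply: max_special; rewrite sX; apply: max_cvar.
have mY : max_ideal Y by apply: max_special; rewrite sY; apply: max_cvar.
rewrite eval_unfolding // => [|j]; last exact: max_liftT.
rewrite specialD special_sum big1 => [|j _]; last by rewrite specialM special_liftT mphi scale0r mul0r.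
rewrite addr0; have -> : special (at_point f X Y) = at_point f (special X) (special Y) by exact: at_point_subst.
by rewrite sX sY at_point_id.
Qed.

Theorem versality k (T T' : germ C k) F X' Y' phi' : straight_es f T F -> subgerm T' T ->
  deformation_morphism f T' S F G X' Y' phi' ->
  (sec -> gideal T' (on_trivial_section X') /\ gideal T' (on_trivial_section Y')) ->
  exists X Y phi, [/\ deformation_morphism f T S F G X Y phi,
    sec -> gideal T (on_trivial_section X) /\ gideal T (on_trivial_section Y),
    forall j, gideal T' (phi j - phi' j), idealC T' F (X - X') & idealC T' F (Y - Y')].
Proof.
move=> hF hT hm oXY; have pF h := straight_principal h hF.
have oF : sec -> gideal T' (on_trivial_section F) by move=> _; apply/hT/straight_ots.
have [X0 [Y0 [sX sY [oX oY] [cX cY] cG]]] := normalize pF oF hm oXY.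
have [mphi _ _ _ _] := hm.
have [Fm [hFm slFm]] := straight_reduction hf hF.
have [c hc] := idealC_decomp cG.
have sFm : special Fm = special F.
  by apply/eqP; rewrite eq_sym -subr_eq0 -specialB (special_idealM hFm).
have [p pE] : exists p, special F = p * f.
  by apply/principalP; apply/pF; apply/principalP; exists 1; rewrite mul1r.
have [f0 _ _] := hf.
(* Restricted to the special fibre, the equation reads [f = special c * p * f]; so [c] is a unit and
   [c * Fm] still defines the same family. *)
have sc : special c * p = 1.
  have := special_idealM hc; rewrite specialB specialM special_eval_unfolding // pE mulrA => /eqP.
  rewrite -{1}[f]mul1r -mulrBl mulf_eq0 subr_eq0 => /orP[/eqP <- //|/eqP].
  by move/f0.
have uc : c \is a GRing.unit.
  have : special c \is a GRing.unit by apply/unitrPr; exists p.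
  by rewrite !unit_cpsE /special evalE coef_subst0.
have hcm : idealM T' (eval G X0 Y0 (fun j => liftT (phi' j)) - c * Fm).
  have -> : eval G X0 Y0 (fun j => liftT (phi' j)) - c * Fm =
    eval G X0 Y0 (fun j => liftT (phi' j)) - c * F + c * (F - Fm) by ring.
  by apply: ideal_genD => //; apply: ideal_genM; apply: idealM_sub hT hFm.
have [d [a [w [ha wE]]]] := idealM_decomp hcm.
have mX : max_ideal X0 by apply: max_special; rewrite sX; apply: max_cvar.
have mY : max_ideal Y0 by apply: max_special; rewrite sY; apply: max_cvar.
pose phi0 (i : 'I_(n + r)) := match split i with inl j => phi' j | inr _ => 0 end.
have mphi0 i : max_ideal (phi0 i) by rewrite /phi0; case: split.
have spl j : split (lshift r j) = inl j := unsplitK (inl j).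
have spr j : split (rshift n j) = inr j := unsplitK (inr j).
have evs Z W phi : max_ideal Z -> max_ideal W -> (forall i, max_ideal (phi i)) ->
    eval (unfolding f directions) Z W (fun i => liftT (phi i)) =
    at_point f Z W + \sum_j liftT (phi (lshift r j)) * at_point (g j) Z W +
      \sum_j liftT (phi (rshift n j)) * at_point (e j) Z W :> cps C (2 + k).
  move=> hZ hW hphi; rewrite eval_unfolding // => [|i]; last exact: max_liftT.
  rewrite big_split_ord addrA; congr (_ + _ + _); apply: eq_bigr => j _.
    by rewrite directions_l.
  by rewrite directions_r.
have E0 : eval (unfolding f directions) X0 Y0 (fun i => liftT (phi0 i)) =
    eval G X0 Y0 (fun j => liftT (phi' j)).
  rewrite evs // [RHS]eval_unfolding // => [|j]; last exact: max_liftT.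
  rewrite [X in _ + X]big1 ?addr0 => [|j _]; last first.
    by rewrite /phi0 spr [liftT 0]subst0 mul0r.
  by congr (_ + _); apply: eq_bigr => j _; rewrite /phi0 spl.
(* The unfolding along all directions, with zero coefficients on the [e j], differs from [c * Fm] by
   [sum a j * w j] with the [a j] in the ideal of [T']. Absorbing the opposite of this difference
   reaches [u * c * Fm] over all of [(C^k, 0)] and alters the maps only modulo that ideal. *)
have [u [X1 [Y1 [phi1 [hu E1 [sX1 sY1 iX iY] [p1 mp1] [oX1 oY1]]]]]] :=
  absorb_all directions_span (fun j => - w j) sX sY mphi0 ha oX oY.
have E2 : eval (unfolding f directions) X1 Y1 (fun i => liftT (phi1 i)) = u * c * Fm.
  rewrite E1 E0 -mulrA; congr (_ * _); under eq_bigr do rewrite mulrN.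
  by rewrite sumrN -wE; ring.
have mX1 : max_ideal X1 by apply: max_special; rewrite sX1; apply: max_cvar.
have mY1 : max_ideal Y1 by apply: max_special; rewrite sY1; apply: max_cvar.
rewrite evs // in E2.
have slE al : singularity_ideal f (slice al (u * c * Fm)).
  rewrite sliceM; apply: singularity_ideal_sum => be _.
  by apply: singularity_idealM; apply: slFm.
have [Wg _ _] := hg.
have psi0 := equisingular_parameters hf Wg he slE sX1 sY1 oX1 oY1
  (fun j => mp1 (lshift r j)) (fun j => mp1 (rshift n j)) (esym E2).
have E3 : eval G X1 Y1 (fun j => liftT (phi1 (lshift r j))) = u * c * Fm.
  rewrite eval_unfolding // => [|j]; last exact: max_liftT.
  rewrite -E2 [X in _ = _ + X]big1 ?addr0 // => j _.
  by rewrite psi0 [liftT 0]subst0 mul0r.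
exists X1, Y1, (fun j => phi1 (lshift r j)); split.
- split=> //.
  + by move=> z -> ; rewrite subst0; apply: gideal0.
  + rewrite E3; have -> : u * c * Fm = u * c * F - u * c * (F - Fm) by ring.
    apply: ideal_genB; first exact: idealC_self.
    by apply: ideal_genM; apply: idealM_idealC.
  + by rewrite sX1 subrr; apply/principalP; exists 0; rewrite mul0r.
  + by rewrite sY1 subrr; apply/principalP; exists 0; rewrite mul0r.
- by move=> hs; rewrite oX1 // oY1 //; split; apply: gideal0.
- by move=> j; have := p1 (lshift r j); rewrite /phi0 spl.
- by rewrite -(subrKA X0); apply: ideal_genD => //; apply: idealM_idealC.
- by rewrite -(subrKA Y0); apply: ideal_genD => //; apply: idealM_idealC.
Qed.

(** Both morphisms express a unit multiple of [F] through [G]. Differentiating along a tangent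
    vector and subtracting leaves a combination of the [g i] in the trivial ideal, so its
    coefficients vanish; the derivative of [F] cancels because the units agree on the special
    fibre. *)
Theorem tangent_uniqueness k (T : germ C k) F X1 Y1 phi1 X2 Y2 phi2 : straight_es f T F ->
  deformation_morphism f T S F G X1 Y1 phi1 ->
  (sec -> gideal T (on_trivial_section X1) /\ gideal T (on_trivial_section Y1)) ->
  deformation_morphism f T S F G X2 Y2 phi2 ->
  (sec -> gideal T (on_trivial_section X2) /\ gideal T (on_trivial_section Y2)) ->
  forall j, ideal_sum (ideal_exp max_ideal 2) (gideal T) (phi1 j - phi2 j).
Proof.
move=> hF hm1 o1 hm2 o2 j; have pF h := straight_principal h hF.
have oF : sec -> gideal T (on_trivial_section F) by move=> _; apply: straight_ots.
have [f0 _ _] := hf.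
have [p pE] : exists p, special F = p * f.
  by apply/principalP; apply/pF; apply/principalP; exists 1; rewrite mul1r.
have sF0 : special F <> 0.
  move=> z; apply: f0; have /principalP[b ->] : principal (special F) f.
    by apply/pF; apply/principalP; exists 1; rewrite mul1r.
  by rewrite z mulr0.
have m1 i : max_ideal (phi1 i) by have [] := hm1.
have m2 i : max_ideal (phi2 i) by have [] := hm2.
suff [a ha aE] : exists2 a, gideal T a & forall t, a U_(t)%MM = (phi1 j - phi2 j) U_(t)%MM.
  exists (phi1 j - phi2 j - a), a; split=> //; last by rewrite subrK.
  apply: ideal_exp_max2 => m; rewrite ltnS leq_eqVlt => /predU1P[/eqP/mdeg1P[t /eqP ->]|].
    by rewrite coefB aE subrr.
  rewrite ltnS leqn0 mdeg_eq0 => /eqP ->.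
  by rewrite !coefB m1 m2 (gideal_proper ha) !subr0.
apply: linear_duality => w hw.
(* The derivative at the origin of the base along [w], followed by restriction to the special fibre;
   it kills [idealM T] because [w] is tangent to [T]. *)
pose dl (H : cps C (2 + k)) : cps C 2 := \sum_t w t *: special (pderiv (rshift 2 t) H).
have dlD u v : dl (u + v) = dl u + dl v.
  by rewrite /dl -big_split; apply: eq_bigr => t _; rewrite pderivD specialD scalerDr.
have dl0 : dl 0 = 0 by rewrite /dl big1 // => t _; rewrite pderiv0 /special evalE subst0 scaler0.
have dlM u v : dl (u * v) = dl u * special v + special u * dl v.
  rewrite /dl mulr_suml mulr_sumr -big_split; apply: eq_bigr => t _.
  by rewrite pderivM specialD !specialM scalerDr -scalerAl -scalerAr.
have dlsum (I : finType) (H : I -> cps C (2 + k)) : dl (\sum_i H i) = \sum_i dl (H i).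
  by apply: (big_morph dl).
have dlT (u : cps C k) : dl (liftT u) = (\sum_t w t * u U_(t)%MM)%:A.
  rewrite /dl scaler_suml; apply: eq_bigr => t _; rewrite -scalerA; congr (_ *: _).
  apply: cpsP => a; rewrite coef_special coef_pderiv xm_r mul1r coef_liftT coefA.
  rewrite U_r xpartE tpartE //.
have dlI h : idealM T h -> dl h = 0.
  move=> /idealM_decomp[d [a [z [ha ->]]]]; rewrite dlsum big1 // => i _.
  by rewrite dlM dlT hw // special_liftT (gideal_proper (ha i)) !scale0r !mul0r addr0.
have dl_at h (X Y : cps C (2 + k)) : special X = x -> special Y = y ->
    dl (at_point h X Y) = derivation (dl X) (dl Y) h.
  move=> sX sY; rewrite /dl /derivation !mulr_suml -big_split; apply: eq_bigr => t _.
  have sp_at h' : special (at_point h' X Y) = h'.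
    have -> : special (at_point h' X Y) = at_point h' (special X) (special Y) by exact: at_point_subst.
    by rewrite sX sY at_point_id.
  rewrite chain_rule sum2 /= specialD !specialM -!/(at_point _ X Y) !sp_at scalerDr.
  by rewrite -!scalerAl; congr (_ *: _ + _ *: _); apply: mulrC.
have key X' Y' phi : deformation_morphism f T S F G X' Y' phi ->
    (sec -> gideal T (on_trivial_section X') /\ gideal T (on_trivial_section Y')) ->
    exists c A B, [/\ admissible sec A, admissible sec B, f = special c * special F &
     special c * dl F + dl c * special F = derivation A B f +
       \sum_i (\sum_t w t * phi i U_(t)%MM) *: g i].
  move=> hm oXY; have [X [Y [sX sY [oX oY] _ cG]]] := normalize pF oF hm oXY.
  have mphi i : max_ideal (phi i) by have [] := hm.
  have [c hc] := idealC_decomp cG.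
  have mX : max_ideal X by apply: max_special; rewrite sX; apply: max_cvar.
  have mY : max_ideal Y by apply: max_special; rewrite sY; apply: max_cvar.
  have adm Z : (sec -> on_trivial_section Z = 0) -> admissible sec (dl Z).
    move=> oZ hs; rewrite /max_ideal /dl coef_sum big1 // => t _.
    rewrite coefZ coef_special coef_pderiv xm0 mnm0E mul1r add0m U_r -coef_ots oZ //.
    exact: mulr0.
  exists c, (dl X), (dl Y); split; [exact: adm|exact: adm| |].
    have := special_idealM hc; rewrite specialB specialM special_eval_unfolding // => /eqP.
    by rewrite subr_eq0 => /eqP.
  have ND u v : dl (u - v) = dl u - dl v.
    by apply/eqP; rewrite eq_sym subr_eq -dlD subrK.
  have := dlI _ hc; rewrite ND dlM => /eqP; rewrite subr_eq0 addrC => /eqP <-.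
  rewrite eval_unfolding // => [|i]; last exact: max_liftT.
  rewrite dlD dl_at // dlsum; congr (_ + _); apply: eq_bigr => i _.
  rewrite dlM dlT special_liftT mphi scale0r mul0r addr0 -scalerAl mul1r.
  have -> : special (at_point (g i) X Y) = at_point (g i) (special X) (special Y) by exact: at_point_subst.
  by rewrite sX sY at_point_id.
have [c1 [A1 [B1 [a1 b1 s1 E1]]]] := key _ _ _ hm1 o1.
have [c2 [A2 [B2 [a2 b2 s2 E2]]]] := key _ _ _ hm2 o2.
have c12 : special c1 = special c2.
  have : (special c1 - special c2) * special F == 0 by rewrite mulrBl -s1 -s2 subrr.
  by rewrite mulf_eq0 subr_eq0 => /orP[/eqP //|/eqP /sF0].
have [_ indep _] := hg.
have /indep/(_ j) h0 : trivial_ideal f sec (\sum_i (\sum_t w t * (phi1 i - phi2 i) U_(t)%MM) *: g i).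
  exists ((dl c1 - dl c2) * p), (- 1 * A1 + A2), (- 1 * B1 + B2); split.
  - by move=> hs; apply: max_idealD; [apply: max_idealMl; apply: a1|apply: a2].
  - by move=> hs; apply: max_idealD; [apply: max_idealMl; apply: b1|apply: b2].
  - have -> : \sum_i (\sum_t w t * (phi1 i - phi2 i) U_(t)%MM) *: g i =
        \sum_i (\sum_t w t * phi1 i U_(t)%MM) *: g i - \sum_i (\sum_t w t * phi2 i U_(t)%MM) *: g i.
      rewrite -sumrB; apply: eq_bigr => i _; rewrite -scalerBl -sumrB; congr (_ *: _).
      by apply: eq_bigr => t _; rewrite coefB mulrBr.
    have e1 : \sum_i (\sum_t w t * phi1 i U_(t)%MM) *: g i =
       special c1 * dl F + dl c1 * special F - derivation A1 B1 f by rewrite E1 addrC addKr.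
    have e2 : \sum_i (\sum_t w t * phi2 i U_(t)%MM) *: g i =
       special c2 * dl F + dl c2 * special F - derivation A2 B2 f by rewrite E2 addrC addKr.
    by rewrite e1 e2 c12 pE /derivation; ring.
by [].
Qed.

End Unfolding.

Lemma semiuniversal_unfolding (f : cps C 2) (sec : bool) n (g : 'I_n -> cps C 2) r (e : 'I_r -> cps C 2)
    (mor : forall k l, germ C k -> germ C l -> cps C (2 + k) -> cps C (2 + l) ->
       cps C (2 + k) -> cps C (2 + k) -> ('I_l -> cps C k) -> Prop) :
  reduced_singularity f ->
  (forall k l (T : germ C k) (S : germ C l) F G X Y phi, mor k l T S F G X Y phi <->
    deformation_morphism f T S F G X Y phi /\
    (sec -> gideal T (on_trivial_section X) /\ gideal T (on_trivial_section Y))) ->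
  basis_mod (singularity_ideal f) (trivial_ideal f sec) g ->
  (forall c : 'I_r -> C, tangent_sum f sec (\sum_i c i *: e i) -> forall i, c i = 0) ->
  (forall h, exists (c : 'I_n -> C) (d : 'I_r -> C),
    trivial_ideal f sec (h - \sum_i c i *: g i - \sum_i d i *: e i)) ->
  semiuniversal (@straight_es C f) mor (affine_germ n) (unfolding f g).
Proof.
move=> hf hmor hg he hge; split.
- by apply: straight_unfolding => //; case: hg.
- move=> k T T' F X' Y' phi' hF hT /hmor[hm oXY].
  have [X [Y [phi [h1 h2 h3 h4 h5]]]] := versality hf hg he hge hF hT hm oXY.
  by exists X, Y, phi; split=> //; apply/hmor.
- move=> k T F X1 Y1 phi1 X2 Y2 phi2 hF /hmor[hm1 o1] /hmor[hm2 o2].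
  exact: (tangent_uniqueness hf hg hF hm1 o1 hm2 o2).
Qed.

End Semiuniversality.

Theorem proposition2p14 (R : realType) (f : cps R[i] 2)
    (hf : reduced_singularity f) :
  (exists (tau' : nat) (g : 'I_tau' -> cps R[i] 2),
     basis_mod (singularity_ideal f)
       (ideal_gen (fun h => h = f \/ ideal_mul max_ideal (jacobian_ideal f) h)) g /\
     semiuniversal_straight_es f (affine_germ tau') (unfolding f g)) /\
  (exists (tau'' : nat) (g : 'I_tau'' -> cps R[i] 2),
     basis_mod (ideal_gen (fun h => jacobian_ideal f h \/ singularity_ideal f h))
       (ideal_gen (fun h => h = f \/ jacobian_ideal f h)) g /\
     semiuniversal_straight_es_nosec f (affine_germ tau'') (unfolding f g)).
Proof.
split.
  have [n [g [r [e [hg he hge]]]]] := bases_exist true hf; exists n, g; split.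
    case: hg => h1 h2 h3; split=> // [c /trivial_ideal_sec|h /h3[c hc]]; first exact: h2.
    by exists c; apply/trivial_ideal_sec.
  apply: (semiuniversal_unfolding hf _ hg he hge) => k l T S F G X Y phi.
  by split=> [[h1 h2 h3]|[h1 /(_ isT)[h2 h3]]].
have [n [g [r [e [hg he hge]]]]] := bases_exist false hf; exists n, g; split.
  case: hg => h1 h2 h3; split=> [i|c /trivial_ideal_nosec|h hh].
  - by apply: ideal_gen_mem; right.
  - exact: h2.
  (* The ideal generated by the Jacobian ideal and I lies in the sum of the trivial ideal and I, so
     modulo the former every element is represented in I, where the [g i] span. *)
  have [a [b [ha hb ->]]] : tangent_sum f false h.
    have [m [a [s [hs ->]]]] := hh; elim/big_ind: _ => [|u v|i _].
    - exists 0, 0; rewrite addr0; split=> //; first exact: trivial_ideal0.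
      exact: singularity_ideal0.
    - move=> [a1 [b1 [ha1 hb1 ->]]] [a2 [b2 [ha2 hb2 ->]]]; exists (a1 + a2), (b1 + b2); split.
      + exact: trivial_idealD.
      + exact: singularity_idealD.
      + by rewrite addrACA.
    - case: (hs i) => h4.
        exists (a i * s i), 0; rewrite addr0; split=> //; last exact: singularity_ideal0.
        apply: trivial_idealM; apply/trivial_ideal_nosec; apply: ideal_gen_mem; right; exact: h4.
      exists 0, (a i * s i); rewrite add0r; split=> //; first exact: trivial_ideal0.
      exact: singularity_idealM.
  have [c hc] := h3 b hb; exists c; apply/trivial_ideal_nosec.
  by rewrite -addrA; apply: trivial_idealD.
apply: (semiuniversal_unfolding hf _ hg he hge) => k l T S F G X Y phi.
by split=> [h1|[]].
Qed.
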